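(* Let $H=\lambda V+W$ be the model described in the context, with eigenvalues $\mu_1\le\dots\le\mu_N$, and let $\xi=\frac{A_0+o(1)}{2}\log\log N$. There are constants $\nu>0$ and $C>0$, depending on $\theta$, $C_0$, $\lambda_0$, $E_0$, $A_0$ and the measure $\mu$, such that the following holds. Consider $\mu_i<\mu_j$ with $i\ge\epsilon N$ and $j\le(1-\epsilon)N$, for some constant $\epsilon>0$, and assume that $|i-j|\ge(\varphi_N)^{C'\xi}$ for some constant $C'>C$. Then there exist constants $C_1,C_2$, depending only on $\epsilon$, $\max\{\rho_{fc}(x):\mu_i\le x\le\mu_j\}$ and $\min\{\rho_{fc}(x):\mu_i\le x\le\mu_j\}$, such that $$C_1\frac{|i-j|}N\le|\mu_i-\mu_j|\le C_2\frac{|i-j|}N$$ holds with $(\xi,\nu)$-high probability, for all $\lambda\in\mathcal D_{\lambda_0}$. If we assume further that $|i-j|\le(\varphi_N)^{c\xi}N^{1/2}$ for some constant $c>0$, then there exists a constant $K$ such that $$\left||\mu_i-\mu_j|-\frac{|i-j|}{N\rho_{fc}(\mu_i)}\right|\le(\varphi_N)^{K\xi}\frac1N$$ with $(\xi,\nu)$-high probability, for all $\lambda\in\mathcal D_{\lambda_0}$.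
   Context: Model. For each $N$, $W=(w_{ij})$ is an $N\times N$ random matrix whose entries are independent up to the symmetry constraint $w_{ij}=\overline{w_{ji}}$, centered, complex, with $\mathbb E w_{ii}^2=\frac1N$, $\mathbb E|w_{ij}|^2=\frac1N$, $\mathbb E w_{ij}^2=0$ ($i\neq j$), and $\mathbb P(\sqrt N|w_{ij}|>x)\le C_0e^{-x^{1/\theta}}$ for fixed constants $C_0>0$, $\theta>1$. $V=\operatorname{diag}(v_1,\dots,v_N)$ has real, centered, i.i.d. entries with law $\mu$, $\operatorname{supp}\mu=[-1,1]$, and is independent of $W$. $H=\lambda V+W$. Fix $\lambda_0>0$, $\mathcal D_{\lambda_0}=\{\lambda\in\mathbb R^+:\lambda\le\lambda_0\}$ and $E_0\ge3+\lambda_0$. Assumption on $\lambda,\mu$ (for every $\lambda\in\mathcal D_{\lambda_0}$): if $\lambda\le1$, $\mu$ has a continuous density $\mu(v)$ with $\mu(v)>0$ for $v\in(-1,1)$ and $\mu(v)=0$ for $v\notin[-1,1]$; if $\lambda>1$, $\mu$ is a centered Jacobi measure, i.e. has density $Z^{-1}(1+v)^{a}(1-v)^{b}d(v)\mathbf 1_{[-1,1]}(v)$ with $d\in C^1([-1,1])$, $d>0$ on $[-1,1]$, $Z$ a normalization, and either $-1<a,b\le1$, or $1<a,b<\infty$ and $\lambda<\lambda_1$, $\lambda<\lambda_2$, where $\lambda_1=(\int(1+v)^{-2}d\mu(v))^{1/2}$, $\lambda_2=(\int(1-v)^{-2}d\mu(v))^{1/2}$. Deformed semicircle law. $m_{fc}=m_{fc}^\lambda$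 is the unique solution, with $\operatorname{Im}m_{fc}(z)\ge0$, of $m_{fc}(z)=\int\frac{d\mu(v)}{\lambda v-z-m_{fc}(z)}$, $z\in\mathbb C^+$ (upper half-plane); it is the Stieltjes transform ($\int\frac{d\mu_{fc}(x)}{x-z}$) of a probability measure $\mu_{fc}=\mu_{fc}^\lambda$ with density $\rho_{fc}$, whose support is an interval $[L_1,L_2]$, $L_1<0<L_2$. Parameters. $\varphi_N=(\log N)^{C_\varphi}$ and $\xi=\xi_N$ satisfies $a_0<\xi\le A_0\log\log N$, where $a_0>2$, $A_0\ge10$, $C_\varphi\ge1$ are fixed constants, depending only on $\theta,C_0$, chosen such that the following large deviation estimates hold for $N$ sufficiently large and all $a_0\le\xi\le A_0\log\log N$: for independent centered complex random variables $(a_i),(b_i)$ with variance $\sigma^2$ and $\mathbb P(|a_i|\ge x\sigma)\le C_0e^{-x^{1/\theta}}$, $\mathbb P(|b_i|\ge x\sigma)\le C_0e^{-x^{1/\theta}}$, and $A_i,B_{ij}\in\mathbb C$, each of the events $|\sum_iA_ia_i|\ge\varphi_N^\xi\sigma(\sum_i|A_i|^2)^{1/2}$; $|\sum_i\bar a_iB_{ii}a_i-\sum_i\sigma^2B_{ii}|\ge\varphi_N^\xi\sigma^2(\sum_i|B_{ii}|^2)^{1/2}$; $|\sum_{i\ne j}\bar a_iB_{ij}a_j|\ge\varphi_N^\xi\sigma^2(\sum_{i\neq j}|B_{ij}|^2)^{1/2}$; $|\sum_{i,j}\bar a_iB_{ij}b_j|\ge\varphi_N^\xi\sigma^2(\sum_{i,j}|B_{ij}|^2)^{1/2}$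 has probability at most $e^{-(\log N)^\xi}$. An event $\Omega$ has $(\xi,\nu)$-high probability if $\mathbb P(\Omega^c)\le e^{-\nu(\log N)^\xi}$ for $N$ sufficiently large. *)

(* Defs.v *)
From HB Require Import structures.
From mathcomp Require Import all_boot all_order all_algebra.
From mathcomp Require Import spectral complex.
From mathcomp Require Import all_classical all_reals all_analysis.

Set Implicit Arguments.
Unset Strict Implicit.
Unset Printing Implicit Defensive.

Import Order.TTheory GRing.Theory Num.Theory.
Import numFieldNormedType.Exports.
Import ComplexField.Normc.

Local Open Scope classical_set_scope.
Local Open Scope ring_scope.
Local Open Scope complex_scope.

Section complex_random_variables.
Context {R : realType} {d : measure_display} {T : measurableType d}.

(* R[i] carries no measurable structure: a complex random variable is handled
   through the pair (Re, Im), valued in R * R with its Borel sigma-algebra. *)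
Definition re_im (X : T -> R[i]) : T -> R * R :=
  fun t => (complex.Re (X t), complex.Im (X t)).

Definition complex_rv (X : T -> R[i]) : Prop :=
  measurable_fun [set: T] (re_im X).

Definition sigma_rv (X : T -> R) : set_system T :=
  preimage_set_system [set: T] X measurable.

Definition sigma_crv (X : T -> R[i]) : set_system T :=
  preimage_set_system [set: T] (re_im X) measurable.

Definition cintegral (P : {measure set T -> \bar R}) (f : T -> R[i]) : R[i] :=
  (\int[P]_t complex.Re (f t))%R +i* (\int[P]_t complex.Im (f t))%R.

(* Mutual independence of the classes of events [F i], for [i] in [D]. *)
Definition mutually_independent (P : probability T R) (I : finType)
    (D : {set I}) (F : I -> set_system T) : Prop :=
  forall (J : {set I}) (A : I -> set T), J \subset D ->
    (forall i, i \in J -> F i (A i)) ->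
    P (\bigcap_(i in [set` J]) A i) = (\prod_(i in J) P (A i))%E.

Definition independent_classes (P : probability T R) (F G : set_system T) :
    Prop :=
  forall A B, F A -> G B -> P (A `&` B) = (P A * P B)%E.

End complex_random_variables.

Section deterministic.
Context {R : realType}.
Local Notation law := (probability (measurableTypeR R) R).

Definition in_D (lam0 lam : R) : Prop := 0 <= lam /\ lam <= lam0.

Definition has_density (mu : law) (f : R -> R) : Prop :=
  [/\ measurable_fun [set: R] f, forall x, 0 <= f x &
      forall A : set R, measurable A ->
        mu A = (\int[lebesgue_measure]_(x in A) (f x)%:E)%E].

Definition support_law (mu : law) : set R :=
  [set x | forall U : set R, open U -> U x -> (0 < mu U)%E].

Definition centered_law (mu : law) : Prop := (\int[mu]_x x)%R = 0.

Definition C1_on (a b : R) (f : R -> R) : Prop :=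
  {within `[a, b], continuous f} /\
  exists2 f' : R -> R, {within `[a, b], continuous f'} &
    forall x, a < x < b -> is_derive x 1 f (f' x).

Definition positive_density (mu : law) : Prop :=
  exists f : R -> R,
    [/\ has_density mu f,
        (forall v, -1 < v < 1 -> {for v, continuous f}),
        (forall v, -1 < v < 1 -> 0 < f v) &
        (forall v, ~~ (-1 <= v <= 1) -> f v = 0)].

Definition jacobi_law (a b : R) (mu : law) : Prop :=
  exists (Z : R) (dj : R -> R),
    [/\ 0 < Z, C1_on (-1) 1 dj, (forall v, -1 <= v <= 1 -> 0 < dj v) &
        has_density mu (fun v =>
          if -1 <= v <= 1
          then Z^-1 * (1 + v) `^ a * (1 - v) `^ b * dj v else 0)].

Definition lambda1 (mu : law) : R :=
  Num.sqrt (\int[mu]_v ((1 + v) ^- 2))%R.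

Definition lambda2 (mu : law) : R :=
  Num.sqrt (\int[mu]_v ((1 - v) ^- 2))%R.

Definition law_assumption (mu : law) (lam : R) : Prop :=
  (lam <= 1 -> positive_density mu) /\
  (1 < lam -> exists a b : R,
     [/\ centered_law mu, jacobi_law a b mu &
         [/\ -1 < a, a <= 1, -1 < b & b <= 1] \/
         [/\ 1 < a, 1 < b, lam < lambda1 mu & lam < lambda2 mu]]).

(* For [z] in the upper half-plane the equation has exactly one solution with
   nonnegative imaginary part; [xget] selects it. *)
Definition m_fc (mu : law) (lam : R) (z : R[i]) : R[i] :=
  xget 0 [set m : R[i] | 0 <= complex.Im m /\
    m = cintegral mu (fun v => ((lam * v)%:C - z - m)^-1)].

Definition is_mu_fc (mu : law) (lam : R) (muf : law) : Prop :=
  forall z : R[i], 0 < complex.Im z ->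
    m_fc mu lam z = cintegral muf (fun x => (x%:C - z)^-1).

(* The pointwise values of the density matter, so its continuous version is
   taken; it is unique. *)
Definition rho_fc (mu : law) (lam : R) : R -> R :=
  xget (fun=> 0) [set rho : R -> R | continuous rho /\
    exists2 muf : law, is_mu_fc mu lam muf & has_density muf rho].

Definition phi (Cphi : R) (N : nat) : R := ln N%:R `^ Cphi.

Definition loglog (N : nat) : R := ln (ln N%:R).

Definition xi_sequence (A0 : R) (xi : nat -> R) : Prop :=
  exists2 o : nat -> R, o @ \oo --> (0 : R) &
    \forall N \near \oo, xi N = (A0 + o N) / 2 * loglog N.

(* Eigenvalues of a Hermitian matrix (all real), in nondecreasing order and
   with multiplicity. *)
Definition eigenvalues N (H : 'M[R[i]]_N) : seq R :=
  sort <=%R [seq complex.Re (spectral_diag H 0 k) | k <- enum 'I_N].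

(* Numbered from 1. *)
Definition eigenvalue_nth N (H : 'M[R[i]]_N) (k : nat) : R :=
  (eigenvalues H)`_k.-1.

Definition max_on (f : R -> R) (x y : R) : R := sup [set f t | t in `[x, y]].
Definition min_on (f : R -> R) (x y : R) : R := inf [set f t | t in `[x, y]].

End deterministic.

Section large_deviations.
Context {R : realType}.

Definition ld_variable (theta C0 sigma : R) (d : measure_display)
    (T : measurableType d) (P : probability T R) (X : T -> R[i]) : Prop :=
  [/\ complex_rv X, cintegral P X = 0,
      (\int[P]_t (normc (X t) ^+ 2))%R = sigma ^+ 2 &
      forall x : R, 0 < x ->
        (P [set t | (x * sigma <= normc (X t))%R]
           <= (C0 * expR (- x `^ theta^-1))%:E)%E].

(* The hypothesis [0 < s] excludes the case where all coefficients vanish: the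
   event [s <= |X|] would then have probability 1. *)
Definition ld_bound (d : measure_display) (T : measurableType d)
    (P : probability T R) (N : nat) (xi : R) (X : T -> R[i]) (s : R) : Prop :=
  0 < s -> (P [set t | (s <= normc (X t))%R] <= (expR (- ln N%:R `^ xi))%:E)%E.

Definition large_deviation_constants (theta C0 a0 A0 Cphi : R) : Prop :=
  \forall N \near \oo, forall xi : R, a0 <= xi -> xi <= A0 * loglog N ->
  forall (d : measure_display) (T : measurableType d) (P : probability T R)
    (sigma : R) (a b : 'I_N -> T -> R[i])
    (A : 'I_N -> R[i]) (B : 'I_N -> 'I_N -> R[i]),
  0 < sigma ->
  (forall i, ld_variable theta C0 sigma P (a i)) ->
  (forall i, ld_variable theta C0 sigma P (b i)) ->
  mutually_independent P [set: 'I_N + 'I_N]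
    (fun k => match k with
              | inl i => sigma_crv (a i) | inr i => sigma_crv (b i) end) ->
  [/\ ld_bound P N xi
        (fun t => \sum_i A i * a i t)
        (phi Cphi N `^ xi * sigma * Num.sqrt (\sum_i normc (A i) ^+ 2)),
      ld_bound P N xi
        (fun t => \sum_i conjc (a i t) * B i i * a i t
                  - \sum_i (sigma ^+ 2)%:C * B i i)
        (phi Cphi N `^ xi * sigma ^+ 2
           * Num.sqrt (\sum_i normc (B i i) ^+ 2)),
      ld_bound P N xi
        (fun t => \sum_i \sum_(j | i != j) conjc (a i t) * B i j * a j t)
        (phi Cphi N `^ xi * sigma ^+ 2
           * Num.sqrt (\sum_i \sum_(j | i != j) normc (B i j) ^+ 2)) &
      ld_bound P N xi
        (fun t => \sum_i \sum_j conjc (a i t) * B i j * b j t)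
        (phi Cphi N `^ xi * sigma ^+ 2
           * Num.sqrt (\sum_i \sum_j normc (B i j) ^+ 2))].

End large_deviations.

Section model.
Context {R : realType}.

Definition wigner (theta C0 : R) (N : nat) (d : measure_display)
    (T : measurableType d) (P : probability T R) (W : T -> 'M[R[i]]_N) : Prop :=
  [/\ (forall i j, complex_rv (fun t => W t i j)),
      (forall t i j, W t i j = conjc (W t j i)),
      mutually_independent P [set p : 'I_N * 'I_N | (p.1 <= p.2)%N]
        (fun p => sigma_crv (fun t => W t p.1 p.2)),
      [/\ (forall i j, cintegral P (fun t => W t i j) = 0),
          (forall i, cintegral P (fun t => W t i i ^+ 2) = (N%:R^-1)%:C),
          (forall i j, (\int[P]_t (normc (W t i j) ^+ 2))%R = N%:R^-1) &
          (forall i j, i != j -> cintegral P (fun t => W t i j ^+ 2) = 0)] &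
      forall i j (x : R), 0 < x ->
        (P [set t | (x < Num.sqrt N%:R * normc (W t i j))%R]
           <= (C0 * expR (- x `^ theta^-1))%:E)%E].

Definition random_potential (mu : probability (measurableTypeR R) R) (N : nat)
    (d : measure_display) (T : measurableType d) (P : probability T R)
    (v : 'I_N -> T -> R) : Prop :=
  [/\ (forall i, measurable_fun [set: T] (v i)),
      mutually_independent P [set: 'I_N] (fun i => sigma_rv (v i)) &
      forall i (A : set R), measurable A -> P (v i @^-1` A) = mu A].

Record deformed_wigner (theta C0 : R) (mu : probability (measurableTypeR R) R)
    (N : nat) := DeformedWigner {
  dw_disp : measure_display;
  dw_space : measurableType dw_disp;
  dw_prob : probability dw_space R;
  dw_W : dw_space -> 'M[R[i]]_N;
  dw_v : 'I_N -> dw_space -> R;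
  dw_wigner : wigner theta C0 dw_prob dw_W;
  dw_potential : random_potential mu dw_prob dw_v;
  dw_indep : independent_classes dw_prob
    <<s \bigcup_i sigma_rv (dw_v i) >>
    <<s \bigcup_p sigma_crv (fun t => dw_W t p.1 p.2) >> }.

Definition hamiltonian theta C0 mu N (X : deformed_wigner theta C0 mu N)
    (lam : R) (t : dw_space X) : 'M[R[i]]_N :=
  lam%:C *: diag_mx (\row_k (dw_v k t)%:C) + dw_W t.

Definition eig theta C0 mu N (X : deformed_wigner theta C0 mu N)
    (lam : R) (k : nat) (t : dw_space X) : R :=
  eigenvalue_nth (hamiltonian lam t) k.

(* The bound at a given [N] in "[Omega] has (xi, nu)-high probability";
   [Omega] is not assumed measurable, whence the measurable subset [A]. *)
Definition high_probability (d : measure_display) (T : measurableType d)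
    (P : probability T R) (N : nat) (xi nu : R) (Omega : set T) : Prop :=
  exists A : set T, [/\ measurable A, A `<=` Omega &
    (P (~` A) <= (expR (- nu * ln N%:R `^ xi))%:E)%E].

(* Index gap |i - j|. *)
Definition gap (i j : nat) : R := `|i%:R - j%:R|.

End model.

(* Main.v *)
(* For z = E + i eta the trace m_N(z) of the resolvent of H almost solves the fixed point equation of m_fc: the Schur
   complement formula writes G_ii as 1 / (lam v_i - z - m_N + error), the error being small by the large deviation
   estimates for quadratic forms in a row of W.  Stability of the fixed point equation where Im m_fc is bounded below
   yields, by induction on dyadic heights going down, the weak law |m_N - m_fc| << 1.  Taking a high moment of the
   linearised equation and replacing m_N by a quantity independent of the i-th row (fluctuation averaging) gains the
   rate N^-1/2 + (N eta)^-1 up to powers of (log N)^xi.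
   The counting function is compared with theta_y(E) = sum_k atan ((E - mu_k) / y) / pi at a height y barely above 1/N:
   d theta / dE = N Im m_N / pi, and the error is controlled by N y Im m_N on dyadic heights.  Integrating the weak law
   gives the two-sided bound.  For the asymptotics theta_y is moved up to height N^-1/2, where Im m_fc varies slowly;
   d theta / dy = N Re m_N / pi makes this cost only a logarithm.
   The density of mu_fc is pi^-1 Im m_fc on the real axis, and the bulk, where it is bounded below uniformly in lam,
   carries all but a small part of the mass because Im m_fc is quasi-unimodal. *)
Require Import Defs.
From HB Require Import structures.
From mathcomp Require Import all_boot all_order all_algebra.
From mathcomp Require Import spectral complex.
From mathcomp Require Import all_classical all_reals all_analysis.
From mathcomp Require Import measurable_realfun.
From mathcomp Require Import ring lra.

Set Implicit Arguments.
Unset Strict Implicit.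
Unset Printing Implicit Defensive.

Import Order.TTheory GRing.Theory Num.Theory.
Import numFieldNormedType.Exports.

Local Open Scope classical_set_scope.
Local Open Scope ring_scope.

(* [lra] preprocesses every inequality of the context. *)
Ltac clra := first [by repeat match goal with H : is_true _ |- _ => assert_fails (clearbody H); clear H end; lra|lra].

(** Write [L = (log N)^xi]. The exponent [p] of the moment method must be of order [L], about
    [14 L]: only then does [4^-(p+1)] beat both a net of at most [N^12] points and the target
    probability [exp (- L)]. Yet the crude bounds inside such a moment cost a factor of order
    [N^(9 p)], so the exceptional events of the large deviation estimates must have probability far
    below [exp (- L log N)]. Hence these estimates are used with exponent [3/2 xi], where they fail
    with probability [exp (- L^(3/2))]; this is admissible because [xi] is close to [A0/2 loglog N].
    All losses are then powers of [L], or constants absorbed in one more [L]. The other obstacle is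
    uniformity in [lam]. No edge behaviour of [mu_fc] is used: the bulk is cut out by a level set of
    the density, and the lower bound between its end points comes from comparing imaginary parts in
    the fixed point equation. Everything at a given [N] is an explicit inequality; [N] tends to
    infinity only at the very end, under conditions on [N] that involve neither [lam] nor the
    indices. *)

Lemma eq_ler {R : realType} (x y : R) : x = y -> x <= y. Proof. by move->. Qed.

Notation Rz := complex.Re.
Notation Iz := complex.Im.
Notation nc := ComplexField.Normc.normc.
Notation sqrt := Num.sqrt.
Notation via y := (@le_trans _ _ y _ _).
Notation Cx := Complex.
Notation rc := (@real_complex_def _ (Phant _)).

(** * Real part, imaginary part and modulus of complex numbers *)

Section complex_basics.
Context {R : realType}.
Implicit Types x y z : R[i].

Lemma cReD x y : Rz (x + y) = Rz x + Rz y. Proof. by case: x y => [a b] []. Qed.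
Lemma cImD x y : Iz (x + y) = Iz x + Iz y. Proof. by case: x y => [a b] []. Qed.
Lemma cReN x : Rz (- x) = - Rz x. Proof. by case: x. Qed.
Lemma cImN x : Iz (- x) = - Iz x. Proof. by case: x. Qed.
Lemma cReB x y : Rz (x - y) = Rz x - Rz y. Proof. by rewrite cReD cReN. Qed.
Lemma cImB x y : Iz (x - y) = Iz x - Iz y. Proof. by rewrite cImD cImN. Qed.
Lemma cReM x y : Rz (x * y) = Rz x * Rz y - Iz x * Iz y.
Proof. by case: x y => [a b] []. Qed.
Lemma cImM x y : Iz (x * y) = Rz x * Iz y + Iz x * Rz y.
Proof. by case: x y => [a b] [c d]. Qed.
Lemma Re_rc (a : R) : Rz (rc a) = a. Proof. by []. Qed.
Lemma Im_rc (a : R) : Iz (rc a) = 0. Proof. by []. Qed.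
Lemma cReJ x : Rz (conjc x) = Rz x. Proof. by case: x. Qed.
Lemma cImJ x : Iz (conjc x) = - Iz x. Proof. by case: x. Qed.
Lemma complex_eq x y : Rz x = Rz y -> Iz x = Iz y -> x = y.
Proof. by case: x y => [a b] [c d] /= -> ->. Qed.

Lemma nc2 x : nc x ^+ 2 = Rz x ^+ 2 + Iz x ^+ 2.
Proof. by case: x => a b /=; rewrite sqr_sqrtr // addr_ge0 // sqr_ge0. Qed.
Lemma nc_ge0 x : 0 <= nc x. Proof. by case: x => a b; apply: sqrtr_ge0. Qed.
Lemma ncM x y : nc (x * y) = nc x * nc y.
Proof. exact: ComplexField.Normc.normcM. Qed.
Lemma ncV x : nc x^-1 = (nc x)^-1. Proof. exact: ComplexField.Normc.normcV. Qed.
Lemma nc0 : nc (0 : R[i]) = 0. Proof. exact: ComplexField.Normc.normc0. Qed.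
Lemma nc1 : nc (1 : R[i]) = 1. Proof. exact: ComplexField.Normc.normc1. Qed.
Lemma ncN x : nc (- x) = nc x.
Proof. by case: x => a b /=; rewrite !sqrrN. Qed.
Lemma ncJ x : nc (conjc x) = nc x.
Proof. by case: x => a b /=; rewrite sqrrN. Qed.
Lemma nc_rc (a : R) : nc (rc a) = `|a|.
Proof. by rewrite /= expr0n addr0 sqrtr_sqr. Qed.
Lemma nc_eq0 x : (nc x == 0) = (x == 0).
Proof.
apply/eqP/eqP => [|->]; [exact: ComplexField.Normc.eq0_normc|exact: nc0].
Qed.
Lemma nc_gt0 x : (0 < nc x) = (x != 0).
Proof. by rewrite lt0r nc_eq0 nc_ge0 andbT. Qed.
Lemma ncX x n : nc (x ^+ n) = nc x ^+ n.
Proof. by elim: n => [|n IH]; rewrite ?expr0 ?nc1 // !exprS ncM IH. Qed.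

Lemma Re_le x : `|Rz x| <= nc x.
Proof. by rewrite -ler_sqr ?nnegrE ?nc_ge0 // nc2 real_normK ?num_real // lerDl sqr_ge0. Qed.
Lemma Im_le x : `|Iz x| <= nc x.
Proof. by rewrite -ler_sqr ?nnegrE ?nc_ge0 // nc2 real_normK ?num_real // lerDr sqr_ge0. Qed.
Lemma ncD x y : nc (x + y) <= nc x + nc y.
Proof.
rewrite -ler_sqr ?nnegrE ?addr_ge0 ?nc_ge0 // nc2 cReD cImD.
have h : Rz x * Rz y + Iz x * Iz y <= nc x * nc y.
 apply: le_trans (ler_norm _) _.
 have -> : Rz x * Rz y + Iz x * Iz y = Rz (x * conjc y).
  by rewrite cReM cReJ cImJ; ring.
 by apply: le_trans (Re_le _) _; rewrite ncM ncJ.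
have := nc2 x; have := nc2 y; nra.
Qed.
Lemma ncB x y : nc (x - y) <= nc x + nc y.
Proof. by rewrite -(ncN y); exact: ncD. Qed.
Lemma ncC x y : nc (x - y) = nc (y - x).
Proof. by rewrite -ncN opprB. Qed.
Lemma nc_le_ReIm x : nc x <= `|Rz x| + `|Iz x|.
Proof.
rewrite -ler_sqr ?nnegrE ?addr_ge0 ?nc_ge0 // nc2.
rewrite -(@real_normK _ (Rz x)) ?num_real // -(@real_normK _ (Iz x)) ?num_real //.
by have := normr_ge0 (Rz x); have := normr_ge0 (Iz x); nra.
Qed.
Lemma nc_triB x y : nc x <= nc (x - y) + nc y.
Proof. by rewrite -{1}(subrK y x) ncD. Qed.
Lemma nc_tri x y z : nc (x - z) <= nc (x - y) + nc (y - z).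
Proof. by rewrite -(subrKA y x (- z)) ncD. Qed.

Lemma Re_sum (I : Type) (s : seq I) (P : pred I) (F : I -> R[i]) :
 Rz (\sum_(i <- s | P i) F i) = \sum_(i <- s | P i) Rz (F i).
Proof. exact: (big_morph _ cReD erefl). Qed.
Lemma Im_sum (I : Type) (s : seq I) (P : pred I) (F : I -> R[i]) :
 Iz (\sum_(i <- s | P i) F i) = \sum_(i <- s | P i) Iz (F i).
Proof. exact: (big_morph _ cImD erefl). Qed.
Lemma nc_sum (I : Type) (s : seq I) (P : pred I) (F : I -> R[i]) :
 nc (\sum_(i <- s | P i) F i) <= \sum_(i <- s | P i) nc (F i).
Proof.
elim/big_ind2: _ => [|x1 x2 y1 y2 h1 h2|//]; first by rewrite nc0.
by apply: le_trans (ncD _ _) _; apply: lerD.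
Qed.

Lemma cImV x : Iz x^-1 = - Iz x / nc x ^+ 2.
Proof. by rewrite nc2; case: x => a b /=; rewrite ?mulNr. Qed.
Lemma cReV x : Rz x^-1 = Rz x / nc x ^+ 2.
Proof. by rewrite nc2; case: x => a b /=; rewrite ?mulNr. Qed.
Lemma Im_neq0 x : Iz x != 0 -> x != 0.
Proof. by apply: contraNneq => ->. Qed.
Lemma mulJ x : x * conjc x = rc (nc x ^+ 2).
Proof. by rewrite nc2; apply: complex_eq; rewrite ?cReM ?cImM cReJ cImJ /=; ring. Qed.
Lemma nc_half x y : 2 * Rz (x * y) = nc x ^+ 2 + nc y ^+ 2 - nc (x - conjc y) ^+ 2.
Proof. by rewrite !nc2 cReB cImB cReJ cImJ cReM; ring. Qed.

End complex_basics.

(** * Measurable and bounded functions, real and complex *)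

Section bounded_measurable.
Context {R : realType} {d : measure_display} {T : measurableType d}.
Implicit Types (f g : T -> R) (X Y : T -> R[i]).

(** The inverse is [x * (x^2)^-1] with the inverse of the nonnegative number [x^2] taken as a real
    power; the convention [0^-1 = 0] makes the identity valid at [0] too. *)
Lemma measurable_invr : measurable_fun [set: R] (fun x : R => x^-1).
Proof.
have -> : (fun x : R => x^-1) = (fun x => x * (x ^+ 2) `^ (-1)).
 apply/funext => x; rewrite powR_inv1 ?sqr_ge0 //.
 have [->|x0] := eqVneq x 0; first by rewrite invr0 mul0r.
 by field.
apply: measurable_funM => //.
exact: (measurableT_comp (@measurable_powR R (-1)) (@exprn_measurable R setT 2)).
Qed.

(** On this class every expectation is finite and linear, so the algebra of means carries no
    integrability side conditions. *)
Definition bmf f := measurable_fun [set: T] f /\ exists M, forall t, `|f t| <= M.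
Definition cme X :=
 measurable_fun [set: T] (fun t => Rz (X t)) /\
 measurable_fun [set: T] (fun t => Iz (X t)).
Definition cbm X := bmf (fun t => Rz (X t)) /\ bmf (fun t => Iz (X t)).

Lemma bmf_cst (a : R) : bmf (fun=> a).
Proof. by split; [exact: measurable_cst|exists `|a|]. Qed.
Lemma bmfD f g : bmf f -> bmf g -> bmf (fun t => f t + g t).
Proof.
move=> [mf [M hM]] [mg [K hK]]; split; first exact: measurable_funD.
by exists (M + K) => t; apply: le_trans (ler_normD _ _) _; apply: lerD.
Qed.
Lemma bmfM f g : bmf f -> bmf g -> bmf (fun t => f t * g t).
Proof.
move=> [mf [M hM]] [mg [K hK]]; split; first exact: measurable_funM.
by exists (M * K) => t; rewrite normrM; apply: ler_pM.
Qed.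
Lemma bmfN f : bmf f -> bmf (fun t => - f t).
Proof.
move=> hf; have := bmfM (bmf_cst (-1)) hf; congr bmf.
by apply/funext => t; rewrite mulN1r.
Qed.
Lemma bmfB f g : bmf f -> bmf g -> bmf (fun t => f t - g t).
Proof. by move=> hf /bmfN hg; exact: bmfD. Qed.
Lemma bmfZ (a : R) f : bmf f -> bmf (fun t => a * f t).
Proof. exact: bmfM (bmf_cst a). Qed.
Lemma bmfX f n : bmf f -> bmf (fun t => f t ^+ n).
Proof.
move=> hf; elim: n => [|n IH]; first by under eq_fun do rewrite expr0; exact: bmf_cst.
by under eq_fun do rewrite exprS; exact: bmfM.
Qed.
Lemma bmf_sum (I : Type) (s : seq I) (F : I -> T -> R) :
 (forall i, bmf (F i)) -> bmf (fun t => \sum_(i <- s) F i t).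
Proof.
move=> h; elim: s => [|i s IH].
 by under eq_fun do rewrite big_nil; exact: bmf_cst.
by under eq_fun do rewrite big_cons; exact: bmfD.
Qed.
Lemma bmf_indic (A : set T) : measurable A -> bmf (fun t => \1_A t).
Proof.
move=> mA; split; first exact: measurable_indic.
by exists 1 => t; rewrite indicE; case: (_ \in _); rewrite ?normr0 ?normr1.
Qed.

Lemma bmf_integrable (P : {finite_measure set T -> \bar R}) f :
 bmf f -> P.-integrable [set: T] (EFin \o f).
Proof.
move=> [mf [M hM]]; apply: measurable_bounded_integrable => //.
 by apply: fin_num_fun_lty; exact: fin_num_measure.
by exists M; split; [exact: num_real|move=> x Mx t _; exact: le_trans (hM t) (ltW Mx)].
Qed.

Lemma cme_cst (a : R[i]) : cme (fun=> a).
Proof. by split; exact: measurable_cst. Qed.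
Lemma cmeD X Y : cme X -> cme Y -> cme (fun t => X t + Y t).
Proof.
move=> [X1 X2] [Y1 Y2]; split; [under eq_fun do rewrite cReD|under eq_fun do rewrite cImD];
 exact: measurable_funD.
Qed.
Lemma cmeM X Y : cme X -> cme Y -> cme (fun t => X t * Y t).
Proof.
move=> [X1 X2] [Y1 Y2]; split; [under eq_fun do rewrite cReM|under eq_fun do rewrite cImM].
 by apply: measurable_funB; exact: measurable_funM.
by apply: measurable_funD; exact: measurable_funM.
Qed.
Lemma cmeN X : cme X -> cme (fun t => - X t).
Proof.
move=> hf; have := cmeM (cme_cst (-1)) hf; congr cme.
by apply/funext => t; rewrite mulN1r.
Qed.
Lemma cmeB X Y : cme X -> cme Y -> cme (fun t => X t - Y t).
Proof. by move=> hf /cmeN hg; exact: cmeD. Qed.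
Lemma cmeJ X : cme X -> cme (fun t => conjc (X t)).
Proof.
move=> [X1 X2]; split; [under eq_fun do rewrite cReJ|under eq_fun do rewrite cImJ] => //.
exact: measurable_funN.
Qed.
Lemma measurable_nc2 X : cme X -> measurable_fun [set: T] (fun t => nc (X t) ^+ 2).
Proof.
move=> [X1 X2]; under eq_fun do rewrite nc2.
by apply: measurable_funD; exact: measurable_funX.
Qed.
Lemma cmeV X : cme X -> cme (fun t => (X t)^-1).
Proof.
move=> hX; have := measurableT_comp measurable_invr (measurable_nc2 hX).
case: hX => [X1 X2] h.
split; [under eq_fun do rewrite cReV|under eq_fun do rewrite cImV].
 exact: measurable_funM.
by apply: measurable_funM => //; exact: measurable_funN.
Qed.
Lemma measurable_nc X : cme X -> measurable_fun [set: T] (fun t => nc (X t)).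
Proof.
move=> hX; have -> : (fun t => nc (X t)) = (fun t => (nc (X t) ^+ 2) `^ 2^-1).
 by apply/funext => t; rewrite powR12_sqrt ?sqr_ge0 // sqrtr_sqr ger0_norm ?nc_ge0.
exact: (measurableT_comp (@measurable_powR R 2^-1) (measurable_nc2 hX)).
Qed.
Lemma cme_sum (I : Type) (s : seq I) (P : pred I) (F : I -> T -> R[i]) :
 (forall i, cme (F i)) -> cme (fun t => \sum_(i <- s | P i) F i t).
Proof.
move=> h; elim: s => [|i s IH].
 by under eq_fun do rewrite big_nil; exact: cme_cst.
by under eq_fun do rewrite big_cons; case: (P i) => //; exact: cmeD.
Qed.
Lemma cme_prod (I : Type) (s : seq I) (P : pred I) (F : I -> T -> R[i]) :
 (forall i, cme (F i)) -> cme (fun t => \prod_(i <- s | P i) F i t).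
Proof.
move=> h; elim: s => [|i s IH].
 by under eq_fun do rewrite big_nil; exact: cme_cst.
by under eq_fun do rewrite big_cons; case: (P i) => //; exact: cmeM.
Qed.
Lemma cme_rc f : measurable_fun [set: T] f -> cme (fun t => rc (f t)).
Proof. by move=> mf; split => //; exact: measurable_cst. Qed.
Lemma cme_complex_rv X : cme X <-> complex_rv X.
Proof.
split=> [[X1 X2]|h]; first exact: measurable_fun_pair.
by split; [exact: (measurableT_comp measurable_fst h)|exact: (measurableT_comp measurable_snd h)].
Qed.

Lemma cbm_cme X : cbm X <-> cme X /\ exists M, forall t, nc (X t) <= M.
Proof.
split=> [[[X1 [M hM]] [X2 [K hK]]]|[[X1 X2] [M hM]]].
 split; first by split.
 by exists (M + K) => t; apply: le_trans (nc_le_ReIm _) _; apply: lerD.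
split; split => //; exists M => t; [apply: le_trans (Re_le _) _|apply: le_trans (Im_le _) _];
 exact: hM.
Qed.
Lemma cbm_cst a : cbm (fun=> a).
Proof. by split; exact: bmf_cst. Qed.
Lemma cbmD X Y : cbm X -> cbm Y -> cbm (fun t => X t + Y t).
Proof.
move=> [X1 X2] [Y1 Y2]; split; [under eq_fun do rewrite cReD|under eq_fun do rewrite cImD];
 exact: bmfD.
Qed.
Lemma cbmM X Y : cbm X -> cbm Y -> cbm (fun t => X t * Y t).
Proof.
move=> [X1 X2] [Y1 Y2]; split; [under eq_fun do rewrite cReM|under eq_fun do rewrite cImM].
 by apply: bmfB; exact: bmfM.
by apply: bmfD; exact: bmfM.
Qed.
Lemma cbmN X : cbm X -> cbm (fun t => - X t).
Proof.
move=> hf; have := cbmM (cbm_cst (-1)) hf; congr cbm.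
by apply/funext => t; rewrite mulN1r.
Qed.
Lemma cbmB X Y : cbm X -> cbm Y -> cbm (fun t => X t - Y t).
Proof. by move=> hf /cbmN hg; exact: cbmD. Qed.
Lemma cbmJ X : cbm X -> cbm (fun t => conjc (X t)).
Proof.
move=> [X1 X2]; split; [under eq_fun do rewrite cReJ|under eq_fun do rewrite cImJ] => //.
exact: bmfN.
Qed.
Lemma cbm_rc f : bmf f -> cbm (fun t => rc (f t)).
Proof. by move=> mf; split => //; exact: bmf_cst. Qed.
Lemma cbm_sum (I : Type) (s : seq I) (F : I -> T -> R[i]) :
 (forall i, cbm (F i)) -> cbm (fun t => \sum_(i <- s) F i t).
Proof.
move=> h; elim: s => [|i s IH].
 by under eq_fun do rewrite big_nil; exact: cbm_cst.
by under eq_fun do rewrite big_cons; exact: cbmD.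
Qed.
Lemma bmf_nc X : cbm X -> bmf (fun t => nc (X t)).
Proof.
move=> /cbm_cme[hX [M hM]]; split; first exact: measurable_nc.
by exists M => t; rewrite ger0_norm ?nc_ge0.
Qed.
End bounded_measurable.

(** * Expectations treated axiomatically *)

Section mean.
Context {R : realType} {d : measure_display} {T : measurableType d}.

(** The same algebra serves four functionals: expectation on the probability space, integration
    against a law on the line, the uniform law on a segment, and the empirical mean of the
    potential. *)
Record is_mean (E : (T -> R) -> R) : Prop := IsMean {
 mean_cst : E (fun=> 1) = 1;
 mean_lin : forall a f g, bmf f -> bmf g -> E (fun t => a * f t + g t) = a * E f + E g;
 mean_ge0 : forall f, bmf f -> (forall t, 0 <= f t) -> 0 <= E f }.

Definition cmean (E : (T -> R) -> R) (X : T -> R[i]) : R[i] :=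
 Cx (E (fun t => Rz (X t))) (E (fun t => Iz (X t))).

Lemma expectation_is_mean (P : probability T R) : is_mean (fun f => \int[P]_t f t).
Proof.
split.
- by rewrite Rintegral_cst //= probability_setT mulr1.
- move=> a f g hf hg; rewrite RintegralD //; last 2 first.
 + by apply: bmf_integrable; exact: bmfZ.
 + exact: bmf_integrable.
 by rewrite RintegralZl //; exact: bmf_integrable.
- by move=> f _ h; apply: Rintegral_ge0 => t _; exact: h.
Qed.

Variables (E : (T -> R) -> R) (hE : is_mean E).
Implicit Types (f g : T -> R) (X Y : T -> R[i]).

Lemma meanD f g : bmf f -> bmf g -> E (fun t => f t + g t) = E f + E g.
Proof.
move=> hf hg; rewrite -[E f]mul1r -(mean_lin hE) //.
by congr E; apply/funext => t; rewrite mul1r.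
Qed.
Lemma mean0 : E (fun=> 0) = 0.
Proof.
have := meanD (bmf_cst 0) (bmf_cst 0); under eq_fun do rewrite addr0.
by move/(congr1 (fun x => x - E (fun=> 0))); rewrite addrK subrr.
Qed.
Lemma meanZ a f : bmf f -> E (fun t => a * f t) = a * E f.
Proof.
move=> hf; rewrite -[RHS]addr0 -mean0 -(mean_lin hE) //; last exact: bmf_cst.
by congr E; apply/funext => t; rewrite addr0.
Qed.
Lemma mean_const a : E (fun=> a) = a.
Proof.
rewrite -[RHS]mulr1 -(mean_cst hE) -meanZ; last exact: bmf_cst.
by congr E; apply/funext => t; rewrite mulr1.
Qed.
Lemma meanN f : bmf f -> E (fun t => - f t) = - E f.
Proof.
move=> hf; rewrite -mulN1r -meanZ //.
by congr E; apply/funext => t; rewrite mulN1r.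
Qed.
Lemma meanB f g : bmf f -> bmf g -> E (fun t => f t - g t) = E f - E g.
Proof. by move=> hf hg; rewrite meanD ?meanN //; exact: bmfN. Qed.
Lemma mean_le f g : bmf f -> bmf g -> (forall t, f t <= g t) -> E f <= E g.
Proof.
move=> hf hg h; rewrite -subr_ge0 -meanB //.
by apply: (mean_ge0 hE) => [|t]; [exact: bmfB|rewrite subr_ge0].
Qed.
Lemma mean_sum (I : Type) (s : seq I) (F : I -> T -> R) :
 (forall i, bmf (F i)) -> E (fun t => \sum_(i <- s) F i t) = \sum_(i <- s) E (F i).
Proof.
move=> h; elim: s => [|i s IH].
 by rewrite big_nil -[RHS]mean0; congr E; apply/funext => t; rewrite big_nil.
rewrite big_cons -IH -meanD //; last exact: bmf_sum.
by congr E; apply/funext => t; rewrite big_cons.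
Qed.
Lemma mean_sqr f : bmf f -> (E f) ^+ 2 <= E (fun t => f t ^+ 2).
Proof.
move=> hf; have : 0 <= E (fun t => (f t - E f) ^+ 2).
 by apply: (mean_ge0 hE) => [|t]; [apply/bmfX/bmfB => //; exact: bmf_cst|exact: sqr_ge0].
have -> : (fun t => (f t - E f) ^+ 2) = (fun t => (- (2 * E f)) * f t + (f t ^+ 2 + E f ^+ 2)).
 by apply/funext => t; ring.
rewrite (mean_lin hE) //; last by apply: bmfD; [exact: bmfX|exact: bmf_cst].
rewrite meanD ?mean_const; [lra|exact: bmfX|exact: bmf_cst].
Qed.

Lemma cmean_lin (a : R[i]) X Y : cbm X -> cbm Y ->
 cmean E (fun t => a * X t + Y t) = a * cmean E X + cmean E Y.
Proof.
move=> [X1 X2] [Y1 Y2]; case: a => a b.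
have -> : cmean E (fun t => (Cx a b) * X t + Y t) =
 Cx (E (fun t => a * Rz (X t) + ((- b) * Iz (X t) + Rz (Y t))))
  (E (fun t => a * Iz (X t) + (b * Rz (X t) + Iz (Y t)))).
 by congr Cx; congr E; apply/funext => t; rewrite ?cReD ?cImD ?cReM ?cImM /=; ring.
have h (x y : R) f g h' : bmf f -> bmf g -> bmf h' ->
  E (fun t => x * f t + (y * g t + h' t)) = x * E f + (y * E g + E h').
 move=> hf hg hh; rewrite (mean_lin hE) ?(mean_lin hE) //.
 by apply: bmfD => //; exact: bmfZ.
by rewrite !h //; apply: complex_eq; rewrite ?cReD ?cImD ?cReM ?cImM /=; ring.
Qed.
Lemma cmeanD X Y : cbm X -> cbm Y ->
 cmean E (fun t => X t + Y t) = cmean E X + cmean E Y.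
Proof.
move=> hX hY; rewrite -[cmean E X]mul1r -cmean_lin //.
by congr cmean; apply/funext => t; rewrite mul1r.
Qed.
Lemma cmean_cst a : cmean E (fun=> a) = a.
Proof. by case: a => a b; rewrite /cmean /= !mean_const. Qed.
Lemma cmeanZ a X : cbm X -> cmean E (fun t => a * X t) = a * cmean E X.
Proof.
move=> hX; rewrite -[RHS]addr0 -(cmean_cst 0) -cmean_lin //; last exact: cbm_cst.
by congr cmean; apply/funext => t; rewrite addr0.
Qed.
Lemma cmeanN X : cbm X -> cmean E (fun t => - X t) = - cmean E X.
Proof.
move=> hf; rewrite -mulN1r -cmeanZ //.
by congr cmean; apply/funext => t; rewrite mulN1r.
Qed.
Lemma cmeanB X Y : cbm X -> cbm Y ->
 cmean E (fun t => X t - Y t) = cmean E X - cmean E Y.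
Proof. by move=> hf hg; rewrite cmeanD ?cmeanN //; exact: cbmN. Qed.
Lemma cmean_sum (I : Type) (s : seq I) (F : I -> T -> R[i]) :
 (forall i, cbm (F i)) -> cmean E (fun t => \sum_(i <- s) F i t) = \sum_(i <- s) cmean E (F i).
Proof.
move=> h; elim: s => [|i s IH].
 by rewrite big_nil -[RHS](cmean_cst 0); congr cmean; apply/funext => t; rewrite big_nil.
rewrite big_cons -IH -cmeanD //; last exact: cbm_sum.
by congr cmean; apply/funext => t; rewrite big_cons.
Qed.
(* Rotating [X] by the phase of its mean reduces the bound to real parts. *)
Lemma nc_cmean X : cbm X -> nc (cmean E X) <= E (fun t => nc (X t)).
Proof.
move=> hX; set z := cmean E X.
have [->|z0] := eqVneq z 0.
 by rewrite nc0; apply: (mean_ge0 hE) => [|t]; [exact: bmf_nc|exact: nc_ge0].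
have nz : 0 < nc z by rewrite nc_gt0.
rewrite -(ler_pM2l nz) -expr2.
have -> : nc z ^+ 2 = Rz (cmean E (fun t => conjc z * X t)).
 by rewrite cmeanZ // mulrC mulJ.
rewrite -meanZ; last exact: bmf_nc.
change (E (fun t => Rz (conjc z * X t)) <= E (fun t => nc z * nc (X t))).
apply: mean_le.
- by case: (cbmM (cbm_cst (conjc z)) hX).
- by apply: bmfZ; exact: bmf_nc.
- by move=> t; apply: le_trans (ler_norm _) _; apply: le_trans (Re_le _) _; rewrite ncM ncJ.
Qed.
End mean.

Lemma cvg_geometric_steps (R : realType) (u : nat -> R) (C q : R) :
 0 <= q < 1 -> (forall k, `|u k.+1 - u k| <= C * q ^+ k) -> cvgn u.
Proof.
move=> /andP[q0 q1] h.
have C0 : 0 <= C by have := le_trans (normr_ge0 _) (h 0%N); rewrite expr0 mulr1.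
pose v k := u k.+1 - u k.
have hs : cvgn (series v).
 apply: normed_cvg; apply: (series_le_cvg _ _ (h)).
 - by move=> k; exact: normr_ge0.
 - by move=> k; apply: mulr_ge0 => //; exact: exprn_ge0.
 - have := @is_cvg_geometric_series R C q.
  by rewrite ger0_norm // => /(_ q1).
have -> : u = (fun k => u 0%N + series v k).
 apply/funext => k; rewrite /series /= telescope_sumr // addrC subrK //.
by apply: is_cvgD => //; exact: is_cvg_cst.
Qed.

(** * The map [w -> E (1 / (lam v - w))], its divided differences, stability and existence of fixed
    points *)

Section green.
Context {R : realType}.
Variable lam : R.

Definition gr (w : R[i]) (v : R) : R[i] := (rc (lam * v) - w)^-1.

Lemma gr_den w v : 0 < Iz w -> rc (lam * v) - w != 0.
Proof.
by move=> w0; apply: Im_neq0; rewrite cImB Im_rc sub0r oppr_eq0 gt_eqF.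
Qed.
Lemma gr_nc w v : 0 < Iz w -> nc (gr w v) <= (Iz w)^-1.
Proof.
move=> w0; rewrite /gr ncV lef_pV2 ?posrE //; last by rewrite nc_gt0 gr_den.
have := Im_le (rc (lam * v) - w); rewrite cImB Im_rc sub0r normrN.
by apply: le_trans; rewrite ler_norm.
Qed.
Lemma Im_gr w v : 0 < Iz w -> Iz (gr w v) = Iz w * nc (gr w v) ^+ 2.
Proof. by move=> w0; rewrite /gr cImV cImB Im_rc sub0r opprK ncV exprVn. Qed.
Lemma cbm_gr w : 0 < Iz w -> cbm (gr w).
Proof.
move=> w0; apply/cbm_cme; split; last by exists (Iz w)^-1 => v; exact: gr_nc.
apply: cmeV; apply: cmeB (cme_cst w); apply: cme_rc.
exact: measurable_funM.
Qed.
Lemma gr_diff w w' v : 0 < Iz w -> 0 < Iz w' ->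
 gr w v - gr w' v = (w - w') * (gr w v * gr w' v).
Proof.
move=> h h'; rewrite /gr; have := gr_den v h; have := gr_den v h'.
by move: (rc (lam * v)) => a h1 h2; field; rewrite h1 h2.
Qed.
End green.

Section mean_green.
Context {R : realType}.
Variables (E : (R -> R) -> R) (hE : is_mean E) (lam : R).
Implicit Types w z : R[i].
Notation gr := (gr lam).

(** With [w = z + m] the equation of [m_fc] reads [w = z + stj w]. Working with [w] rather than [m]
    makes the perturbation identities symmetric. *)
Definition stj w := cmean E (gr w).
Arguments stj : simpl never.
(** The divided difference of [stj] between [w] and [w'], by the resolvent identity for scalars; at
    [w = w'] it is the derivative. Stability amounts to keeping [1 - kap] away from [0]. *)
Definition kap w w' := cmean E (fun v => gr w v * gr w' v).
Definition sq w := E (fun v => nc (gr w v) ^+ 2).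

Lemma cbm_gr2 w w' : 0 < Iz w -> 0 < Iz w' -> cbm (fun v => gr w v * gr w' v).
Proof. by move=> h h'; apply: cbmM; exact: cbm_gr. Qed.
Lemma bmf_sq w : 0 < Iz w -> bmf (fun v => nc (gr w v) ^+ 2).
Proof. by move=> h; apply/bmfX/bmf_nc/cbm_gr. Qed.

Lemma stj_diff w w' : 0 < Iz w -> 0 < Iz w' ->
 stj w - stj w' = (w - w') * kap w w'.
Proof.
move=> h h'; rewrite /stj -cmeanB //; [|exact: cbm_gr|exact: cbm_gr].
rewrite -cmeanZ //; last exact: cbm_gr2.
by congr cmean; apply/funext => v; exact: gr_diff.
Qed.
Lemma Im_stj w : 0 < Iz w -> Iz (stj w) = Iz w * sq w.
Proof.
move=> h; rewrite /sq -(meanZ hE) //; last exact: bmf_sq.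
by rewrite /=; congr E; apply/funext => v; exact: Im_gr.
Qed.
Lemma sq_ge0 w : 0 < Iz w -> 0 <= sq w.
Proof. by move=> h; apply: (mean_ge0 hE) => [|v]; [exact: bmf_sq|exact: sqr_ge0]. Qed.
Lemma Im_stj_ge0 w : 0 < Iz w -> 0 <= Iz (stj w).
Proof. by move=> h; rewrite Im_stj // mulr_ge0 ?sq_ge0 // ltW. Qed.
Lemma nc_stj w : 0 < Iz w -> nc (stj w) <= (Iz w)^-1.
Proof.
move=> h; apply: le_trans (nc_cmean hE (cbm_gr _ h)) _.
rewrite -[leRHS](mean_const hE); apply: (mean_le hE).
- exact/bmf_nc/cbm_gr.
- exact: bmf_cst.
- by move=> v; exact: gr_nc.
Qed.
Lemma Im_stj_le w : 0 < Iz w -> Iz (stj w) <= (Iz w)^-1.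
Proof. by move=> h; apply: le_trans (nc_stj h); apply: le_trans (Im_le _); exact: ler_norm. Qed.
Lemma nc_stj_sq w : 0 < Iz w -> nc (stj w) ^+ 2 <= sq w.
Proof.
move=> h; have hb := bmf_nc (cbm_gr lam h).
apply: le_trans (mean_sqr hE hb).
rewrite ler_sqr ?nnegrE ?nc_ge0 //; first exact/(nc_cmean hE)/cbm_gr.
by apply: (mean_ge0 hE) => // v; exact: nc_ge0.
Qed.

(* [|g - conj g'|^2 >= (Im g + Im g')^2], and Jensen. *)
Lemma Re_kap w w' : 0 < Iz w -> 0 < Iz w' ->
 2 * Rz (kap w w') <= sq w + sq w' - (Iz (stj w) + Iz (stj w')) ^+ 2.
Proof.
move=> h h'.
have hI u : 0 < Iz u -> bmf (fun v => Iz (gr u v)) by move=> /(cbm_gr lam)[].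
have hR : bmf (fun v => Rz (gr w v * gr w' v)) by case: (cbm_gr2 h h').
have hS : bmf (fun v => Iz (gr w v) + Iz (gr w' v)) by apply: bmfD; exact: hI.
have h1 := mean_sqr hE hS; rewrite (meanD hE) in h1; [|exact: hI|exact: hI].
have : E (fun v => 2 * Rz (gr w v * gr w' v)) <=
  E (fun v => nc (gr w v) ^+ 2 + nc (gr w' v) ^+ 2 - (Iz (gr w v) + Iz (gr w' v)) ^+ 2).
 apply: (mean_le hE).
 - exact: bmfZ.
 - by apply: bmfB; [apply: bmfD; exact: bmf_sq|exact: bmfX].
 move=> v; rewrite nc_half lerB // (nc2 (_ - _)) cImB cImJ opprK.
 by rewrite lerDr sqr_ge0.
rewrite (meanZ hE) // (meanB hE); [|by apply: bmfD; exact: bmf_sq|exact: bmfX].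
rewrite (meanD hE); [|exact: bmf_sq|exact: bmf_sq].
move: h1; rewrite /sq /kap /=; set a := E _; set b := E _; lra.
Qed.

(** Cauchy-Schwarz for an abstract mean: the mean of [|g - conj (c g')|^2] with
    [c = s * conj (kap w w')] is a quadratic polynomial in the real [s] that never becomes
    negative. *)
Lemma nc_kap w w' : 0 < Iz w -> 0 < Iz w' -> nc (kap w w') ^+ 2 <= sq w * sq w'.
Proof.
move=> h h'; set k := kap w w'.
have key (s : R) : 0 <= sq w - 2 * s * nc k ^+ 2 + s ^+ 2 * nc k ^+ 2 * sq w'.
 pose c := rc s * conjc k.
 have : 0 <= E (fun v => nc (gr w v - conjc (c * gr w' v)) ^+ 2).
  apply: (mean_ge0 hE) => [|v]; last exact: sqr_ge0.
  apply/bmfX/bmf_nc/cbmB; first exact: cbm_gr.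
  by apply/cbmJ/cbmM; [exact: cbm_cst|exact: cbm_gr].
 have -> : (fun v => nc (gr w v - conjc (c * gr w' v)) ^+ 2) =
   (fun v => nc (gr w v) ^+ 2 + (nc c ^+ 2 * nc (gr w' v) ^+ 2 +
    (- 2) * Rz (c * (gr w v * gr w' v)))).
  apply/funext => v; have := nc_half (gr w v) (c * gr w' v).
  rewrite (ncM c) exprMn [gr w v * (c * _)]mulrCA; lra.
 have hc : cbm (fun v => c * (gr w v * gr w' v)) by apply: cbmM (cbm_cst _) (cbm_gr2 h h').
 have hR : bmf (fun v => Rz (c * (gr w v * gr w' v))) by case: hc.
 rewrite (meanD hE) ?(meanD hE) ?(meanZ hE) //.
 all: try (exact: bmf_sq); try (exact: bmfZ (bmf_sq h')); try (exact: bmfZ).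
 2: by apply: bmfD; [exact: bmfZ (bmf_sq h')|exact: bmfZ].
 have -> : E (fun v => Rz (c * (gr w v * gr w' v))) = s * nc k ^+ 2.
  rewrite -[LHS]/(Rz (cmean E (fun v => c * (gr w v * gr w' v)))).
  rewrite (cmeanZ hE); last exact: cbm_gr2.
  by rewrite /c -mulrA [conjc k * _]mulrC mulJ cReM Re_rc Im_rc mul0r subr0.
 rewrite /c ncM ncJ nc_rc exprMn real_normK ?num_real // /sq.
 set x := E _; set y := E _; lra.
(* If [sq w' = 0] the polynomial is affine in [s], and a large [s] would make it negative unless
   [kap = 0]; otherwise [s = 1 / sq w'] is the optimal value. *)
have [s0|s0] := leP (sq w') 0.
 have sE : sq w' = 0 by apply/eqP; rewrite eq_le s0 sq_ge0.
 rewrite sE mulr0 leNgt; apply/negP => x0.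
 have := key ((sq w + 1) / nc k ^+ 2); rewrite sE mulr0 addr0.
 by rewrite mulrA divfK ?gt_eqF //; have := sq_ge0 h; lra.
have := key (sq w')^-1.
have -> : sq w - 2 * (sq w')^-1 * nc k ^+ 2 + (sq w')^-1 ^+ 2 * nc k ^+ 2 * sq w' =
 (sq w * sq w' - nc k ^+ 2) / sq w' by field; rewrite gt_eqF.
by rewrite pmulr_lge0 ?invr_gt0 // subr_ge0.
Qed.

Lemma stab_id z z' w w' dl dl' : 0 < Iz w -> 0 < Iz w' ->
 w = z + stj w + dl -> w' = z' + stj w' + dl' ->
 (w - w') * (1 - kap w w') = z - z' + (dl - dl').
Proof.
move=> h h' e e'; rewrite mulrBr mulr1 -stj_diff //.
by rewrite {1}e {1}e'; ring.
Qed.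

(** Taking imaginary parts in [w = z + stj w + dl] gives [sq w = 1 - (Im z + Im dl) / Im w];
    inserting this for both points into [Re_kap] turns the bound on [Re kap] into a lower bound on
    [1 - Re kap]. The square of the imaginary parts is what survives when [Im z] tends to [0], so
    stability holds wherever [Im m] is bounded below. *)
Lemma stab_re z z' w w' dl dl' : 0 < Iz w -> 0 < Iz w' ->
 w = z + stj w + dl -> w' = z' + stj w' + dl' ->
 (Iz (stj w) + Iz (stj w')) ^+ 2 + (Iz z + Iz dl) / Iz w + (Iz z' + Iz dl') / Iz w'
  <= 2 * (1 - Rz (kap w w')).
Proof.
move=> h h' e e'; have := Re_kap h h'.
have s u y d0 : 0 < Iz u -> u = y + stj u + d0 -> sq u = 1 - (Iz y + Iz d0) / Iz u.
 move=> u0 eu; have := congr1 (fun x : R[i] => Iz x) eu; rewrite !cImD Im_stj // => ei.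
 have -> : Iz y + Iz d0 = Iz u - Iz u * sq u by lra.
 by field; rewrite gt_eqF.
by rewrite (s _ _ _ h e) (s _ _ _ h' e'); lra.
Qed.

Lemma stab_bound z z' w w' dl dl' : 0 < Iz w -> 0 < Iz w' ->
 w = z + stj w + dl -> w' = z' + stj w' + dl' ->
 nc (w - w') * ((Iz (stj w) + Iz (stj w')) ^+ 2 + (Iz z + Iz dl) / Iz w
  + (Iz z' + Iz dl') / Iz w') <= 2 * nc (z - z' + (dl - dl')).
Proof.
move=> h h' e e'; rewrite -(stab_id h h' e e') ncM.
have := stab_re h h' e e'; set a := _ + _; move=> ha.
have h1 : 1 - Rz (kap w w') <= nc (1 - kap w w').
 by apply: le_trans (Re_le _); rewrite cReB /=; exact: ler_norm.
have n0 := nc_ge0 (w - w').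
have : nc (w - w') * a <= nc (w - w') * (2 * nc (1 - kap w w')).
 by apply: ler_wpM2l => //; lra.
lra.
Qed.

Section existence.
Variables (z : R[i]) (z0 : 0 < Iz z).
Fixpoint fp_iter k := if k is k'.+1 then z + stj (fp_iter k') else z.
Let u := fp_iter.
Let B := (Iz z)^-1.
Let q := B / (Iz z + B).

Lemma fp_iter_Im k : Iz z <= Iz (u k) <= Iz z + B.
Proof.
have B0 : 0 < B by rewrite invr_gt0.
elim: k => [|k /andP[h _]]; first by rewrite /u /= lexx lerDl ltW.
have h' := lt_le_trans z0 h.
rewrite [u k.+1]/(z + stj (u k)) cImD lerDl Im_stj_ge0 // lerD2l.
by apply: le_trans (Im_stj_le h') _; rewrite lef_pV2 ?posrE.
Qed.

(** The quotient [|a - b|^2 / (Im a Im b)] is an increasing function of the hyperbolic distance.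
    Cauchy-Schwarz bounds [|kap a b|^2] by [sq a * sq b], and [sq a = Im (stj a) / Im a], so the
    factor gained is a product of two quotients [x / (Im z + x)] with [x <= 1 / Im z], each at most
    [q]. *)
Lemma fp_contract a b : 0 < Iz a -> 0 < Iz b -> Iz z <= Iz a -> Iz z <= Iz b ->
 nc (stj a - stj b) ^+ 2 / (Iz (z + stj a) * Iz (z + stj b)) <=
 q ^+ 2 * (nc (a - b) ^+ 2 / (Iz a * Iz b)).
Proof.
move=> a0 b0 ha hb; rewrite stj_diff // ncM exprMn.
have B0 : 0 < B by rewrite invr_gt0.
have hq x : 0 <= x <= B -> 0 <= x / (Iz z + x) <= q.
 move=> /andP[x0 xB]; have -> /= : 0 <= x / (Iz z + x) by rewrite divr_ge0 // addr_ge0 // ltW.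
 rewrite /q ler_pdivrMr ?ltr_pwDl // mulrAC ler_pdivlMr ?ltr_pwDl //.
 by rewrite !mulrDr [B * x]mulrC lerD2r; apply: ler_wpM2r => //; exact: ltW.
 exact: ltW.
have hS u0 : 0 < Iz u0 -> Iz z <= Iz u0 -> 0 <= Iz (stj u0) <= B.
 move=> h h'; apply/andP; split; first exact: Im_stj_ge0.
 by apply: le_trans (Im_stj_le h) _; rewrite lef_pV2 ?posrE.
have Sa := hS _ a0 ha; have Sb := hS _ b0 hb.
have qa := hq _ Sa; have qb := hq _ Sb.
have pa : 0 < Iz z + Iz (stj a) by case/andP: Sa => *; rewrite ltr_pwDl.
have pb : 0 < Iz z + Iz (stj b) by case/andP: Sb => *; rewrite ltr_pwDl.
rewrite !cImD.
apply: (via (nc (a - b) ^+ 2 * (sq a * sq b) /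
  ((Iz z + Iz (stj a)) * (Iz z + Iz (stj b))))).
 rewrite ler_pM2r ?invr_gt0 ?mulr_gt0 //.
 by apply: ler_wpM2l; [exact: sqr_ge0|exact: nc_kap].
have -> : sq a = Iz (stj a) / Iz a by rewrite Im_stj // mulrAC divff ?mul1r // gt_eqF.
have -> : sq b = Iz (stj b) / Iz b by rewrite Im_stj // mulrAC divff ?mul1r // gt_eqF.
set x := Iz (stj a); set y := Iz (stj b).
have -> : nc (a - b) ^+ 2 * (x / Iz a * (y / Iz b)) / ((Iz z + x) * (Iz z + y)) =
 ((x / (Iz z + x)) * (y / (Iz z + y))) * (nc (a - b) ^+ 2 / (Iz a * Iz b)).
 by field; rewrite !gt_eqF.
apply: ler_wpM2r; first by apply: divr_ge0; [exact: sqr_ge0|apply: mulr_ge0; exact: ltW].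
by case/andP: qa => *; case/andP: qb => *; rewrite expr2; apply: ler_pM.
Qed.

(** Picard iteration started at [z]. The hyperbolic quotient of consecutive iterates decays like
    [q^(2 k)], and since all heights stay between [Im z] and [Im z + 1 / Im z] this gives geometric
    decay of the Euclidean steps. The limit is a fixed point because [kap] is bounded by [B^2] at
    these heights. *)
Lemma stj_exists : exists w, [/\ 0 < Iz w, 0 <= Iz (stj w) & w = z + stj w].
Proof.
have B0 : 0 < B by rewrite invr_gt0.
have q0 : 0 <= q by rewrite divr_ge0 ?addr_ge0 ?ltW.
have q1 : q < 1 by rewrite /q ltr_pdivrMr ?mul1r ?ltrDr // addr_gt0.
have uI k : 0 < Iz (u k) by case/andP: (fp_iter_Im k) => h _; exact: lt_le_trans h.
pose T k := nc (u k.+1 - u k) ^+ 2 / (Iz (u k.+1) * Iz (u k)).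
have T0 k : 0 <= T k by rewrite divr_ge0 ?sqr_ge0 // mulr_ge0 ?ltW.
have hT k : T k <= T 0%N * q ^+ k ^+ 2.
 elim: k => [|k IH]; first by rewrite expr0 expr1n mulr1.
 have -> : T k.+1 = nc (stj (u k.+1) - stj (u k)) ^+ 2 /
   (Iz (z + stj (u k.+1)) * Iz (z + stj (u k))).
  rewrite /T; have -> : u k.+2 - u k.+1 = stj (u k.+1) - stj (u k) by rewrite {1 2}/u /=; ring.
  by [].
 have hz j : Iz z <= Iz (u j) by case/andP: (fp_iter_Im j).
 apply: le_trans (fp_contract (uI _) (uI _) (hz _) (hz _)) _.
 apply: le_trans (ler_wpM2l (sqr_ge0 q) IH) _.
  have -> : T 0%N * q ^+ k.+1 ^+ 2 = q ^+ 2 * (T 0%N * q ^+ k ^+ 2) by rewrite [q ^+ k.+1]exprS; ring.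
  by [].
pose C := (1 + T 0%N) * (Iz z + B).
have zB : 0 <= Iz z + B by rewrite addr_ge0 // ltW.
have C0 : 0 <= C by apply: mulr_ge0 => //; apply: addr_ge0 => //; exact: T0.
have hD k : nc (u k.+1 - u k) <= C * q ^+ k.
 have Cq : 0 <= C * q ^+ k by apply: mulr_ge0 => //; exact: exprn_ge0.
 rewrite -ler_sqr ?nnegrE ?nc_ge0 //.
 have -> : nc (u k.+1 - u k) ^+ 2 = T k * (Iz (u k.+1) * Iz (u k)).
  by rewrite /T divfK // mulf_neq0 // gt_eqF.
 have hI j : Iz (u j) <= Iz z + B by case/andP: (fp_iter_Im j).
 apply: (via (T 0%N * q ^+ k ^+ 2 * (Iz z + B) ^+ 2)).
  apply: ler_pM => //; first by apply: mulr_ge0; exact: ltW.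
  by rewrite expr2; apply: ler_pM => //; exact: ltW.
 have -> : (C * q ^+ k) ^+ 2 = (1 + T 0%N) ^+ 2 * q ^+ k ^+ 2 * (Iz z + B) ^+ 2 by rewrite /C; ring.
 apply: ler_wpM2r; first exact: sqr_ge0.
 apply: ler_wpM2r; first exact: sqr_ge0.
 by have := T0 0%N; nra.
have cR : cvgn (fun k => Rz (u k)).
 apply: (@cvg_geometric_steps _ _ C q) => [|k]; first by rewrite q0.
 by rewrite -cReB; apply: le_trans (Re_le _) (hD k).
have cI : cvgn (fun k => Iz (u k)).
 apply: (@cvg_geometric_steps _ _ C q) => [|k]; first by rewrite q0.
 by rewrite -cImB; apply: le_trans (Im_le _) (hD k).
pose w := Cx (limn (fun k => Rz (u k))) (limn (fun k => Iz (u k))).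
have wz : Iz z <= Iz w.
 by apply: limr_ge => //; near=> k; case/andP: (fp_iter_Im k).
have w0 : 0 < Iz w := lt_le_trans z0 wz.
exists w; split => //; first exact: Im_stj_ge0.
have cw (e : R) : 0 < e -> \forall k \near \oo, nc (w - u k) <= e.
 move=> e0.
 have e2 : 0 < e / 2 by rewrite divr_gt0.
 move/cvgr_dist_le : cR => /(_ _ e2) h1; move/cvgr_dist_le : cI => /(_ _ e2) h2.
 near=> k; apply: le_trans (nc_le_ReIm _) _; rewrite cReB cImB.
 have a1 : `|Rz w - Rz (u k)| <= e / 2 by near: k.
 have a2 : `|Iz w - Iz (u k)| <= e / 2 by near: k.
 lra.
apply/eqP; rewrite -subr_eq0 -nc_eq0 eq_le nc_ge0 andbT.
apply/ler_addgt0Pr => e e0; rewrite add0r.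
pose e' := e / (1 + B ^+ 2).
have e'0 : 0 < e' by rewrite divr_gt0 // ltr_pwDl ?sqr_ge0.
have h := cw e' e'0.
have [k [h1 h2]] : exists k, nc (w - u k) <= e' /\ nc (w - u k.+1) <= e'.
 case: h => n _ hn; exists n; split; apply: hn => //=.
apply: (via (nc (w - u k.+1) + nc (stj (u k) - stj w))).
 have -> : w - (z + stj w) = (w - u k.+1) + (stj (u k) - stj w).
  by rewrite {1}/u /=; ring.
 exact: ncD.
rewrite stj_diff // ncM.
have hk : nc (kap (u k) w) <= B ^+ 2.
 rewrite -ler_sqr ?nnegrE ?nc_ge0 ?sqr_ge0 //.
 apply: le_trans (nc_kap _ _) _ => //.
 have hs (x : R[i]) : 0 < Iz x -> Iz z <= Iz x -> sq x <= B ^+ 2.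
  move=> x0 hx; rewrite /sq -[leRHS](mean_const hE).
  apply: (mean_le hE); [exact: bmf_sq|exact: bmf_cst|move=> v].
  rewrite ler_sqr ?nnegrE ?nc_ge0 ?(ltW B0) //.
  by apply: le_trans (gr_nc _ _ x0) _; rewrite lef_pV2 ?posrE.
 rewrite [leRHS]expr2; apply: ler_pM; [exact: sq_ge0|exact: sq_ge0| |exact: hs].
 by apply: hs => //; case/andP: (fp_iter_Im k).
rewrite ncC in h1.
apply: (via (e' + e' * B ^+ 2)).
 by apply: lerD => //; apply: ler_pM => //; exact: nc_ge0.
by rewrite -[X in X + _]mulr1 -mulrDr /e' divfK // gt_eqF // ltr_pwDl ?sqr_ge0.
Unshelve. all: by end_near.
Qed.
End existence.
End mean_green.

Lemma lesq (R : realType) (x y : R) : 0 <= x -> x <= y -> x ^+ 2 <= y ^+ 2.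
Proof. by move=> x0 xy; rewrite ler_sqr ?nnegrE // (le_trans x0). Qed.

(** The geometric comparison behind [quasi_unimodal]: a point at height at most [c / 2] which lies
    to the right of the support point [l], up to [c / 2], is nearer to [l] than a point further
    right at height at least [c]. *)
Lemma shift_sqr_le (R : realType) (l u u2 v v2 c : R) : 0 < v -> v <= c / 2 -> c <= v2 ->
 u <= u2 -> l - u <= c / 2 -> (l - u) ^+ 2 + v ^+ 2 <= (l - u2) ^+ 2 + v2 ^+ 2.
Proof.
move=> v0 vc cv uu lu.
have bI : v ^+ 2 <= (c / 2) ^+ 2 by apply: lesq => //; exact: ltW.
have cI : c ^+ 2 <= v2 ^+ 2 by apply: lesq => //; lra.
have [hv|hv] := leP l u.
 apply: lerD; last by have := sqr_ge0 c; lra.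
 by rewrite -sqrrN -[leRHS]sqrrN; apply: lesq; lra.
have : (l - u) ^+ 2 <= (c / 2) ^+ 2 by apply: lesq; lra.
by have := sqr_ge0 (l - u2); have := sqr_ge0 c; lra.
Qed.

Section cube_root.
Context {R : realType}.
Definition cr (x : R) : R := x `^ 3^-1.
Lemma cr_ge0 x : 0 <= cr x. Proof. exact: powR_ge0. Qed.
Lemma cr_cube x : 0 <= x -> cr x ^+ 3 = x.
Proof. by move=> x0; rewrite -powR_mulrn ?cr_ge0 // /cr -powRrM mulVf ?powRr1. Qed.
Lemma cr_le x y : 0 <= x -> x <= y -> cr x <= cr y.
Proof. by move=> x0 xy; apply: ge0_ler_powR => //; rewrite ?nnegrE ?invr_ge0 // (le_trans x0). Qed.
Lemma le_cr (d x : R) : 0 <= x -> d ^+ 3 <= x -> d <= cr x.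
Proof.
move=> x0 dx; rewrite leNgt; apply/negP => h.
have d0 : 0 <= d by apply: le_trans (cr_ge0 x) (ltW h).
suff : x < d ^+ 3 by rewrite ltNge dx.
by rewrite -{1}(cr_cube x0) ltrXn2r ?cr_ge0 ?nnegrE.
Qed.
Lemma cr_small (e : R) : 0 < e -> exists2 d, 0 < d & forall x, 0 <= x -> x <= d -> cr (6 * x) <= e.
Proof.
move=> e0; exists (e ^+ 3 / 6); first by rewrite divr_gt0 // exprn_gt0.
move=> x x0 xd; rewrite leNgt; apply/negP => h.
have x6 : 0 <= 6 * x by rewrite mulr_ge0.
have := cr_cube x6; suff : e ^+ 3 < cr (6 * x) ^+ 3 by lra.
by rewrite ltrXn2r ?nnegrE ?cr_ge0 // ltW.
Qed.
End cube_root.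

(** * The solution [m] of the fixed point equation: bounds, regularity, boundary values *)

Section selfconsistent.
Context {R : realType}.
Variables (E : (R -> R) -> R) (hE : is_mean E) (lam : R) (lam_ge0 : 0 <= lam).
Hypothesis hsupp : forall f : R -> R, bmf f -> (forall v, -1 <= v <= 1 -> 0 <= f v) -> 0 <= E f.
Variable m : R[i] -> R[i].
Hypotheses (m_ge0 : forall z, 0 < Iz z -> 0 <= Iz (m z))
 (m_eq : forall z, 0 < Iz z -> m z = stj E lam (z + m z)).
Notation sq := (sq E lam).
Notation kap := (kap E lam).
Notation stj := (stj E lam).
Implicit Types z : R[i].

Definition wz z := z + m z.

Lemma supp_le (f g : R -> R) : bmf f -> bmf g -> (forall v, -1 <= v <= 1 -> f v <= g v) -> E f <= E g.
Proof.
move=> hf hg h; rewrite -subr_ge0 -(meanB hE) //.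
by apply: hsupp => [|v hv]; [exact: bmfB|rewrite subr_ge0; exact: h].
Qed.

Lemma Im_wz z : Iz (wz z) = Iz z + Iz (m z). Proof. exact: cImD. Qed.
Lemma wz_gt0 z : 0 < Iz z -> 0 < Iz (wz z).
Proof. by move=> h; rewrite Im_wz ltr_pwDl // m_ge0. Qed.
Lemma wz_ge z : 0 < Iz z -> Iz z <= Iz (wz z).
Proof. by move=> h; rewrite Im_wz lerDl m_ge0. Qed.
Lemma wz_eq z : 0 < Iz z -> wz z = z + stj (wz z) + 0.
Proof. by move=> h; rewrite addr0 /wz {1}m_eq. Qed.
Lemma stj_wz z : 0 < Iz z -> stj (wz z) = m z.
Proof. by move=> h; rewrite [RHS]m_eq. Qed.
Lemma Im_m z : 0 < Iz z -> Iz (m z) = Iz (wz z) * sq (wz z).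
Proof. by move=> h; rewrite -[m z]stj_wz // Im_stj // wz_gt0. Qed.
(** The imaginary part of the fixed point equation. Since the right side is at most [1], Jensen's
    inequality yields [|m| <= 1] in [nc_m]. *)
Lemma sq_wz z : 0 < Iz z -> sq (wz z) = 1 - Iz z / Iz (wz z).
Proof.
move=> h; have h' := wz_gt0 h; have := Im_m h.
have -> : Iz (m z) = Iz (wz z) - Iz z by rewrite Im_wz addrC addKr.
move=> e; apply: (mulfI (lt0r_neq0 h')); rewrite -e mulrBr mulr1 mulrCA divff ?mulr1 //.
by rewrite gt_eqF.
Qed.
Lemma sq_wz_le1 z : 0 < Iz z -> sq (wz z) <= 1.
Proof. by move=> h; rewrite sq_wz // gerBl divr_ge0 ?ltW // wz_gt0. Qed.
Lemma nc_m z : 0 < Iz z -> nc (m z) <= 1.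
Proof.
move=> h; rewrite -[m z]stj_wz // -ler_sqr ?nnegrE ?nc_ge0 // expr1n.
exact: le_trans (nc_stj_sq hE _ (wz_gt0 h)) (sq_wz_le1 h).
Qed.
Lemma Im_m_le1 z : 0 < Iz z -> Iz (m z) <= 1.
Proof. by move=> h; apply: le_trans (nc_m h); apply: le_trans (Im_le _); exact: ler_norm. Qed.

Lemma wz_lip z z' : 0 < Iz z -> 0 < Iz z' ->
 nc (wz z - wz z') * (Iz (m z) + Iz (m z')) ^+ 2 <= 2 * nc (z - z').
Proof.
move=> h h'; have := stab_bound hE (wz_gt0 h) (wz_gt0 h') (wz_eq h) (wz_eq h').
rewrite !stj_wz // !Im_rc !addr0 subrr addr0; apply: le_trans.
apply: ler_wpM2l; first exact: nc_ge0.
rewrite -addrA lerDl addr_ge0 // divr_ge0 ?ltW // wz_gt0 //.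
Qed.

(** Stability gives [|w - w'| (Im m + Im m')^2 <= 2 |z - z'|], and [Im m + Im m'] dominates
    [|Im m - Im m'|]. Hence the cube of the difference is at most [(|w - w'| + |z - z'|) (Im m + Im
    m')^2 <= 2 |z - z'| + 4 |z - z'|]: this is where the [6] in [cr (6 * _)] comes from. No lower
    bound on [Im m] enters, so the estimate also holds at the edges. *)
Lemma Im_m_holder z z' : 0 < Iz z -> 0 < Iz z' ->
 `|Iz (m z) - Iz (m z')| <= cr (6 * nc (z - z')).
Proof.
move=> h h'; apply: le_cr; first by rewrite mulr_ge0 ?nc_ge0.
have := wz_lip h h'; have := m_ge0 h; have := m_ge0 h'.
have := Im_m_le1 h; have := Im_m_le1 h'.
have : `|Iz (m z) - Iz (m z')| <= nc (wz z - wz z') + nc (z - z').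
 have -> : Iz (m z) - Iz (m z') = Iz (wz z - wz z' - (z - z')).
  by rewrite !cImB !Im_wz; ring.
 by apply: le_trans (Im_le _) _; exact: ncB.
have : `|Iz (m z) - Iz (m z')| ^+ 2 = (Iz (m z) - Iz (m z')) ^+ 2.
 by rewrite real_normK ?num_real.
have := normr_ge0 (Iz (m z) - Iz (m z')).
have := nc_ge0 (z - z'); have := nc_ge0 (wz z - wz z').
move: (Iz (m z)) (Iz (m z')) (nc (z - z')) (nc (wz z - wz z')) => a b dl D.
move: (`|a - b|) => x D0 dl0 x0 xE xD b1 a1 b0 a0 hD.
have xs : x ^+ 2 <= (a + b) ^+ 2 by rewrite xE; nra.
have s4 : (a + b) ^+ 2 <= 4 by nra.
rewrite exprS; apply: (via ((D + dl) * (a + b) ^+ 2)); last by nra.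
by apply: ler_pM => //; exact: sqr_ge0.
Qed.

Lemma gr_den_ge z v : 0 < Iz z -> -1 <= v <= 1 -> nc z - lam - 1 <= nc (rc (lam * v) - wz z).
Proof.
move=> h hv; have h1 : nc (rc (lam * v)) <= lam by rewrite nc_rc normrM ger0_norm //;
 rewrite -[leRHS]mulr1 ler_wpM2l // ler_norml.
have := nc_m h; have : nc z <= nc (rc (lam * v) - wz z) + nc (rc (lam * v)) + nc (m z).
 have e : z = - (rc (lam * v) - wz z) + rc (lam * v) - m z by rewrite /wz; ring.
 rewrite [X in nc X <= _]e; apply: le_trans (ncB _ _) _; rewrite lerD2r.
 by apply: le_trans (ncD _ _) _; rewrite ncN.
lra.
Qed.
Lemma gr_den_le z v : 0 < Iz z -> -1 <= v <= 1 -> nc (rc (lam * v) - wz z) <= lam + nc z + 1.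
Proof.
move=> h hv; have h1 : nc (rc (lam * v)) <= lam by rewrite nc_rc normrM ger0_norm //;
 rewrite -[leRHS]mulr1 ler_wpM2l // ler_norml.
have := nc_m h; have := ncB (rc (lam * v)) (wz z); have := ncD z (m z); rewrite -/(wz z).
lra.
Qed.

Lemma m_decay z : 0 < Iz z -> lam + 1 < nc z -> nc (m z) <= (nc z - lam - 1)^-1.
Proof.
move=> h hz; rewrite -[m z]stj_wz //; have h' := wz_gt0 h.
apply: le_trans (nc_cmean hE (cbm_gr lam h')) _.
rewrite -[leRHS](mean_const hE); apply: supp_le; [exact/bmf_nc/cbm_gr|exact: bmf_cst|].
move=> v hv; rewrite /gr ncV lef_pV2 ?posrE ?nc_gt0 ?gr_den //; last by lra.
exact: gr_den_ge.
Qed.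
(** At distance at least [2] from the support the squared kernel is at most [1/4], so
    [Im m <= (Im z + Im m) / 4]. Letting [Im z] tend to [0] confines the boundary density to
    [[-(lam + 3), lam + 3]]. *)
Lemma Im_m_outside z : 0 < Iz z -> lam + 3 <= nc z -> Iz (m z) <= Iz z.
Proof.
move=> h hz; have h' := wz_gt0 h.
have : sq (wz z) <= 4^-1.
 rewrite -[leRHS](mean_const hE); apply: supp_le; [exact: bmf_sq|exact: bmf_cst|].
 move=> v hv; rewrite /gr ncV exprVn lef_pV2 ?posrE ?exprn_gt0 ?nc_gt0 ?gr_den //.
 have -> : 4 = 2 ^+ 2 :> R by ring.
 rewrite ler_sqr ?nnegrE ?nc_ge0 //; apply: le_trans (gr_den_ge h hv); lra.
have := Im_m h; rewrite Im_wz => e hs.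
have : Iz (m z) <= (Iz z + Iz (m z)) * 4^-1 by rewrite {1}e -Im_wz ler_wpM2l // ltW.
by have := m_ge0 h; lra.
Qed.
Lemma Im_m_lower z : 0 < Iz z -> Iz z / (lam + nc z + 1) ^+ 2 <= Iz (m z).
Proof.
move=> h; have h' := wz_gt0 h; rewrite Im_m //.
have d0 : 0 < lam + nc z + 1 by rewrite ltr_wpDl // addr_ge0 ?nc_ge0.
apply: ler_pM; [exact: ltW|by rewrite invr_ge0 exprn_ge0 // ltW|exact: wz_ge|].
rewrite -[leLHS](mean_const hE); apply: supp_le; [exact: bmf_cst|exact: bmf_sq|].
move=> v hv; rewrite /gr ncV exprVn lef_pV2 ?posrE ?exprn_gt0 ?nc_gt0 ?gr_den //.
by rewrite ler_sqr ?nnegrE ?nc_ge0 ?(ltW d0) // gr_den_le.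
Qed.

(** For points at equal height [(w - w') (1 - kap)] is the real number [y - x], and [1 - kap] has
    positive real part by [stab_re]; so does its inverse. *)
Lemma Re_wz_mono (x y eta : R) : 0 < eta -> x < y ->
 Rz (wz (Cx x eta)) < Rz (wz (Cx y eta)).
Proof.
move=> e0 xy; set z := Cx y eta; set z' := Cx x eta.
have h : 0 < Iz z by []. have h' : 0 < Iz z' by [].
have := stab_id hE (wz_gt0 h) (wz_gt0 h') (wz_eq h) (wz_eq h').
have := stab_re hE (wz_gt0 h) (wz_gt0 h') (wz_eq h) (wz_eq h').
rewrite !Im_rc !addr0 subrr addr0.
set k := 1 - kap _ _; have -> : 1 - Rz (kap (wz z) (wz z')) = Rz k by rewrite cReB.
have -> : z - z' = rc (y - x) by apply: complex_eq; rewrite ?cReB ?cImB /= ?subrr.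
move=> hk ek.
have k0 : 0 < Rz k.
 rewrite -(pmulr_rgt0 _ (ltr0n R 2)); apply: lt_le_trans hk.
 rewrite ltr_pwDr ?divr_gt0 ?wz_gt0 // addr_ge0 ?sqr_ge0 // divr_ge0 ?ltW ?wz_gt0 //.
have kn : k != 0 by apply/eqP => k1; move: k0; rewrite k1 /= ltxx.
have e : wz z - wz z' = rc (y - x) * k^-1 by rewrite -ek mulfK.
rewrite -subr_gt0 -cReB e cReM Re_rc Im_rc mul0r subr0 cReV.
by rewrite mulr_gt0 ?subr_gt0 // divr_gt0 // exprn_gt0 // nc_gt0.
Qed.

Lemma nc_gr2 w v : nc (gr lam w v) ^+ 2 = ((lam * v - Rz w) ^+ 2 + Iz w ^+ 2)^-1.
Proof. by rewrite /gr ncV exprVn nc2 cReB cImB Re_rc Im_rc sub0r sqrrN. Qed.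

(* With [u = Re w], the map [E |-> u] is increasing, and [Im w] is recovered from
  [E (1 / ((lam v - u)^2 + (Im w)^2)) = 1 - eta / Im w]. *)
Lemma quasi_unimodal (lam0 c kp a b : R) :
 lam <= lam0 -> 0 < c -> 0 < kp -> 0 < b -> b <= c / 2 -> b <= a / (1 + lam0 ^+ 2) ->
 lam0 * kp <= c / 2 ->
 (forall y, -(1 - kp) <= y <= 1 - kp -> forall f (s : R), bmf f -> (forall v, 0 <= f v) ->
   (forall v, `|v - y| <= b -> s <= f v) -> 2 * a * b * s <= E f) ->
 forall x1 x x2 eta, 0 < eta -> x1 <= x -> x <= x2 ->
 c <= Iz (wz (Cx x1 eta)) -> c <= Iz (wz (Cx x2 eta)) ->
 b <= Iz (wz (Cx x eta)).
Proof.
move=> ll c0 kp0 b0 bc ba lk hd x1 x x2 eta e0 h1 h2 g1 g2.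
rewrite leNgt; apply/negP => hb.
set w := wz (Cx x eta); set w1 := wz (Cx x1 eta); set w2 := wz (Cx x2 eta).
have Iw : 0 < Iz w by apply: wz_gt0.
have Iw1 : 0 < Iz w1 by apply: wz_gt0.
have Iw2 : 0 < Iz w2 by apply: wz_gt0.
have eqw : sq w = 1 - eta / Iz w by apply: sq_wz.
have R1 : Rz w1 <= Rz w.
 by move: h1; rewrite /w1 le_eqVlt => /orP[/eqP->|/(Re_wz_mono e0)/ltW] //.
have R2 : Rz w <= Rz w2.
 by move: h2; rewrite /w2 le_eqVlt => /orP[/eqP<-|/(Re_wz_mono e0)/ltW] //.
(* If [w] is at least as near as [w'] to every point [lam v] of the support, then [sq w' <= sq w];
   the fixed point equation turns this into [Im w' <= Im w], against [Im w < b <= c / 2]. *)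
have cmp w' x' : w' = wz (Cx x' eta) -> c <= Iz w' ->
  (forall v, -1 <= v <= 1 -> (lam * v - Rz w) ^+ 2 + Iz w ^+ 2 <= (lam * v - Rz w') ^+ 2 + Iz w' ^+ 2) -> False.
 move=> ew hc hv; have I' : 0 < Iz w' by rewrite ew; apply: wz_gt0.
 have : sq w' <= sq w.
  apply: supp_le; [exact: bmf_sq|exact: bmf_sq|move=> v hv'].
  rewrite !nc_gr2 lef_pV2 ?posrE; [exact: hv| |].
  - by rewrite ltr_wpDl ?sqr_ge0 ?exprn_gt0.
  - by rewrite ltr_wpDl ?sqr_ge0 ?exprn_gt0.
 have -> : sq w' = 1 - eta / Iz w' by rewrite ew; apply: sq_wz.
 rewrite eqw lerD2l lerN2 ler_pM2l // lef_pV2 ?posrE // => hh.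
 by move: (le_trans hc hh); rewrite leNgt => /negP; apply; lra.
have lkp : lam * kp <= c / 2 by apply: le_trans lk; rewrite ler_wpM2r // ltW.
have lk0 : 0 <= lam * kp by rewrite mulr_ge0 // ltW.
have hbc : Iz w <= c / 2 by exact: le_trans (ltW hb) bc.
(* Beyond the shrunken support, [w] is compared with [w2] on the right and with [w1] on the left.
   The strip of width [lam kp] cut off at each end is at most [c / 2], which [shift_sqr_le]
   tolerates. *)
have [hA|hA] := leP (Rz w) (lam * (1 - kp)); last first.
 apply: (cmp w2 x2 erefl g2) => v /andP[v1 v2].
 have lv := ler_wpM2l lam_ge0 v2; rewrite mulr1 in lv.
 by apply: (@shift_sqr_le _ _ _ _ _ _ c) => //; move: hA lv lkp; rewrite mulrBr mulr1; lra.
have [hC|hC] := leP (- (lam * (1 - kp))) (Rz w); last first.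
 apply: (cmp w1 x1 erefl g1) => v /andP[v1 v2].
 have lv := ler_wpM2l lam_ge0 v1; rewrite mulrN1 in lv.
 have nn (x' y' : R) : (x' - y') ^+ 2 = (- x' - (- y')) ^+ 2 by ring.
 rewrite (nn _ (Rz w)) (nn _ (Rz w1)).
 apply: (@shift_sqr_le _ _ _ _ _ _ c) => //; first by rewrite lerN2.
 by move: hC lv lkp; rewrite mulrBr mulr1; lra.
(* Now [Re w] lies over a point [y] around which the law has a density bounded below. For [lam = 0]
   the choice [y = 0] works if [kp <= 1]; otherwise the comparison with [w2] already concludes. *)
have [y [hy ey]] : exists y, -(1 - kp) <= y <= 1 - kp /\ Rz w = lam * y.
 move: lam_ge0; rewrite le_eqVlt => /orP[/eqP l0|l0].
  have kp1 : kp <= 1 \/ 1 < kp by have [|] := leP kp 1; [left|right].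
  case: kp1 => kp1; first by exists 0; rewrite -l0 mul0r in hA hC *; split; lra.
  exfalso; apply: (cmp w2 x2 erefl g2) => v _.
  rewrite -l0 !mul0r in hA hC *; have -> : Rz w = 0 by lra.
  have h : Iz w ^+ 2 <= Iz w2 ^+ 2 by apply: lesq (ltW Iw) (le_trans hbc (le_trans _ g2)); lra.
  by rewrite subrr expr0n /= add0r; apply: le_trans h _; rewrite lerDr sqr_ge0.
 exists (Rz w / lam); rewrite mulrCA divff ?gt_eqF // mulr1; split=> //.
 by rewrite ler_pdivrMr // ler_pdivlMr // ![_ * lam]mulrC mulrN hA hC.
pose s := ((1 + lam0 ^+ 2) * b ^+ 2)^-1.
have l00 : 0 <= lam0 by exact: le_trans ll.
have q0 : 0 < 1 + lam0 ^+ 2 by rewrite ltr_pwDl ?sqr_ge0.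
(* On the window of half-width [b] the squared kernel is at least [s], so [sq w >= 2 a b s], which
   is at least [2] by the choice of [b], against [sq w <= 1]. *)
have : 2 * a * b * s <= sq w.
 apply: (hd y hy); [exact: bmf_sq|by move=> v; exact: sqr_ge0|move=> v hv].
 rewrite nc_gr2 ey -mulrBr exprMn /s lef_pV2 ?posrE; last 2 first.
 - by rewrite mulr_gt0 // exprn_gt0.
 - by rewrite ltr_wpDl ?exprn_gt0 // mulr_ge0 ?sqr_ge0.
 have v2 : (v - y) ^+ 2 <= b ^+ 2 by rewrite -real_normK ?num_real // ler_sqr ?nnegrE ?(ltW b0).
 have l2 : lam ^+ 2 <= lam0 ^+ 2 by exact: lesq.
 have I2 : Iz w ^+ 2 <= b ^+ 2 by exact: lesq (ltW Iw) (ltW hb).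
 rewrite mulrDl mul1r [leRHS]addrC; apply: lerD => //.
 by apply: ler_pM => //; exact: sqr_ge0.
have -> : 2 * a * b * s = 2 * (a / (1 + lam0 ^+ 2) / b).
 by rewrite /s; field; rewrite !gt_eqF.
have : 1 <= a / (1 + lam0 ^+ 2) / b by rewrite ler_pdivlMr // mul1r.
by have := sq_wz_le1 (_ : 0 < Iz (Cx x eta)); rewrite -/w => /(_ e0); lra.
Qed.

(** The boundary value of [Im m] on the real axis, defined as an infimum instead of a limit: by the
    Hölder estimate every term of the family bounds it from above, within [2 * cr (6 * eta)]. *)
Definition imb (x : R) : R :=
 inf [set Iz (m (Cx x eta)) + cr (6 * eta) | eta in [set eta | 0 < eta]].

Lemma imb_near x eta : 0 < eta -> `|Iz (m (Cx x eta)) - imb x| <= cr (6 * eta).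
Proof.
move=> e0; rewrite /imb; set S := image _ _.
have hz e : 0 < e -> 0 < Iz (Cx x e) by [].
have hol (e e' : R) : 0 < e -> 0 < e' ->
  `|Iz (m (Cx x e)) - Iz (m (Cx x e'))| <= cr (6 * `|e - e'|).
 move=> p p'; have := Im_m_holder (hz _ p) (hz _ p'); congr (_ <= cr (6 * _)).
 have -> : Cx x e - Cx x e' = 'i%C * rc (e - e').
  by apply: complex_eq; rewrite ?cReB ?cImB ?cReM ?cImM /=; ring.
 by rewrite ncM nc_rc /= expr0n expr1n add0r sqrtr1 mul1r.
have lb : lbound S (Iz (m (Cx x eta)) - cr (6 * eta)).
 move=> _ [e p <-]; have := hol _ _ e0 p; rewrite ler_norml => /andP[_].
 have : cr (6 * `|eta - e|) <= cr (6 * eta) + cr (6 * e).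
  have [h|h] := leP e eta.
   apply: (via (cr (6 * eta))); last by rewrite lerDl cr_ge0.
   apply: cr_le; first by rewrite mulr_ge0.
   by rewrite ger0_norm ?subr_ge0 // ler_pM2l // gerBl ltW.
  apply: (via (cr (6 * e))); last by rewrite lerDr cr_ge0.
  apply: cr_le; first by rewrite mulr_ge0.
  by rewrite ltr0_norm ?subr_lt0 // ler_pM2l // opprB gerBl ltW.
 lra.
have S0 : S !=set0 by exists (Iz (m (Cx x eta)) + cr (6 * eta)); exists eta.
rewrite ler_distl; apply/andP; split; last first.
 by rewrite -lerBlDr; exact: lb_le_inf.
rewrite lerBlDr; apply: ge_inf; last by exists eta.
by exists (Iz (m (Cx x eta)) - cr (6 * eta)).
Qed.

Lemma imb_holder x y : `|imb x - imb y| <= cr (6 * `|x - y|).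
Proof.
apply/ler_addgt0Pr => e e0.
have e2 : 0 < e / 2 by rewrite divr_gt0.
have [d d0 hd] := cr_small e2; have ed := hd _ (ltW d0) (lexx _).
have h := Im_m_holder (_ : 0 < Iz (Cx x d)) (_ : 0 < Iz (Cx y d)).
have := h d0 d0; have := imb_near x d0; have := imb_near y d0.
have -> : nc (Cx x d - Cx y d) = `|x - y|.
 by rewrite -nc_rc; congr nc; apply: complex_eq; rewrite ?cReB ?cImB /= ?subrr.
by rewrite !ler_distl; lra.
Qed.
Lemma imb_ge0 x : 0 <= imb x.
Proof.
apply/ler_addgt0Pr => e e0; have [d d0 hd] := cr_small e0.
have := imb_near x d0; have := hd _ (ltW d0) (lexx _).
by have := m_ge0 (_ : 0 < Iz (Cx x d)) => /(_ d0); rewrite ler_distl; lra.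
Qed.
Lemma imb_le1 x : imb x <= 1.
Proof.
apply/ler_addgt0Pr => e e0; have [d d0 hd] := cr_small e0.
have := imb_near x d0; have := hd _ (ltW d0) (lexx _).
by have := Im_m_le1 (_ : 0 < Iz (Cx x d)) => /(_ d0); rewrite ler_distl; lra.
Qed.
Lemma imb_outside x : lam + 3 <= `|x| -> imb x = 0.
Proof.
move=> hx; apply/eqP; rewrite eq_le imb_ge0 andbT; apply/ler_addgt0Pr => e e0.
have e2 : 0 < e / 2 by rewrite divr_gt0.
have [d d0 hd] := cr_small e2.
pose t := Num.min d (e / 2).
have t0 : 0 < t by rewrite lt_min d0 divr_gt0.
have td : t <= d by rewrite ge_min lexx.
have := hd t (ltW t0) td.
have := imb_near x t0.
have := Im_m_outside (_ : 0 < Iz (Cx x t)) => /(_ t0) => h.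
have : Iz (m (Cx x t)) <= t.
 by apply: h; apply: le_trans hx _; exact: (Re_le (Cx x t)).
have : t <= e / 2 by rewrite ge_min lexx orbT.
by rewrite ler_distl add0r; lra.
Qed.
Lemma continuous_imb : continuous imb.
Proof.
move=> x; apply/cvgrPdist_le => e e0; have [d d0 hd] := cr_small e0.
near=> y; apply: le_trans (imb_holder x y) _; apply: hd; first exact: normr_ge0.
by near: y; apply: cvgr_dist_le.
Unshelve. all: by end_near.
Qed.
End selfconsistent.

(** * Holomorphy by quantitative expansions, and shifting of horizontal segments *)

Section hol.
Context {R : realType}.
Implicit Types (q D : R[i] -> R[i]) (z d : R[i]).

(* A quantitative, closed-half-plane version of holomorphy: first-order expansions
  with a uniform quadratic remainder. *)
Definition holx q D (C : R) :=
 [/\ 0 <= C, forall z, 0 <= Iz z -> nc (q z) <= C, forall z, 0 <= Iz z -> nc (D z) <= C &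
  forall z d, 0 <= Iz z -> 0 <= Iz (z + d) -> nc (q (z + d) - q z - d * D z) <= C * nc d ^+ 2].
Definition hol q := exists D C, holx q D C.

(** For [|d| <= 1] the first-order expansion gives the bound; for larger [d] the boundedness of [q]
    does. *)
Lemma holx_lip q D C z d : holx q D C -> 0 <= Iz z -> 0 <= Iz (z + d) ->
 nc (q (z + d) - q z) <= 2 * C * nc d.
Proof.
move=> [C0 hq hD h] z0 zd.
have d0 := nc_ge0 d.
have [d1|d1] := leP (nc d) 1.
 have := h z d z0 zd; have := nc_triB (q (z + d) - q z) (d * D z); rewrite ncM.
 have : nc d * nc (D z) <= nc d * C by apply: ler_wpM2l => //; exact: hD.
 have : C * nc d ^+ 2 <= C * nc d.
  by apply: ler_wpM2l => //; rewrite expr2 -[leRHS]mulr1 ler_wpM2l.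
 lra.
have := ncB (q (z + d)) (q z); have := hq _ zd; have := hq _ z0.
have : C <= C * nc d by rewrite -[leLHS]mulr1 ler_wpM2l // ltW.
lra.
Qed.

Lemma hol_cst a : hol (fun=> a).
Proof.
exists (fun=> 0), (nc a); split.
- exact: nc_ge0.
- by [].
- by move=> *; rewrite nc0 nc_ge0.
- by move=> *; rewrite subrr mulr0 subr0 nc0 mulr_ge0 ?sqr_ge0 ?nc_ge0.
Qed.
Lemma holD q1 q2 : hol q1 -> hol q2 -> hol (fun z => q1 z + q2 z).
Proof.
move=> [D1 [C1 [c1 a1 b1 h1]]] [D2 [C2 [c2 a2 b2 h2]]].
exists (fun z => D1 z + D2 z), (C1 + C2); split.
- exact: addr_ge0.
- by move=> z z0; apply: le_trans (ncD _ _) _; apply: lerD; [exact: a1|exact: a2].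
- by move=> z z0; apply: le_trans (ncD _ _) _; apply: lerD; [exact: b1|exact: b2].
- move=> z d z0 zd.
 have -> : q1 (z + d) + q2 (z + d) - (q1 z + q2 z) - d * (D1 z + D2 z) =
  (q1 (z + d) - q1 z - d * D1 z) + (q2 (z + d) - q2 z - d * D2 z) by ring.
 by apply: le_trans (ncD _ _) _; rewrite mulrDl; apply: lerD; [exact: h1|exact: h2].
Qed.
Lemma holM q1 q2 : hol q1 -> hol q2 -> hol (fun z => q1 z * q2 z).
Proof.
move=> [D1 [C1 H1]] [D2 [C2 H2]].
have [c1 a1 b1 h1] := H1; have [c2 a2 b2 h2] := H2.
have C12 : 0 <= C1 * C2 by exact: mulr_ge0.
have pM x y : nc x <= C1 -> nc y <= C2 -> nc (x * y) <= C1 * C2.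
 by move=> *; rewrite ncM; apply: ler_pM => //; exact: nc_ge0.
exists (fun z => D1 z * q2 z + q1 z * D2 z), (4 * (C1 * C2)); split.
- exact: mulr_ge0.
- by move=> z z0; have := pM _ _ (a1 z z0) (a2 z z0); lra.
- move=> z z0; apply: le_trans (ncD _ _) _.
 by have := pM _ _ (b1 z z0) (a2 z z0); have := pM _ _ (a1 z z0) (b2 z z0); lra.
- move=> z d z0 zd.
 have -> : q1 (z + d) * q2 (z + d) - q1 z * q2 z - d * (D1 z * q2 z + q1 z * D2 z) =
  (q1 (z + d) - q1 z - d * D1 z) * q2 (z + d) + d * D1 z * (q2 (z + d) - q2 z)
  + q1 z * (q2 (z + d) - q2 z - d * D2 z) by ring.
 apply: le_trans (ncD _ _) _.
 have -> : 4 * (C1 * C2) * nc d ^+ 2 = (C1 * nc d ^+ 2 * C2 + (nc d * C1) * (2 * C2 * nc d))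
   + C1 * (C2 * nc d ^+ 2) by ring.
 apply: lerD.
  apply: le_trans (ncD _ _) _; rewrite !ncM; apply: lerD.
   by apply: ler_pM; rewrite ?nc_ge0 //; [exact: h1|exact: a2].
  apply: ler_pM; rewrite ?mulr_ge0 ?nc_ge0 //; last exact: holx_lip H2 _ _.
  by apply: ler_wpM2l; [exact: nc_ge0|exact: b1].
 by rewrite ncM; apply: ler_pM; rewrite ?nc_ge0 //; [exact: a1|exact: h2].
Qed.
Lemma holN q : hol q -> hol (fun z => - q z).
Proof.
move=> hq; have := holM (hol_cst (-1)) hq; congr hol.
by apply/funext => z; rewrite mulN1r.
Qed.
Lemma hol_inv q (c : R) : 0 < c -> (forall z, 0 <= Iz z -> c <= nc (q z)) ->
 hol q -> hol (fun z => (q z)^-1).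
Proof.
move=> c0 hc [D [C H]]; have [C0 a b h] := H.
have qi z : 0 <= Iz z -> nc (q z)^-1 <= c^-1.
 by move=> z0; rewrite ncV lef_pV2 ?posrE ?hc // (lt_le_trans c0 (hc _ z0)).
have qn z : 0 <= Iz z -> q z != 0.
 by move=> z0; rewrite -nc_gt0 (lt_le_trans c0 (hc _ z0)).
have ci : 0 <= c^-1 by rewrite invr_ge0 ltW.
have t1 : 0 <= c^-1 * c^-1 * C by rewrite !mulr_ge0.
have t2 : 0 <= 3 * C * C * c^-1 ^+ 3 by rewrite !mulr_ge0 // exprn_ge0.
exists (fun z => - ((q z)^-1 * (q z)^-1 * D z)), (c^-1 + c^-1 * c^-1 * C + 3 * C * C * c^-1 ^+ 3).
split.
- by rewrite !addr_ge0.
- by move=> z z0; have := qi z z0; lra.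
- move=> z z0; rewrite ncN !ncM.
 have : nc (q z)^-1 * nc (q z)^-1 * nc (D z) <= c^-1 * c^-1 * C.
  by apply: ler_pM; rewrite ?mulr_ge0 ?nc_ge0 //; [apply: ler_pM; rewrite ?nc_ge0 ?qi|exact: b].
 lra.
- move=> z d z0 zd.
 have -> : (q (z + d))^-1 - (q z)^-1 - d * - ((q z)^-1 * (q z)^-1 * D z) =
  ((q z)^-1 * (q z)^-1 * (q (z + d))^-1) *
   (d * D z * (q (z + d) - q z) - q z * (q (z + d) - q z - d * D z)).
  by field; rewrite !qn.
 rewrite ncM.
 have h1 : nc ((q z)^-1 / q z / q (z + d)) <= c^-1 ^+ 3.
  rewrite !ncM !exprS expr0 mulr1 mulrA.
  by apply: ler_pM; rewrite ?mulr_ge0 ?nc_ge0 ?qi //; apply: ler_pM; rewrite ?nc_ge0 ?qi.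
 have h2 : nc (d * D z * (q (z + d) - q z) - q z * (q (z + d) - q z - d * D z)) <=
   3 * C * C * nc d ^+ 2.
  apply: le_trans (ncB _ _) _; rewrite !ncM.
  have -> : 3 * C * C * nc d ^+ 2 = nc d * C * (2 * C * nc d) + C * (C * nc d ^+ 2) by ring.
  apply: lerD; apply: ler_pM; rewrite ?mulr_ge0 ?nc_ge0 ?a ?h //.
  - by apply: ler_wpM2l; rewrite ?nc_ge0 ?b.
  - exact: holx_lip H _ _.
 apply: (via (c^-1 ^+ 3 * (3 * C * C * nc d ^+ 2))).
  by apply: ler_pM; rewrite ?nc_ge0.
 rewrite mulrA; apply: ler_wpM2r; first exact: sqr_ge0.
 by rewrite mulrC lerDr addr_ge0.
Qed.
Lemma hol_pole a : Iz a < 0 -> hol (fun z => (z - a)^-1).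
Proof.
move=> a0; set e := - Iz a; have e0 : 0 < e by rewrite oppr_gt0.
have hi z : 0 <= Iz z -> e <= nc (z - a).
 by move=> z0; apply: le_trans (Im_le _); apply: le_trans (ler_norm _); rewrite cImB /e; lra.
have hn z : 0 <= Iz z -> z - a != 0.
 by move=> z0; rewrite -nc_gt0 (lt_le_trans e0 (hi _ z0)).
have hv z : 0 <= Iz z -> nc (z - a)^-1 <= e^-1.
 by move=> z0; rewrite ncV lef_pV2 ?posrE ?hi // (lt_le_trans e0 (hi _ z0)).
have ei : 0 <= e^-1 by rewrite invr_ge0 ltW.
have t2 : 0 <= e^-1 ^+ 2 by exact: sqr_ge0.
have t3 : 0 <= e^-1 ^+ 3 by exact: exprn_ge0.
exists (fun z => - ((z - a)^-1 * (z - a)^-1)), (e^-1 + e^-1 ^+ 2 + e^-1 ^+ 3); split.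
- lra.
- by move=> z z0; have := hv z z0; lra.
- move=> z z0; rewrite ncN ncM; have : nc (z - a)^-1 * nc (z - a)^-1 <= e^-1 ^+ 2.
  by rewrite expr2; apply: ler_pM; rewrite ?nc_ge0 ?hv.
 lra.
- move=> z d z0 zd.
 have -> : (z + d - a)^-1 - (z - a)^-1 - d * - ((z - a)^-1 * (z - a)^-1) =
   d ^+ 2 * ((z - a)^-1 * (z - a)^-1 * (z + d - a)^-1) by field; rewrite !hn.
 rewrite ncM ncX [leRHS]mulrC; apply: ler_wpM2l; first exact: sqr_ge0.
 have : nc ((z - a)^-1 * (z - a)^-1 * (z + d - a)^-1) <= e^-1 ^+ 3.
  rewrite !ncM !exprS expr0 mulr1 mulrA.
  by apply: ler_pM; rewrite ?mulr_ge0 ?nc_ge0 ?hv //; apply: ler_pM; rewrite ?nc_ge0 ?hv.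
 lra.
Qed.

Lemma is_derive_quadratic (f : R -> R) (x D C : R) :
 (forall d : R, `|f (x + d) - f x - d * D| <= C * d ^+ 2) -> is_derive (x : R) (1 : R) f D.
Proof.
move=> h.
have C0 : 0 <= C.
 by have := le_trans (normr_ge0 _) (h 1); rewrite expr1n mulr1.
have hc : (fun d : R => d^-1 *: (f (d *: 1 + x) - f x)) d @[d --> 0^'] --> D.
 apply/cvgrPdist_le => e e0; near=> d.
 have d0 : d != 0 by near: d; exact: nbhs_dnbhs_neq.
 have hd : `|d| <= e / (C + 1).
  near: d; apply: (@dnbhs0_le R R^o).
  by rewrite divr_gt0 // ltr_wpDl.
 rewrite /= scaler1 distrC; have := h d; rewrite [x + d]addrC => hh.
 have -> : d^-1 * (f (d + x) - f x) - D = d^-1 * (f (d + x) - f x - d * D) by field.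
 rewrite normrM normfV ler_pdivrMl ?normr_gt0 //; apply: le_trans hh _.
 rewrite -real_normK ?num_real // expr2 mulrCA; apply: ler_wpM2l; first exact: normr_ge0.
 apply: (via ((C + 1) * (e / (C + 1)))); last first.
  by rewrite mulrCA divff ?mulr1 // gt_eqF // ltr_wpDl.
 by apply: ler_pM => //; rewrite lerDl.
apply: DeriveDef; first exact/cvg_ex/(ex_intro _ D).
exact: cvg_lim.
Unshelve. all: by end_near.
Qed.

End hol.

Lemma law_is_mean (R : realType) (P : probability (measurableTypeR R) R) :
 is_mean (fun f : R -> R => \int[P]_x f x).
Proof.
have h := expectation_is_mean P; split; first exact: (mean_cst h).
- by move=> a f g [f1 f2] [g1 g2]; apply: (mean_lin h); split.
- by move=> f [f1 f2] f0; apply: (mean_ge0 h) => //; split.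
Qed.

Section contour.
Context {R : realType}.
Variable (r : R) (r0 : 0 < r).
Let rr : - r < r. by rewrite -subr_gt0 opprK addr_gt0. Qed.
Notation U := (uniform_prob rr).
Definition meanU (f : R -> R) : R := \int[U]_x f x.
Lemma meanU_is_mean : is_mean meanU. Proof. exact: law_is_mean. Qed.

Lemma meanU_ftc (f F : R -> R) : bmf f -> continuous f ->
 (forall x : R, is_derive x (1 : R) F (f x)) -> meanU f = (F r - F (- r)) / (2 * r).
Proof.
move=> bf cf dF.
have key (g G : R -> R) : bmf g -> (forall x, 0 <= g x) -> continuous g ->
  (forall x : R, is_derive x (1 : R) G (g x)) -> meanU g = (G r - G (- r)) / (2 * r).
 move=> bg g0 cg dG; rewrite /meanU /Rintegral integral_uniform; last 2 first.
 - by apply/measurable_EFinP; case: bg.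
 - by move=> x; rewrite lee_fin.
 rewrite (@continuous_FTC2 R g G (- r) r) //.
 - have -> : r - - r = 2 * r by ring.
  by rewrite /= mulrC.
 - exact: continuous_subspaceT.
 - split => //.
  + apply: cvg_at_right_filter; apply: differentiable_continuous.
   by apply/derivable1_diffP; apply: ex_derive.
  + apply: cvg_at_left_filter; apply: differentiable_continuous.
   by apply/derivable1_diffP; apply: ex_derive.
 - by move=> x _; rewrite derive1E; apply: derive_val.
(* Adding the bound [M] makes the integrand nonnegative, the case for which integrals against the
   uniform law are expressed by Lebesgue measure. *)
have [M hM] : exists M : R, forall t, `|f t| <= M by case: bf.
have hE := meanU_is_mean.
have h1 : bmf (fun x => f x + M) by apply: bmfD => //; exact: bmf_cst.
have h2 x : 0 <= f x + M by have := hM x; rewrite ler_norml; lra.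
have h3 : continuous (fun x => f x + M).
 by move=> x; apply: cvgD; [exact: cf|exact: cvg_cst].
have h4 (x : R) : is_derive x (1 : R) (fun x => F x + M * x) (f x + M).
 have := is_deriveD (dF x) (is_deriveZ M (is_derive_id x (1 : R))).
 by rewrite scaler1.
have := key _ _ h1 h2 h3 h4; rewrite (meanD hE) ?(mean_const hE) //; last exact: bmf_cst.
move=> h; apply: (addIr M); rewrite h.
by field; rewrite gt_eqF.
Qed.

Lemma mean_close (q1 q2 : R -> R[i]) (e : R) : cbm q1 -> cbm q2 ->
 (forall x, nc (q1 x - q2 x) <= e) -> nc (cmean meanU q1 - cmean meanU q2) <= e.
Proof.
move=> h1 h2 h; have hE := meanU_is_mean; rewrite -(cmeanB hE) //.
have hb := cbmB h1 h2.
apply: le_trans (nc_cmean hE hb) _; rewrite -[leRHS](mean_const hE).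
by apply: (mean_le hE) => //; [exact: bmf_nc|exact: bmf_cst].
Qed.

(** Along a horizontal line [q] is a primitive of [D], so the mean of [D] only sees the end points;
    this produces the boundary terms of [contour_shift]. *)
Lemma holx_line (q D : R[i] -> R[i]) C (y : R) : holx q D C -> 0 <= y ->
 [/\ cbm (fun x => q (Cx x y)), cbm (fun x => D (Cx x y)) &
  cmean meanU (fun x => D (Cx x y)) =
   rc (2 * r)^-1 * (q (Cx r y) - q (Cx (- r) y))].
Proof.
move=> H y0; have [C0 a b h] := H.
have hz x : 0 <= Iz (Cx x y) by [].
have zd x d : Cx x y + rc d = Cx (x + d) y by apply: complex_eq; rewrite ?cReD ?cImD /= ?addr0.
have hx x d : nc (q (Cx (x + d) y) - q (Cx x y) - rc d * D (Cx x y)) <= C * d ^+ 2.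
 have := h (Cx x y) (rc d) (hz x); rewrite zd => /(_ (hz _)).
 by rewrite nc_rc real_normK ?num_real.
have dR (x : R) : is_derive x (1 : R) (fun x => Rz (q (Cx x y))) (Rz (D (Cx x y))).
 apply: (@is_derive_quadratic _ _ _ _ C) => d; apply: le_trans (hx x d).
 by apply: le_trans (Re_le _); rewrite !cReB cReM Re_rc Im_rc mul0r subr0.
have dI (x : R) : is_derive x (1 : R) (fun x => Iz (q (Cx x y))) (Iz (D (Cx x y))).
 apply: (@is_derive_quadratic _ _ _ _ C) => d; apply: le_trans (hx x d).
 by apply: le_trans (Im_le _); rewrite !cImB cImM Re_rc Im_rc mul0r addr0.
(* Adding the expansions of [q] from [x] to [x + d] and back cancels [q] and leaves [d] times the
   increment of [D], up to quadratic terms. *)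
have Dlip x d : nc (D (Cx (x + d) y) - D (Cx x y)) <= 2 * C * `|d|.
 have [->|d0] := eqVneq d 0; first by rewrite addr0 subrr nc0 normr0 mulr0.
 have h1 := hx x d; have := hx (x + d) (- d); rewrite addrK sqrrN => h2.
 have e : rc d * (D (Cx (x + d) y) - D (Cx x y)) =
  (q (Cx (x + d) y) - q (Cx x y) - rc d * D (Cx x y)) +
  (q (Cx x y) - q (Cx (x + d) y) - rc (- d) * D (Cx (x + d) y)).
  by rewrite rmorphN; ring.
 rewrite -(ler_pM2l (_ : 0 < `|d|)) ?normr_gt0 // -nc_rc -ncM e nc_rc.
 apply: le_trans (ncD _ _) _; rewrite mulrCA -expr2 real_normK ?num_real //; lra.
have lip_cont (f : R -> R) K : 0 <= K -> (forall x d, `|f (x + d) - f x| <= K * `|d|) -> continuous f.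
 move=> K0 hf x; apply/cvgrPdist_le => e e0; near=> t.
 have := hf x (t - x); rewrite [x + _]addrC subrK distrC => /le_trans; apply.
 have ht : `|x - t| <= e / (K + 1).
  by near: t; apply: cvgr_dist_le => //; rewrite divr_gt0 // ltr_wpDl.
 apply: (via ((K + 1) * (e / (K + 1)))); last first.
  by rewrite mulrCA divff ?mulr1 // gt_eqF // ltr_wpDl.
 by rewrite distrC; apply: ler_pM => //; rewrite lerDl.
have K0 : 0 <= 2 * C by rewrite mulr_ge0.
have qlip x d : nc (q (Cx (x + d) y) - q (Cx x y)) <= 2 * C * `|d|.
 by have := holx_lip (d := rc d) H (hz x); rewrite zd nc_rc; apply.
have cq1 : continuous (fun x => Rz (q (Cx x y))).
 apply: (lip_cont _ _ K0) => x d; apply: le_trans (qlip x d); rewrite -cReB; exact: Re_le.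
have cq2 : continuous (fun x => Iz (q (Cx x y))).
 apply: (lip_cont _ _ K0) => x d; apply: le_trans (qlip x d); rewrite -cImB; exact: Im_le.
have cD1 : continuous (fun x => Rz (D (Cx x y))).
 apply: (lip_cont _ _ K0) => x d; apply: le_trans (Dlip x d); rewrite -cReB; exact: Re_le.
have cD2 : continuous (fun x => Iz (D (Cx x y))).
 apply: (lip_cont _ _ K0) => x d; apply: le_trans (Dlip x d); rewrite -cImB; exact: Im_le.
have bq : cbm (fun x => q (Cx x y)).
 by split; split; [exact: continuous_measurable_fun|exists C => x; apply: le_trans (a _ (hz x)); exact: Re_le
  |exact: continuous_measurable_fun|exists C => x; apply: le_trans (a _ (hz x)); exact: Im_le].
have bD : cbm (fun x => D (Cx x y)).
 by split; split; [exact: continuous_measurable_fun|exists C => x; apply: le_trans (b _ (hz x)); exact: Re_le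
  |exact: continuous_measurable_fun|exists C => x; apply: le_trans (b _ (hz x)); exact: Im_le].
split=> //; rewrite /cmean.
rewrite (meanU_ftc (F := fun x => Rz (q (Cx x y)))) //; last by case: bD.
rewrite (meanU_ftc (F := fun x => Iz (q (Cx x y)))) //; last by case: bD.
by apply: complex_eq; rewrite ?cReM ?cImM ?cReB ?cImB /=; ring.
Unshelve. all: by end_near.
Qed.

(* Moving a horizontal segment up by [t] is, up to [O(t^2)], [i] times moving it to
  the right by [t], and the latter only produces boundary terms. *)
Lemma contour_shift (q : R[i] -> R[i]) (S Y : R) : hol q -> 0 <= Y ->
 (forall y, 0 <= y -> nc (q (Cx r y)) <= S /\ nc (q (Cx (- r) y)) <= S) ->
 nc (cmean meanU (fun x => q (Cx x Y)) - cmean meanU (fun x => q (Cx x 0))) <= S / r * Y.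
Proof.
move=> [D [C H]] Y0 hS; have [C0 a b h] := H; have hE := meanU_is_mean.
pose I y := cmean meanU (fun x => q (Cx x y)).
have step y t : 0 <= y -> 0 <= t -> nc (I (y + t) - I y) <= S / r * t + C * t ^+ 2.
 move=> y0 t0; have [b1 bD e] := holx_line H y0.
 have [b2 _ _] := holx_line H (addr_ge0 y0 t0).
 pose it := Cx 0 t : R[i].
 have hb : cbm (fun x => q (Cx x y) + it * D (Cx x y)).
  by apply: cbmD => //; apply: cbmM => //; exact: cbm_cst.
 have h1 : nc (I (y + t) - cmean meanU (fun x => q (Cx x y) + it * D (Cx x y))) <= C * t ^+ 2.
  apply: mean_close => // x; have := h (Cx x y) it y0.
  have -> : Cx x y + it = Cx x (y + t) by apply: complex_eq; rewrite ?cReD ?cImD /= ?addr0.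
  move=> /(_ (addr_ge0 y0 t0)); rewrite (_ : nc it ^+ 2 = t ^+ 2); last first.
   by rewrite nc2 /= expr0n add0r.
  by congr (nc _ <= _); ring.
 have h2 : cmean meanU (fun x => q (Cx x y) + it * D (Cx x y)) - I y =
   it * (rc (2 * r)^-1 * (q (Cx r y) - q (Cx (- r) y))).
  by rewrite (cmeanD hE) ?(cmeanZ hE) ?e //; [rewrite /I addrC addKr|apply: cbmM => //; exact: cbm_cst].
 apply: le_trans (nc_tri _ (cmean meanU (fun x => q (Cx x y) + it * D (Cx x y))) _) _.
 rewrite addrC; apply: lerD => //; rewrite h2 !ncM nc_rc.
 have -> : nc it = t by rewrite /= expr0n add0r sqrtr_sqr ger0_norm.
 have [s1 s2] := hS y y0; have := ncB (q (Cx r y)) (q (Cx (- r) y)) => s3.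
 have -> : S / r * t = t * ((2 * r)^-1 * (S + S)) by field; rewrite gt_eqF.
 apply: ler_wpM2l => //; rewrite ger0_norm; last by rewrite invr_ge0 mulr_ge0 // ltW.
 by apply: ler_wpM2l; [rewrite invr_ge0 mulr_ge0 // ltW|lra].
have steps t n : 0 <= t -> nc (I (t *+ n) - I 0) <= (S / r * t + C * t ^+ 2) *+ n.
 move=> t0; elim: n => [|n IH]; first by rewrite !mulr0n subrr nc0.
 rewrite !mulrSr; apply: le_trans (nc_tri _ (I (t *+ n)) _) _.
 rewrite addrC; apply: lerD => //; apply: step => //; exact: mulrn_wge0.
apply/ler_addgt0Pr => e e0.
(* With [n + 1] steps of size [Y / (n + 1)] the quadratic errors add up to [C Y^2 / (n + 1)]. *)
have [n hn] : exists n : nat, C * Y ^+ 2 / e < n.+1%:R.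
 have hp : 0 <= C * Y ^+ 2 / e by apply: divr_ge0; [apply: mulr_ge0 => //; exact: sqr_ge0|exact: ltW].
 have hb := archi_boundP hp.
 by exists (Num.bound (C * Y ^+ 2 / e)); apply: lt_trans hb _; rewrite ltr_nat.
have := steps (Y / n.+1%:R) n.+1 (divr_ge0 Y0 (ler0n _ _)).
have -> : Y / n.+1%:R *+ n.+1 = Y by rewrite -[LHS]mulr_natr divfK // gt_eqF.
rewrite -[X in _ <= X]mulr_natr => /le_trans; apply.
have -> : (S / r * (Y / n.+1%:R) + C * (Y / n.+1%:R) ^+ 2) * n.+1%:R =
  S / r * Y + C * Y ^+ 2 / n.+1%:R by field; rewrite !gt_eqF.
by rewrite lerD2l ler_pdivrMr // [e * _]mulrC -ler_pdivrMr //; exact: ltW.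
Qed.
End contour.

Lemma cJM (R : realType) (x y : R[i]) : conjc (x * y) = conjc x * conjc y.
Proof. exact: rmorphM. Qed.
Lemma cJB (R : realType) (x y : R[i]) : conjc (x - y) = conjc x - conjc y.
Proof. exact: rmorphB. Qed.
Lemma cJV (R : realType) (x : R[i]) : conjc x^-1 = (conjc x)^-1.
Proof. exact: fmorphV. Qed.

(** * Poisson representation of [m] on a line at positive height *)

Section representation.
Context {R : realType}.
Variables (E : (R -> R) -> R) (hE : is_mean E) (lam : R) (lam_ge0 : 0 <= lam).
Hypothesis hsupp : forall f : R -> R, bmf f -> (forall v, -1 <= v <= 1 -> 0 <= f v) -> 0 <= E f.
Variable m : R[i] -> R[i].
Hypotheses (m_ge0 : forall z, 0 < Iz z -> 0 <= Iz (m z))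
 (m_eq : forall z, 0 < Iz z -> m z = stj E lam (z + m z)).
Notation kap := (kap E lam).
Notation wz := (wz m).
Notation imb := (imb m).
Notation g := (gr lam).
Implicit Types z d w : R[i].

Lemma cmean_bound (X : R -> R[i]) (B : R) : cbm X -> (forall v, nc (X v) <= B) -> nc (cmean E X) <= B.
Proof.
move=> hX hB; apply: le_trans (nc_cmean hE hX) _; rewrite -[leRHS](mean_const hE).
by apply: (mean_le hE) => //; [exact: bmf_nc|exact: bmf_cst].
Qed.

Section fixed_height.
Variable h : R.
Hypotheses (h0 : 0 < h) (h1 : h <= 1).
Let ih : R[i] := Cx 0 h.
Let M z := m (z + ih).
Let W z := wz (z + ih).
(** Since [Im m <= 1], at heights at least [h] one has [Im z / Im w >= h / (h + 1)], and [stab_re]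
    keeps [|1 - kap|] above [c]. This makes [m] shifted by [i h] regular up to the real axis, as
    [hol] demands. *)
Let c := h / (h + 1).

Let c0 : 0 < c. by rewrite divr_gt0 // addr_gt0. Qed.
Let ci0 : 0 <= c^-1. by rewrite invr_ge0 ltW. Qed.
Let hi0 : 0 <= h^-1. by rewrite invr_ge0 ltW. Qed.
Let Ih z : 0 <= Iz z -> 0 < Iz (z + ih).
Proof. by move=> z0; rewrite cImD /= ltr_wpDl. Qed.
Let IW z : 0 <= Iz z -> 0 < Iz (W z).
Proof. by move=> z0; apply: (wz_gt0 m_ge0); exact: Ih. Qed.
Let hW z : 0 <= Iz z -> h <= Iz (W z).
Proof.
move=> z0; apply: le_trans (wz_ge m_ge0 (Ih z0)).
by rewrite cImD /= lerDr.
Qed.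
Let gb w v : 0 < Iz w -> h <= Iz w -> nc (g w v) <= h^-1.
Proof. by move=> w0 hw; apply: le_trans (gr_nc _ _ w0) _; rewrite lef_pV2 ?posrE. Qed.

Let one_kap z z' : 0 <= Iz z -> 0 <= Iz z' -> c <= nc (1 - kap (W z) (W z')).
Proof.
move=> z0 z0'.
have := stab_re hE (IW z0) (IW z0') (wz_eq m_eq (Ih z0)) (wz_eq m_eq (Ih z0')).
rewrite !Im_rc !addr0.
have q u : 0 <= Iz u -> c <= Iz (u + ih) / Iz (W u).
 move=> u0; have Iu := Ih u0.
 rewrite ler_pdivlMr ?IW // /c mulrAC ler_pdivrMr ?addr_gt0 //.
 have : h <= Iz (u + ih) by rewrite cImD /= lerDr.
 have := Im_m_le1 hE m_ge0 m_eq Iu; have := m_ge0 Iu; rewrite (Im_wz m).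
 move: (Iz (u + ih)) (Iz (m _)) => a b b0 b1 ha.
 have := ler_wpM2l (ltW h0) b1; lra.
have := q _ z0; have := q _ z0'; have := sqr_ge0 (Iz (stj E lam (W z)) + Iz (stj E lam (W z'))).
have : Rz (1 - kap (W z) (W z')) <= nc (1 - kap (W z) (W z')).
 by apply: le_trans (Re_le _); exact: ler_norm.
rewrite cReB /=; lra.
Qed.
Let one_kap_n z z' : 0 <= Iz z -> 0 <= Iz z' -> 1 - kap (W z) (W z') != 0.
Proof. by move=> z0 z0'; rewrite -nc_gt0 (lt_le_trans c0) // one_kap. Qed.
Let one_kap_V z z' : 0 <= Iz z -> 0 <= Iz z' -> nc (1 - kap (W z) (W z'))^-1 <= c^-1.
Proof.
move=> z0 z0'; rewrite ncV lef_pV2 ?posrE ?one_kap //.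
by rewrite nc_gt0 one_kap_n.
Qed.

Let W_diff z z' : 0 <= Iz z -> 0 <= Iz z' -> (W z - W z') * (1 - kap (W z) (W z')) = z - z'.
Proof.
move=> z0 z0'; rewrite (stab_id hE (IW z0) (IW z0') (wz_eq m_eq (Ih z0)) (wz_eq m_eq (Ih z0'))).
by rewrite subrr addr0 opprD addrACA subrr addr0.
Qed.
Let W_diff' z z' : 0 <= Iz z -> 0 <= Iz z' -> W z - W z' = (z - z') / (1 - kap (W z) (W z')).
Proof. by move=> z0 z0'; rewrite -(W_diff z0 z0') mulfK // one_kap_n. Qed.
Let M_diff z z' : 0 <= Iz z -> 0 <= Iz z' ->
 M z - M z' = (z - z') * (kap (W z) (W z') / (1 - kap (W z) (W z'))).
Proof.
move=> z0 z0'; have := W_diff' z0 z0'; have := one_kap_n z0 z0'.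
have -> : M z - M z' = (W z - W z') - (z - z') by rewrite /W /wz /M; ring.
by move=> hn ->; field.
Qed.
Let W_lip z z' : 0 <= Iz z -> 0 <= Iz z' -> nc (W z - W z') <= c^-1 * nc (z - z').
Proof.
by move=> z0 z0'; rewrite W_diff' // ncM mulrC ler_wpM2r ?nc_ge0 // one_kap_V.
Qed.

(** The second divided difference of [stj]; it controls the variation of [kap]. *)
Let trip w1 w2 w3 := cmean E (fun v => g w1 v * (g w2 v * g w3 v)).
Let cb3 w1 w2 w3 : 0 < Iz w1 -> 0 < Iz w2 -> 0 < Iz w3 -> cbm (fun v => g w1 v * (g w2 v * g w3 v)).
Proof. by move=> *; apply: cbmM; [exact: cbm_gr|exact: cbm_gr2]. Qed.
Let gb2 w w' v : 0 < Iz w -> 0 < Iz w' -> h <= Iz w -> h <= Iz w' -> nc (g w v * g w' v) <= h^-1 ^+ 2.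
Proof. by move=> *; rewrite ncM expr2; apply: ler_pM; rewrite ?nc_ge0 ?gb. Qed.
Let kap_b w w' : 0 < Iz w -> 0 < Iz w' -> h <= Iz w -> h <= Iz w' -> nc (kap w w') <= h^-1 ^+ 2.
Proof. by move=> *; apply: cmean_bound => [|v]; [exact: cbm_gr2|exact: gb2]. Qed.
Let trip_b w1 w2 w3 : 0 < Iz w1 -> 0 < Iz w2 -> 0 < Iz w3 -> h <= Iz w1 -> h <= Iz w2 -> h <= Iz w3 ->
 nc (trip w1 w2 w3) <= h^-1 ^+ 3.
Proof.
move=> *; apply: cmean_bound => [|v]; first exact: cb3.
by rewrite ncM exprS; apply: ler_pM; rewrite ?nc_ge0 ?gb ?gb2.
Qed.
Let kap_diff w w' w0 : 0 < Iz w -> 0 < Iz w' -> 0 < Iz w0 ->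
 kap w w0 - kap w' w0 = (w - w') * trip w w' w0.
Proof.
move=> p p' p0; rewrite /kap -(cmeanB hE); [|exact: cbm_gr2|exact: cbm_gr2].
rewrite /trip -(cmeanZ hE); last exact: cb3.
congr cmean; apply/funext => v; rewrite -mulrBl gr_diff //; ring.
Qed.
Let trip_diff w w' w2 w3 : 0 < Iz w -> 0 < Iz w' -> 0 < Iz w2 -> 0 < Iz w3 ->
 h <= Iz w -> h <= Iz w' -> h <= Iz w2 -> h <= Iz w3 ->
 nc (trip w w2 w3 - trip w' w2 w3) <= nc (w - w') * h^-1 ^+ 4.
Proof.
move=> *; rewrite /trip -(cmeanB hE); [|exact: cb3|exact: cb3].
apply: cmean_bound => [|v]; first by apply: cbmB; exact: cb3.
have -> : g w v * (g w2 v * g w3 v) - g w' v * (g w2 v * g w3 v) =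
 (w - w') * ((g w v * g w' v) * (g w2 v * g w3 v)) by rewrite -mulrBl gr_diff // !mulrA.
rewrite ncM; apply: ler_wpM2l; first exact: nc_ge0.
rewrite ncM (exprD _ 2 2); apply: ler_pM; rewrite ?nc_ge0 //; exact: gb2.
Qed.

Let kap_W_lip z z' z2 : 0 <= Iz z -> 0 <= Iz z' -> 0 <= Iz z2 ->
 nc (kap (W z) (W z2) - kap (W z') (W z2)) <= c^-1 * nc (z - z') * h^-1 ^+ 3.
Proof.
move=> a b e; rewrite kap_diff ?IW // ncM; apply: ler_pM; rewrite ?nc_ge0 ?W_lip //.
by apply: trip_b; rewrite ?IW ?hW.
Qed.
Let inv_kap_lip z z' z2 : 0 <= Iz z -> 0 <= Iz z' -> 0 <= Iz z2 ->
 nc ((1 - kap (W z) (W z2))^-1 - (1 - kap (W z') (W z2))^-1) <= c^-1 ^+ 3 * h^-1 ^+ 3 * nc (z - z').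
Proof.
move=> a b e.
have -> : (1 - kap (W z) (W z2))^-1 - (1 - kap (W z') (W z2))^-1 =
 (kap (W z) (W z2) - kap (W z') (W z2)) * ((1 - kap (W z) (W z2))^-1 * (1 - kap (W z') (W z2))^-1).
 by field; rewrite !one_kap_n.
rewrite ncM; have -> : c^-1 ^+ 3 * h^-1 ^+ 3 * nc (z - z') = c^-1 * nc (z - z') * h^-1 ^+ 3 * (c^-1 * c^-1) by ring.
apply: ler_pM; rewrite ?nc_ge0 ?kap_W_lip //.
by rewrite ncM; apply: ler_pM; rewrite ?nc_ge0 ?one_kap_V.
Qed.

Let hol_M : hol M.
Proof.
have p1 : 0 <= h^-1 ^+ 2 * c^-1 by rewrite mulr_ge0 // sqr_ge0.
have p2 : 0 <= c^-1 ^+ 3 * h^-1 ^+ 3 by rewrite mulr_ge0 ?exprn_ge0.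
exists (fun z => kap (W z) (W z) / (1 - kap (W z) (W z))), (1 + h^-1 ^+ 2 * c^-1 + c^-1 ^+ 3 * h^-1 ^+ 3).
split.
- lra.
- by move=> z z0; have := nc_m hE m_ge0 m_eq (Ih z0); rewrite -/(M z); lra.
- move=> z z0; rewrite ncM.
 have : nc (kap (W z) (W z)) * nc (1 - kap (W z) (W z))^-1 <= h^-1 ^+ 2 * c^-1.
  by apply: ler_pM; rewrite ?nc_ge0 ?one_kap_V ?kap_b ?IW ?hW.
 lra.
- move=> z d z0 zd; rewrite M_diff // [z + d]addrC addrK -mulrBr.
 have -> : kap (W (d + z)) (W z) / (1 - kap (W (d + z)) (W z)) - kap (W z) (W z) / (1 - kap (W z) (W z)) =
  (1 - kap (W (d + z)) (W z))^-1 - (1 - kap (W z) (W z))^-1.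
  by field; rewrite !one_kap_n // addrC.
 rewrite ncM expr2 mulrCA; apply: ler_wpM2l; first exact: nc_ge0.
 apply: le_trans (inv_kap_lip _ _ _) _ => //; first by rewrite addrC.
 by rewrite addrK; apply: ler_wpM2r; [exact: nc_ge0|lra].
Qed.

Let hol_K z2 : 0 <= Iz z2 -> hol (fun z => kap (W z) (W z2)).
Proof.
move=> z20.
have p1 : 0 <= h^-1 ^+ 3 * c^-1 by rewrite mulr_ge0 // exprn_ge0.
have p2 : 0 <= c^-1 ^+ 2 * h^-1 ^+ 4 by rewrite mulr_ge0 ?exprn_ge0.
have p3 : 0 <= c^-1 ^+ 3 * h^-1 ^+ 6 by rewrite mulr_ge0 ?exprn_ge0.
have p4 : 0 <= h^-1 ^+ 2 by exact: sqr_ge0.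
exists (fun z => trip (W z) (W z) (W z2) / (1 - kap (W z) (W z))),
 (h^-1 ^+ 2 + h^-1 ^+ 3 * c^-1 + (c^-1 ^+ 2 * h^-1 ^+ 4 + c^-1 ^+ 3 * h^-1 ^+ 6)).
split.
- lra.
- move=> z z0; have : nc (kap (W z) (W z2)) <= h^-1 ^+ 2 by apply: kap_b; rewrite ?IW ?hW.
 lra.
- move=> z z0; rewrite ncM.
 have : nc (trip (W z) (W z) (W z2)) * nc (1 - kap (W z) (W z))^-1 <= h^-1 ^+ 3 * c^-1.
  by apply: ler_pM; rewrite ?nc_ge0 ?one_kap_V ?trip_b ?IW ?hW.
 lra.
- move=> z d z0 zd; rewrite kap_diff ?IW // W_diff' // [z + d]addrC addrK.
 have zd' : 0 <= Iz (d + z) by rewrite addrC.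
 set k' := (1 - kap (W (d + z)) (W z))^-1; set k := (1 - kap (W z) (W z))^-1.
 set t' := trip _ _ _; set t := trip _ _ _.
 have -> : d * k' * t' - d * (t * k) = d * (k' * (t' - t) + t * (k' - k)) by ring.
 rewrite ncM expr2 mulrCA; apply: ler_wpM2l; first exact: nc_ge0.
 apply: le_trans (ncD _ _) _; rewrite !ncM.
 have a1 : nc k' <= c^-1 by exact: one_kap_V.
 have a2 : nc (t' - t) <= c^-1 * nc d * h^-1 ^+ 4.
  apply: le_trans (trip_diff _ _ _ _ _ _ _ _) _; rewrite ?IW ?hW //.
  apply: ler_wpM2r; first exact: exprn_ge0.
  by have := W_lip zd' z0; rewrite addrK.
 have a3 : nc t <= h^-1 ^+ 3 by apply: trip_b; rewrite ?IW ?hW.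
 have a4 : nc (k' - k) <= c^-1 ^+ 3 * h^-1 ^+ 3 * nc d.
  by have := inv_kap_lip zd' z0 z0; rewrite addrK.
 have b1 : nc k' * nc (t' - t) <= c^-1 * (c^-1 * nc d * h^-1 ^+ 4) by apply: ler_pM; rewrite ?nc_ge0.
 have b2 : nc t * nc (k' - k) <= h^-1 ^+ 3 * (c^-1 ^+ 3 * h^-1 ^+ 3 * nc d) by apply: ler_pM; rewrite ?nc_ge0.
 apply: (via ((c^-1 ^+ 2 * h^-1 ^+ 4 + c^-1 ^+ 3 * h^-1 ^+ 6) * nc d)).
  have -> : (c^-1 ^+ 2 * h^-1 ^+ 4 + c^-1 ^+ 3 * h^-1 ^+ 6) * nc d =
   c^-1 * (c^-1 * nc d * h^-1 ^+ 4) + h^-1 ^+ 3 * (c^-1 ^+ 3 * h^-1 ^+ 3 * nc d) by ring.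
  exact: lerD.
 by apply: ler_wpM2r; [exact: nc_ge0|lra].
Qed.

Section kernel.
Variables (z : R[i]) (z0 : 0 < Iz z) (r : R) (r0 : 0 < r).
Hypothesis hr : 2 * (nc z + lam + 2) <= r.
Let zJ : Iz (conjc z) < 0. by rewrite cImJ oppr_lt0. Qed.
(** Away from [z], the first term is the divided difference of [M], but written through [kap] it has
    no singularity at [z]; adding [M z / (x - conj z)] improves the decay to [|x|^-2]. The pole of
    [q2] lies in the lower half-plane. On the real axis [Im M / (x - z)] is [M z] times the Poisson
    kernel plus a combination of [q1] and [conj q2], so the representation follows once both have
    small integrals. *)
Let q1 x := kap (W x) (W z) / (1 - kap (W x) (W z)) + M z * (x - conjc z)^-1.
Let q2 x := M x * (x - conjc z)^-1.

Let hol_q1 : hol q1.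
Proof.
have K := hol_K (ltW z0).
apply: holD; last by apply: holM; [exact: hol_cst|exact: hol_pole].
apply: holM => //; apply: (hol_inv c0); first by move=> x x0; apply: one_kap => //; exact: ltW.
by apply: holD; [exact: hol_cst|exact: holN].
Qed.
Let hol_q2 : hol q2.
Proof. by apply: holM => //; exact: hol_pole. Qed.

Let q1E (x : R[i]) : 0 <= Iz x -> x != z ->
 q1 x = (M x - M z * (z - conjc z) * (x - conjc z)^-1) * (x - z)^-1.
Proof.
move=> x0 xz; have h2 : x - z != 0 by rewrite subr_eq0.
have h3 : x - conjc z != 0.
 by apply: Im_neq0; rewrite cImB; apply/eqP => e; have := zJ; lra.
rewrite /q1; have -> : kap (W x) (W z) / (1 - kap (W x) (W z)) = (M x - M z) * (x - z)^-1.
 by rewrite (M_diff x0 (ltW z0)) mulrAC mulfV // mul1r.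
by field; rewrite h2 h3.
Qed.

Let far (x : R[i]) : 0 <= Iz x -> r <= nc x ->
 nc (q1 x) <= (4 + 8 * Iz z) / r ^+ 2 /\ nc (q2 x) <= 4 / r ^+ 2.
Proof.
move=> x0 xr; have zn := nc_ge0 z; have l0 := lam_ge0.
have ri : 0 <= r^-1 by rewrite invr_ge0 ltW.
have [lr zr] : lam + 1 + r / 2 <= r /\ nc z < r by move: hr zn l0; move: (nc z) => a *; split; lra.
have d1 : nc (x - z)^-1 <= 2 / r.
 have hd : r / 2 <= nc (x - z) by move: (nc_triB x z) hr xr zn l0; move: (nc x) (nc z) (nc (x - z)) => a b e; lra.
 rewrite ncV -[2 / r]invrK invf_div lef_pV2 ?posrE ?divr_gt0 //.
 by apply: lt_le_trans hd; rewrite divr_gt0.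
have d2 : nc (x - conjc z)^-1 <= 2 / r.
 have hd : r / 2 <= nc (x - conjc z) by move: (nc_triB x (conjc z)) hr xr zn l0; rewrite ncJ; move: (nc x) (nc z) (nc (x - conjc z)) => a b e; lra.
 rewrite ncV -[2 / r]invrK invf_div lef_pV2 ?posrE ?divr_gt0 //.
 by apply: lt_le_trans hd; rewrite divr_gt0.
have Mx : nc (M x) <= 2 / r.
 have xh : r <= nc (x + ih).
  apply: le_trans xr _; rewrite -ler_sqr ?nnegrE ?nc_ge0 // !nc2 cReD cImD /= addr0 lerD2l.
  by apply: lesq => //; rewrite lerDl ltW.
 apply: le_trans (m_decay hE lam_ge0 hsupp m_ge0 m_eq (Ih x0) _) _.
  by apply: lt_le_trans xh; move: lr r0; lra.
 rewrite -[2 / r]invrK invf_div lef_pV2 ?posrE ?divr_gt0 //; move: lr xh r0; move: (nc (x + ih)) => a; lra.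
have Mz := nc_m hE m_ge0 m_eq (Ih (ltW z0)); rewrite -/(M z) in Mz.
have e4 : 4 / r ^+ 2 = 2 / r * (2 / r) by field; rewrite gt_eqF.
split; last by rewrite ncM e4; apply: ler_pM; rewrite ?nc_ge0.
have xz : x != z by apply/eqP => e; move: zr; rewrite -e ltNge xr.
rewrite q1E // ncM.
have -> : (4 + 8 * Iz z) / r ^+ 2 = (2 / r + 1 * (2 * Iz z) * (2 / r)) * (2 / r) by field; rewrite gt_eqF.
apply: ler_pM; rewrite ?nc_ge0 //; apply: le_trans (ncB _ _) _; apply: lerD => //.
rewrite !ncM; apply: ler_pM; rewrite ?mulr_ge0 ?nc_ge0 //; apply: ler_pM; rewrite ?nc_ge0 //.
have -> : z - conjc z = Cx 0 (2 * Iz z).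
 by apply: complex_eq; rewrite ?cReB ?cImB ?cReJ ?cImJ /=; ring.
by rewrite /= expr0n add0r sqrtr_sqr ger0_norm // mulr_ge0 // ltW.
Qed.

Let nc_ge_r (x y : R) : r <= `|x| \/ r <= y -> r <= nc (Cx x y).
Proof.
case=> hx; first by apply: le_trans hx _; exact: (Re_le (Cx x y)).
by apply: le_trans hx _; apply: le_trans (ler_norm _) _; exact: (Im_le (Cx x y)).
Qed.

(** The segment [[-r, r]] is moved up to height [r]. The vertical displacement costs
    [S / r * r = S], and on the upper segment all points have modulus at least [r], which costs
    another [S]. *)
Let small (q : R[i] -> R[i]) (S : R) : hol q -> (forall x : R[i], 0 <= Iz x -> r <= nc x -> nc (q x) <= S) ->
 nc (cmean (meanU r0) (fun x => q (Cx x 0))) <= 2 * S.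
Proof.
move=> hq hS.
have := contour_shift r0 hq (ltW r0) (S := S).
have hl y : 0 <= y -> nc (q (Cx r y)) <= S /\ nc (q (Cx (- r) y)) <= S.
 move=> y0; split; apply: hS => //; apply: nc_ge_r; left.
  by rewrite ler_norm.
 by rewrite normrN ler_norm.
move=> /(_ hl); rewrite divfK ?gt_eqF // => h2.
have h3 : nc (cmean (meanU r0) (fun x => q (Cx x r))) <= S.
 have [D [C H]] := hq; have [b _ _] := holx_line r0 H (ltW r0).
 have hm := meanU_is_mean r0.
 apply: le_trans (nc_cmean hm b) _; rewrite -[leRHS](mean_const hm).
 apply: (mean_le hm); [exact: bmf_nc|exact: bmf_cst|move=> x].
 by apply: hS; [exact: ltW|apply: nc_ge_r; right].
have := nc_triB (cmean (meanU r0) (fun x => q (Cx x 0))) (cmean (meanU r0) (fun x => q (Cx x r))).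
by rewrite ncC; lra.
Qed.

Definition pker (x : R) := Iz z / ((x - Rz z) ^+ 2 + Iz z ^+ 2).
Definition cker (x : R) : R[i] := (rc x - z)^-1.

Lemma cker_bound x : nc (cker x) <= (Iz z)^-1.
Proof. by have := gr_nc 1 x z0; rewrite /gr mul1r. Qed.
Lemma cbm_cker : cbm cker.
Proof.
have := cbm_gr 1 z0; congr cbm; apply/funext => x; rewrite /gr mul1r //.
Qed.
Lemma Im_cker x : Iz (cker x) = pker x.
Proof. by rewrite /cker /pker cImV cImB Im_rc sub0r opprK nc2 cReB cImB Re_rc Im_rc sub0r sqrrN. Qed.
Lemma bmf_pker : bmf pker.
Proof. by case: cbm_cker => _; congr bmf; apply/funext => x; rewrite Im_cker. Qed.

Lemma rep_height : nc (cmean (meanU r0) (fun x => rc (Iz (m (Cx x h))) * cker x)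
  - m (z + ih) * rc (meanU r0 pker)) <= (8 + 8 * Iz z) / r ^+ 2.
Proof.
have hm := meanU_is_mean r0.
have s1 := small hol_q1 (fun x x0 xr => (far x0 xr).1).
have s2 := small hol_q2 (fun x x0 xr => (far x0 xr).2).
have b1 : cbm (fun x : R => q1 (Cx x 0)) by have [D [C H]] := hol_q1; have [] := holx_line r0 H (lexx 0).
have b2 : cbm (fun x : R => q2 (Cx x 0)) by have [D [C H]] := hol_q2; have [] := holx_line r0 H (lexx 0).
pose i2 : R[i] := Cx 0 (- 2^-1).
have i2n : nc i2 = 2^-1.
 by rewrite /= expr0n add0r sqrtr_sqr normrN ger0_norm // invr_ge0.
(* For real [x] one has [Im M = (M - conj M) / (2 i)] and [x - conj z = conj (x - z)]; the number
   [i2] is [1 / (2 i)]. *)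
have e (x : R) : rc (Iz (m (Cx x h))) * cker x =
  i2 * q1 (Cx x 0) + (M z * rc (pker x) + (- i2) * conjc (q2 (Cx x 0))).
 have x0 : 0 <= Iz (Cx x 0) by [].
 have xz : Cx x 0 != z by apply/eqP => e; move: z0; rewrite -e /= ltxx.
 have xh : Cx x 0 + ih = Cx x h by apply: complex_eq; rewrite ?cReD ?cImD /= ?addr0 ?add0r.
 have n1 : Cx x 0 - z != 0 by rewrite subr_eq0.
 have n2 : Cx x 0 - conjc z != 0.
  by apply: Im_neq0; rewrite cImB cImJ /= opprK add0r gt_eqF.
 rewrite q1E // /q2 /cker -[rc x]/(Cx x 0) /M xh cJM cJV cJB conjcK.
 have -> : conjc (Cx x 0) = Cx x 0 by rewrite /= oppr0.
 have -> : rc (pker x) = rc (Iz z) * ((Cx x 0 - z)^-1 * (Cx x 0 - conjc z)^-1).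
  have -> : (Cx x 0 - z)^-1 * (Cx x 0 - conjc z)^-1 = (rc ((x - Rz z) ^+ 2 + Iz z ^+ 2))^-1.
   rewrite -invfM; congr (_ ^-1).
   by apply: complex_eq; rewrite ?cReM ?cImM ?cReB ?cImB ?cReJ ?cImJ /=; ring.
  by rewrite -fmorphV -rmorphM.
 have -> : rc (Iz (m (Cx x h))) = i2 * (m (Cx x h) - conjc (m (Cx x h))).
  by apply: complex_eq; rewrite ?cReM ?cImM ?cReB ?cImB ?cReJ ?cImJ /=; field.
 have -> : rc (Iz z) = i2 * (z - conjc z).
  by apply: complex_eq; rewrite ?cReM ?cImM ?cReB ?cImB ?cReJ ?cImJ /=; field.
 by field; rewrite n1 n2.
have -> : (fun x => rc (Iz (m (Cx x h))) * cker x) =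
 (fun x => i2 * q1 (Cx x 0) + (M z * rc (pker x) + (- i2) * conjc (q2 (Cx x 0)))).
 by apply/funext => x; exact: e.
have bp : cbm (fun x => rc (pker x)) by apply: cbm_rc; exact: bmf_pker.
have bj := cbmJ b2.
have ba := cbmM (cbm_cst (M z)) bp; have bb := cbmM (cbm_cst (- i2)) bj.
rewrite (cmeanD hm (cbmM (cbm_cst i2) b1) (cbmD ba bb)) (cmeanD hm ba bb).
rewrite (cmeanZ hm _ b1) (cmeanZ hm _ bp) (cmeanZ hm _ bj).
have -> : cmean (meanU r0) (fun x => rc (pker x)) = rc (meanU r0 pker).
 by rewrite /cmean /=; congr Cx; rewrite (mean0 hm).
have -> : cmean (meanU r0) (fun x => conjc (q2 (Cx x 0))) = conjc (cmean (meanU r0) (fun x => q2 (Cx x 0))).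
 have [_ bI] := b2; rewrite {2}/cmean /= -(meanN hm) // /cmean.
 by congr Cx; congr (meanU r0 _); apply/funext => x; rewrite ?cReJ ?cImJ.
have -> : i2 * cmean (meanU r0) (fun x => q1 (Cx x 0)) +
  (M z * rc (meanU r0 pker) + - i2 * conjc (cmean (meanU r0) (fun x => q2 (Cx x 0)))) - m (z + ih) * rc (meanU r0 pker)
  = i2 * cmean (meanU r0) (fun x => q1 (Cx x 0)) - i2 * conjc (cmean (meanU r0) (fun x => q2 (Cx x 0))).
 by rewrite /M; ring.
apply: le_trans (ncB _ _) _; rewrite !ncM ncJ i2n.
have : (8 + 8 * Iz z) / r ^+ 2 = (4 + 8 * Iz z) / r ^+ 2 + 4 / r ^+ 2 by field; rewrite gt_eqF.
lra.
Qed.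
End kernel.
End fixed_height.
End representation.

(** * Laws given by densities *)

Section density.
Context {R : realType}.
Notation leb := (@lebesgue_measure R).
Notation law := (probability (measurableTypeR R) R).

Lemma density_integrable (P : law) (f : R -> R) : has_density P f ->
 leb.-integrable setT (EFin \o f).
Proof.
move=> [mf f0 hP]; apply/integrableP; split; first exact/measurable_EFinP.
under eq_integral do rewrite /= ger0_norm //.
by rewrite -hP // probability_setT ltry.
Qed.

Lemma bmf_mul_integrable (g f : R -> R) : bmf g -> leb.-integrable setT (EFin \o f) ->
 leb.-integrable setT (EFin \o (fun x => g x * f x)).
Proof.
move=> [mg [M hM]] fi; have mf : measurable_fun setT f by apply/measurable_EFinP; exact: (measurable_int leb fi).
apply: (@le_integrable _ _ _ leb _ _ _ (fun x => (M%:E * (EFin \o f) x)%E)) => //.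
- by apply/measurable_EFinP; exact: measurable_funM.
- move=> x _ /=; rewrite lee_fin !normrM; apply: ler_wpM2r => //.
 by apply: le_trans (hM x) _; exact: ler_norm.
- exact: integrableZl.
Qed.

(** The Radon-Nikodym derivative and [f] have the same integral over every measurable set, hence
    agree almost everywhere, and the change of variables applies. *)
Lemma density_integral (P : law) (f : R -> R) (g : R -> R) : has_density P f -> bmf g ->
 \int[P]_x g x = \int[leb]_x (g x * f x).
Proof.
move=> hP [mg bg]; have [mf f0 hA] := hP; have fi := density_integrable hP.
have Pl : P `<< leb.
 apply/null_content_dominatesP => A mA A0; rewrite hA //.
 by apply: null_set_integral => //; apply: measurable_funTS; exact/measurable_EFinP.
have gi : P.-integrable setT (EFin \o g).
 apply: measurable_bounded_integrable => //.
  by apply: fin_num_fun_lty; exact: fin_num_measure.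
 case: bg => M hM; exists M; split; [exact: num_real|move=> x Mx t _; exact: le_trans (hM t) (ltW Mx)].
rewrite /Rintegral -(Radon_Nikodym_change_of_variables Pl measurableT gi); congr fine.
set D := Radon_Nikodym _ _.
have DI : leb.-integrable setT D by apply: Radon_Nikodym_integrable.
have mD : measurable_fun setT D := measurable_int _ DI.
apply: ae_eq_integral => //.
- by apply: emeasurable_funM => //; exact/measurable_EFinP.
- by apply/measurable_EFinP; exact: measurable_funM.
have : ae_eq leb setT D (EFin \o f).
 apply: integral_ae_eq => //; first exact/measurable_EFinP.
 by move=> A _ mA; rewrite -hA // -Radon_Nikodym_integral.
move=> h; apply: filterS h => x hx xT /=; by rewrite hx //= EFinM.
Qed.

Definition density_prob (f : R -> R) (mf : measurable_fun setT f) (f0 : forall x, 0 <= f x)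
 (f1 : (\int[leb]_x (f x)%:E = 1)%E) (A : set (measurableTypeR R)) : \bar R :=
 (\int[leb]_(x in A) (f x)%:E)%E.

Section density_prob.
Variables (f : R -> R) (mf : measurable_fun setT f) (f0 : forall x, 0 <= f x)
 (f1 : (\int[leb]_x (f x)%:E = 1)%E).
Notation dp := (density_prob mf f0 f1).
Let dp0 : dp set0 = 0%E. by rewrite /density_prob integral_set0. Qed.
Let dp_ge0 A : (0 <= dp A)%E.
Proof. by apply: integral_ge0 => x _; rewrite lee_fin. Qed.
Let dp_int : leb.-integrable setT (EFin \o f).
Proof.
apply/integrableP; split; first exact/measurable_EFinP.
by under eq_integral do rewrite /= ger0_norm //; rewrite f1 ltry.
Qed.
Let dp_sigma : semi_sigma_additive dp.
Proof.
move=> /= A mA tA mUA; rewrite /density_prob integral_bigcup //=; last first.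
 by apply: (integrableS _ _ (subsetT _)).
apply: is_cvg_ereal_nneg_natsum_cond => n _ _.
by apply: integral_ge0 => /= x ?; rewrite lee_fin.
Qed.
HB.instance Definition _ := isMeasure.Build _ _ _ dp dp0 dp_ge0 dp_sigma.
Let dpT : dp [set: _] = 1%E. exact: f1. Qed.
HB.instance Definition _ := @Measure_isProbability.Build _ _ R dp dpT.

Lemma density_law : exists P : law, has_density P f.
Proof. by exists dp; split. Qed.
End density_prob.

Lemma meanU_E (r : R) (r0 : 0 < r) (g : R -> R) : bmf g ->
 2 * r * meanU r0 g = \int[leb]_(x in `[- r, r]) g x.
Proof.
move=> bg; have hE := meanU_is_mean r0.
have key (h : R -> R) : bmf h -> (forall x, 0 <= h x) -> 2 * r * meanU r0 h = \int[leb]_(x in `[- r, r]) h x.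
 move=> [mh _] h0; rewrite /meanU /Rintegral integral_uniform; last 2 first.
 - exact/measurable_EFinP.
 - by move=> x; rewrite lee_fin.
 have -> : r - - r = 2 * r by ring.
 case: (\int[_]_(x in _) _)%E => [s||] /=.
 - by field; rewrite gt_eqF.
 - by rewrite mulry gtr0_sg ?mul1e ?mulr0 // invr_gt0 mulr_gt0.
 - by rewrite mulrNy gtr0_sg ?mul1e ?mulr0 // invr_gt0 mulr_gt0.
have [M hM] : exists M : R, forall t, `|g t| <= M by case: bg.
have b1 : bmf (fun x => g x + M) by apply: bmfD => //; exact: bmf_cst.
have p1 x : 0 <= g x + M by have := hM x; rewrite ler_norml; lra.
have M0 : 0 <= M := le_trans (normr_ge0 _) (hM 0).
have e1 := key _ b1 p1; rewrite (meanD hE) // ?(mean_const hE) in e1; last exact: bmf_cst.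
have e2 := key _ (bmf_cst M) (fun _ => M0); rewrite (mean_const hE) in e2.
have li (h : R -> R) : bmf h -> leb.-integrable `[- r, r] (EFin \o h).
 move=> [mh [K hK]]; apply: measurable_bounded_integrable => //.
 - by rewrite /= lebesgue_measure_itv; case: ifP => _; rewrite ?ltry // -EFinD ltry.
 - exact: measurable_funTS.
 - by exists K; split; [exact: num_real|move=> x Kx t _; exact: le_trans (hK t) (ltW Kx)].
rewrite RintegralD // in e1; [|exact: li|exact/li/bmf_cst].
by rewrite -e2 mulrDr in e1; exact: (addIr _ e1).
Qed.
End density.

Section poisson.
Context {R : realType}.
Notation leb := (@lebesgue_measure R).

Lemma atan_large (e : R) : 0 < e -> exists T, forall t, T <= t -> pi / 2 - e <= atan t <= pi / 2.
Proof.
move=> e0; have := @cvgy_atan R => /cvgrPdist_le /(_ e e0) [T [_ hT]].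
exists (T + 1) => t ht; have := hT t; rewrite ler_norml => /(_ _)/andP[|h1 h2].
 by apply: lt_le_trans ht; rewrite ltrDl.
have := atan_ltpi2 t; lra.
Qed.

Lemma meanU_pker (z : R[i]) (z0 : 0 < Iz z) (r : R) (r0 : 0 < r) :
 2 * r * meanU r0 (pker z) = atan ((r - Rz z) / Iz z) + atan ((r + Rz z) / Iz z).
Proof.
have zn : Iz z != 0 by rewrite gt_eqF.
have d (x : R) : is_derive x (1 : R) (fun x => atan ((x - Rz z) / Iz z)) (pker z x).
 have h1 : is_derive x (1 : R) (fun x : R => (x - Rz z) / Iz z) (Iz z)^-1.
  have -> : (fun x : R => (x - Rz z) / Iz z) = (fun x : R => (Iz z)^-1 *: (x + (- Rz z))).
   by apply/funext => t; rewrite mulrC.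
  have := is_deriveZ (Iz z)^-1 (is_deriveD (is_derive_id x (1 : R)) (is_derive_cst (- Rz z) x (1 : R))).
  by rewrite addr0 scaler1.
 have h2 := @is_derive1_comp _ (@atan R) (fun x : R => (x - Rz z) / Iz z) x _ _ (is_derive1_atan ((x - Rz z) / Iz z)) h1.
 apply: (is_derive_eq h2).
 rewrite /pker; have p : 0 < (x - Rz z) ^+ 2 + Iz z ^+ 2 by rewrite ltr_wpDl ?sqr_ge0 ?exprn_gt0.
 have p' : 0 < Iz z ^+ 2 + (x - Rz z) ^+ 2 by rewrite addrC.
 by field; rewrite zn !gt_eqF.
rewrite (meanU_ftc r0 (bmf_pker z0) _ d); last first.
 move=> x; apply: cvgM; first exact: cvg_cst.
 apply: cvgV; first by rewrite gt_eqF // ltr_wpDl ?sqr_ge0 ?exprn_gt0.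
 by apply: cvgD; [apply: cvgM; (apply: cvgB; [exact: cvg_id|exact: cvg_cst])|exact: cvg_cst].
rewrite [X in X = _]mulrC divfK; last by rewrite gt_eqF // mulr_gt0.
have -> : (- r - Rz z) / Iz z = - ((r + Rz z) / Iz z) by field.
by rewrite atanN opprK.
Qed.

Lemma sub_div_split (u z n : R[i]) : u - (z + n) != 0 ->
 (u - n) / (u - (z + n)) = 1 + z / (u - (z + n)).
Proof. by move=> h; field. Qed.

Lemma holder_continuous (f : R -> R) : (forall x y, `|f x - f y| <= cr (6 * `|x - y|)) -> continuous f.
Proof.
move=> hf x; apply/cvgrPdist_le => e e0; have [d d0 hd] := cr_small e0.
near=> y; apply: le_trans (hf x y) _; apply: hd; first exact: normr_ge0.
by near: y; apply: cvgr_dist_le.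
Unshelve. all: by end_near.
Qed.
End poisson.

(** * Descent to the real axis: [imb / pi] as a probability density with Stieltjes transform [m] *)

Section rep_boundary.
Context {R : realType}.
Notation leb := (@lebesgue_measure R).
Variables (E : (R -> R) -> R) (hE : is_mean E) (lam : R) (lam_ge0 : 0 <= lam).
Hypothesis hsupp : forall f : R -> R, bmf f -> (forall v, -1 <= v <= 1 -> 0 <= f v) -> 0 <= E f.
Variable m : R[i] -> R[i].
Hypotheses (m_ge0 : forall z, 0 < Iz z -> 0 <= Iz (m z))
 (m_eq : forall z, 0 < Iz z -> m z = stj E lam (z + m z)).
Notation imb := (imb m).
Implicit Types z : R[i].

Lemma bmf_imb : bmf imb.
Proof.
split; first by apply: continuous_measurable_fun; exact: (continuous_imb hE m_ge0 m_eq).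
exists 1 => x; rewrite ger0_norm ?(imb_ge0 hE m_ge0 m_eq) //.
exact: (imb_le1 hE m_ge0 m_eq x).
Qed.

Lemma Im_m_pos z : 0 < Iz z -> 0 < Iz (m z).
Proof.
move=> z0; apply: lt_le_trans (Im_m_lower hE lam_ge0 hsupp m_ge0 m_eq z0).
by rewrite divr_gt0 // exprn_gt0 // ltr_wpDl // addr_ge0 ?nc_ge0.
Qed.

(** The limit of [rep_height] as [h] tends to [0]: [imb_near] is uniform in [x], and [m] is
    continuous at the interior point [z]. *)
Lemma rep_boundary z (z0 : 0 < Iz z) r (r0 : 0 < r) : 2 * (nc z + lam + 2) <= r ->
 nc (cmean (meanU r0) (fun x => rc (imb x) * cker z x) - m z * rc (meanU r0 (pker z)))
  <= (8 + 8 * Iz z) / r ^+ 2.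
Proof.
move=> hr; have hm := meanU_is_mean r0; set eta := Iz z in z0 *.
apply/ler_addgt0Pr => e e0.
pose s := Iz (m z); have s0 : 0 < s by exact: Im_m_pos.
(* By [wz_lip] at [z], where [Im m = s], the difference [m (z + i h) - m z] is at most
   [(2 / s^2 + 1) h]; the division by [eta] accounts for the mean of the Poisson kernel, at most
   [1 / eta]. *)
pose K := (2 / s ^+ 2 + 1) / eta.
have K0 : 0 < K by rewrite divr_gt0 // ltr_wpDl // divr_ge0 ?sqr_ge0.
have ee : 0 < e / 2 * eta by rewrite !mulr_gt0 ?invr_gt0.
have [d d0 hd] := cr_small ee.
pose h := Num.min 1 (Num.min d (e / 2 / K)).
have h0 : 0 < h by rewrite !lt_min ltr01 d0 /=; apply: divr_gt0 => //; apply: divr_gt0.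
have h1 : h <= 1 by rewrite /h ge_min lexx.
have h2 : cr (6 * h) <= e / 2 * eta by apply: hd; [exact: ltW|rewrite /h !ge_min lexx !orbT].
have h3 : h * K <= e / 2 by rewrite -ler_pdivlMr // /h !ge_min lexx !orbT.
have rep := rep_height hE lam_ge0 hsupp m_ge0 m_eq h0 z0 r0 hr.
have cI : bmf (fun x => Iz (m (Cx x h))).
 split.
  apply: continuous_measurable_fun; apply: holder_continuous => x y.
  have := Im_m_holder hE m_ge0 m_eq (_ : 0 < Iz (Cx x h)) (_ : 0 < Iz (Cx y h)).
  move=> /(_ h0 h0); congr (_ <= cr (6 * _)).
  by rewrite -nc_rc; congr nc; apply: complex_eq; rewrite ?cReB ?cImB /= ?subrr.
 exists 1 => x; rewrite ger0_norm ?m_ge0 //; exact: (Im_m_le1 hE m_ge0 m_eq).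
have bi := bmf_imb; have bk := cbm_cker z0.
have d1 : nc (cmean (meanU r0) (fun x => rc (imb x) * cker z x) -
  cmean (meanU r0) (fun x => rc (Iz (m (Cx x h))) * cker z x)) <= e / 2.
 apply: mean_close => [| |x]; [by apply: cbmM => //; exact: cbm_rc|by apply: cbmM => //; exact: cbm_rc|].
 rewrite -mulrBl -rmorphB ncM nc_rc.
 have a1 := imb_near hE m_ge0 m_eq x h0; rewrite distrC in a1.
 have a2 := cker_bound z0 x.
 apply: (via (e / 2 * eta * eta^-1)); last by rewrite mulfK // gt_eqF.
 by apply: ler_pM; rewrite ?nc_ge0 //; exact: le_trans h2.
have d2 : nc (m (z + Cx 0 h) - m z) <= (2 / s ^+ 2 + 1) * h.
 have zh : 0 < Iz (z + Cx 0 h) by rewrite cImD /= addr_gt0.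
 have nh : nc (z + Cx 0 h - z) = h.
  by rewrite [z + _]addrC addrK /= expr0n add0r sqrtr_sqr ger0_norm // ltW.
 have := wz_lip hE m_ge0 m_eq zh z0; rewrite nh => hw.
 have s2 : s ^+ 2 <= (Iz (m (z + Cx 0 h)) + Iz (m z)) ^+ 2.
  by apply: lesq; [exact: ltW|rewrite lerDr m_ge0].
 have hw' : nc (wz m (z + Cx 0 h) - wz m z) <= 2 * h / s ^+ 2.
  rewrite ler_pdivlMr ?exprn_gt0 //; apply: le_trans hw.
  by apply: ler_wpM2l => //; exact: nc_ge0.
 have -> : m (z + Cx 0 h) - m z = (wz m (z + Cx 0 h) - wz m z) - (z + Cx 0 h - z).
  by rewrite /wz; ring.
 apply: le_trans (ncB _ _) _; rewrite nh; move: hw'.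
 have -> : (2 / s ^+ 2 + 1) * h = 2 * h / s ^+ 2 + h by field; rewrite gt_eqF.
 lra.
have d3 : meanU r0 (pker z) <= eta^-1.
 rewrite -[leRHS](mean_const hm); apply: (mean_le hm); [exact: bmf_pker|exact: bmf_cst|].
 move=> x; rewrite -Im_cker; apply: le_trans (cker_bound z0 x).
 by apply: le_trans (Im_le _); exact: ler_norm.
have d4 : 0 <= meanU r0 (pker z).
 apply: (mean_ge0 hm) => [|x]; first exact: bmf_pker.
 by rewrite /pker divr_ge0 ?ltW // ltr_wpDl ?sqr_ge0 ?exprn_gt0.
set A := cmean _ _ in d1 *; set B := cmean _ _ in d1 rep; set p := meanU _ _ in d3 d4 rep *.
have -> : A - m z * rc p = (A - B) + (B - m (z + Cx 0 h) * rc p) + (m (z + Cx 0 h) - m z) * rc p by ring.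
have d5 : nc ((m (z + Cx 0 h) - m z) * rc p) <= e / 2.
 rewrite ncM nc_rc ger0_norm //; apply: le_trans h3.
 have -> : h * K = (2 / s ^+ 2 + 1) * h * eta^-1 by rewrite /K; field; rewrite !gt_eqF.
 by apply: ler_pM => //; exact: nc_ge0.
apply: le_trans (ncD _ _) _; have := ncD (A - B) (B - m (z + Cx 0 h) * rc p).
move: rep d1 d5; rewrite -/eta; lra.
Qed.

Lemma meanU_imb (f : R -> R) (r : R) (r0 : 0 < r) : bmf f -> lam + 3 <= r ->
 2 * r * meanU r0 (fun x => imb x * f x) = \int[leb]_x (f x * imb x).
Proof.
move=> bf hr; rewrite meanU_E; last by apply: bmfM => //; exact: bmf_imb.
rewrite Rintegral_mkcond; congr (fine _); apply: eq_integral => x _; congr EFin.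
rewrite patchE; case: ifPn => [_|]; first by rewrite mulrC.
rewrite notin_setE /= in_itv /= => /negP h; rewrite (imb_outside hE lam_ge0 hsupp m_ge0 m_eq) ?mulr0 //.
by apply: le_trans hr _; move: h; rewrite -ler_norml -ltNge => /ltW.
Qed.

(** The limit of [rep_boundary] for long segments: after multiplication by the length [2 r] the
    error is [(16 + 16 Im z) / r], while the Poisson kernel integrates over [[-r, r]] to nearly
    [pi]. The radius [S] collects the requirements on [r]. *)
Lemma imb_stieltjes z : 0 < Iz z ->
 Cx (\int[leb]_x (Rz (cker z x) * imb x)) (\int[leb]_x (Iz (cker z x) * imb x)) = m z * rc pi.
Proof.
move=> z0; apply/eqP; rewrite -subr_eq0 -nc_eq0 eq_le nc_ge0 andbT.
apply/ler_addgt0Pr => e e0; rewrite add0r.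
have e2 : 0 < e / 4 by rewrite divr_gt0.
have [T hT] := atan_large e2.
pose S := `|T| * Iz z + `|Rz z| + 2 * (nc z + lam + 2) + (lam + 3) + (16 + 16 * Iz z) / (e / 2).
have zn := nc_ge0 z; have az : 0 <= `|Rz z| by []. have aT : 0 <= `|T| by [].
have p1 : 0 <= `|T| * Iz z by rewrite mulr_ge0 // ltW.
have q2 : 0 < 16 + 16 * Iz z by rewrite addr_gt0 // mulr_gt0.
have p2 : 0 < (16 + 16 * Iz z) / (e / 2) by rewrite divr_gt0 ?divr_gt0.
have l0 := lam_ge0.
have S0 : 0 < S by rewrite /S; lra.
have hr1 : 2 * (nc z + lam + 2) <= S by rewrite /S; lra.
have hr2 : lam + 3 <= S by rewrite /S; lra.
have rep := rep_boundary z0 S0 hr1.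
have hm := meanU_is_mean S0.
have [b1 b2] := cbm_cker z0.
have Sn : 2 * S != 0 by rewrite mulf_neq0 // gt_eqF.
have eA : Cx (\int[leb]_x (Rz (cker z x) * imb x)) (\int[leb]_x (Iz (cker z x) * imb x)) =
  rc (2 * S) * cmean (meanU S0) (fun x => rc (imb x) * cker z x).
 rewrite -(meanU_imb S0 b1 hr2) -(meanU_imb S0 b2 hr2).
 apply: complex_eq; rewrite ?cReM ?cImM Re_rc Im_rc mul0r ?subr0 ?addr0 /=;
  congr (_ * meanU _ _); apply/funext => x; rewrite ?cReM ?cImM Re_rc Im_rc mul0r ?subr0 ?addr0 //.
have eP := meanU_pker z0 S0.
set P := meanU S0 (pker z) in rep eP.
have hP : `|2 * S * P - pi| <= e / 2.
 have T1 : T <= (S - Rz z) / Iz z.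
  rewrite ler_pdivlMr //; apply: (via (`|T| * Iz z)).
   by apply: ler_wpM2r; [exact: ltW|exact: ler_norm].
  by have := ler_norm (Rz z); rewrite /S; lra.
 have T2 : T <= (S + Rz z) / Iz z.
  rewrite ler_pdivlMr //; apply: (via (`|T| * Iz z)).
   by apply: ler_wpM2r; [exact: ltW|exact: ler_norm].
  by have := ler_norm (- Rz z); rewrite normrN /S; lra.
 have /andP[a1 a2] := hT _ T1; have /andP[a3 a4] := hT _ T2.
 by rewrite eP ler_norml; apply/andP; split; move: a1 a2 a3 a4; clra.
rewrite eA; have -> : rc (2 * S) * cmean (meanU S0) (fun x => rc (imb x) * cker z x) - m z * rc pi =
  rc (2 * S) * (cmean (meanU S0) (fun x => rc (imb x) * cker z x) - m z * rc P) + m z * rc (2 * S * P - pi).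
 by rewrite rmorphB !rmorphM; ring.
apply: le_trans (ncD _ _) _; rewrite !ncM !nc_rc.
have -> : e = e / 2 + 1 * (e / 2) by field.
apply: lerD; last by apply: ler_pM; rewrite ?nc_ge0 //; exact: (nc_m hE m_ge0 m_eq).
rewrite ger0_norm; last by rewrite mulr_ge0 // ltW.
apply: (via (2 * S * ((8 + 8 * Iz z) / S ^+ 2))).
 by apply: ler_wpM2l => //; rewrite mulr_ge0 // ltW.
have -> : 2 * S * ((8 + 8 * Iz z) / S ^+ 2) = (16 + 16 * Iz z) / S by field; rewrite gt_eqF.
rewrite ler_pdivrMr // [e / 2 * S]mulrC -ler_pdivrMr ?divr_gt0 //.
by rewrite /S; lra.
Qed.

Lemma imb_integral : \int[leb]_x imb x = pi.
Proof.
pose K := lam + 3; have K0 : 0 < K by rewrite ltr_wpDl.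
have hm := meanU_is_mean K0; have bi := bmf_imb.
have e1 : \int[leb]_x imb x = 2 * K * meanU K0 imb.
 have := meanU_imb K0 (bmf_cst 1) (lexx K).
 by under eq_fun do rewrite mulr1; under [in RHS]eq_Rintegral do rewrite mul1r; move=> ->.
(* [y Im m(iy) -> 1] while [y Im m(iy)] is the integral of [imb y^2/(x^2+y^2)] *)
apply/eqP; rewrite -subr_eq0 -normr_eq0 eq_le normr_ge0 andbT.
apply/ler_addgt0Pr => e e0; rewrite add0r.
pose I := \int[leb]_x imb x.
have I0 : 0 <= I by apply: Rintegral_ge0 => x _; exact: (imb_ge0 hE m_ge0 m_eq x).
pose D := (K ^+ 2 * I + pi * (lam + 1)) / e.
have D0 : 0 <= D.
 by rewrite divr_ge0 ?(ltW e0) // addr_ge0 ?mulr_ge0 ?sqr_ge0 ?pi_ge0 // addr_ge0.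
pose y := 1 + D; have y1 : 1 <= y by rewrite lerDl.
have y0 : 0 < y by exact: lt_le_trans y1.
pose z : R[i] := Cx 0 y; have z0 : 0 < Iz z by [].
have := congr1 (fun u : R[i] => Iz u) (imb_stieltjes z0).
rewrite cImM Re_rc Im_rc mulr0 add0r => e2.
have {}e2 : \int[leb]_x (Iz (cker z x) * imb x) = Iz (m z) * pi by exact: e2.
have bp := bmf_pker z0.
have e3 : \int[leb]_x (Iz (cker z x) * imb x) = 2 * K * meanU K0 (fun x => imb x * pker z x).
 rewrite (meanU_imb K0 bp (lexx K)); apply: eq_Rintegral => x _; by rewrite Im_cker.
have h1 : y * (Iz (m z) * pi) <= I /\ I - y * (Iz (m z) * pi) <= K ^+ 2 / y ^+ 2 * I.
 have k2 : 0 <= 2 * K by rewrite mulr_ge0 // ltW.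
 have bm : bmf (fun x => y * (imb x * pker z x)) by apply/bmfZ/bmfM.
 have pE x : y * pker z x = y ^+ 2 / (x ^+ 2 + y ^+ 2).
  by rewrite /pker /= subr0 mulrA expr2.
 have eI : y * (Iz (m z) * pi) = 2 * K * meanU K0 (fun x => y * (imb x * pker z x)).
  by rewrite -e2 e3 (meanZ hm) ?[y * (_ * _)]mulrCA //; exact: bmfM.
 rewrite /I e1 eI; split.
  apply: ler_wpM2l => //; apply: (mean_le hm) => // x.
  rewrite mulrCA pE -[leRHS]mulr1; apply: ler_wpM2l; first exact: (imb_ge0 hE m_ge0 m_eq).
  by rewrite ler_pdivrMr ?mul1r ?lerDr ?sqr_ge0 // ltr_wpDl ?sqr_ge0 ?exprn_gt0.
 rewrite -mulrBr -(meanB hm) // [K ^+ 2 / _ * _]mulrCA; apply: ler_wpM2l => //.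
 rewrite -(meanZ hm) //; apply: (mean_le hm); [exact: bmfB|exact: bmfZ|move=> x].
 have [hx|hx] := leP K `|x|.
  by rewrite (imb_outside hE lam_ge0 hsupp m_ge0 m_eq) // !mul0r mulr0 subrr mulr0.
 rewrite mulrCA pE -[X in X - _]mulr1 -mulrBr mulrC; apply: ler_wpM2r; first exact: (imb_ge0 hE m_ge0 m_eq).
 have q0 : 0 < x ^+ 2 + y ^+ 2 by rewrite ltr_wpDl ?sqr_ge0 ?exprn_gt0.
 have -> : 1 - y ^+ 2 / (x ^+ 2 + y ^+ 2) = x ^+ 2 / (x ^+ 2 + y ^+ 2) by field; rewrite gt_eqF.
 have xK : x ^+ 2 <= K ^+ 2 by rewrite -real_normK ?num_real //; apply: lesq => //; exact: ltW.
 apply: ler_pM; rewrite ?sqr_ge0 ?invr_ge0 ?(ltW q0) // lef_pV2 ?posrE ?exprn_gt0 //.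
 by rewrite lerDr sqr_ge0.
have h2 : `|y * Iz (m z) - 1| <= (lam + 1) / y.
 have w0 := wz_gt0 m_ge0 z0.
 (* The identity [1 + z / (lam v - w) = (lam v - m) / (lam v - w)] is averaged at [z = i y]; on the
    support the numerator is at most [lam + 1] and the kernel at most [1 / y]. *)
 have hI : 1 + Cx 0 y * m z = cmean E (fun v => (rc (lam * v) - m z) * gr lam (wz m z) v).
  have hb := cbm_gr lam w0.
  have -> : (fun v => (rc (lam * v) - m z) * gr lam (wz m z) v) = (fun v => 1 + Cx 0 y * gr lam (wz m z) v).
   apply/funext => v; rewrite /gr; have := gr_den lam v w0; rewrite /wz -/z => hn.
   exact: (sub_div_split hn).
  rewrite (cmeanD hE) ?(cmeanZ hE) ?(cmean_cst hE) //; last 2 first.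
  - exact: cbm_cst.
  - by apply: cbmM => //; exact: cbm_cst.
  by rewrite -/(stj E lam (wz m z)) (stj_wz m_eq z0).
 have -> : y * Iz (m z) - 1 = - Rz (1 + Cx 0 y * m z).
  by rewrite cReD cReM /=; ring.
 rewrite normrN; apply: le_trans (Re_le _) _; rewrite hI.
 have hb : cbm (fun v => (rc (lam * v) - m z) * gr lam (wz m z) v).
  have -> : (fun v => (rc (lam * v) - m z) * gr lam (wz m z) v) = (fun v => 1 + Cx 0 y * gr lam (wz m z) v).
   apply/funext => v; rewrite /gr; have := gr_den lam v w0; rewrite /wz -/z => hn.
   exact: (sub_div_split hn).
  by apply: cbmD; [exact: cbm_cst|apply: cbmM; [exact: cbm_cst|exact: cbm_gr]].
 apply: le_trans (nc_cmean hE hb) _; rewrite -[leRHS](mean_const hE).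
 apply: (supp_le hE hsupp); [exact: bmf_nc|exact: bmf_cst|move=> v hv].
 rewrite ncM; apply: ler_pM; rewrite ?nc_ge0 //.
  apply: le_trans (ncB _ _) _; apply: lerD; last exact: (nc_m hE m_ge0 m_eq).
  by rewrite nc_rc normrM ger0_norm // -[leRHS]mulr1 ler_wpM2l // ler_norml.
 apply: le_trans (gr_nc _ _ w0) _; rewrite lef_pV2 ?posrE //.
 exact: (wz_ge m_ge0 z0).
have [h3 h4] := h1.
have p0 := @pi_gt0 R.
have h5 : `|y * (Iz (m z) * pi) - pi| <= pi * ((lam + 1) / y).
 have -> : y * (Iz (m z) * pi) - pi = pi * (y * Iz (m z) - 1) by ring.
 by rewrite normrM (ger0_norm (ltW p0)); apply: ler_wpM2l => //; exact: ltW.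
have h6 : K ^+ 2 / y ^+ 2 * I <= K ^+ 2 * I / y.
 rewrite mulrAC; apply: ler_wpM2l; first by rewrite mulr_ge0 ?sqr_ge0.
 rewrite lef_pV2 ?posrE ?exprn_gt0 // expr2 -[leLHS]mulr1; apply: ler_wpM2l => //; exact: ltW.
have h7 : K ^+ 2 * I / y + pi * ((lam + 1) / y) <= e.
 rewrite mulrA -mulrDl ler_pdivrMr // [e * _]mulrC -ler_pdivrMr // -/D /y; lra.
move: h5; rewrite !ler_norml -/I => /andP[h8 h9]; apply/andP; split; move: h3 h4 h6 h7 h8 h9; clra.
Qed.
End rep_boundary.

(** * The Poisson kernel as an approximate identity *)

Section primitives.
Context {R : realType}.
Notation leb := (@lebesgue_measure R).
Notation law := (probability (measurableTypeR R) R).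

Lemma is_derive_poisson (z : R[i]) (x : R) : 0 < Iz z ->
 is_derive x (1 : R) (fun x => atan ((x - Rz z) / Iz z)) (pker z x).
Proof.
move=> z0; have zn : Iz z != 0 by rewrite gt_eqF.
have h1 : is_derive x (1 : R) (fun x : R => (x - Rz z) / Iz z) (Iz z)^-1.
 have -> : (fun x : R => (x - Rz z) / Iz z) = (fun x : R => (Iz z)^-1 *: (x + (- Rz z))).
  by apply/funext => t; rewrite mulrC.
 have := is_deriveZ (Iz z)^-1 (is_deriveD (is_derive_id x (1 : R)) (is_derive_cst (- Rz z) x (1 : R))).
 by rewrite addr0 scaler1.
have h2 := @is_derive1_comp _ (@atan R) (fun x : R => (x - Rz z) / Iz z) x _ _ (is_derive1_atan ((x - Rz z) / Iz z)) h1.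
apply: (is_derive_eq h2).
rewrite /pker; have p : 0 < (x - Rz z) ^+ 2 + Iz z ^+ 2 by rewrite ltr_wpDl ?sqr_ge0 ?exprn_gt0.
have p' : 0 < Iz z ^+ 2 + (x - Rz z) ^+ 2 by rewrite addrC.
by field; rewrite zn !gt_eqF.
Qed.

Lemma continuous_pker (z : R[i]) : 0 < Iz z -> continuous (pker z).
Proof.
move=> z0 x; apply: cvgM; first exact: cvg_cst.
apply: cvgV; first by rewrite gt_eqF // ltr_wpDl ?sqr_ge0 ?exprn_gt0.
by apply: cvgD; [apply: cvgM; (apply: cvgB; [exact: cvg_id|exact: cvg_cst])|exact: cvg_cst].
Qed.

Lemma Rint_ftc (a b : R) (f F : R -> R) : a < b -> continuous f ->
 (forall x : R, is_derive x (1 : R) F (f x)) -> \int[leb]_(x in `[a, b]) f x = F b - F a.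
Proof.
move=> ab cf dF; rewrite /Rintegral (@continuous_FTC2 R f F a b) //.
- exact: continuous_subspaceT.
- split => //.
 + by apply: cvg_at_right_filter; apply: differentiable_continuous; apply/derivable1_diffP; apply: ex_derive.
 + by apply: cvg_at_left_filter; apply: differentiable_continuous; apply/derivable1_diffP; apply: ex_derive.
- by move=> x _; rewrite derive1E; apply: derive_val.
Qed.

Lemma pker_ge0 (z : R[i]) t : 0 < Iz z -> 0 <= pker z t.
Proof. by move=> z0; rewrite /pker divr_ge0 ?(ltW z0) // addr_ge0 ?sqr_ge0. Qed.

(** Near [x] continuity keeps [rho] within [e'] of [rho x], and the kernel cut off to the window has
    mass [2 atan (D / eta)], nearly [pi]. Outside the window the kernel is at most [eta / D^2],
    while [rho] has total mass one. *)
Lemma poisson_limit (rho : R -> R) (x e : R) : continuous rho -> (forall t, 0 <= rho t) ->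
 leb.-integrable setT (EFin \o rho) -> \int[leb]_t rho t = 1 -> 0 < e ->
 exists2 d, 0 < d & forall eta, 0 < eta -> eta <= d ->
  `|\int[leb]_t (pker (Cx x eta) t * rho t) - pi * rho x| <= e.
Proof.
move=> cr r0 ri r1 e0; have p0 := @pi_gt0 R.
have p1 : 0 < pi + 2 * rho x + 1 by have := r0 x; lra.
pose e' := e / (pi + 2 * rho x + 1).
have e'0 : 0 < e' by rewrite divr_gt0.
have e'E : e' * (pi + 2 * rho x + 1) = e by rewrite divfK // gt_eqF.
have /cvgrPdist_le /(_ e' e'0) := cr x => -[d /= d0 hd].
pose D := d / 2; have D0 : 0 < D by rewrite divr_gt0.
have hD t : `|t - x| <= D -> `|rho x - rho t| <= e'.
 by move=> h; apply: hd => /=; rewrite distrC; apply: le_lt_trans h _; rewrite /D; move: d0; lra.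
have [T0 hT] := atan_large e'0.
pose d1 := Num.min (e' * D ^+ 2) (D / (`|T0| + 1)).
have d10 : 0 < d1.
 by rewrite lt_min; apply/andP; split; [rewrite mulr_gt0 // exprn_gt0|rewrite divr_gt0 // ltr_wpDl].
exists d1 => // eta t0 ht; pose z : R[i] := Cx x eta; have z0 : 0 < Iz z by [].
rewrite -/z; pose I := `[x - D, x + D]%classic : set R.
pose h1 := (pker z \_ I) : R -> R.
have mI : measurable I by exact: measurable_itv.
have iI : leb.-integrable I (EFin \o pker z).
 have [mp [M hM]] := bmf_pker z0.
 apply: measurable_bounded_integrable => //.
 - by rewrite /= lebesgue_measure_itv; case: ifP => _; rewrite ?ltry // -EFinD ltry.
 - exact: measurable_funTS.
 - by exists M; split; [exact: num_real|move=> y My s _; exact: le_trans (hM s) (ltW My)].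
have i1 : leb.-integrable setT (EFin \o h1).
 have := iI; rewrite integrable_mkcond //; congr (_.-integrable _ _).
 by apply/funext => t /=; rewrite /h1 !patchE /=; case: ifP.
have e1 : \int[leb]_t h1 t = 2 * atan (D / eta).
 have ab : x - D < x + D by rewrite ltrBlDr -addrA ltrDl addr_gt0.
 rewrite -Rintegral_mkcond (Rint_ftc ab (continuous_pker z0) (fun t => is_derive_poisson t z0)).
 rewrite /= [x + D]addrC addrK [x - D]addrC addrK mulNr atanN opprK; ring.
set A := 2 * _ in e1.
have hA : pi - 2 * e' <= A <= pi.
 have /hT/andP[a1 a2] : T0 <= D / eta; last by rewrite /A; apply/andP; split; move: a1 a2; clra.
 rewrite ler_pdivlMr //; apply: (via ((`|T0| + 1) * d1)).
  apply: (via ((`|T0| + 1) * eta)); last by apply: ler_wpM2l => //; rewrite addr_ge0.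
  by apply: ler_wpM2r; [exact: ltW|have := ler_norm T0; clra].
 by rewrite mulrC -ler_pdivlMr ?ge_min ?lexx ?orbT // ltr_wpDl.
have iJ : leb.-integrable setT (EFin \o (fun t => pker z t * rho t)).
 by apply: bmf_mul_integrable => //; exact: bmf_pker.
set J := \int[_]_t _.
have iZ (c : R) : leb.-integrable setT (EFin \o (fun t => c * h1 t)).
 exact: (integrableZl measurableT c i1).
have iZ' (c : R) : leb.-integrable setT (EFin \o (fun t => c * rho t)).
 exact: (integrableZl measurableT c ri).
have inI t : (t \in I) = (`|t - x| <= D).
 by rewrite mem_setE in_itv /= ler_distl.
have J1 : (rho x - e') * A <= J.
 rewrite -e1 -RintegralZl //; apply: le_Rintegral => //.
 move=> t _; rewrite /h1 patchE inI; case: ifP => [/hD|_]; last by rewrite mulr0 mulr_ge0 // pker_ge0.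
 rewrite ler_distl => /andP[b1 b2]; rewrite [leRHS]mulrC; apply: ler_wpM2r; first exact: pker_ge0.
 by move: b1 b2; clra.
have J2 : J <= (rho x + e') * A + eta / D ^+ 2.
 have -> : eta / D ^+ 2 = \int[leb]_t (eta / D ^+ 2 * rho t) by rewrite RintegralZl // r1 mulr1.
 rewrite -e1 -RintegralZl // -RintegralD //; apply: le_Rintegral => //.
  exact: (integrableD measurableT (iZ _) (iZ' _)).
 move=> t _; have q0 : 0 <= eta / D ^+ 2 * rho t by rewrite !mulr_ge0 // ?invr_ge0 ?sqr_ge0 // ltW.
 rewrite /h1 patchE inI; case: ifPn => [/hD|].
  rewrite ler_distl => /andP[b1 b2]; apply: ler_wpDr => //; rewrite mulrC; apply: ler_wpM2r; first exact: pker_ge0.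
  by move: b1 b2; clra.
 rewrite -ltNge => hx; rewrite mulr0 add0r; apply: ler_wpM2r => //.
 rewrite /pker /=; apply: ler_wpM2l; first exact: ltW.
 rewrite lef_pV2 ?posrE ?exprn_gt0 //; last by rewrite ltr_wpDl ?sqr_ge0 ?exprn_gt0.
 apply: ler_wpDr; first exact: sqr_ge0.
 by rewrite -(real_normK (num_real (t - x))); apply: lesq; rewrite ltW.
have h3 : eta / D ^+ 2 <= e'.
 rewrite ler_pdivrMr ?exprn_gt0 //; apply: le_trans ht _.
 by rewrite /d1 ge_min lexx.
have /andP[a1 a2] := hA; have rx := r0 x.
have h4 : e' * A <= e' * pi by apply: ler_wpM2l => //; exact: ltW.
have h5 : rho x * (pi - 2 * e') <= rho x * A by apply: ler_wpM2l.
have h6 : rho x * A <= rho x * pi by apply: ler_wpM2l.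
rewrite ler_distl -e'E; apply/andP; split.
 by move: J1 J2 h3 h4 h5 h6 e'0; move: (eta / D ^+ 2) => q; clra.
by move: J1 J2 h3 h4 h5 h6 e'0; move: (eta / D ^+ 2) => q; clra.
Qed.

End primitives.

(** * Identification of [rho_fc] *)

Section deterministic_law.
Context {R : realType}.
Notation leb := (@lebesgue_measure R).
Notation law := (probability (measurableTypeR R) R).
Variable mu : law.
Notation E := (fun f : R -> R => \int[mu]_x f x).
Let hE : is_mean E := law_is_mean mu.

Lemma m_fc_spec (lam : R) (z : R[i]) : 0 < Iz z ->
 0 <= Iz (m_fc mu lam z) /\ m_fc mu lam z = stj E lam (z + m_fc mu lam z).
Proof.
move=> z0.
have key (m : R[i]) : m = cintegral mu (fun v => ((lam * v)%:C%C - z - m)^-1) <-> m = stj E lam (z + m).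
 suff -> : cintegral mu (fun v => ((lam * v)%:C%C - z - m)^-1) = stj E lam (z + m) by [].
 rewrite /stj /cmean /cintegral /gr.
 by apply: complex_eq => /=; apply: eq_Rintegral => t _; rewrite opprD addrA.
have [|h0 h1] := xgetPex (0 : R[i]) (P := [set m : R[i] | 0 <= complex.Im m /\
  m = cintegral mu (fun v => ((lam * v)%:C%C - z - m)^-1)]).
 have [w [w0 s0 ew]] := stj_exists hE lam z0.
 exists (stj E lam w) => /=; split => //; apply/key; by rewrite -ew.
by split => //; apply/key.
Qed.

Variable f : R -> R.
Hypotheses (muf : has_density mu f) (f_out : forall v, ~~ (-1 <= v <= 1) -> f v = 0).
Variables (lam : R) (lam_ge0 : 0 <= lam).
Notation m := (m_fc mu lam).

Lemma density_supp (g : R -> R) : bmf g -> (forall v, -1 <= v <= 1 -> 0 <= g v) -> 0 <= E g.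
Proof.
move=> bg g0; rewrite /= (density_integral muf bg); apply: Rintegral_ge0 => x _.
have [_ f0 _] := muf.
have [/g0 h|/f_out ->] := boolP (-1 <= x <= 1); [exact: mulr_ge0|by rewrite mulr0].
Qed.

Lemma m_fc_ge0 z : 0 < Iz z -> 0 <= Iz (m z). Proof. by move=> /(m_fc_spec lam)[]. Qed.
Lemma m_fc_eq z : 0 < Iz z -> m z = stj E lam (z + m z). Proof. by move=> /(m_fc_spec lam)[]. Qed.

Let imb_g0 := imb_ge0 hE m_fc_ge0 m_fc_eq.
Let imb_int := imb_integral hE lam_ge0 density_supp m_fc_ge0 m_fc_eq.
Let bmf_im : bmf (imb m) := bmf_imb hE m_fc_ge0 m_fc_eq.
Let imb_out := imb_outside hE lam_ge0 density_supp m_fc_ge0 m_fc_eq.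

Lemma imb_integrable : leb.-integrable setT (EFin \o imb m).
Proof.
pose r := lam + 3; have r0 : 0 < r by rewrite ltr_wpDl.
have h : leb.-integrable `[- r, r] (EFin \o imb m).
 have [mp [M hM]] := bmf_im.
 apply: measurable_bounded_integrable => //.
 - by rewrite /= lebesgue_measure_itv; case: ifP => _; rewrite ?ltry // -EFinD ltry.
 - exact: measurable_funTS.
 - by exists M; split; [exact: num_real|move=> y My s _; exact: le_trans (hM s) (ltW My)].
have := h; rewrite integrable_mkcond //; congr (_.-integrable _ _).
apply/funext => t /=; rewrite patchE; case: ifPn => //.
rewrite notin_setE /= in_itv /= => /negP; rewrite -ler_norml -ltNge => /ltW hr.
by rewrite imb_out.
Qed.

Lemma imb_law : exists2 P : law, is_mu_fc mu lam P & has_density P (fun x => imb m x / pi).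
Proof.
have p0 := @pi_gt0 R.
have [|||P hP] := @density_law _ (fun x => imb m x / pi).
- by apply: measurable_funM => //; case: bmf_im.
- by move=> x; rewrite divr_ge0 // ltW.
- have := imb_int; rewrite /Rintegral; have := imb_integrable.
 under [X in _ -> _ -> X = _]eq_integral do rewrite EFinM muleC.
 move=> hi e; rewrite integralZl //.
 rewrite -[X in (_ * X)%E]fineK ?e ?(integrable_fin_num _ hi) //.
 by rewrite -EFinM mulVf // gt_eqF.
exists P => // z z0.
have [b1 b2] := cbm_cker z0.
have := imb_stieltjes hE lam_ge0 density_supp m_fc_ge0 m_fc_eq z0.
rewrite /cintegral (density_integral hP b1) (density_integral hP b2) => e.
have pn : pi != 0 :> R by rewrite gt_eqF.
have key (g : R -> R) : bmf g -> \int[leb]_x (g x * (imb m x / pi)) = (\int[leb]_x (g x * imb m x)) / pi.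
 move=> bg; under eq_Rintegral do rewrite mulrA mulrC.
 by rewrite RintegralZl 1?mulrC //; apply: bmf_mul_integrable => //; exact: imb_integrable.
have -> : m z = (m z * rc pi) * rc pi^-1 by rewrite -mulrA -rmorphM mulfV // mulr1.
rewrite -e; apply: complex_eq; rewrite ?cReM ?cImM Re_rc Im_rc /= ?mulr0 ?subr0 ?add0r; by rewrite key.
Qed.

(** Stieltjes inversion. The pair built in [imb_law] shows that [xget] has something to choose from;
    whatever continuous density it returns has Poisson integral [Im m], which tends to [pi * rho] by
    [poisson_limit] and to [imb] by [imb_near]. *)
Lemma rho_fcE x : rho_fc mu lam x = imb m x / pi.
Proof.
have p0 := @pi_gt0 R; have pn : pi != 0 :> R by rewrite gt_eqF.
have [|rc [P hP dP]] := xgetPex (fun=> 0 : R) (P := [set rho : R -> R | continuous rho /\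
  exists2 muf : law, is_mu_fc mu lam muf & has_density muf rho]).
 exists (fun x => imb m x / pi); split; last exact: imb_law.
 by move=> y; apply: cvgM; [exact: (continuous_imb hE m_fc_ge0 m_fc_eq)|exact: cvg_cst].
rewrite -/(rho_fc mu lam) in rc dP.
have [mr r0 _] := dP; have ri := density_integrable dP.
have r1 : \int[leb]_t rho_fc mu lam t = 1.
 by rewrite /Rintegral; have [_ _ /(_ setT measurableT)] := dP => <-; rewrite probability_setT.
apply/eqP; rewrite -subr_eq0 -normr_eq0 eq_le normr_ge0 andbT.
apply/ler_addgt0Pr => e e0; rewrite add0r.
have e2 : 0 < e * pi / 2 by rewrite divr_gt0 // mulr_gt0.
have [d d0 hd] := poisson_limit x rc r0 ri r1 e2.
have [d' d'0 hd'] := cr_small e2.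
pose t := Num.min d d'; have t0 : 0 < t by rewrite lt_min d0 d'0.
have z0 : 0 < Iz (Cx x t) by [].
have h1 := hd t t0 (_ : t <= d); have h2 := hd' t (ltW t0).
have := imb_near hE m_fc_ge0 m_fc_eq x t0.
have -> : Iz (m (Cx x t)) = \int[leb]_s (pker (Cx x t) s * rho_fc mu lam s).
 rewrite (hP _ z0) /= (density_integral dP); last by have [] := cbm_cker z0.
 by apply: eq_Rintegral => s _; rewrite -Im_cker.
move: (\int[leb]_s _) h1 h2 => J h1 h2 h3.
have {}h1 : `|J - pi * rho_fc mu lam x| <= e * pi / 2 by apply: h1; rewrite /t ge_min lexx.
have {}h2 : cr (6 * t) <= e * pi / 2 by apply: h2; rewrite /t ge_min lexx orbT.
rewrite -(ler_pM2r p0) -[X in _ * X](ger0_norm (ltW p0)) -normrM mulrBl mulfVK //.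
move: h1 h3 h2; rewrite !ler_distl => /andP[a1 a2] /andP[a3 a4] h2.
by apply/andP; split; lra.
Qed.

(** Masses of intervals are measured below by increments of a primitive, which compare with the
    smoothed counting function through the mean value theorem. *)
Lemma imb_primitive : exists2 A : R -> R, (forall x : R, is_derive x (1 : R) A (imb m x)) &
 A (lam + 3) - A (- (lam + 3)) = pi.
Proof.
pose A x := \int[leb]_(t in `]-oo, x]) imb m t.
have hi := imb_integrable.
have dA (x : R) : is_derive x (1 : R) A (imb m x).
 have cx : {for x, continuous (imb m)} by exact: (continuous_imb hE m_fc_ge0 m_fc_eq).
 have [||//|d e] := @continuous_FTC1 R (imb m) -oo%O x (x + 1) _ _ _ cx.
 - by rewrite ltrDl.
 - exact: integrableS hi.
 - exact: ltNyr.
 by split; [exact: d|rewrite -derive1E; exact: e].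
exists A => //; rewrite -imb_int.
have -> : A (- (lam + 3)) = 0.
 rewrite /A; under eq_Rintegral => t ht.
  rewrite imb_out; first over.
  move: ht; rewrite inE /= in_itv /= => ht; rewrite ler0_norm; first by rewrite lerNr.
  by apply: le_trans ht _; rewrite oppr_le0 addr_ge0.
 by rewrite /Rintegral integral0.
rewrite subr0 /A Rintegral_mkcond; apply: eq_Rintegral => t _; rewrite patchE; case: ifPn => //.
rewrite notin_setE /= in_itv /= => /negP; rewrite -ltNge => h; rewrite imb_out //.
by apply: le_trans (ler_norm _); exact: ltW.
Qed.

End deterministic_law.

Lemma mvt_bounds (R : realType) (F F' : R -> R) (a b lo hi : R) : a <= b ->
 (forall x : R, a <= x <= b -> is_derive x (1 : R) F (F' x)) ->
 (forall x, a < x < b -> lo <= F' x <= hi) ->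
 lo * (b - a) <= F b - F a <= hi * (b - a).
Proof.
rewrite le_eqVlt => /predU1P[->|ab] dF hF; first by rewrite !subrr !mulr0 lexx.
have [||x] := @MVT R F F' a b ab.
- by move=> x; rewrite in_itv /= => /andP[h1 h2]; apply: dF; rewrite !ltW.
- apply: derivable_within_continuous => x; rewrite in_itv /= => hx.
 by have := dF x hx => -[].
rewrite in_itv /= => /hF/andP[h1 h2] ->; have d0 : 0 <= b - a by rewrite subr_ge0 ltW.
by rewrite !ler_wpM2r.
Qed.

(** * The bulk and a lower bound for [Im m] there, uniform in [lam] *)

Section bulk.
Context {R : realType}.
Notation law := (probability (measurableTypeR R) R).
Notation leb := (@lebesgue_measure R).

(** The constant [a] is the minimum of the density over [[-(1 - kp/2), 1 - kp/2]], which contains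
    every window of half-width at most [kp / 2] centred in [[-(1 - kp), 1 - kp]]. *)
Lemma density_lower (mu : law) (f : R -> R) (kp : R) : has_density mu f ->
 (forall v, -1 < v < 1 -> {for v, continuous f}) -> (forall v, -1 < v < 1 -> 0 < f v) ->
 0 < kp -> kp <= 1 -> exists2 a, 0 < a & forall b y, 0 < b -> b <= kp / 2 ->
  -(1 - kp) <= y <= 1 - kp -> forall h (s : R), bmf h -> (forall v, 0 <= h v) ->
   (forall v, `|v - y| <= b -> s <= h v) -> 2 * a * b * s <= \int[mu]_x h x.
Proof.
move=> hf cf pf kp0 kp1; pose q := 1 - kp / 2.
have q0 : - q <= q by rewrite /q; lra.
have cq : {within `[- q, q], continuous f}.
 apply: continuous_in_subspaceT => x; rewrite inE /= in_itv /= => /andP[x1 x2]; apply: cf.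
 by apply/andP; split; rewrite /q in x1 x2; lra.
have [x0 hx0 hmin] := EVT_min q0 cq.
exists (f x0).
 by apply: pf; move: hx0; rewrite in_itv /= /q => /andP[x1 x2]; apply/andP; split; lra.
have [mf f0 _] := hf.
move=> b y b0 bk /andP[y1 y2] h s bh h0 hs.
have hm := law_is_mean mu.
have [s0|s0] := leP s 0.
 apply: (via 0); last exact: (mean_ge0 hm).
 by apply: mulr_ge0_le0 => //; rewrite !mulr_ge0 // ltW.
rewrite (density_integral hf bh).
pose I := `[y - b, y + b]%classic : set R.
have mI : measurable I by exact: measurable_itv.
have lI : lebesgue_measure I = (2 * b)%:E.
 rewrite /I lebesgue_measure_itv /= lte_fin ltrD2l gt0_cp // -EFinD; congr EFin; ring.
have inI t : (t \in I) = (`|t - y| <= b) by rewrite mem_setE in_itv /= ler_distl.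
have iI : leb.-integrable I (EFin \o (fun=> f x0 * s)).
 apply: measurable_bounded_integrable => //; first by rewrite [X in (X < _)%E]lI ltry.
 by exists `|f x0 * s|; split; [exact: num_real|move=> M hM t _; exact: ltW].
have -> : 2 * f x0 * b * s = \int[leb]_x ((fun=> f x0 * s) \_ I) x.
 rewrite -Rintegral_mkcond /Rintegral integral_cst // [X in (_ * X)%E]lI /=; ring.
apply: le_Rintegral => //.
- suff <- : (EFin \o (fun=> f x0 * s)) \_ I = EFin \o ((fun=> f x0 * s) \_ I) by rewrite -integrable_mkcond.
 by apply/funext => t /=; rewrite !patchE /=; case: ifP.
- apply: bmf_mul_integrable => //; exact: (density_integrable hf).
move=> t _; rewrite patchE inI; case: ifP => [ht|_]; last by rewrite mulr_ge0.
rewrite mulrC; apply: ler_pM; rewrite ?(ltW s0) ?hs //.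
apply: hmin; rewrite in_itv /= /q; move: ht; rewrite ler_distl => /andP[t1 t2].
by apply/andP; split; lra.
Qed.

(** The bulk is the hull of the level set [imb >= c0]. Outside it the density is so low that little
    mass is lost; inside, [quasi_unimodal] carries the lower bound from the two end points, where
    [imb >= c0 - c] by Hölder continuity, to everything between. The constants are fixed before
    [lam] is introduced. *)
Lemma bulk_exists (mu : law) (lam0 e : R) : positive_density mu -> 0 < lam0 -> 0 < e ->
 exists2 c, 0 < c & forall lam, 0 <= lam -> lam <= lam0 -> exists x1 x2,
  [/\ x1 <= x2, - (lam + 3) <= x1, x2 <= lam + 3,
   (forall x eta, x1 <= x <= x2 -> 0 < eta -> eta <= 2 -> c <= Iz (m_fc mu lam (Cx x eta))) &
   forall A : R -> R, (forall x : R, is_derive x (1 : R) A (imb (m_fc mu lam) x)) ->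
     A (lam + 3) - A (- (lam + 3)) = pi -> pi - e <= A x2 - A x1].
Proof.
move=> [f [hf cf pf f_out]] l0 e0.
(* The interval [[-(lam + 3), lam + 3]] has length at most [2 (lam0 + 3)], so the region [imb < c0]
   carries mass at most [min e 1]: no more than [e], and less than the total mass [pi], so that the
   level set is not empty. *)
pose c0 := Num.min e 1 / (2 * (lam0 + 3)).
have q0 : 0 < 2 * (lam0 + 3) by rewrite mulr_gt0 // addr_gt0.
have m0 : 0 < Num.min e 1 by rewrite lt_min e0 ltr01.
have c00 : 0 < c0 by rewrite divr_gt0.
have c0E : c0 * (2 * (lam0 + 3)) = Num.min e 1 by rewrite divfK // gt_eqF.
pose c := c0 / 4; have cc : 0 < c by rewrite divr_gt0.
pose kp := Num.min 1 (c / 2 / lam0).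
have kp0 : 0 < kp by rewrite lt_min ltr01 /= !divr_gt0.
have kp1 : kp <= 1 by rewrite ge_min lexx.
have lk : lam0 * kp <= c / 2 by rewrite mulrC -ler_pdivlMr // ge_min lexx orbT.
have [a a0 ha] := density_lower hf cf pf kp0 kp1.
have s0 : 0 < 1 + lam0 ^+ 2 by rewrite ltr_wpDr ?sqr_ge0.
pose b := Num.min (c / 2) (Num.min (kp / 2) (a / (1 + lam0 ^+ 2))).
have b0 : 0 < b by rewrite !lt_min !divr_gt0.
have b1 : b <= c / 2 by rewrite ge_min lexx.
have b2 : b <= kp / 2 by rewrite !ge_min lexx !orbT.
have b3 : b <= a / (1 + lam0 ^+ 2) by rewrite !ge_min lexx !orbT.
have [d d0 hd] := cr_small cc.
pose d1 := Num.min d (b / 2); have d10 : 0 < d1 by rewrite lt_min d0 divr_gt0.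
pose c1 := d1 / (2 * lam0 + 6) ^+ 2.
have q1 : 0 < 2 * lam0 + 6 by rewrite addr_gt0 // mulr_gt0.
have c10 : 0 < c1 by rewrite divr_gt0 // exprn_gt0.
exists (Num.min (b / 2) c1); first by rewrite lt_min c10 divr_gt0.
move=> lam lam_ge0 ll; set m := m_fc mu lam.
have hE := law_is_mean mu; have hs := density_supp hf f_out.
have hm0 := @m_fc_ge0 _ mu lam; have hm := @m_fc_eq _ mu lam.
have p1 := @pi_ge2 R.
pose S := [set x | c0 <= imb m x].
have ho := imb_outside hE lam_ge0 hs hm0 hm.
have Sr x : S x -> - (lam + 3) <= x <= lam + 3.
 rewrite /S /= => hx; rewrite -ler_norml leNgt; apply/negP => /ltW /ho h.
 by move: hx; rewrite h leNgt c00.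
have [A0 dA0 A0E] := imb_primitive hf f_out lam_ge0.
have rr : - (lam + 3) <= lam + 3 by have := lam_ge0; clra.
have i0 := imb_ge0 hE hm0 hm.
have Sn : exists x, S x.
 apply: contrapT => /forallNP h.
 have := mvt_bounds (lo := 0) (hi := c0) rr (fun x _ => dA0 x).
 rewrite A0E => /(_ _)/andP[|_ h1].
  by move=> x _; rewrite i0 /= leNgt; apply/negP => /ltW; exact: h.
 have h2 : c0 * (lam + 3 - - (lam + 3)) <= c0 * (2 * (lam0 + 3)) by apply: ler_wpM2l; [exact: ltW|lra].
 have h3 : Num.min e 1 <= 1 by rewrite ge_min lexx orbT.
 by move: c0E h1 h2 h3 p1; clra.
have hi : has_inf S by split=> //; exists (- (lam + 3)) => x /Sr/andP[].
have hsu : has_sup S by split=> //; exists (lam + 3) => x /Sr/andP[].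
have [z0 Sz0] := Sn.
have holder := imb_holder hE hm0 hm.
have x1S : c0 - c <= imb m (inf S).
 have [x Sx hx] := inf_adherent d0 hi; have hx' := ge_inf hi.2 Sx.
 have hxd : `|x - inf S| <= d by rewrite ger0_norm ?subr_ge0 // lerBlDl ltW.
 have := hd _ (normr_ge0 _) hxd; have := holder x (inf S); rewrite ler_distl => /andP[h2 h3].
 move=> h1; rewrite lerBlDr; apply: le_trans Sx _; apply: le_trans h3 _; by rewrite lerD2l.
have x2S : c0 - c <= imb m (sup S).
 have [x Sx hx] := sup_adherent d0 hsu; have hx' := ub_le_sup hsu.2 Sx.
 have hxd : `|x - sup S| <= d by rewrite ler0_norm ?subr_le0 // opprB lerBlDl -lerBlDr ltW.
 have := hd _ (normr_ge0 _) hxd; have := holder x (sup S); rewrite ler_distl => /andP[h2 h3].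
 move=> h1; rewrite lerBlDr; apply: le_trans Sx _; apply: le_trans h3 _; by rewrite lerD2l.
have x12 : inf S <= sup S by apply: (via z0); [exact: ge_inf hi.2 _ Sz0|exact: ub_le_sup hsu.2 _ Sz0].
have g1 : - (lam + 3) <= inf S by apply: lb_le_inf => // x /Sr/andP[].
have g2 : sup S <= lam + 3 by apply: ge_sup => // x /Sr/andP[].
exists (inf S), (sup S); split => //.
(* [quasi_unimodal] bounds [Im w = eta + Im m] below by [b]; as [eta <= b / 2], half of it is left
   for [Im m]. *)
- have small x eta : inf S <= x <= sup S -> 0 < eta -> eta <= d1 -> b / 2 <= Iz (m (Cx x eta)).
  move=> /andP[h1 h2] t0 ht.
  have h3 : cr (6 * eta) <= c by apply: hd; [exact: ltW|apply: le_trans ht _; rewrite ge_min lexx].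
  have h4 : eta <= b / 2 by apply: le_trans ht _; rewrite ge_min lexx orbT.
  have ends y : c0 - c <= imb m y -> c <= Iz (wz m (Cx y eta)).
   move=> hy; rewrite Im_wz /=; have := imb_near hE hm0 hm y t0.
   rewrite -/m; move: hy h3 t0 c00; move: (imb m y) (Iz (m _)) (cr _) => a1 a2 a3.
   by rewrite ler_distl /c => hy h3 t0' c0' /andP[h5 h6]; clear -hy h3 t0' c0' h5; lra.
  have := quasi_unimodal hE lam_ge0 hs hm0 hm ll cc kp0 b0 b1 b3 lk (fun y => ha b y b0 b2) t0 h1 h2 (ends _ x1S) (ends _ x2S).
  rewrite Im_wz /= -/m; move: h4; move: (Iz (m _)) => a1; clear; lra.
 move=> x eta hx t0 t2; rewrite ge_min; have [ht|ht] := leP eta d1; first by rewrite small.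
 (* Above height [d1] the general bound [Im_m_lower] suffices, because [z] stays in a bounded
    region. *)
 apply/orP; right; have zz : 0 < Iz (Cx x eta) by [].
 apply: le_trans (Im_m_lower hE lam_ge0 hs hm0 hm zz).
 have nx : lam + nc (Cx x eta) + 1 <= 2 * lam0 + 6.
  have := nc_le_ReIm (Cx x eta); rewrite /= (ger0_norm (ltW t0)).
  move: hx => /andP[hx1 hx2].
  have : `|x| <= lam + 3 by rewrite ler_norml; apply/andP; split; [exact: le_trans hx1|exact: le_trans g2].
  move: t2 ll; move: (sqrt _) `|x| => s x'; clear; lra.
 have nn : 0 < lam + nc (Cx x eta) + 1 by rewrite ltr_wpDl // addr_ge0 // nc_ge0.
 apply: ler_pM; rewrite ?(ltW d10) ?invr_ge0 ?sqr_ge0 ?(ltW ht) //.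
 by rewrite lef_pV2 ?posrE ?exprn_gt0 //; apply: lesq => //; exact: ltW.
- move=> A dA AE.
 have o1 := mvt_bounds (lo := 0) (hi := c0) g1 (fun x _ => dA x).
 have o2 := mvt_bounds (lo := 0) (hi := c0) g2 (fun x _ => dA x).
 have /andP[_ h1] : 0 * (inf S - - (lam + 3)) <= A (inf S) - A (- (lam + 3)) <= c0 * (inf S - - (lam + 3)).
  apply: o1 => x /andP[_ hx]; rewrite i0 /= leNgt; apply/negP => /ltW Sx.
  by have := ge_inf hi.2 Sx; rewrite leNgt hx.
 have /andP[_ h2] : 0 * (lam + 3 - sup S) <= A (lam + 3) - A (sup S) <= c0 * (lam + 3 - sup S).
  apply: o2 => x /andP[hx _]; rewrite i0 /= leNgt; apply/negP => /ltW Sx.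
  by have := ub_le_sup hsu.2 Sx; rewrite leNgt hx.
 have h3 : c0 * (inf S - - (lam + 3)) + c0 * (lam + 3 - sup S) <= c0 * (2 * (lam0 + 3)).
  rewrite -mulrDr; apply: ler_wpM2l; first exact: ltW.
  move: ll x12; move: (inf S) (sup S) => s1 s2; clear; lra.
 have h4 : Num.min e 1 <= e by rewrite ge_min lexx.
 move: h1 h2 h3 h4 AE; rewrite c0E; move: (A _) (A _) (A _) (A _) => a1 a2 a3 a4; clear; lra.
Qed.
End bulk.

(** * Independence of generated sigma-algebras and decoupling *)

Section independence.
Context {R : realType} {d : measure_display} {T : measurableType d}.
Variable P : probability T R.
Implicit Types F G : set_system T.

Lemma lambda_indep (B : set T) : measurable B ->
 lambda_system setT [set A | measurable A /\ P (A `&` B) = (P A * P B)%E].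
Proof.
move=> mB; split => //=.
- by split => //; rewrite setTI probability_setT mul1e.
- move=> A A' AA [mA eA] [mA' eA']; split; first exact: measurableD.
 have fin X : measurable X -> P X \is a fin_num by move=> mX; exact: fin_num_measure.
 have -> : (A `\` A') `&` B = (A `&` B) `\` (A' `&` B).
  by apply/seteqP; split => x /= [[xA xB] n]; split => //; [move=> []|split => // xA'; apply: n].
 rewrite !measureD ?eA ?eA' //; try exact: measurableI; try (by rewrite ltey_eq fin // ; exact: measurableI).
 rewrite (setIidr AA); have -> : A `&` B `&` (A' `&` B) = A' `&` B.
  by rewrite setIACA setIid (setIidr AA).
 transitivity (P A * P B - P A' * P B)%E; first by rewrite -eA -eA'.
 by rewrite muleBl ?fin //; apply: fin_num_adde_defl; rewrite fin_numN fin.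
- move=> A ndA hA; have mA i : measurable (A i) := (hA i).1.
 have mU : measurable (\bigcup_n A n) by exact: bigcupT_measurable.
 split => //; rewrite setI_bigcupl.
 have c1 : P \o (fun n => A n `&` B) @ \oo --> P (\bigcup_n (A n `&` B)).
  apply: nondecreasing_cvg_mu.
  - by move=> i; exact: measurableI.
  - by rewrite -setI_bigcupl; exact: measurableI.
  - by move=> i j ij; apply/subsetPset; apply: setSI; exact/subsetPset/ndA.
 have c2 : (fun n => P (A n) * P B)%E @ \oo --> (P (\bigcup_n A n) * P B)%E.
  apply: cvgeZr; first exact: fin_num_measure.
  exact: nondecreasing_cvg_mu.
 have e : P \o (fun n => A n `&` B) = (fun n => P (A n) * P B)%E.
  by apply/funext => n /=; have [_] := hA n.
 by rewrite e in c1; exact: (cvg_unique _ c1 c2).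
Qed.

Lemma indep_generated F G : setI_closed F -> setI_closed G ->
 F `<=` measurable -> G `<=` measurable ->
 independent_classes P F G -> independent_classes P <<s F >> <<s G >>.
Proof.
move=> iF iG mF mG h.
have s1 A B : <<s F >> A -> G B -> P (A `&` B) = (P A * P B)%E.
 move=> sA gB; have mB := mG _ gB.
 by have [] : [set A | measurable A /\ P (A `&` B) = (P A * P B)%E] A;
  first by apply: (lambda_system_subset iF (lambda_indep mB)) sA => // A' fA'; split; [exact: mF|exact: h].
have sm : <<s F >> `<=` measurable.
 apply: smallest_sub mF; split => //.
 - by move=> A mA; exact: measurableD.
 - by move=> A mA; exact: bigcupT_measurable.
move=> A B sA sB; have mA := sm _ sA.
rewrite setIC muleC.
have [] : [set B | measurable B /\ P (B `&` A) = (P B * P A)%E] B => //.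
apply: (lambda_system_subset iG (lambda_indep mA)) sB => // B' gB'; split; first exact: mG.
by rewrite setIC muleC; exact: s1.
Qed.

Section finite_family.
Variables (K : finType) (D : {set K}) (F : K -> set_system T).
Hypotheses (hF : mutually_independent P D F) (FI : forall k, setI_closed (F k)) (FT : forall k, F k setT)
 (Fm : forall k, F k `<=` measurable).

Definition cylinders (J : {set K}) : set_system T :=
 [set X | exists2 A : K -> set T, (forall k, k \in J -> F k (A k)) & X = \bigcap_(k in [set` J]) A k].

Lemma cylinders_setI J : setI_closed (cylinders J).
Proof.
move=> _ _ [A hA ->] [B hB ->]; exists (fun k => A k `&` B k); last by rewrite bigcapI.
by move=> k kJ; apply: FI; [exact: hA|exact: hB].
Qed.

Lemma cylinders_measurable J : cylinders J `<=` measurable.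
Proof.
move=> _ [A hA ->]; apply: fin_bigcap_measurable; first exact: finite_finset.
by move=> k /= kJ; apply: Fm; exact: hA.
Qed.

Lemma sub_cylinders (J : {set K}) k : k \in J -> F k `<=` cylinders J.
Proof.
move=> kJ X FX; exists (fun l => if l == k then X else setT).
 by move=> l _; case: eqP => // ->.
apply/seteqP; split => x; first by move=> Xx l _; case: ifP.
by move=> /(_ k kJ); rewrite eqxx.
Qed.

Lemma indep_families (J1 J2 : {set K}) : J1 \subset D -> J2 \subset D -> fintype.disjoint (mem J1) (mem J2) ->
 independent_classes P <<s \bigcup_(k in [set` J1]) F k >> <<s \bigcup_(k in [set` J2]) F k >>.
Proof.
move=> s1 s2 dJ.
have sub (J : {set K}) : <<s \bigcup_(k in [set` J]) F k >> `<=` <<s cylinders J >>.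
 apply: smallest_sub; first exact: smallest_sigma_algebra.
 move=> X [k kJ FX]; apply: sub_sigma_algebra; exact: (sub_cylinders kJ).
suff h : independent_classes P <<s cylinders J1 >> <<s cylinders J2 >>.
 by move=> A B hA hB; apply: h; exact: sub.
apply: indep_generated; try exact: cylinders_setI; try exact: cylinders_measurable.
move=> _ _ [A hA ->] [B hB ->].
pose C k := if k \in J1 then A k else B k.
have hC k : k \in J1 :|: J2 -> F k (C k).
 by rewrite inE /C; case: ifP => /= [/hA|_ /hB].
have CA k : k \in J1 -> C k = A k by rewrite /C => ->.
have CB k : k \in J2 -> C k = B k by rewrite /C => kJ; rewrite (disjointFl dJ kJ).
have -> : \bigcap_(k in [set` J1]) A k `&` \bigcap_(k in [set` J2]) B k = \bigcap_(k in [set` J1 :|: J2]) C k.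
 apply/seteqP; split => [x [xA xB] k /=|x xC].
  rewrite inE => /orP[kJ|kJ]; [rewrite CA //; exact: xA|rewrite CB //; exact: xB].
 split => k /= kJ; [rewrite -CA //|rewrite -CB //]; apply: xC => /=; by rewrite inE kJ ?orbT.
have sU : J1 :|: J2 \subset D by rewrite finset.subUset s1 s2.
rewrite (hF sU hC) (hF s1 hA) (hF s2 hB) (bigID (mem J1)) /=.
congr (_ * _)%E; apply: eq_big => k.
- by rewrite inE; case: (k \in J1) => //=; rewrite andbF.
- by move=> /andP[_ kJ]; rewrite (CA k kJ).
- rewrite inE; case: (boolP (k \in J1)) => //= kJ; last by rewrite andbT.
 by rewrite (disjointFr dJ kJ).
- by rewrite inE => /andP[/orP[->//|kJ] _]; rewrite (CB k kJ).
Qed.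
End finite_family.

Section decoupling.
Variables (F G : set_system T).
Hypotheses (Fm : F `<=` measurable) (Gm : G `<=` measurable) (FG : independent_classes P <<s F >> <<s G >>).
Notation TF := (g_sigma_algebraType F).
Notation TG := (g_sigma_algebraType G).

Lemma measurable_toF : measurable_fun setT (id : T -> TF).
Proof.
move=> _ A mA; rewrite setTI; move: A mA; apply: smallest_sub Fm.
by split => //; [move=> A mA; exact: measurableD|move=> A mA; exact: bigcupT_measurable].
Qed.
Lemma measurable_toG : measurable_fun setT (id : T -> TG).
Proof.
move=> _ A mA; rewrite setTI; move: A mA; apply: smallest_sub Gm.
by split => //; [move=> A mA; exact: measurableD|move=> A mA; exact: bigcupT_measurable].
Qed.

Lemma decouple_measurable (psi : TF * TG -> \bar R) : measurable_fun setT psi ->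
 (forall x, 0 <= psi x)%E -> measurable_fun setT (fun s : T => \int[P]_t psi (t, s))%E.
Proof.
move=> mpsi psi0.
pose X : {mfun T >-> TF} := HB.pack (id : T -> TF) (isMeasurableFun.Build _ _ _ _ _ measurable_toF).
have mG := measurable_fun_fubini_tonelli_G (m1 := distribution P X) psi mpsi psi0.
have := measurableT_comp mG measurable_toG.
congr measurable_fun; apply/funext => s /=.
by rewrite /fubini_G ge0_integral_distribution //; exact: measurableT_comp.
Qed.

(** By independence the map [t -> (t, t)] pushes [P] forward to the product of its restrictions to
    the two sigma-algebras, so the diagonal integral is an iterated one. This replaces conditioning
    on the second family. *)
Lemma decouple (psi : TF * TG -> \bar R) : measurable_fun setT psi -> (forall x, 0 <= psi x)%E ->
 (\int[P]_t psi (t, t) = \int[P]_s \int[P]_t psi (t, s))%E.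
Proof.
move=> mpsi psi0.
pose X : {mfun T >-> TF} := HB.pack (id : T -> TF) (isMeasurableFun.Build _ _ _ _ _ measurable_toF).
pose Y : {mfun T >-> TG} := HB.pack (id : T -> TG) (isMeasurableFun.Build _ _ _ _ _ measurable_toG).
have mXY : measurable_fun setT (fun t => (X t, Y t)).
 by apply/measurable_fun_pairP; split; exact: measurable_funP.
pose XY : {mfun T >-> (TF * TG)%type} := HB.pack (fun t => (X t, Y t)) (isMeasurableFun.Build _ _ _ _ _ mXY).
have hp : forall A, measurable A -> (distribution P X \x distribution P Y)%E A = distribution P XY A.
 apply: product_measure_unique => A B mA mB.
 rewrite /distribution /pushforward /=.
 exact: (FG mA mB).
transitivity (\int[distribution P XY]_x psi x)%E; first by rewrite ge0_integral_distribution.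
transitivity (\int[distribution P X \x distribution P Y]_x psi x)%E.
 by apply: eq_measure_integral => A mA _; first [exact: hp|exact: (esym (hp _ mA))].
rewrite fubini_tonelli2 // /fubini_G.
have mG := measurable_fun_fubini_tonelli_G (m1 := distribution P X) psi mpsi psi0.
rewrite ge0_integral_distribution //; last by move=> y; exact: integral_ge0.
apply: eq_integral => s _ /=; rewrite ge0_integral_distribution //.
exact: measurableT_comp.
Qed.

(** An estimate known for each frozen value of the second family extends to the random one. This is
    how bounds for deterministic coefficients are applied to coefficients built from a minor. *)
Lemma decouple_set (S : set (TF * TG)) (q : \bar R) : measurable S ->
 (forall s, P [set t | S (t, s)] <= q)%E -> (P [set t | S (t, t)] <= q)%E.
Proof.
move=> mS hq.
pose psi := (EFin \o \1_S) : TF * TG -> \bar R.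
have mpsi : measurable_fun setT psi by apply/measurable_EFinP; exact: measurable_indic.
have psi0 x : (0 <= psi x)%E by rewrite lee_fin.
have := decouple mpsi psi0.
have mD : measurable [set t : T | S (t, t)].
 have mXY : measurable_fun setT (fun t : T => (t : TF, t : TG)).
  by apply/measurable_fun_pairP; split; [exact: measurable_toF|exact: measurable_toG].
 by rewrite -[X in measurable X]setTI; exact: mXY.
have mS1 s : measurable [set t : T | S (t, s)].
 have mXY : measurable_fun setT (fun t : T => (t : TF, s : TG)).
  by apply/measurable_fun_pairP; split; [exact: measurable_toF|exact: measurable_cst].
 by rewrite -[X in measurable X]setTI; exact: mXY.
have e (f : T -> TF * TG) (A : set T) : measurable A -> (forall t, S (f t) <-> A t) -> (\int[P]_t psi (f t) = P A)%E.
 move=> mA hA; transitivity (\int[P]_t (\1_A t)%:E)%E; last by rewrite integral_indic // setIT.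
 apply: eq_integral => t _.
 rewrite /psi /= !indicE; congr (_%:R%:E); congr nat_of_bool.
 by apply/idP/idP => /set_mem h; apply/mem_set; apply/hA.
rewrite (e (fun t => (t, t)) _ mD) // => ->.
apply: (via (\int[P]_s cst q s)%E); last by rewrite integral_cst //= -[leRHS]mule1 -(probability_setT P).
apply: ge0_le_integral => //.
- by move=> s _; exact: integral_ge0.
- exact: decouple_measurable.
- by move=> s _ ; rewrite (e (fun t => (t, s)) _ (mS1 s)).
Qed.

(** [decouple] concerns nonnegative functions, so bounds are added to both factors and the product
    formula is expanded at the end. *)
Lemma indep_expectation (f g : T -> R) : bmf f -> bmf g ->
 measurable_fun setT (f : TF -> R) -> measurable_fun setT (g : TG -> R) ->
 \int[P]_t (f t * g t) = (\int[P]_t f t) * (\int[P]_t g t).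
Proof.
have hE := expectation_is_mean P.
have key (a b : T -> R) : bmf a -> bmf b -> (forall t, 0 <= a t) -> (forall t, 0 <= b t) ->
  measurable_fun setT (a : TF -> R) -> measurable_fun setT (b : TG -> R) ->
  \int[P]_t (a t * b t) = (\int[P]_t a t) * (\int[P]_t b t).
 move=> ba bb a0 b0 ma mb.
 pose psi := (fun x : TF * TG => (a x.1 * b x.2)%:E).
 have mpsi : measurable_fun setT psi.
  apply/measurable_EFinP; apply: measurable_funM.
   exact: (measurableT_comp ma measurable_fst).
  exact: (measurableT_comp mb measurable_snd).
 have psi0 x : (0 <= psi x)%E by rewrite lee_fin mulr_ge0.
 have := decouple mpsi psi0; rewrite /psi /= /Rintegral => ->.
 have fa : (\int[P]_t (a t)%:E)%E \is a fin_num.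
  by apply: integrable_fin_num => //; exact: bmf_integrable.
 have -> : (\int[P]_s \int[P]_t (a t * b s)%:E = \int[P]_s ((\int[P]_t (a t)%:E) * (b s)%:E))%E.
  apply: eq_integral => s _; under eq_integral do rewrite mulrC EFinM.
  by rewrite integralZl 1?muleC //; exact: bmf_integrable.
 rewrite -(fineK fa) integralZl //; last exact: bmf_integrable.
 by rewrite fineM // integrable_fin_num //; exact: bmf_integrable.
move=> bf bg mf mg.
have [A hA] : exists M : R, forall t, `|f t| <= M by case: bf.
have [B hB] : exists M : R, forall t, `|g t| <= M by case: bg.
have bA : bmf (fun t => f t + A) by apply: bmfD => //; exact: bmf_cst.
have bB : bmf (fun t => g t + B) by apply: bmfD => //; exact: bmf_cst.
have bfg : bmf (fun t => f t * g t) by exact: bmfM.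
have b1 : bmf (fun t => A * g t) by exact: bmfZ.
have b2 : bmf (fun t => B * f t) by exact: bmfZ.
have b3 : bmf (fun _ : T => A * B) by exact: bmf_cst.
have b4 := bmfD b2 b3; have b5 := bmfD b1 b4.
have e0 : (fun t => (f t + A) * (g t + B)) = (fun t => f t * g t + (A * g t + (B * f t + A * B))).
 by apply/funext => t; ring.
have p1 t : 0 <= f t + A by have := hA t; rewrite ler_norml => /andP[h _]; rewrite -lerBlDr sub0r.
have p2 t : 0 <= g t + B by have := hB t; rewrite ler_norml => /andP[h _]; rewrite -lerBlDr sub0r.
have m1 : measurable_fun setT (fun t : TF => f t + A) by apply: measurable_funD => //; exact: measurable_cst.
have m2 : measurable_fun setT (fun t : TG => g t + B) by apply: measurable_funD => //; exact: measurable_cst.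
have := key _ _ bA bB p1 p2 m1 m2; rewrite e0.
rewrite (meanD hE bfg b5) (meanD hE b1 b4) (meanD hE b2 b3) (meanZ hE _ bf) (meanZ hE _ bg) (mean_const hE).
rewrite (meanD hE bf (bmf_cst _)) (meanD hE bg (bmf_cst _)) !(mean_const hE).
move: (\int[P]_t _) (\int[P]_t _) (\int[P]_t _) => x y z h.
by apply: (addIr (A * y + (B * x + A * B))); rewrite h; ring.
Qed.

End decoupling.
End independence.

Lemma mulmx_unique (F : comNzRingType) (n : nat) (A B G : 'M[F]_n) :
 G *m A = 1%:M -> A *m B = 1%:M -> G = B.
Proof. by move=> h1 h2; rewrite -[B]mul1mx -h1 -mulmxA h2 mulmx1. Qed.

(** * Resolvents of Hermitian matrices: Ward identity, minors, Schur complement *)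

Section resolvent.
Context {R : realType} (N : nat).
Implicit Types (H A B : 'M[R[i]]_N) (z : R[i]).

Definition herm H := forall i j, H i j = conjc (H j i).
Definition adj A : 'M[R[i]]_N := \matrix_(i, j) conjc (A j i).
Definition res H z : 'M[R[i]]_N := invmx (H - z%:M).

Lemma adjM A B : adj (A *m B) = adj B *m adj A.
Proof.
apply/matrixP => i j; rewrite !mxE rmorph_sum; apply: eq_bigr => k _.
by rewrite !mxE rmorphM mulrC.
Qed.

Lemma adj1 : adj 1%:M = 1%:M.
Proof. by apply/matrixP => i j; rewrite !mxE rmorph_nat eq_sym. Qed.

Lemma quad_real H (v : 'I_N -> R[i]) : herm H ->
 Iz (\sum_i \sum_j conjc (v i) * H i j * v j) = 0.
Proof.
move=> hH; set q := \sum_i _.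
have : conjc q = q.
 rewrite /q rmorph_sum; under eq_bigr do rewrite rmorph_sum.
 rewrite exchange_big; apply: eq_bigr => i _; apply: eq_bigr => j _ /=.
 by rewrite !rmorphM /= conjcK -hH mulrC mulrA mulrAC.
move=> /(congr1 (fun x : R[i] => Iz x)); rewrite cImJ => h.
by move: h; move: (Iz q) => x h; lra.
Qed.

(** A kernel vector would make the Hermitian form, which is real, equal to [z] times the squared
    norm of the vector. *)
Lemma res_unit H z : herm H -> 0 < Iz z -> (H - z%:M) \in unitmx.
Proof.
move=> hH z0; rewrite -row_free_unit; apply: inj_row_free => v hv.
have e : \sum_i \sum_j v 0 i * H i j * conjc (v 0 j) = z * rc (\sum_i nc (v 0 i) ^+ 2).
 rewrite exchange_big /= rmorph_sum mulr_sumr; apply: eq_bigr => j _.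
 rewrite -mulr_suml; have /matrixP/(_ 0 j) := hv; rewrite mulmxBr mul_mx_scalar !mxE => /eqP.
 by rewrite subr_eq0 => /eqP ->; rewrite -mulrA mulJ.
have := quad_real (fun i => conjc (v 0 i)) hH.
have -> : \sum_i \sum_j conjc (conjc (v 0 i)) * H i j * conjc (v 0 j) = z * rc (\sum_i nc (v 0 i) ^+ 2).
 by rewrite -e; apply: eq_bigr => i _; apply: eq_bigr => j _; rewrite conjcK.
rewrite cImM Re_rc Im_rc mulr0 add0r => /eqP; rewrite mulf_eq0 (gt_eqF z0) /= => /eqP h.
apply/rowP => i; rewrite mxE; apply/eqP; rewrite -nc_eq0 -sqrf_eq0.
have : nc (v 0 i) ^+ 2 <= 0.
 by rewrite -h (bigD1 i) //= lerDl sumr_ge0 // => k _; exact: sqr_ge0.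
by move=> h'; rewrite eq_le h' sqr_ge0.
Qed.

Section bounds.
Variables (H : 'M[R[i]]_N) (hH : herm H) (z : R[i]) (z0 : 0 < Iz z).
Notation G := (res H z).
Notation eta := (Iz z).

Lemma res_mulV : (H - z%:M) *m G = 1%:M. Proof. by rewrite mulmxV // res_unit. Qed.
Lemma res_mulVr : G *m (H - z%:M) = 1%:M. Proof. by rewrite mulVmx // res_unit. Qed.

Lemma adj_herm : adj (H - z%:M) = H - (conjc z)%:M.
Proof.
apply/matrixP => i j; rewrite !mxE rmorphB /= -hH; congr (_ - _).
by rewrite eq_sym rmorphMn.
Qed.

Lemma res_adj : (H - (conjc z)%:M) *m adj G = 1%:M /\ adj G *m (H - (conjc z)%:M) = 1%:M.
Proof. by rewrite -adj_herm -!adjM res_mulV res_mulVr adj1. Qed.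

(** The resolvent identity between [z] and [conj z], in both orders; comparing the two shows that
    [G] commutes with its adjoint. *)
Lemma ward_mx : G - adj G = (z - conjc z) *: (G *m adj G) /\ G - adj G = (z - conjc z) *: (adj G *m G).
Proof.
have [a1 a2] := res_adj; have e : (H - (conjc z)%:M) - (H - z%:M) = (z - conjc z)%:M.
 by rewrite opprB addrC addrA subrK raddfB.
split.
 have -> : G - adj G = G *m ((H - (conjc z)%:M) - (H - z%:M)) *m adj G.
  by rewrite mulmxBr mulmxBl -!mulmxA a1 mulmx1 mulmxA res_mulVr mul1mx.
 by rewrite e mul_mx_scalar -scalemxAl.
have -> : G - adj G = adj G *m ((H - (conjc z)%:M) - (H - z%:M)) *m G.
 by rewrite mulmxBr mulmxBl -!mulmxA res_mulV mulmx1 mulmxA a2 mul1mx.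
by rewrite e mul_mx_scalar -scalemxAl.
Qed.

Lemma zJ2 : z - conjc z = Cx 0 (2 * eta).
Proof. by apply: complex_eq; rewrite ?cReB ?cImB ?cReJ ?cImJ /=; ring. Qed.

Lemma ward i : \sum_j nc (G i j) ^+ 2 = Iz (G i i) / eta.
Proof.
have [/matrixP/(_ i i) e _] := ward_mx; move: e; rewrite !mxE zJ2 => e.
have : Iz (G i i) * 2 = 2 * eta * \sum_j nc (G i j) ^+ 2.
 have h := congr1 (fun x : R[i] => Iz x) e; rewrite cImB cImJ opprK in h.
 have -> : Iz (G i i) * 2 = Iz (G i i) + Iz (G i i) by ring.
 rewrite h cImM /= mul0r add0r; congr (_ * _).
 have -> : \sum_j G i j * adj G j i = rc (\sum_j nc (G i j) ^+ 2); last by [].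
 by rewrite rmorph_sum; apply: eq_bigr => j _; rewrite mxE mulJ.
move=> h; apply: (mulfI (_ : 2 * eta != 0)); first by rewrite mulf_neq0 ?gt_eqF.
by rewrite -h; field; rewrite gt_eqF.
Qed.

Lemma ward_col i : \sum_j nc (G j i) ^+ 2 = Iz (G i i) / eta.
Proof.
have [_ /matrixP/(_ i i) e] := ward_mx; move: e; rewrite !mxE zJ2 => e.
have : Iz (G i i) * 2 = 2 * eta * \sum_j nc (G j i) ^+ 2.
 have h := congr1 (fun x : R[i] => Iz x) e; rewrite cImB cImJ opprK in h.
 have -> : Iz (G i i) * 2 = Iz (G i i) + Iz (G i i) by ring.
 rewrite h cImM /= mul0r add0r; congr (_ * _).
 have -> : \sum_j adj G i j * G j i = rc (\sum_j nc (G j i) ^+ 2); last by [].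
 by rewrite rmorph_sum; apply: eq_bigr => j _; rewrite mxE mulrC mulJ.
move=> h; apply: (mulfI (_ : 2 * eta != 0)); first by rewrite mulf_neq0 ?gt_eqF.
by rewrite -h; field; rewrite gt_eqF.
Qed.

Lemma Im_res_ge0 i : 0 <= Iz (G i i).
Proof.
have := ward i; move=> h; have : 0 <= Iz (G i i) / eta by rewrite -h sumr_ge0 // => k _; exact: sqr_ge0.
by rewrite pmulr_lge0 // invr_gt0.
Qed.

Lemma nc_res_sqr i j : nc (G i j) ^+ 2 <= Iz (G i i) / eta.
Proof. by rewrite -ward (bigD1 j) //= lerDl sumr_ge0 // => k _; exact: sqr_ge0. Qed.

Lemma nc_res_diag i : nc (G i i) <= eta^-1.
Proof.
have h := nc_res_sqr i i; have [->|g0] := eqVneq (nc (G i i)) 0; first by rewrite invr_ge0 ltW.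
have gp : 0 < nc (G i i) by rewrite lt_neqAle eq_sym g0 nc_ge0.
rewrite -(ler_pM2r gp) -expr2; apply: le_trans h _; rewrite mulrC.
by apply: ler_wpM2l; [rewrite invr_ge0 ltW|apply: le_trans (Im_le _); exact: ler_norm].
Qed.

Lemma nc_res i j : nc (G i j) <= eta^-1.
Proof.
rewrite -ler_sqr ?nnegrE ?nc_ge0 ?invr_ge0 ?(ltW z0) //; apply: le_trans (nc_res_sqr i j) _.
rewrite expr2; apply: ler_wpM2r; first by rewrite invr_ge0 ltW.
by apply: le_trans (nc_res_diag i); apply: le_trans (Im_le _); exact: ler_norm.
Qed.

Lemma nc_res2 i j : nc ((G *m G) i j) <= (Iz (G i i) + Iz (G j j)) / (2 * eta).
Proof.
rewrite mxE; apply: le_trans (nc_sum _ _ _) _.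
have -> : (Iz (G i i) + Iz (G j j)) / (2 * eta) = \sum_k (nc (G i k) ^+ 2 + nc (G k j) ^+ 2) / 2.
 by rewrite -mulr_suml big_split /= ward ward_col; field; rewrite gt_eqF.
apply: ler_sum => k _; rewrite ncM ler_pdivlMr //.
by have := sqr_ge0 (nc (G i k) - nc (G k j)); rewrite sqrrB; lra.
Qed.

Lemma sum_nc_res2 : \sum_i \sum_j nc ((G *m G) i j) ^+ 2 <= (\sum_i Iz (G i i)) / eta ^+ 3.
Proof.
(* both sides of [(G G)(G G)^* ] and [(G^* G)^2] have the same trace, and [G^* G = Im G / eta] *)
pose S := adj G *m G.
have en : z - conjc z != 0 by rewrite zJ2; apply: Im_neq0; rewrite /= mulf_neq0 // gt_eqF.
have eS : S = G *m adj G by apply: (scalerI en); have [h1 h2] := ward_mx; rewrite -h1 -h2.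
have t (A : 'M[R[i]]_N) : \tr (A *m adj A) = rc (\sum_i \sum_j nc (A i j) ^+ 2).
 rewrite /mxtrace rmorph_sum; apply: eq_bigr => i _; rewrite mxE rmorph_sum; apply: eq_bigr => j _.
 by rewrite mxE mulJ.
have aS : adj S = S.
 rewrite /S adjM; congr (_ *m _); by apply/matrixP => i j; rewrite !mxE conjcK.
have e1 : rc (\sum_i \sum_j nc ((G *m G) i j) ^+ 2) = rc (\sum_i \sum_j nc (S i j) ^+ 2).
 rewrite -!t aS adjM -mulmxA [G *m (adj G *m _)]mulmxA -eS mxtrace_mulC.
 by rewrite -mulmxA -/S.
have {}e1 := congr1 (fun x : R[i] => Rz x) e1; rewrite /= in e1; rewrite e1.
have Sij i j : nc (S i j) ^+ 2 <= (nc (G i j) ^+ 2 + nc (G j i) ^+ 2) / (2 * eta ^+ 2).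
 have h0 : G i j - conjc (G j i) = Cx 0 (2 * eta) * S i j.
  by have [_ /matrixP/(_ i j)] := ward_mx; rewrite -/S zJ2 !mxE.
 have := congr1 (fun x : R[i] => nc x) h0.
 rewrite ncM (_ : nc (Cx 0 (2 * eta)) = 2 * eta); last first.
  by rewrite /= expr0n add0r sqrtr_sqr ger0_norm // mulr_ge0 // ltW.
 move=> h; have h2 := ncB (G i j) (conjc (G j i)); rewrite ncJ h in h2.
 rewrite ler_pdivlMr ?mulr_gt0 ?exprn_gt0 //.
 have h3 : (2 * eta * nc (S i j)) ^+ 2 <= (nc (G i j) + nc (G j i)) ^+ 2.
  by apply: lerXn2r => //; rewrite nnegrE ?addr_ge0 ?mulr_ge0 ?nc_ge0 // ltW.
 have := sqr_ge0 (nc (G i j) - nc (G j i)); move: h3.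
 by rewrite !exprMn sqrrD sqrrB; move: (nc (S i j)) eta (nc (G i j)) (nc (G j i)) => s e a b; lra.
apply: le_trans (_ : \sum_i \sum_j (nc (G i j) ^+ 2 + nc (G j i) ^+ 2) / (2 * eta ^+ 2) <= _).
 by apply: ler_sum => i _; apply: ler_sum.
have -> : \sum_i \sum_j (nc (G i j) ^+ 2 + nc (G j i) ^+ 2) / (2 * eta ^+ 2) = \sum_i Iz (G i i) / eta ^+ 3.
 apply: eq_bigr => i _; rewrite -mulr_suml big_split /= ward ward_col.
 by field; rewrite gt_eqF.
by rewrite mulr_suml.
Qed.

End bounds.

Lemma res_diff A B z : herm A -> herm B -> 0 < Iz z ->
 res A z - res B z = res A z *m (B - A) *m res B z.
Proof.
move=> hA hB z0; have -> : B - A = (B - z%:M) - (A - z%:M) by rewrite opprB addrA subrK.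
by rewrite mulmxBr mulmxBl -!mulmxA res_mulV // mulmx1 mulmxA res_mulVr // mul1mx.
Qed.

Section minor.
Variables (H : 'M[R[i]]_N) (hH : herm H) (z : R[i]) (z0 : 0 < Iz z) (i : 'I_N).
(** Row and column [i] are set to zero rather than deleted, so that the minor keeps the index type
    of [H]. Its resolvent splits off the entry [(i, i)], and its other entries off row and column
    [i] are those of the resolvent of the true minor. *)
Definition zrc : 'M[R[i]]_N := \matrix_(k, l) (if (k == i) || (l == i) then 0 else H k l).
Notation G := (res H z).
Notation G' := (res zrc z).
Notation eta := (Iz z).

Lemma herm_zrc : herm zrc.
Proof. by move=> k l; rewrite !mxE orbC; case: ifP => _; [rewrite conjc0|exact: hH]. Qed.
Let hZ := herm_zrc.
Let zn : z != 0. by apply: Im_neq0; rewrite gt_eqF. Qed.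

Lemma minor_row k : k != i -> G' i k = 0 /\ G' k i = 0.
Proof.
move=> ki; split.
 have /matrixP/(_ i k) := res_mulV hZ z0; rewrite mulmxBl mul_scalar_mx !mxE big1 => [|l _].
  by rewrite eq_sym (negbTE ki) sub0r => /eqP; rewrite oppr_eq0 mulf_eq0 (negbTE zn) /= => /eqP.
 by rewrite !mxE eqxx mul0r.
have /matrixP/(_ k i) := res_mulVr hZ z0; rewrite mulmxBr mul_mx_scalar !mxE big1 => [|l _].
 by rewrite (negbTE ki) sub0r => /eqP; rewrite oppr_eq0 mulf_eq0 (negbTE zn) /= => /eqP.
by rewrite !mxE eqxx orbT mulr0.
Qed.

(* [zrc - H] only has entries in row and column [i] *)
Lemma minor_diff k l : k != i -> G k l - G' k l = - (\sum_(q | q != i) G' k q * H q i) * G i l.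
Proof.
move=> ki; have /matrixP/(_ k l) := res_diff hZ hH z0; rewrite mxE [RHS]mxE.
rewrite mulNr -[G k l - _]opprB mxE => -> ; congr (- _).
transitivity (\sum_q (\sum_p G' k p * (H - zrc) p q) * G q l).
 by apply: eq_bigr => q _; rewrite mxE.
rewrite (bigD1 i) //= [X in _ + X]big1 ?addr0 => [|q qi].
 congr (_ * _); rewrite (bigD1 i) //= (minor_row ki).2 mul0r add0r.
 by apply: eq_bigr => p pi; rewrite !mxE eqxx orbT subr0.
rewrite [X in X * _]big1 ?mul0r // => p _; rewrite !mxE.
have [->|pi] := eqVneq p i; first by rewrite (minor_row ki).2 mul0r.
by rewrite (negbTE qi) /= subrr mulr0.
Qed.

Lemma minor_col k : k != i -> G k i = - (\sum_(q | q != i) G' k q * H q i) * G i i.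
Proof. by move=> ki; rewrite -(minor_diff i ki) (minor_row ki).2 subr0. Qed.

(** The [(i, i)] entry of [(H - z) G = 1], in which [minor_col] expresses the off-diagonal entries
    of column [i] through [G i i]. *)
Lemma schur : (H i i - z - \sum_(k | k != i) \sum_(l | l != i) H i k * G' k l * H l i) * G i i = 1.
Proof.
have /matrixP/(_ i i) := res_mulV hH z0; rewrite mulmxBl mul_scalar_mx !mxE eqxx => h.
transitivity (true%:R : R[i]) => //; rewrite -h [in RHS](bigD1 i) //= !mulrBl [LHS]addrAC; congr (_ - _); congr (_ + _); rewrite mulr_suml -sumrN.
apply: eq_bigr => k ki; rewrite (minor_col ki) mulNr mulrN; congr (- _).
by rewrite mulrA mulr_sumr; congr (_ * _); apply: eq_bigr => l _; rewrite mulrA.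
Qed.

Lemma res_diag_neq0 : G i i != 0.
Proof. by apply/eqP => h; have := schur; rewrite h mulr0 => /eqP; rewrite eq_sym oner_eq0. Qed.

Lemma minor_diag k : k != i -> G k k - G' k k = G k i * G i k / G i i.
Proof.
move=> ki; rewrite (minor_diff k ki) [in RHS](minor_col ki).
by move: (\sum_(q | _) _) => s; field; exact: res_diag_neq0.
Qed.

(** One [1 / eta] bounds [G i i] itself; the other bounds the rank-one corrections
    [G k i * G i k / G i i], by the inequality of means and the Ward identity in both directions. *)
Lemma minor_trace : nc (\sum_k G k k - \sum_(k | k != i) G' k k) <= 2 / eta.
Proof.
rewrite (bigD1 i) //= -addrA -sumrB; apply: le_trans (ncD _ _) _.
have -> : 2 / eta = eta^-1 + eta^-1 by ring.
apply: lerD; first exact: nc_res_diag.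
rewrite (eq_bigr (fun k => G k i * G i k / G i i)); last by move=> k ki; exact: minor_diag.
rewrite -mulr_suml ncM ncV.
have gp : 0 < nc (G i i) by rewrite nc_gt0 res_diag_neq0.
rewrite ler_pdivrMr //; apply: le_trans (nc_sum _ _ _) _.
apply: (via (\sum_(k | k != i) (nc (G i k) ^+ 2 + nc (G k i) ^+ 2) / 2)).
 apply: ler_sum => k _; rewrite ncM ler_pdivlMr //.
 by have := sqr_ge0 (nc (G i k) - nc (G k i)); rewrite sqrrB; lra.
apply: (via (\sum_k (nc (G i k) ^+ 2 + nc (G k i) ^+ 2) / 2)).
 by rewrite [leRHS](bigD1 i) //= lerDr divr_ge0 // addr_ge0 ?sqr_ge0.
rewrite -mulr_suml big_split /= ward // ward_col //.
have -> : (Iz (G i i) / eta + Iz (G i i) / eta) / 2 = eta^-1 * Iz (G i i) by field; rewrite gt_eqF.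
by apply: ler_wpM2l; [rewrite invr_ge0 ltW|apply: le_trans (Im_le _); exact: ler_norm].
Qed.

End minor.
End resolvent.

(** * Poisson kernels at dyadic heights *)

Section dyadic.
Context {R : realType}.
Implicit Types t y : R.

(** The single term whose height is comparable with [|t|] already dominates; the factor [4] pays for
    a ratio of at most two. If [|t|] exceeds every height, the last summand does the work. *)
Lemma dyadic_bound t y n : 0 < y ->
 (sqrt (t ^+ 2 + y ^+ 2))^-1 <=
  4 * (\sum_(l < n.+1) (2 ^+ l * y) / (t ^+ 2 + (2 ^+ l * y) ^+ 2)) + (2 ^+ n * y)^-1.
Proof.
move=> y0; pose r l := 2 ^+ l * y : R; have r0 l : 0 < r l by rewrite mulr_gt0 ?exprn_gt0.
have p0 l : 0 < t ^+ 2 + r l ^+ 2 by rewrite ltr_wpDl ?sqr_ge0 ?exprn_gt0.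
have s0 l : 0 <= r l / (t ^+ 2 + r l ^+ 2) by rewrite divr_ge0 // ltW.
have ts : `|t| <= sqrt (t ^+ 2 + y ^+ 2) by rewrite -sqrtr_sqr ler_wsqrtr // lerDl sqr_ge0.
have [tn|tn] := leP `|t| (r n); last first.
 apply: ler_wpDl; first (rewrite mulr_ge0 // sumr_ge0 // => l _; exact: s0).
 have tp : 0 < `|t| := lt_trans (r0 n) tn.
 by rewrite lef_pV2 ?posrE //; [exact: le_trans (ltW tn) ts|exact: lt_le_trans tp ts|exact: r0].
apply: ler_wpDr; first by rewrite invr_ge0 (ltW (r0 n)).
rewrite -/(r _); elim: n tn => [|n IH] tn.
 rewrite big_ord1 /r expr0 mul1r in tn *.
 have q0 : 0 < t ^+ 2 + y ^+ 2 by rewrite ltr_wpDl ?sqr_ge0 ?exprn_gt0.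
 have sq0 : 0 < sqrt (t ^+ 2 + y ^+ 2) by rewrite sqrtr_gt0.
 rewrite -[t ^+ 2 + y ^+ 2 in leRHS]sqr_sqrtr ?(ltW q0) // expr2 invfM !mulrA.
 apply: ler_peMl; first by rewrite invr_ge0 ltW.
 rewrite ler_pdivlMr // mul1r.
 rewrite -ler_sqr ?nnegrE ?(ltW sq0) ?mulr_ge0 ?(ltW y0) // sqr_sqrtr ?(ltW q0) //.
 have : t ^+ 2 <= y ^+ 2 by rewrite -(real_normK (num_real t)) ler_sqr ?nnegrE // ltW.
 by have := sqr_ge0 y; rewrite exprMn; lra.
rewrite big_ord_recr /= mulrDr.
have [tn'|tn'] := leP `|t| (r n).
 by apply: ler_wpDr; [rewrite mulr_ge0 // (s0 n.+1)|exact: IH].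
apply: ler_wpDl; first (rewrite mulr_ge0 // sumr_ge0 // => l _; exact: s0).
have rS : r n.+1 = 2 * r n by rewrite /r exprS mulrA.
have tp : 0 < `|t| := lt_trans (r0 n) tn'.
apply: (via `|t|^-1).
 by rewrite lef_pV2 ?posrE //; exact: lt_le_trans tp ts.
rewrite -/(r n.+1) -[leLHS]mul1r ler_pdivrMr //.
have -> : 4 * (r n.+1 / (t ^+ 2 + r n.+1 ^+ 2)) * `|t| = 4 * r n.+1 * `|t| / (t ^+ 2 + r n.+1 ^+ 2) by ring.
rewrite ler_pdivlMr ?p0 // mul1r.
have : t ^+ 2 <= r n.+1 ^+ 2 by rewrite -(real_normK (num_real t)) ler_sqr ?nnegrE // ltW.
have : r n.+1 * r n.+1 <= r n.+1 * (2 * `|t|) by apply: ler_wpM2l; [exact: ltW|rewrite rS ler_pM2l // ltW].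
by move: (r n.+1) => a; rewrite (expr2 a); lra.
Qed.

(** Doubling the height changes the Poisson kernel by a factor between [1/2] and [2]. This lets
    crude bounds on [Im mN] pass from one dyadic height to the next lower one. *)
Lemma poisson_scale t y : 0 < y ->
 y / (t ^+ 2 + y ^+ 2) <= 2 * ((2 * y) / (t ^+ 2 + (2 * y) ^+ 2)) /\
 2^-1 * ((2 * y) / (t ^+ 2 + (2 * y) ^+ 2)) <= y / (t ^+ 2 + y ^+ 2).
Proof.
move=> y0; have p1 : 0 < t ^+ 2 + y ^+ 2 by rewrite ltr_wpDl ?sqr_ge0 ?exprn_gt0.
have p2 : 0 < t ^+ 2 + (2 * y) ^+ 2 by rewrite ltr_wpDl ?sqr_ge0 ?exprn_gt0 // mulr_gt0.
have y2 := sqr_ge0 y; have t2 := sqr_ge0 t; split.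
 rewrite ler_pdivrMr //; have -> : 2 * (2 * y / (t ^+ 2 + (2 * y) ^+ 2)) * (t ^+ 2 + y ^+ 2) =
  4 * y * (t ^+ 2 + y ^+ 2) / (t ^+ 2 + (2 * y) ^+ 2) by ring.
 rewrite ler_pdivlMr // -subr_ge0; have -> : 4 * y * (t ^+ 2 + y ^+ 2) - y * (t ^+ 2 + (2 * y) ^+ 2) = 3 * y * t ^+ 2 by ring.
 by rewrite mulr_ge0 // mulr_ge0 // ltW.
rewrite !mulrA mulVf // mul1r; apply: ler_wpM2l; first exact: ltW.
by rewrite lef_pV2 ?posrE // lerD2l exprMn; lra.
Qed.
End dyadic.

(** * The Stieltjes transform of the eigenvalues *)

Section spectral.
Context {R : realType} (N : nat) (H : 'M[R[i]]_N) (hH : herm H).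
Implicit Types z : R[i].
Notation U := (spectralmx H).
Definition ev (k : 'I_N) : R := Rz (spectral_diag H 0 k).
Let hs : H \is hermsymmx.
Proof.
apply/is_hermitianmxP; rewrite expr0 scale1r; apply/matrixP => i j; rewrite !mxE.
exact: hH.
Qed.

Let diagE k : spectral_diag H 0 k = rc (ev k).
Proof.
have /mxOverP/(_ 0 k) := hermitian_spectral_diag_real hs.
rewrite /ev; case: (spectral_diag H 0 k) => a b.
by rewrite complex_real /= => /eqP ->.
Qed.

Lemma spectral_row k : \sum_i nc (U k i) ^+ 2 = 1.
Proof.
have /unitarymxP/matrixP/(_ k k) := spectral_unitarymx H; rewrite !mxE eqxx => e.
have := congr1 (fun x : R[i] => Rz x) e; rewrite /= => <-.
rewrite Re_sum; apply: eq_bigr => i _; rewrite !mxE.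
exact: (esym (congr1 (fun x : R[i] => Rz x) (mulJ _))).
Qed.

Lemma res_spectral z i j : 0 < Iz z ->
 res H z i j = \sum_k conjc (U k i) * U k j * (rc (ev k) - z)^-1.
Proof.
move=> z0; have Uu := spectral_unit H.
have dn k : rc (ev k) - z != 0 by apply: Im_neq0; rewrite cImB Im_rc sub0r oppr_eq0 gt_eqF.
have e := orthomx_spectralP (hermitian_normalmx hs).
pose D := diag_mx (\row_k (rc (ev k) - z)); pose D' := diag_mx (\row_k (rc (ev k) - z)^-1).
have DD : D *m D' = 1%:M.
 apply/matrixP => k l; rewrite mul_diag_mx !mxE; case: eqVneq => [->|_]; last by rewrite mulr0n mulr0.
 by rewrite !mulr1n mulfV.
have eH : H - z%:M = invmx U *m D *m U.
 have -> : D = diag_mx (spectral_diag H) - z%:M.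
  by apply/matrixP => k l; rewrite !mxE -mulrnBl -diagE.
 by rewrite mulmxBr mulmxBl -e mul_mx_scalar -scalemxAl (mulVmx Uu) scalemx1.
have eB : (H - z%:M) *m (invmx U *m D' *m U) = 1%:M.
 rewrite eH -!mulmxA [U *m (invmx U *m _)]mulmxA (mulmxV Uu) mul1mx [D *m (D' *m U)]mulmxA DD mul1mx.
 by rewrite mulVmx.
have -> : res H z = invmx U *m D' *m U by exact: (mulmx_unique (res_mulVr hH z0) eB).
rewrite invmx_unitary ?spectral_unitarymx // mxE; apply: eq_bigr => k _.
by rewrite mul_mx_diag !mxE mulrAC.
Qed.

Lemma tr_res z : 0 < Iz z -> \sum_i res H z i i = \sum_k (rc (ev k) - z)^-1.
Proof.
move=> z0; under eq_bigr do rewrite res_spectral //.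
rewrite exchange_big; apply: eq_bigr => k _ /=; rewrite -mulr_suml -[RHS]mul1r; congr (_ * _).
have := congr1 (fun x : R => rc x) (spectral_row k); rewrite rmorph_sum rmorph1 => <-.
by apply: eq_bigr => i _; rewrite mulrC mulJ.
Qed.

Definition pois (t y : R) : R := y / (t ^+ 2 + y ^+ 2).

Lemma Im_inv_pois (a : R) z : Iz ((rc a - z)^-1) = pois (a - Rz z) (Iz z).
Proof. by rewrite cImV nc2 cReB cImB Re_rc Im_rc sub0r sqrrN opprK. Qed.

Definition mN z : R[i] := rc N%:R^-1 * \sum_i res H z i i.

Lemma mN_ev z : 0 < Iz z -> mN z = rc N%:R^-1 * \sum_k (rc (ev k) - z)^-1.
Proof. by move=> z0; rewrite /mN tr_res. Qed.

Lemma Im_mN z : Iz (mN z) = N%:R^-1 * \sum_i Iz (res H z i i).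
Proof. by rewrite cImM Re_rc Im_rc mul0r addr0 Im_sum. Qed.

Lemma Im_mN_ev z : 0 < Iz z -> Iz (mN z) = N%:R^-1 * \sum_k pois (ev k - Rz z) (Iz z).
Proof.
move=> z0; rewrite mN_ev // cImM Re_rc Im_rc mul0r addr0 Im_sum; congr (_ * _).
by apply: eq_bigr => k _; rewrite Im_inv_pois.
Qed.

Lemma Im_mN_ge0 z : 0 < Iz z -> 0 <= Iz (mN z).
Proof. by move=> z0; rewrite Im_mN mulr_ge0 ?invr_ge0 // sumr_ge0 // => i _; exact: Im_res_ge0. Qed.

Lemma Im_mN_scale (x y : R) : 0 < y ->
 Iz (mN (Cx x y)) <= 2 * Iz (mN (Cx x (2 * y))) /\
 2^-1 * Iz (mN (Cx x (2 * y))) <= Iz (mN (Cx x y)).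
Proof.
move=> y0; have y2 : 0 < 2 * y by rewrite mulr_gt0.
rewrite !Im_mN_ev // ![_ * (N%:R^-1 * _)]mulrCA; split; (apply: ler_wpM2l; first by rewrite invr_ge0);
 rewrite mulr_sumr; apply: ler_sum => k _ /=; have [h1 h2] := poisson_scale (ev k - x) y0; [exact: h1|exact: h2].
Qed.

Lemma nc_mN z : (0 < N)%N -> 0 < Iz z -> nc (mN z) <= (Iz z)^-1.
Proof.
move=> N0 z0; rewrite ncM nc_rc ger0_norm ?invr_ge0 // ler_pdivrMl ?ltr0n //.
apply: le_trans (nc_sum _ _ _) _.
apply: (via (\sum_(i < N) (Iz z)^-1)); first by apply: ler_sum => i _; exact: nc_res_diag.
by rewrite sumr_const card_ord mulr_natl.
Qed.

Lemma mN_lip z z' : (0 < N)%N -> 0 < Iz z -> 0 < Iz z' -> nc (mN z - mN z') <= nc (z - z') / (Iz z * Iz z').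
Proof.
move=> N0 z0 z0'; rewrite !mN_ev // -mulrBr -sumrB ncM nc_rc ger0_norm ?invr_ge0 // ler_pdivrMl ?ltr0n //.
apply: le_trans (nc_sum _ _ _) _.
apply: (via (\sum_(i < N) (nc (z - z') / (Iz z * Iz z')))); last by rewrite sumr_const card_ord mulr_natl.
apply: ler_sum => k _.
have dn w : 0 < Iz w -> rc (ev k) - w != 0 by move=> w0; apply: Im_neq0; rewrite cImB Im_rc sub0r oppr_eq0 gt_eqF.
have dl w : 0 < Iz w -> nc ((rc (ev k) - w)^-1) <= (Iz w)^-1.
 move=> w0; rewrite ncV lef_pV2 ?posrE ?nc_gt0 ?dn //.
 by apply: le_trans (Im_le _); rewrite cImB Im_rc sub0r normrN; exact: ler_norm.
have -> : (rc (ev k) - z)^-1 - (rc (ev k) - z')^-1 = (z - z') * ((rc (ev k) - z)^-1 * (rc (ev k) - z')^-1).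
 by have h1 := dn z z0; have h2 := dn z' z0'; field; rewrite h1 h2.
rewrite !ncM; apply: ler_wpM2l; first exact: nc_ge0.
by rewrite invfM; apply: ler_pM; rewrite ?nc_ge0 ?dl.
Qed.
End spectral.

Section empirical.
Context {R : realType} (N : nat) (N0 : (0 < N)%N) (v : 'I_N -> R).
(** As this functional is an [is_mean], the stability analysis applies to the equation driven by the
    sampled potential; the deviation of the sample from [mu] enters only as a perturbation [dl']. *)
Definition emp (f : R -> R) : R := N%:R^-1 * \sum_i f (v i).

Lemma emp_is_mean : is_mean emp.
Proof.
have Nn : N%:R != 0 :> R by rewrite pnatr_eq0 -lt0n.
split.
- by rewrite /emp sumr_const card_ord mulVf.
- by move=> a f g _ _; rewrite /emp big_split /= mulrDr -mulr_sumr mulrCA.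
- by move=> f _ f0; rewrite /emp mulr_ge0 ?invr_ge0 // sumr_ge0.
Qed.

Lemma emp_cmean (X : R -> R[i]) : cmean emp X = rc N%:R^-1 * \sum_i X (v i).
Proof.
by apply: complex_eq; rewrite ?cReM ?cImM Re_rc Im_rc mul0r ?subr0 ?addr0 /= ?Re_sum ?Im_sum.
Qed.
End empirical.

(** * Weak law at one point, from a priori bounds *)

Section stability.
Context {R : realType}.
Variables (E : (R -> R) -> R) (hE : is_mean E) (lam : R).
Notation stj := (stj E lam).

(** The smallness of [dl] and [dl'] keeps both quotients in [stab_bound] above [- c^2 / 8], while
    [Im (stj (z + m0)) >= 3/4 c] contributes [9/16 c^2]: at least [c^2 / 4] remains. About [M] only
    the bound [b] on [Im (z + M)] has to be known beforehand. *)
Lemma weak_stab (z M m0 dl dl' : R[i]) (b c : R) : 0 < Iz z -> 0 < b -> 0 < c ->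
 b <= Iz (z + M) -> c <= Iz m0 ->
 M = stj (z + M) + dl -> m0 = stj (z + m0) + dl' ->
 nc dl <= b * c ^+ 2 / 8 -> nc dl' <= c ^+ 3 / 8 -> c <= 1 ->
 nc (M - m0) <= 8 / c ^+ 2 * (nc dl + nc dl').
Proof.
move=> z0 b0 c0 hb hc eM em hd hd' c1.
have w0 : 0 < Iz (z + M) by exact: lt_le_trans hb.
have w0' : 0 < Iz (z + m0) by rewrite cImD addr_gt0 // (lt_le_trans c0).
have e1 : z + M = z + stj (z + M) + dl by rewrite {1}eM addrA.
have e2 : z + m0 = z + stj (z + m0) + dl' by rewrite {1}em addrA.
have := stab_bound hE w0 w0' e1 e2.
have -> : z + M - (z + m0) = M - m0 by ring.
have -> : z - z + (dl - dl') = dl - dl' by ring.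
set A := _ ^+ 2 + _ + _ => hA.
have hs : 0 <= Iz (stj (z + M)) by apply: Im_stj_ge0 => //; exact: ltW.
have hs' : 3 / 4 * c <= Iz (stj (z + m0)).
 have -> : stj (z + m0) = m0 - dl' by rewrite {2}em addrK.
 rewrite cImB; have := le_trans (ler_norm _) (Im_le dl').
 have : c ^+ 3 / 8 <= c / 4.
  rewrite ler_pdivrMr // exprS -mulrA; apply: ler_wpM2l; first exact: ltW.
  by have : c ^+ 2 <= 1 by [rewrite expr_le1 // ltW]; lra.
 by move: hd' hc; lra.
have k1 : - (c ^+ 2 / 8) <= (Iz z + Iz dl) / Iz (z + M).
 rewrite ler_pdivlMr // mulNr; have h1 : - nc dl <= Iz dl by have := Im_le dl; rewrite ler_norml => /andP[].
 have h2 : c ^+ 2 / 8 * b <= c ^+ 2 / 8 * Iz (z + M) by apply: ler_wpM2l => //; rewrite divr_ge0 ?sqr_ge0.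
 by move: h1 h2 hd z0; move: (Iz (z + M)) => u; lra.
have k2 : - (c ^+ 2 / 8) <= (Iz z + Iz dl') / Iz (z + m0).
 rewrite ler_pdivlMr // mulNr; have h1 : - nc dl' <= Iz dl' by have := Im_le dl'; rewrite ler_norml => /andP[].
 have h2 : c ^+ 2 / 8 * c <= c ^+ 2 / 8 * Iz (z + m0).
  by apply: ler_wpM2l; [rewrite divr_ge0 ?sqr_ge0|rewrite cImD; move: hc z0; lra].
 have h3 : c ^+ 3 / 8 = c ^+ 2 / 8 * c by ring.
 by move: h1 h2 hd' z0; rewrite h3; move: (Iz (z + m0)) => u; lra.
have k3 : (3 / 4 * c) ^+ 2 <= (Iz (stj (z + M)) + Iz (stj (z + m0))) ^+ 2.
 apply: lerXn2r; rewrite ?nnegrE ?mulr_ge0 ?(ltW c0) //; last by apply: (le_trans hs'); rewrite lerDr.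
 by rewrite addr_ge0 // (le_trans _ hs') // mulr_ge0 // ltW.
have k4 : c ^+ 2 / 4 <= A.
 by move: k1 k2 k3; rewrite /A exprMn; move: (_ / Iz _) (_ / Iz _) ((_ + _) ^+ 2) => u1 u2 u3; have := sqr_ge0 c; lra.
have n0 := nc_ge0 (M - m0).
have k5 : nc (M - m0) * (c ^+ 2 / 4) <= 2 * (nc dl + nc dl').
 apply: le_trans (_ : nc (M - m0) * A <= _); first exact: ler_wpM2l.
 by apply: le_trans hA _; apply: ler_wpM2l => //; exact: ncB.
have -> : 8 / c ^+ 2 * (nc dl + nc dl') = 2 * (nc dl + nc dl') / (c ^+ 2 / 4) by field; rewrite gt_eqF.
by rewrite ler_pdivlMr // divr_gt0 // exprn_gt0.
Qed.
End stability.

Section weak_step.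
Context {R : realType} (N : nat) (N0 : (0 < N)%N).
Variables (H : 'M[R[i]]_N) (hH : herm H) (lam : R) (v : 'I_N -> R) (D : 'I_N -> R[i]).
Variables (z : R[i]) (z0 : 0 < Iz z) (La e1 b : R).
Hypotheses (La1 : 1 <= La) (HD : forall i, H i i = rc (lam * v i) + D i) (hD : forall i, nc (D i) <= e1).
Notation G := (res H z).
Notation G' i := (res (zrc H i) z).
Notation eta := (Iz z).
Notation m := (mN H z).
(** The fluctuation of the quadratic form in row [i] around its mean over that row; [quad_var] is
    the squared norm of its coefficients, which governs its size. *)
Definition quad_err i : R[i] :=
 \sum_(k | k != i) \sum_(l | l != i) H i k * G' i k l * H l i - rc N%:R^-1 * \sum_(k | k != i) G' i k k.
Definition quad_var i : R := \sum_(k | k != i) \sum_(l | l != i) nc (G' i k l) ^+ 2.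
Hypotheses (hq : forall i, nc (quad_err i) <= 2 * La / N%:R * sqrt (quad_var i)) (Neta : 1 <= N%:R * eta)
 (Im4 : Iz m <= 4) (b0 : 0 < b) (hb : b <= Iz (z + m)).
(** [e1] is for the diagonal entry, [5] for the quadratic form, and [2] for replacing the trace of
    the minor by the full trace. *)
Let e := e1 + 7 * La / sqrt (N%:R * eta).
Hypothesis eb : e <= b / 2.

Let Np : 0 < N%:R :> R. by rewrite ltr0n. Qed.

Lemma minor_im_le i : \sum_(k | k != i) Iz (G' i k k) <= 6 * N%:R.
Proof.
have h1 := minor_trace hH z0 i.
have h2 : \sum_(k | k != i) Iz (G' i k k) <= \sum_k Iz (G k k) + 2 / eta.
 have : - Iz (\sum_k G k k - \sum_(k | k != i) G' i k k) <= 2 / eta.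
  by apply: le_trans h1; apply: le_trans (Im_le _); rewrite -normrN; exact: ler_norm.
 by rewrite cImB !Im_sum; lra.
have h3 : \sum_k Iz (G k k) = N%:R * Iz m by rewrite Im_mN mulVKf // gt_eqF.
have h4 : eta^-1 <= N%:R by rewrite -[leLHS]mul1r ler_pdivrMr.
have h5 : N%:R * Iz m <= N%:R * 4 by apply: ler_wpM2l => //; exact: ltW.
by move: h2; rewrite h3; lra.
Qed.

Lemma quad_var_le i : quad_var i <= 6 * N%:R / eta.
Proof.
have hZ := herm_zrc hH i.
apply: (via (\sum_(k | k != i) Iz (G' i k k) / eta)).
 apply: ler_sum => k _; rewrite -ward // [leRHS](bigID (fun l => l != i)) /= lerDl.
 by apply: sumr_ge0 => l _; exact: sqr_ge0.
by rewrite -mulr_suml; apply: ler_wpM2r; [rewrite invr_ge0 ltW|exact: minor_im_le].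
Qed.

(** The total error in the denominator: [G i i] is the inverse of
    [lam v_i - (z + mN) - self_err i]. *)
Definition self_err i : R[i] := (quad_err i - D i) + (rc N%:R^-1 * \sum_(k | k != i) G' i k k - m).

Lemma self_eq i : (rc (lam * v i) - (z + m) - self_err i) * G i i = 1.
Proof.
rewrite -(schur hH z0 i) HD; congr (_ * _); rewrite /self_err /quad_err.
ring.
Qed.

Lemma nc_quad_err i : nc (quad_err i) <= 5 * La / sqrt (N%:R * eta).
Proof.
have Ne : 0 < N%:R * eta by rewrite mulr_gt0.
have sq1 : 1 <= sqrt (N%:R * eta) by have := ler_wsqrtr Neta; rewrite sqrtr1.
have sq0 : 0 < sqrt (N%:R * eta) by exact: lt_le_trans sq1.
have sqE : sqrt (N%:R * eta) ^+ 2 = N%:R * eta by rewrite sqr_sqrtr // ltW.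
apply: le_trans (hq i) _.
have h : sqrt (quad_var i) <= 5 / 2 * (N%:R / sqrt (N%:R * eta)).
 have p : 0 <= 5 / 2 * (N%:R / sqrt (N%:R * eta)) by rewrite mulr_ge0 // divr_ge0 // ltW.
 rewrite -[leRHS]ger0_norm // -sqrtr_sqr; apply: ler_wsqrtr; apply: le_trans (quad_var_le i) _.
 have -> : (5 / 2 * (N%:R / sqrt (N%:R * eta))) ^+ 2 = 25 / 4 * (N%:R / eta).
  transitivity (25 / 4 * (N%:R ^+ 2 / sqrt (N%:R * eta) ^+ 2)); first by field; rewrite gt_eqF.
  by rewrite sqE; field; rewrite !gt_eqF.
 by rewrite -mulrA; apply: ler_wpM2r; [rewrite divr_ge0 // ltW|lra].
apply: (via (2 * La / N%:R * (5 / 2 * (N%:R / sqrt (N%:R * eta))))).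
 by apply: ler_wpM2l => //; rewrite divr_ge0 ?(ltW Np) // mulr_ge0 // (le_trans ler01).
have -> : 2 * La / N%:R * (5 / 2 * (N%:R / sqrt (N%:R * eta))) = 5 * La / sqrt (N%:R * eta).
 by field; rewrite !gt_eqF.
by [].
Qed.

Lemma nc_self_err i : nc (self_err i) <= e.
Proof.
have Ne : 0 < N%:R * eta by rewrite mulr_gt0.
have sq1 : 1 <= sqrt (N%:R * eta) by have := ler_wsqrtr Neta; rewrite sqrtr1.
have sq0 : 0 < sqrt (N%:R * eta) by exact: lt_le_trans sq1.
have sqE : sqrt (N%:R * eta) ^+ 2 = N%:R * eta by rewrite sqr_sqrtr // ltW.
have h1 := nc_quad_err i.
have h2 : nc (rc N%:R^-1 * \sum_(k | k != i) G' i k k - m) <= 2 * La / sqrt (N%:R * eta).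
 rewrite /mN -mulrBr ncM nc_rc ger0_norm ?invr_ge0 ?(ltW Np) // ncC.
 apply: (via (N%:R^-1 * (2 / eta))).
  by apply: ler_wpM2l; [rewrite invr_ge0 ltW|exact: minor_trace].
 have -> : N%:R^-1 * (2 / eta) = 2 / sqrt (N%:R * eta) * (sqrt (N%:R * eta))^-1.
  transitivity (2 / sqrt (N%:R * eta) ^+ 2); first by rewrite sqE; field; rewrite !gt_eqF.
  by field; rewrite gt_eqF.
 have -> : 2 * La / sqrt (N%:R * eta) = 2 / sqrt (N%:R * eta) * La by ring.
 apply: ler_wpM2l; first by rewrite divr_ge0 // ltW.
 by apply: le_trans La1; rewrite invf_le1.
apply: le_trans (ncD _ _) _; have h3 := ncB (quad_err i) (D i); have h4 := hD i.
have -> : e = e1 + 5 * La / sqrt (N%:R * eta) + 2 * La / sqrt (N%:R * eta) by rewrite /e; ring.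
by move: h1 h2 h3 h4; lra.
Qed.

Lemma weak_diag i : nc (G i i) <= 2 / b /\ nc (G i i - gr lam (z + m) (v i)) <= 2 * e / b ^+ 2.
Proof.
set a := rc (lam * v i) - (z + m); have w0 : 0 < Iz (z + m) by exact: lt_le_trans hb.
have an : b <= nc a.
 apply: le_trans hb _; apply: le_trans (Im_le _); rewrite cImB Im_rc sub0r normrN; exact: ler_norm.
have ap : 0 < nc a by exact: lt_le_trans an.
have he := nc_self_err i.
have h1 : b / 2 <= nc (a - self_err i).
 have := nc_triB a (self_err i); have := nc_triB a (self_err i).
 by move: he eb an; lra.
have p1 : 0 < nc (a - self_err i) by apply: lt_le_trans h1; rewrite divr_gt0.
have an0 : a != 0 by rewrite -nc_gt0.
have an1 : a - self_err i != 0 by rewrite -nc_gt0.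
have eG : G i i = (a - self_err i)^-1.
 by apply: (mulfI an1); rewrite self_eq mulfV.
have g1 : nc (G i i) <= 2 / b.
 by rewrite eG ncV -[2 / b]invrK invf_div lef_pV2 ?posrE // divr_gt0.
split => //.
have -> : G i i - gr lam (z + m) (v i) = G i i * self_err i * a^-1.
 by rewrite eG /gr -/a; field; rewrite an0 an1.
rewrite !ncM ncV; apply: (via (2 / b * e * b^-1)).
 apply: ler_pM; rewrite ?mulr_ge0 ?invr_ge0 ?nc_ge0 //; last by rewrite lef_pV2 ?posrE.
 by apply: ler_pM; rewrite ?nc_ge0.
have -> : 2 / b * e * b^-1 = 2 * e / b ^+ 2 by field; rewrite gt_eqF.
by [].
Qed.

Lemma weak_self : nc (m - stj (emp v) lam (z + m)) <= 2 * e / b ^+ 2.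
Proof.
rewrite /stj emp_cmean /mN -mulrBr -sumrB ncM nc_rc ger0_norm ?invr_ge0 ?(ltW Np) // ler_pdivrMl //.
apply: le_trans (nc_sum _ _ _) _.
apply: (via (\sum_(i < N) (2 * e / b ^+ 2))); last by rewrite sumr_const card_ord -[X in X <= _]mulr_natl.
by apply: ler_sum => i _; have [] := weak_diag i.
Qed.
End weak_step.

(** * Measurability of resolvents and the independent inputs of the model *)

Section measurable_resolvent.
Context {R : realType} {d : measure_display} {S : measurableType d}.

Lemma cme_det n (A : S -> 'M[R[i]]_n) : (forall i j, cme (fun s => A s i j)) -> cme (fun s => \det (A s)).
Proof.
move=> hA; rewrite /determinant; apply: cme_sum => s; apply: cmeM; first exact: cme_cst.
by apply: cme_prod => i.
Qed.

(** By Cramer's rule a resolvent entry is a quotient of determinants, which are polynomials in the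
    entries. *)
Lemma cme_res N (A : S -> 'M[R[i]]_N) (z : R[i]) i j : (forall i j, cme (fun s => A s i j)) ->
 (forall s, herm (A s)) -> 0 < Iz z -> cme (fun s => res (A s) z i j).
Proof.
move=> mA hA z0; pose B s := A s - z%:M.
have mB k l : cme (fun s => B s k l).
 have -> : (fun s => B s k l) = (fun s => A s k l + (- z%:M) k l) by apply/funext => s; rewrite mxE.
 by apply: cmeD => //; exact: cme_cst.
have -> : (fun s => res (A s) z i j) = (fun s => (\det (B s))^-1 * ((-1) ^+ (j + i) * \det (row' j (col' i (B s))))).
 apply/funext => s; rewrite /res /invmx res_unit // mxE; congr (_ * _).
 by rewrite mxE.
apply: cmeM; first by apply: cmeV; exact: cme_det.
apply: cmeM; first exact: cme_cst.
apply: cme_det => k l.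
have -> : (fun s => row' j (col' i (B s)) k l) = (fun s => B s (lift j k) (lift i l)) by apply/funext => s; rewrite !mxE.
exact: mB.
Qed.

Lemma cbm_res N (A : S -> 'M[R[i]]_N) (z : R[i]) i j : (forall i j, cme (fun s => A s i j)) ->
 (forall s, herm (A s)) -> 0 < Iz z -> cbm (fun s => res (A s) z i j).
Proof.
move=> mA hA z0; apply/cbm_cme; split; first exact: cme_res.
by exists (Iz z)^-1 => s; exact: nc_res.
Qed.
End measurable_resolvent.

Section sigma_classes.
Context {R : realType} {d : measure_display} {T : measurableType d}.
Implicit Types X : T -> R[i].

Lemma sigma_crvP X A : sigma_crv X A <-> exists2 B, measurable B & A = re_im X @^-1` B.
Proof.
split=> [[B mB <-]|[B mB ->]]; first by exists B => //; rewrite setTI.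
by exists B => //; rewrite setTI.
Qed.

Lemma sigma_rvP (f : T -> R) A : sigma_rv f A <-> exists2 B, measurable B & A = f @^-1` B.
Proof.
split=> [[B mB <-]|[B mB ->]]; first by exists B => //; rewrite setTI.
by exists B => //; rewrite setTI.
Qed.

Lemma sigma_crvI X : setI_closed (sigma_crv X).
Proof.
move=> A B /sigma_crvP[A' mA ->] /sigma_crvP[B' mB ->]; apply/sigma_crvP; exists (A' `&` B') => //.
exact: measurableI.
Qed.
Lemma sigma_rvI (f : T -> R) : setI_closed (sigma_rv f).
Proof.
move=> A B /sigma_rvP[A' mA ->] /sigma_rvP[B' mB ->]; apply/sigma_rvP; exists (A' `&` B') => //.
exact: measurableI.
Qed.

Lemma sigma_crv_conj X : sigma_crv (fun t => conjc (X t)) `<=` sigma_crv X.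
Proof.
move=> A /sigma_crvP[B mB ->]; apply/sigma_crvP.
exists ((fun u : R * R => (u.1, - u.2)) @^-1` B); last first.
 by apply/seteqP; split => t /=; rewrite /re_im cReJ cImJ.
rewrite -[X in measurable X]setTI.
have mf : measurable_fun setT (fun u : R * R => (u.1, - u.2)).
 by apply: measurable_fun_pair; [exact: measurable_fst|apply: measurable_funN; exact: measurable_snd].
exact: mf.
Qed.

(** Selects a subfamily of the independent inputs: an injection of labels keeps distinct inputs
    distinct, and the classes may shrink, for example to that of a complex conjugate. *)
Lemma mutual_indep_comp (P : probability T R) (I K : finType) (D : {set K}) (F : K -> set_system T)
  (f : I -> K) (G : I -> set_system T) : mutually_independent P D F -> injective f ->
 (forall i, f i \in D) -> (forall i, G i `<=` F (f i)) -> mutually_independent P [set: I] G.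
Proof.
move=> h fi fD GF J A _ hA.
pose A' k := if [pick i | f i == k] is Some i then A i else setT.
have A'E i : A' (f i) = A i.
 rewrite /A'; case: pickP => [j /eqP /fi ->//|/(_ i)]; by rewrite eqxx.
have sD : f @: J \subset D by apply/fintype.subsetP => _ /imsetP[i _ ->].
have := h _ A' sD _; rewrite big_imset /=; last by move=> i j _ _; exact: fi.
move=> hh; have {}hh := hh (_ : forall k, k \in f @: J -> F k (A' k)).
have -> : \bigcap_(i in [set` J]) A i = \bigcap_(k in [set` f @: J]) A' k.
 apply/seteqP; split => t.
  by move=> ht _ /imsetP[i iJ ->]; rewrite A'E; exact: ht.
 by move=> ht i iJ; rewrite -A'E; apply: ht; exact: imset_f.
rewrite hh; last by move=> _ /imsetP[i iJ ->]; rewrite A'E; apply: GF; exact: hA.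
by apply: eq_bigr => i _; rewrite A'E.
Qed.
End sigma_classes.

Section model.
Context {R : realType} (theta C0 : R) (mu : probability (measurableTypeR R) R) (N : nat).
Variable X : deformed_wigner theta C0 mu N.
Notation T := (dw_space X).
Notation P := (dw_prob X).
Notation W := (@dw_W _ _ _ _ _ X).
Notation v := (@dw_v _ _ _ _ _ X).
(** One label set for all inputs, pairs for [W] and sites for [v]; [idxD] keeps the pairs on or
    above the diagonal, where the entries of [W] are mutually independent. *)
Definition idx : finType := ('I_N * 'I_N + 'I_N)%type.
Definition cls (k : idx) : set_system T :=
 match k with inl p => sigma_crv (fun t => W t p.1 p.2) | inr i => sigma_rv (v i) end.
Definition idxD : {set idx} :=
 finset (fun k : 'I_N * 'I_N + 'I_N => match k with inl p => (p.1 <= p.2)%N | inr _ => true end).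

Lemma cls_I k : setI_closed (cls k).
Proof. by case: k => p; [exact: sigma_crvI|exact: sigma_rvI]. Qed.
Lemma cls_T k : cls k setT.
Proof. by case: k => p; [apply/sigma_crvP|apply/sigma_rvP]; exists setT. Qed.
Lemma cls_measurable k : cls k `<=` measurable.
Proof.
have [hW _ _ _ _] := dw_wigner X; have [hv _ _] := dw_potential X.
case: k => [p|i] A; [move=> /sigma_crvP|move=> /sigma_rvP] => -[B mB ->]; rewrite -[X in measurable X]setTI.
 by apply: (hW p.1 p.2).
exact: hv.
Qed.

Lemma model_indep : mutually_independent P idxD cls.
Proof.
have [_ _ iW _ _] := dw_wigner X; have [_ iv _] := dw_potential X.
move=> J A sJ hA.
pose JW : {set 'I_N * 'I_N} := finset (fun p : 'I_N * 'I_N => inl p \in J).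
pose Jv : {set 'I_N} := finset (fun i : 'I_N => inr i \in J).
have sW : JW \subset finset (fun p : 'I_N * 'I_N => (p.1 <= p.2)%N).
 by apply/fintype.subsetP => p; rewrite !inE => /(fintype.subsetP sJ); rewrite inE.
have hW p : p \in JW -> sigma_crv (fun t => W t p.1 p.2) (A (inl p)).
 by rewrite inE => /hA.
have hv i : i \in Jv -> sigma_rv (v i) (A (inr i)) by rewrite inE => /hA.
have sv : Jv \subset [set: 'I_N]%SET by exact: finset.subsetT.
have eW := iW JW (fun p => A (inl p)) sW hW.
have ev := iv Jv (fun i => A (inr i)) sv hv.
have -> : \bigcap_(k in [set` J]) A k =
  (\bigcap_(i in [set` Jv]) A (inr i)) `&` (\bigcap_(p in [set` JW]) A (inl p)).
 apply/seteqP; split => [t ht|t [h1 h2] [p|i] kJ].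
 - by split => [i|p] /=; rewrite inE; exact: ht.
 - by apply: h2 => /=; rewrite inE.
 - by apply: h1 => /=; rewrite inE.
have fin (K : finType) (G : {set K}) (F : K -> set T) (Fc : K -> set_system T) :
  (forall k, k \in G -> Fc k (F k)) -> <<s \bigcup_k Fc k >> (\bigcap_(k in [set` G]) F k).
 move=> h; have sc := smallest_sigma_algebra setT (\bigcup_k Fc k).
 have := @fin_bigcap_measurable _ (g_sigma_algebraType (\bigcup_k Fc k)) _ [set` G] F finite_finset.
 by apply => k /= kG; apply: sub_sigma_algebra; exists k => //; exact: h.
rewrite (dw_indep (fin _ _ _ _ hv) (fin _ _ _ (fun p => sigma_crv (fun t => W t p.1 p.2)) hW)).
rewrite ev eW big_sumType /= muleC; congr (_ * _)%E.
 by apply: eq_bigl => p; rewrite inE.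
by apply: eq_bigl => i; rewrite inE.
Qed.

Definition gen (J : {set idx}) : set_system T := \bigcup_(k in [set` J]) cls k.
Lemma gen_measurable J : gen J `<=` measurable.
Proof. by move=> A [k _ hA]; exact: (cls_measurable hA). Qed.

Lemma gen_indep (J1 J2 : {set idx}) : J1 \subset idxD -> J2 \subset idxD -> fintype.disjoint (mem J1) (mem J2) ->
 independent_classes P <<s gen J1 >> <<s gen J2 >>.
Proof. exact: (indep_families model_indep cls_I cls_T cls_measurable). Qed.

(** The label of the independent input that determines the entry [(i, j)], up to conjugation. *)
Definition ordp (i j : 'I_N) : 'I_N * 'I_N := if (i <= j)%N then (i, j) else (j, i).

Lemma W_herm t : herm (W t).
Proof. by move=> i j; have [_ h _ _ _] := dw_wigner X; exact: h. Qed.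

Lemma cme_gen (J : {set idx}) i j : inl (ordp i j) \in J ->
 cme (fun t : g_sigma_algebraType (gen J) => W t i j).
Proof.
have key (p : 'I_N * 'I_N) : inl p \in J -> cme (fun t : g_sigma_algebraType (gen J) => W t p.1 p.2).
 move=> pJ; apply/cme_complex_rv => _ B mB; rewrite setTI; apply: sub_sigma_algebra.
 by exists (inl p) => //=; apply/sigma_crvP; exists B.
rewrite /ordp; case: ifP => _ /key //= h.
have -> : (fun t : g_sigma_algebraType (gen J) => W t i j) = (fun t : g_sigma_algebraType (gen J) => conjc (W t j i)).
 by apply/funext => t; exact: W_herm.
exact: cmeJ.
Qed.

Lemma mfun_gen (J : {set idx}) i : inr i \in J ->
 measurable_fun setT (fun t : g_sigma_algebraType (gen J) => v i t).
Proof.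
move=> iJ _ B mB; rewrite setTI; apply: sub_sigma_algebra.
by exists (inr i) => //=; apply/sigma_rvP; exists B.
Qed.

Lemma cme_W i j : cme (fun t : T => W t i j).
Proof. by have [h _ _ _ _] := dw_wigner X; apply/cme_complex_rv; exact: h. Qed.
Lemma mfun_v i : measurable_fun setT (v i).
Proof. by have [h _ _] := dw_potential X; exact: h. Qed.

End model.

Lemma set_and_true (T : Type) (b : bool) (Q : T -> Prop) : b -> [set t | b /\ Q t] = [set t | Q t].
Proof. by move=> hb; apply/seteqP; split => t //= -[]. Qed.

Section measurable_sets.
Context {R : realType} {d : measure_display} {S : measurableType d}.

Lemma mset_le (f g : S -> R) : measurable_fun setT f -> measurable_fun setT g ->
 measurable [set x | f x <= g x].
Proof.
move=> mf mg; have mh : measurable_fun setT (fun x => g x - f x) by exact: measurable_funB.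
have := mh measurableT `[0, +oo[%classic (measurable_itv _); rewrite setTI.
by congr measurable; apply/seteqP; split => x /=; rewrite in_itv /= andbT subr_ge0.
Qed.

Lemma mset_lt (f g : S -> R) : measurable_fun setT f -> measurable_fun setT g ->
 measurable [set x | f x < g x].
Proof.
move=> mf mg; have := measurableC (mset_le mg mf); congr measurable.
by apply/seteqP; split => x /=; rewrite ltNge => /negP.
Qed.

Lemma msum (J : Type) (s : seq J) (Q : pred J) (F : J -> S -> R) :
 (forall j, measurable_fun setT (F j)) -> measurable_fun setT (fun x => \sum_(j <- s | Q j) F j x).
Proof.
move=> h; elim: s => [|j s IH].
 have -> : (fun x => \sum_(j <- [::] | Q j) F j x) = (fun=> 0) by apply/funext => x; rewrite big_nil.
 exact: measurable_cst.
have [Qj|Qj] := boolP (Q j).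
 have -> : (fun x => \sum_(j <- j :: s | Q j) F j x) = (fun x => F j x + \sum_(j <- s | Q j) F j x).
  by apply/funext => x; rewrite big_cons Qj.
 exact: measurable_funD.
suff -> : (fun x => \sum_(j <- j :: s | Q j) F j x) = (fun x => \sum_(j <- s | Q j) F j x) by [].
by apply/funext => x; rewrite big_cons (negbTE Qj).
Qed.

Lemma measurable_sqrtc (f : S -> R) : measurable_fun setT f -> measurable_fun setT (fun t => sqrt (f t)).
Proof. by move=> mf; apply: measurableT_comp mf; apply: continuous_measurable_fun; exact: sqrt_continuous. Qed.
End measurable_sets.

Section unions.
Context {R : realType} {d : measure_display} {T : measurableType d} (P : probability T R).

Lemma prob_setCI (A B : set T) (a b : R) : measurable A -> measurable B ->
 (P (~` A) <= a%:E)%E -> (P (~` B) <= b%:E)%E -> (P (~` (A `&` B)) <= (a + b)%:E)%E.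
Proof.
move=> mA mB hA hB; rewrite setCI; apply: (le_trans (measureU2 _ (measurableC mA) (measurableC mB))).
by rewrite EFinD; apply: leeD.
Qed.

Lemma prob_setC_bigcap (I : finType) (A : I -> set T) (q : R) : (forall i, measurable (A i)) ->
 (forall i, P (~` (A i)) <= q%:E)%E -> (P (~` \bigcap_(i in [set: I]) A i) <= (#|I|%:R * q)%:E)%E.
Proof.
move=> mA hA.
have key (s : seq I) : measurable (\bigcap_(i in [set` s]) A i) /\
  (P (~` \bigcap_(i in [set` s]) A i) <= ((size s)%:R * q)%:E)%E.
 elim: s => [|i s [m IH]].
  by rewrite set_nil bigcap_set0 setCT measure0 mul0r; split.
 have e : \bigcap_(j in [set` i :: s]) A j = A i `&` \bigcap_(j in [set` s]) A j.
  apply/seteqP; split => t.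
   by move=> h; split; [apply: h; rewrite /= inE eqxx|move=> j js; apply: h; rewrite /= inE; apply/orP; right].
  by move=> [h1 h2] j /=; rewrite inE => /predU1P[->//|]; exact: h2.
 rewrite e; split; first exact: measurableI.
 have -> : (size (i :: s))%:R * q = q + (size s)%:R * q by rewrite /= -addn1 natrD; ring.
 exact: prob_setCI.
have [_] := key (enum I); rewrite cardE.
congr (P (~` _) <= _)%E; apply/seteqP; split => t ht i _; apply: ht => //=.
by rewrite mem_enum.
Qed.
End unions.

(** * Large deviation estimates for fixed [N] *)

Section ld.
Context {R : realType}.

(** The model bounds the probability of [|w| > y], the large deviation hypothesis asks for
    [|w| >= x]. The bounds for all [y < x] pass to the limit because the exponential bound is
    continuous in [y]. *)
Lemma tail_closed (p c x a : R) : 0 < a -> 0 < x ->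
 (forall y, 0 < y -> y < x -> p <= c * expR (- y `^ a)) -> p <= c * expR (- x `^ a).
Proof.
move=> a0 x0 h; rewrite leNgt; apply/negP => hp.
pose g y := c * expR (- expR (a * ln y)).
have gE y : 0 < y -> c * expR (- y `^ a) = g y by move=> y0; rewrite /powR gt_eqF.
have cg : {for x, continuous g}.
 have c1 : {for x, continuous (fun y : R => a * ln y)}.
  by apply: continuousM; [exact: cst_continuous|exact: continuous_ln].
 have c2 : {for x, continuous (fun y : R => expR (a * ln y))}.
  exact: (continuous_comp c1 (@continuous_expR R _)).
 have c3 : {for x, continuous (fun y : R => - expR (a * ln y))} by exact: continuousN.
 have c4 : {for x, continuous (fun y : R => expR (- expR (a * ln y)))}.
  exact: (continuous_comp c3 (@continuous_expR R _)).
 by apply: continuousM; [exact: cst_continuous|exact: c4].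
rewrite gE // in hp.
have e0 : 0 < (p - g x) / 2 by rewrite divr_gt0 // subr_gt0.
have /cvgrPdist_le /(_ _ e0) [d /= d0 hd] := cg.
pose y := x - Num.min (d / 2) (x / 2).
have m0 : 0 < Num.min (d / 2) (x / 2) by rewrite lt_min !divr_gt0.
have m1 : Num.min (d / 2) (x / 2) <= d / 2 by rewrite ge_min lexx.
have m2 : Num.min (d / 2) (x / 2) <= x / 2 by rewrite ge_min lexx orbT.
have y0 : 0 < y by rewrite /y; lra.
have yx : y < x by rewrite /y; lra.
have h1 := h y y0 yx; rewrite gE // in h1.
have := hd y; rewrite /= /y opprB addrC subrK ger0_norm ?(ltW m0) // => /(_ _).
have -> : Num.min (d / 2) (x / 2) < d by apply: le_lt_trans m1 _; rewrite ltr_pdivrMr // ltr_pMr // ltr1n.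
move=> /(_ isT); rewrite -/y ler_distl => /andP[h2 h3].
by move: h1 h2 h3 e0; move: (g x) (g y) => u w; clear; lra.
Qed.

(** The conclusion of [large_deviation_constants] at one [N] and one exponent; it will be used at
    [3/2 xi]. *)
Definition ld_at (theta C0 Cphi : R) (N : nat) (xi : R) : Prop :=
 forall (d : measure_display) (T : measurableType d) (P : probability T R)
  (sigma : R) (a b : 'I_N -> T -> R[i]) (A : 'I_N -> R[i]) (B : 'I_N -> 'I_N -> R[i]),
 0 < sigma ->
 (forall i, ld_variable theta C0 sigma P (a i)) ->
 (forall i, ld_variable theta C0 sigma P (b i)) ->
 mutually_independent P [set: 'I_N + 'I_N]
  (fun k => match k with
       | inl i => sigma_crv (a i) | inr i => sigma_crv (b i) end) ->
 [/\ ld_bound P N xi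
    (fun t => \sum_i A i * a i t)
    (phi Cphi N `^ xi * sigma * sqrt (\sum_i nc (A i) ^+ 2)),
   ld_bound P N xi
    (fun t => \sum_i conjc (a i t) * B i i * a i t
         - \sum_i (sigma ^+ 2)%:C%C * B i i)
    (phi Cphi N `^ xi * sigma ^+ 2
      * sqrt (\sum_i nc (B i i) ^+ 2)),
   ld_bound P N xi
    (fun t => \sum_i \sum_(j | i != j) conjc (a i t) * B i j * a j t)
    (phi Cphi N `^ xi * sigma ^+ 2
      * sqrt (\sum_i \sum_(j | i != j) nc (B i j) ^+ 2)) &
   ld_bound P N xi
    (fun t => \sum_i \sum_j conjc (a i t) * B i j * b j t)
    (phi Cphi N `^ xi * sigma ^+ 2
      * sqrt (\sum_i \sum_j nc (B i j) ^+ 2))].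
End ld.

Lemma two_others (N : nat) (i : 'I_N) : (3 <= N)%N -> exists p q : 'I_N, [/\ (p < q)%N, p != i & q != i].
Proof.
move=> N3; have N0 : (0 < N)%N by exact: leq_trans N3.
have N1 : (1 < N)%N by exact: leq_trans N3.
pose o0 := Ordinal N0; pose o1 := Ordinal N1; pose o2 := Ordinal N3.
have [i0|i0] := eqVneq (i : nat) 0%N; first by exists o1, o2; split => //; apply/eqP => /(congr1 val) /=; rewrite i0.
have [i1|i1] := eqVneq (i : nat) 1%N; first by exists o0, o2; split => //; apply/eqP => /(congr1 val) /=; rewrite i1.
by exists o0, o1; split => //; apply/eqP => /(congr1 val) /= e; [move: i0|move: i1]; rewrite -e.
Qed.

(** * Large deviations for quadratic forms in one row with coefficients from the minor *)

Section rows.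
Context {R : realType} (theta C0 : R) (mu : probability (measurableTypeR R) R) (N : nat).
Hypotheses (N3 : (3 <= N)%N) (theta0 : 0 < theta).
Variable X : deformed_wigner theta C0 mu N.
Notation T := (dw_space X).
Notation P := (dw_prob X).
Notation W := (@dw_W _ _ _ _ _ X).
Notation v := (@dw_v _ _ _ _ _ X).
Notation genX := (@gen _ theta C0 mu N X).
Variables (lam : R).
Notation ham := (@hamiltonian _ theta C0 mu N X lam).

Lemma hamE t i j : ham t i j = rc lam * ((rc (v j t)) *+ (i == j)) + W t i j.
Proof. by rewrite !mxE; congr (_ * _ + _); case: eqVneq => [->|_]. Qed.

Lemma ham_herm t : herm (ham t).
Proof.
move=> i j; rewrite !hamE rmorphD rmorphM /= -W_herm; congr (_ + _).
by rewrite eq_sym; case: eqVneq => [->|_]; apply: complex_eq; rewrite ?cReM ?cImM ?cReJ ?cImJ /=; ring.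
Qed.

Lemma ham_diag t i : ham t i i = rc (lam * v i t) + W t i i.
Proof. by rewrite hamE eqxx mulr1n -rmorphM. Qed.

Lemma cme_ham i j : cme (fun t : T => ham t i j).
Proof.
have -> : (fun t : T => ham t i j) = (fun t => rc lam * ((rc (v j t)) *+ (i == j)) + W t i j).
 by apply/funext => t; rewrite hamE.
apply: cmeD; last exact: cme_W.
apply: cmeM; first exact: cme_cst.
by case: eqVneq => _; [apply: cme_rc; exact: mfun_v|exact: cme_cst].
Qed.

Let Np : 0 < N%:R :> R. by rewrite ltr0n (leq_trans _ N3). Qed.
Let sig : R := sqrt N%:R^-1.
Let sig0 : 0 < sig. by rewrite sqrtr_gt0 invr_gt0. Qed.
Let sig2 : sig ^+ 2 = N%:R^-1. by rewrite sqr_sqrtr // invr_ge0 ltW. Qed.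
Let sigN : sqrt N%:R * sig = 1.
Proof. by rewrite /sig sqrtrV ?(ltW Np) // mulfV // gt_eqF // sqrtr_gt0. Qed.

Lemma ld_W i j : ld_variable theta C0 sig P (fun t => W t i j).
Proof.
have [h1 h2 h3 [h4 h5 h6 h7] h8] := dw_wigner X; split.
- exact: h1.
- exact: h4.
- by rewrite h6 sig2.
move=> x x0; set S := [set t | _].
have mS : measurable S.
 by apply: mset_le; [exact: measurable_cst|apply: measurable_nc; exact: cme_W].
have fS : P S \is a fin_num by exact: fin_num_measure.
rewrite -(fineK fS) lee_fin; apply: tail_closed => //; first by rewrite invr_gt0.
move=> y y0 yx; rewrite -lee_fin fineK //; apply: le_trans (h8 i j y y0).
apply: le_measure; rewrite ?inE //.
 by apply: mset_lt; [exact: measurable_cst|apply: measurable_funM; [exact: measurable_cst|apply: measurable_nc; exact: cme_W]].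
move=> t /= ht; apply: (lt_le_trans yx).
have : sqrt N%:R * (x * sig) <= sqrt N%:R * nc (W t i j) by rewrite ler_pM2l // sqrtr_gt0.
by rewrite mulrCA sigN mulr1.
Qed.

Variables (Cphi xi : R).
Hypothesis LD : ld_at theta C0 Cphi N xi.
Notation f := (phi Cphi N `^ xi).
Notation q := (expR (- ln N%:R `^ xi)).
Hypothesis f0 : 0 < f.

Section one_row.
Variable (i : 'I_N).

Definition row_idx : {set idx N} :=
 finset (fun k : 'I_N * 'I_N + 'I_N =>
  match k with inl p => (p.1 <= p.2)%N && ((p.1 == i) || (p.2 == i)) | inr _ => false end).
Let J1 := row_idx.
Let J2 := (idxD N :\: row_idx)%SET.
Notation T1 := (g_sigma_algebraType (genX J1)).
Notation T2 := (g_sigma_algebraType (genX J2)).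

Lemma indep_row : independent_classes P <<s genX J1 >> <<s genX J2 >>.
Proof.
apply: gen_indep.
- by apply/fintype.subsetP => -[p|k]; rewrite !inE // => /andP[].
- exact: finset.subsetDl.
- by rewrite disjoint_sym; apply/finset.setDidPl; rewrite finset.setDDl finset.setUid.
Qed.

Lemma ordp_le (k l : 'I_N) : ((ordp k l).1 <= (ordp k l).2)%N.
Proof. by rewrite /ordp; case: (leqP k l) => // h; exact: ltnW. Qed.
Lemma ordp_mem (k l a : 'I_N) : ((ordp k l).1 == a) || ((ordp k l).2 == a) = (k == a) || (l == a).
Proof. by rewrite /ordp; case: ifP => //= _; rewrite orbC. Qed.

Lemma cme_row k : cme (fun t : T1 => W t k i).
Proof. by apply: cme_gen; rewrite inE ordp_le ordp_mem eqxx orbT. Qed.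

Variable B : T -> 'I_N -> 'I_N -> R[i].
Hypotheses (mB : forall k l, cme (fun s : T2 => B s k l))
 (B0 : forall s k l, (k == i) || (l == i) -> B s k l = 0).

Lemma ld_row (A : 'I_N -> R[i]) (B' : 'I_N -> 'I_N -> R[i]) :
 [/\ ld_bound P N xi (fun t => \sum_k A k * W t k i) (f * sig * sqrt (\sum_k nc (A k) ^+ 2)),
   ld_bound P N xi (fun t => \sum_k conjc (W t k i) * B' k k * W t k i - \sum_k rc (sig ^+ 2) * B' k k)
    (f * sig ^+ 2 * sqrt (\sum_k nc (B' k k) ^+ 2)) &
   ld_bound P N xi (fun t => \sum_k \sum_(l | k != l) conjc (W t k i) * B' k l * W t l i)
    (f * sig ^+ 2 * sqrt (\sum_k \sum_(l | k != l) nc (B' k l) ^+ 2))].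
Proof.
have [p [r [pr pi ri]]] := two_others i N3.
(* The second family must be independent of row [i]. It consists of diagonal entries, with [W i i],
   which belongs to the row, replaced by an off-diagonal entry [(p, r)] avoiding [i]; hence
   [3 <= N]. *)
pose b (k : 'I_N) (t : T) := if k == i then W t p r else W t k k.
pose fi (x : 'I_N + 'I_N) : idx N := match x with
 | inl k => inl (ordp k i) | inr k => if k == i then inl (p, r) else inl (k, k) end.
have [] := @LD _ _ P sig (fun k t => W t k i) b A B' sig0.
- by move=> k; exact: ld_W.
- by move=> k; rewrite /b; case: eqVneq => _; exact: ld_W.
- apply: (mutual_indep_comp (f := fi) (@model_indep _ theta C0 mu N X)).
 + have c1 k l : ordp k i = ordp l i -> k = l.
   by rewrite /ordp; case: ifP => _; case: ifP => _ h; injection h; intros; congruence.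
  have c2 k l : l != i -> ordp k i <> (l, l).
   move=> li e; have := ordp_mem k i i; rewrite e /= eqxx orbT (negbTE li) //.
  have c3 k : ordp k i <> (p, r).
   by move=> e; have := ordp_mem k i i; rewrite e /= eqxx orbT (negbTE pi) (negbTE ri).
  have c4 k : (k, k) <> (p, r) by move=> [e1 e2]; move: pr; rewrite -e1 -e2 ltnn.
  move=> [k|k] [l|l] /=.
  * by move=> [] /c1 ->.
  * by case: eqVneq => [_|li] [] => [/c3|/(c2 _ _ li)].
  * by case: eqVneq => [_|li] [] => [/esym/c3|/esym/(c2 _ _ li)].
  * case: eqVneq => [->|ki]; case: eqVneq => [->|li] //.
   - by move=> h; case: (c4 l); injection h; intros; congruence.
   - by move=> h; case: (c4 k); injection h; intros; congruence.
   - by move=> [] ->.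
 + by move=> [k|k] /=; rewrite inE ?ordp_le //; case: eqVneq => _ /=; [exact: ltnW|exact: leqnn].
 + move=> [k|k] /=; last first.
   by rewrite /b; case: eqVneq => _ /=.
  rewrite /ordp; case: ifP => _ //=.
  have -> : (fun t => W t k i) = (fun t => conjc (W t i k)) by apply/funext => t; exact: W_herm.
  exact: sigma_crv_conj.
by move=> h1 h2 h3 _; split.
Qed.

(** A subset of a product: the row comes from the first factor, the coefficients from the second. On
    each section the coefficients are deterministic, so [ld_row] applies, and [decouple_set] returns
    to the diagonal. The first conjunct mirrors the restriction [0 < s] in [ld_bound]. *)
Definition bad_off : set (T1 * T2) := [set x : T1 * T2 |
 0 < f * sig ^+ 2 * sqrt (\sum_k \sum_(l | k != l) nc (B x.2 k l) ^+ 2) /\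
 f * sig ^+ 2 * sqrt (\sum_k \sum_(l | k != l) nc (B x.2 k l) ^+ 2)
  <= nc (\sum_k \sum_(l | k != l) conjc (W x.1 k i) * B x.2 k l * W x.1 l i)].
Definition bad_dia : set (T1 * T2) := [set x : T1 * T2 |
 0 < f * sig ^+ 2 * sqrt (\sum_k nc (B x.2 k k) ^+ 2) /\
 f * sig ^+ 2 * sqrt (\sum_k nc (B x.2 k k) ^+ 2)
  <= nc (\sum_k conjc (W x.1 k i) * B x.2 k k * W x.1 k i - \sum_k rc (sig ^+ 2) * B x.2 k k)].

Let cme1 k : cme (fun x : T1 * T2 => W x.1 k i).
Proof.
have [h1 h2] := cme_row k; split; [exact: (measurableT_comp h1 measurable_fst)|exact: (measurableT_comp h2 measurable_fst)].
Qed.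
Let cme2 k l : cme (fun x : T1 * T2 => B x.2 k l).
Proof.
have [h1 h2] := mB k l; split; [exact: (measurableT_comp h1 measurable_snd)|exact: (measurableT_comp h2 measurable_snd)].
Qed.

Lemma measurable_bad_off : measurable bad_off.
Proof.
have mv : measurable_fun setT (fun x : T1 * T2 => f * sig ^+ 2 * sqrt (\sum_k \sum_(l | k != l) nc (B x.2 k l) ^+ 2)).
 apply: measurable_funM; first exact: measurable_cst.
 by apply: measurable_sqrtc; apply: msum => k; apply: msum => l; exact: measurable_nc2.
apply: measurableI; first by apply: mset_lt => //; exact: measurable_cst.
apply: mset_le => //; apply: measurable_nc; apply: cme_sum => k; apply: cme_sum => l.
by apply: cmeM => //; apply: cmeM => //; exact: cmeJ.
Qed.

Lemma measurable_bad_dia : measurable bad_dia.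
Proof.
have mv : measurable_fun setT (fun x : T1 * T2 => f * sig ^+ 2 * sqrt (\sum_k nc (B x.2 k k) ^+ 2)).
 apply: measurable_funM; first exact: measurable_cst.
 by apply: measurable_sqrtc; apply: msum => k; exact: measurable_nc2.
apply: measurableI; first by apply: mset_lt => //; exact: measurable_cst.
apply: mset_le => //; apply: measurable_nc; apply: cmeB.
 by apply: cme_sum => k; apply: cmeM => //; apply: cmeM => //; exact: cmeJ.
by apply: cme_sum => k; apply: cmeM => //; exact: cme_cst.
Qed.

Lemma measurable_diag_set (S : set (T1 * T2)) : measurable S -> measurable [set t : T | S (t, t)].
Proof.
have mXY : measurable_fun setT (fun t : T => (t : T1, t : T2)).
 by apply: measurable_fun_pair; [exact/measurable_toF/gen_measurable|exact/measurable_toG/gen_measurable].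
by move=> mS; rewrite -[X in measurable X]setTI; exact: mXY.
Qed.

Definition row_good : set T := [set t | [/\ ~ bad_off (t, t), ~ bad_dia (t, t) & forall k, nc (W t k i) < f * sig]].

Lemma measurable_row_good : measurable row_good.
Proof.
have -> : row_good = (~` [set t | bad_off (t, t)] `&` ~` [set t | bad_dia (t, t)]) `&`
  \bigcap_(k in [set: 'I_N]) [set t | nc (W t k i) < f * sig].
 apply/seteqP; split => t.
  by case=> g1 g2 g3; split; [split; [exact: g1|exact: g2]|move=> k _; exact: g3].
 by case=> -[g1 g2] g3; split; [exact: g1|exact: g2|move=> k; exact: (g3 k I)].
apply: measurableI.
 by apply: measurableI; apply: measurableC; apply: measurable_diag_set;
  [exact: measurable_bad_off|exact: measurable_bad_dia].
apply: fin_bigcap_measurable => // k _.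
by apply: mset_lt; [apply: measurable_nc; exact: cme_W|exact: measurable_cst].
Qed.

Lemma prob_row_good : (P (~` row_good) <= ((N.+2)%:R * q)%:E)%E.
Proof.
have q0 : 0 <= q by exact: expR_ge0.
have h1 : (P [set t | bad_off (t, t)] <= q%:E)%E.
 apply: (decouple_set (@gen_measurable _ theta C0 mu N X J1) (@gen_measurable _ theta C0 mu N X J2) indep_row measurable_bad_off) => s.
 have [_ _ h] := ld_row (fun=> 0) (B s); rewrite /ld_bound in h.
 have [hs|hs] := boolP (0 < f * sig ^+ 2 * sqrt (\sum_k \sum_(l | k != l) nc (B s k l) ^+ 2)).
  by apply: le_trans (h hs); rewrite (set_and_true _ hs).
 by rewrite (_ : [set t | _] = set0) ?measure0 ?lee_fin //; apply/seteqP; split => t // [] /=; rewrite (negbTE hs).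
have h2 : (P [set t | bad_dia (t, t)] <= q%:E)%E.
 apply: (decouple_set (@gen_measurable _ theta C0 mu N X J1) (@gen_measurable _ theta C0 mu N X J2) indep_row measurable_bad_dia) => s.
 have [_ h _] := ld_row (fun=> 0) (B s); rewrite /ld_bound in h.
 have [hs|hs] := boolP (0 < f * sig ^+ 2 * sqrt (\sum_k nc (B s k k) ^+ 2)).
  by apply: le_trans (h hs); rewrite (set_and_true _ hs).
 by rewrite (_ : [set t | _] = set0) ?measure0 ?lee_fin //; apply/seteqP; split => t // [] /=; rewrite (negbTE hs).
(* A single entry of the row is the linear form whose coefficients are the indicator of [k]. *)
have h3 k : (P (~` [set t | (nc (W t k i) < f * sig)%R]) <= q%:E)%E.
 have [h _ _] := ld_row (fun l => (l == k)%:R) (fun _ _ => 0); rewrite /ld_bound in h.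
 have e1 : \sum_l nc ((l == k)%:R : R[i]) ^+ 2 = 1.
  rewrite (bigD1 k) //= eqxx nc1 expr1n big1 ?addr0 // => l lk.
  by rewrite (negbTE lk) nc0 expr0n.
 rewrite e1 sqrtr1 mulr1 in h; apply: le_trans (h (mulr_gt0 f0 sig0)).
 rewrite (_ : ~` _ = [set t | f * sig <= nc (\sum_l (l == k)%:R * W t l i)]) //.
 apply/seteqP; split => t /=; rewrite (bigD1 k) //= eqxx mul1r big1 ?addr0;
  try (by move=> l lk; rewrite (negbTE lk) mul0r).
  by move/negP; rewrite -leNgt.
 by rewrite leNgt => /negP.
have mO := measurable_diag_set measurable_bad_off; have mD := measurable_diag_set measurable_bad_dia.
have mK k : measurable [set t | nc (W t k i) < f * sig].
 by apply: mset_lt; [apply: measurable_nc; exact: cme_W|exact: measurable_cst].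
have -> : row_good = (~` [set t | bad_off (t, t)] `&` ~` [set t | bad_dia (t, t)]) `&`
  \bigcap_(k in [set: 'I_N]) [set t | nc (W t k i) < f * sig].
 apply/seteqP; split => t.
  by case=> g1 g2 g3; split; [split; [exact: g1|exact: g2]|move=> k _; exact: g3].
 by case=> -[g1 g2] g3; split; [exact: g1|exact: g2|move=> k; exact: (g3 k I)].
have -> : (N.+2)%:R * q = (q + q) + N%:R * q by rewrite -addn2 natrD; ring.
apply: prob_setCI.
- by apply: measurableI; exact: measurableC.
- by apply: fin_bigcap_measurable.
- apply: prob_setCI; [exact: measurableC|exact: measurableC| |]; by rewrite setCK.
- by have := prob_setC_bigcap mK h3; rewrite card_ord.
Qed.

Lemma row_good_quad t : row_good t ->
 (forall k, nc (W t k i) <= f / sqrt N%:R) /\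
 nc (\sum_(k | k != i) \sum_(l | l != i) ham t i k * B t k l * ham t l i - rc N%:R^-1 * \sum_(k | k != i) B t k k)
  <= 2 * f / N%:R * sqrt (\sum_(k | k != i) \sum_(l | l != i) nc (B t k l) ^+ 2).
Proof.
move=> [ho hd hk]; have es : f * sig = f / sqrt N%:R by rewrite /sig sqrtrV // ltW.
split; first by move=> k; rewrite -es; exact: ltW.
have e0 k : k != i -> ham t i k = conjc (W t k i).
 by move=> ki; rewrite hamE eq_sym (negbTE ki) mulr0n mulr0 add0r W_herm.
have e1 k : k != i -> ham t k i = W t k i by move=> ki; rewrite hamE (negbTE ki) mulr0n mulr0 add0r.
pose O := \sum_k \sum_(l | k != l) conjc (W t k i) * B t k l * W t l i.
pose D := \sum_k conjc (W t k i) * B t k k * W t k i - \sum_k rc (sig ^+ 2) * B t k k.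
have B0l k : B t i k = 0 by rewrite B0 ?eqxx.
have B0r k : B t k i = 0 by rewrite B0 ?eqxx ?orbT.
set q1 := \sum_(k | _) \sum_(l | _) _ * _ * _; set tr1 := \sum_(k | _) B t k k; set qv1 := \sum_(k | _) \sum_(l | _) _.
have eq : q1 - rc N%:R^-1 * tr1 = O + D.
 have -> : O + D = \sum_k \sum_l conjc (W t k i) * B t k l * W t l i - \sum_k rc (sig ^+ 2) * B t k k.
  rewrite /O /D addrA -big_split /=; congr (_ - _); apply: eq_bigr => k _.
  rewrite [RHS](bigD1 k) //= addrC; congr (_ + _); apply: eq_bigl => l; by rewrite eq_sym.
 congr (_ - _).
  rewrite [RHS](bigD1 i) //= [X in _ = X + _]big1 ?add0r; last by move=> l _; rewrite B0l mulr0 mul0r.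
  apply: eq_bigr => k ki; rewrite [RHS](bigD1 i) //= B0r mulr0 mul0r add0r.
  by apply: eq_bigr => l li; rewrite e0 // e1.
 rewrite mulr_sumr [RHS](bigD1 i) //= B0l mulr0 add0r; apply: eq_bigr => k ki.
 by rewrite sig2.
have V0 k l : 0 <= nc (B t k l) ^+ 2 by exact: sqr_ge0.
have qv : qv1 = \sum_k \sum_l nc (B t k l) ^+ 2.
 rewrite [RHS](bigD1 i) //= [X in _ = X + _]big1 ?add0r; last by move=> l _; rewrite B0l nc0 expr0n.
 apply: eq_bigr => k ki; rewrite [RHS](bigD1 i) //= B0r nc0 expr0n /= add0r.
 by [].
have v1 : \sum_k \sum_(l | k != l) nc (B t k l) ^+ 2 <= qv1.
 rewrite qv; apply: ler_sum => k _; rewrite [leRHS](bigD1 k) //=.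
 apply: ler_wpDl => //; apply: eq_ler.
 by apply: eq_bigl => l; rewrite eq_sym.
have v2 : \sum_k nc (B t k k) ^+ 2 <= qv1.
 by rewrite qv; apply: ler_sum => k _; rewrite [leRHS](bigD1 k) //= lerDl sumr_ge0.
have c0 : 0 < f * sig ^+ 2 by rewrite mulr_gt0 // exprn_gt0.
have nO : nc O <= f * sig ^+ 2 * sqrt (\sum_k \sum_(l | k != l) nc (B t k l) ^+ 2).
 have [h|h] := boolP (0 < f * sig ^+ 2 * sqrt (\sum_k \sum_(l | k != l) nc (B t k l) ^+ 2)).
  by rewrite leNgt; apply/negP => h'; apply: ho; split => //=; exact: ltW.
 (* When the variance vanishes [ld_bound] is silent, but then all these coefficients vanish and so
    does the form. *)
 have z1 : \sum_k \sum_(l | k != l) nc (B t k l) ^+ 2 = 0.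
  apply/eqP; rewrite eq_le sumr_ge0 ?andbT => [|k _]; last exact: sumr_ge0.
  by move: h; rewrite pmulr_rgt0 // sqrtr_gt0 -leNgt.
 have O0 : O = 0.
  apply: big1 => k _; apply: big1 => l kl.
  have z2 : \sum_(l | k != l) nc (B t k l) ^+ 2 = 0.
   by apply: (psumr_eq0P _ z1) => // k' _; exact: sumr_ge0.
  have /eqP : nc (B t k l) ^+ 2 = 0 by exact: (psumr_eq0P (fun l _ => V0 k l) z2 kl).
  by rewrite sqrf_eq0 nc_eq0 => /eqP ->; rewrite mulr0 mul0r.
 by rewrite O0 nc0 mulr_ge0 ?sqrtr_ge0 // ltW.
have nD : nc D <= f * sig ^+ 2 * sqrt (\sum_k nc (B t k k) ^+ 2).
 have [h|h] := boolP (0 < f * sig ^+ 2 * sqrt (\sum_k nc (B t k k) ^+ 2)).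
  by rewrite leNgt; apply/negP => h'; apply: hd; split => //=; exact: ltW.
 have z1 : \sum_k nc (B t k k) ^+ 2 = 0.
  apply/eqP; rewrite eq_le sumr_ge0 ?andbT //.
  by move: h; rewrite pmulr_rgt0 // sqrtr_gt0 -leNgt.
 have z2 k : B t k k = 0.
  have /eqP : nc (B t k k) ^+ 2 = 0 by exact: (psumr_eq0P (fun k _ => V0 k k) z1 isT).
  by rewrite sqrf_eq0 nc_eq0 => /eqP.
 have D0 : D = 0 by rewrite /D !big1 ?subrr // => k _; rewrite z2 mulr0 ?mul0r.
 by rewrite D0 nc0 mulr_ge0 ?sqrtr_ge0 // ltW.
rewrite eq; apply: le_trans (ncD _ _) _.
have s1 := ler_wsqrtr v1; have s2 := ler_wsqrtr v2.
have -> : 2 * f / N%:R * sqrt (qv1) =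
 f * sig ^+ 2 * sqrt (qv1) + f * sig ^+ 2 * sqrt (qv1).
 by rewrite sig2; ring.
apply: lerD; [apply: le_trans nO _|apply: le_trans nD _]; by apply: ler_wpM2l => //; exact: ltW.
Qed.
End one_row.

Section minors.
Variables (z : R[i]) (z0 : 0 < Iz z) (i : 'I_N).
Notation T2 := (g_sigma_algebraType (genX (idxD N :\: row_idx i)%SET)).

(** The resolvent of [zrc] has a nonzero entry at [(i, i)]; clearing row and column [i] gives
    coefficients that satisfy [B0], and the forms never involve the cleared entries. *)
Definition punct (A : 'M[R[i]]_N) (k l : 'I_N) : R[i] := if (k == i) || (l == i) then 0 else A k l.

Lemma cme_minor k l : cme (fun s : T2 => res (zrc (ham s) i) z k l).
Proof.
apply: cme_res => // [a b|s]; last by apply: herm_zrc; exact: ham_herm.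
have [h|h] := boolP ((a == i) || (b == i)).
 have -> : (fun s : T2 => zrc (ham s) i a b) = (fun s : T2 => 0) by apply/funext => s; rewrite mxE h.
 exact: cme_cst.
have -> : (fun s : T2 => zrc (ham s) i a b) = (fun s : T2 => rc lam * ((rc (v b s)) *+ (a == b)) + W s a b).
 by apply/funext => s; rewrite mxE (negbTE h) hamE.
apply: cmeD; last first.
 by apply: cme_gen; rewrite !inE ordp_le ordp_mem (negbTE h).
apply: cmeM; first exact: cme_cst.
case: eqVneq => _; last exact: cme_cst.
by apply: cme_rc; apply: mfun_gen; rewrite !inE.
Qed.

Lemma cme_minor2 k l : cme (fun s : T2 => (res (zrc (ham s) i) z *m res (zrc (ham s) i) z) k l).
Proof.
have -> : (fun s : T2 => (res (zrc (ham s) i) z *m res (zrc (ham s) i) z) k l) =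
 (fun s : T2 => \sum_q res (zrc (ham s) i) z k q * res (zrc (ham s) i) z q l) by apply/funext => s; rewrite mxE.
by apply: cme_sum => q; apply: cmeM; exact: cme_minor.
Qed.

Lemma cme_punct (A : T -> 'M[R[i]]_N) k l : (forall k l, cme (fun s : T2 => A s k l)) ->
 cme (fun s : T2 => punct (A s) k l).
Proof. by move=> h; rewrite /punct; case: ((k == i) || (l == i)); [exact: cme_cst|exact: h]. Qed.

Lemma punct0 (A : T -> 'M[R[i]]_N) s k l : (k == i) || (l == i) -> punct (A s) k l = 0.
Proof. by rewrite /punct => ->. Qed.

Lemma punctE (A : 'M[R[i]]_N) k l : k != i -> l != i -> punct A k l = A k l.
Proof. by move=> ki li; rewrite /punct (negbTE ki) (negbTE li). Qed.

Notation M1 := (fun s => punct (res (zrc (ham s) i) z)).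
Notation M2 := (fun s => punct (res (zrc (ham s) i) z *m res (zrc (ham s) i) z)).
(** The coefficients are the resolvent of the minor, for the Schur complement, and its square, which
    appears when the trace is expanded around the minor in [minor_trace_eq]. *)
Definition row_event : set T := row_good i M1 `&` row_good i M2.

Lemma row_eventP : [/\ measurable row_event, (P (~` row_event) <= ((N.+2)%:R * q + (N.+2)%:R * q)%:E)%E &
 forall t, row_event t ->
 [/\ forall k, nc (W t k i) <= f / sqrt N%:R,
   nc (quad_err (ham t) z i) <= 2 * f / N%:R * sqrt (quad_var (ham t) z i) &
   let A := res (zrc (ham t) i) z *m res (zrc (ham t) i) z in
   nc (\sum_(k | k != i) \sum_(l | l != i) ham t i k * A k l * ham t l i - rc N%:R^-1 * \sum_(k | k != i) A k k)
   <= 2 * f / N%:R * sqrt (\sum_(k | k != i) \sum_(l | l != i) nc (A k l) ^+ 2)]].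
Proof.
have c1 k l := cme_punct k l cme_minor; have c2 k l := cme_punct k l cme_minor2.
have z1 := punct0 (fun s => res (zrc (ham s) i) z).
have z2 := punct0 (fun s => res (zrc (ham s) i) z *m res (zrc (ham s) i) z).
have m1 := measurable_row_good c1; have m2 := measurable_row_good c2.
split; first exact: measurableI.
 by apply: prob_setCI => //; exact: prob_row_good.
move=> t [t1 t2]; have [h1 h2] := row_good_quad z1 t1; have [_ h3] := row_good_quad z2 t2.
have e2 (A : 'M[R[i]]_N) (F : R[i] -> 'I_N -> 'I_N -> R[i]) :
  \sum_(k | k != i) \sum_(l | l != i) F (punct A k l) k l = \sum_(k | k != i) \sum_(l | l != i) F (A k l) k l.
 by apply: eq_bigr => k ki; apply: eq_bigr => l li; rewrite punctE.
have e1 (A : 'M[R[i]]_N) : \sum_(k | k != i) punct A k k = \sum_(k | k != i) A k k.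
 by apply: eq_bigr => k ki; rewrite punctE.
have e3 (A : 'M[R[i]]_N) : \sum_(k | k != i) \sum_(l | l != i) nc (punct A k l) ^+ 2 = \sum_(k | k != i) \sum_(l | l != i) nc (A k l) ^+ 2.
 by apply: eq_bigr => k ki; apply: eq_bigr => l li; rewrite punctE.
split => //.
 move: h2; rewrite (e2 _ (fun x k l => ham t i k * x * ham t l i)) e1 e3.
 exact.
by move: h3; rewrite (e2 _ (fun x k l => ham t i k * x * ham t l i)) e1 e3.
Qed.
End minors.
End rows.

Section exponential.
Context {R : realType}.

Lemma expR_quad (x : R) : `|x| <= 2^-1 -> expR x <= 1 + x + 2 * x ^+ 2.
Proof.
rewrite ler_norml => /andP[h1 h2].
have h := expR_ge1Dx (- x); rewrite expRN in h.
have p0 : 0 < 1 - x by lra.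
have h3 : expR x <= (1 - x)^-1.
 by rewrite -[expR x]invrK lef_pV2 ?posrE ?invr_gt0 ?expR_gt0.
apply: (le_trans h3); rewrite -[(1 - x)^-1]mul1r ler_pdivrMr //.
have : 0 <= x ^+ 2 * (1 - 2 * x) by rewrite mulr_ge0 ?sqr_ge0 //; lra.
move=> h4; have -> : (1 + x + 2 * x ^+ 2) * (1 - x) = 1 + x ^+ 2 * (1 - 2 * x) by ring.
by rewrite lerDl.
Qed.
End exponential.

Section moments.
Context {R : realType} {d : measure_display} {T : measurableType d} (P : probability T R).
Let hE := expectation_is_mean P.

Lemma prob_indic (A : set T) : measurable A -> P A = (\int[P]_t \1_A t)%:E.
Proof.
move=> mA; rewrite /Rintegral integral_indic // setIT fineK //; exact: fin_num_measure.
Qed.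

Lemma prob_markov (A : set T) (g : T -> R) : measurable A -> bmf g -> (forall t, 0 <= g t) ->
 (forall t, A t -> 1 <= g t) -> (P A <= (\int[P]_t g t)%:E)%E.
Proof.
move=> mA bg g0 hA; rewrite prob_indic // lee_fin; apply: (mean_le hE) => //; first exact: bmf_indic.
move=> t; rewrite indicE; case: (boolP (t \in A)) => [/set_mem/hA //|_]; exact: g0.
Qed.
End moments.

(** * Concentration of the sampled potential *)

Section potential.
Context {R : realType} (theta C0 : R) (mu : probability (measurableTypeR R) R) (N : nat).
Variable X : deformed_wigner theta C0 mu N.
Notation T := (dw_space X).
Notation P := (dw_prob X).
Notation v := (@dw_v _ _ _ _ _ X).
Notation genX := (@gen _ theta C0 mu N X).
Hypothesis N0 : (0 < N)%N.
Let hE := expectation_is_mean P.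
Let hmu := law_is_mean mu.

Lemma bmf_v i (f : R -> R) : bmf f -> bmf (fun t : T => f (v i t)).
Proof.
move=> [mf [M hM]]; split; last by exists M => t.
by apply: measurableT_comp mf _; exact: mfun_v.
Qed.

Lemma mean_v i (f : R -> R) : bmf f -> \int[P]_t f (v i t) = \int[mu]_x f x.
Proof.
move=> bf; have [_ _ hv] := dw_potential X.
have mv : measurable_fun setT (v i : T -> measurableTypeR R) := mfun_v i.
pose V : {mfun T >-> measurableTypeR R} := HB.pack (v i : T -> measurableTypeR R) (isMeasurableFun.Build _ _ _ _ _ mv).
have [mf _] := bf.
rewrite /Rintegral; congr fine.
transitivity (\int[distribution P V]_x (f x)%:E)%E.
 rewrite integral_distribution //; first exact/measurable_EFinP.
 exact: (bmf_integrable P (bmf_v i bf)).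
by apply: eq_measure_integral => A mA _; exact: hv.
Qed.

Lemma mean_prod_v (f : R -> R) (s : seq 'I_N) : bmf f -> uniq s ->
 bmf (fun t : T => \prod_(i <- s) f (v i t)) /\
 \int[P]_t (\prod_(i <- s) f (v i t)) = (\int[mu]_x f x) ^+ size s.
Proof.
move=> bf; elim: s => [|i s IH] /=.
 have -> : (fun t : T => \prod_(i <- [::]) f (v i t)) = (fun=> 1) by apply/funext => t; rewrite big_nil.
 by split; [exact: bmf_cst|rewrite (mean_cst hE)].
move=> /andP[is_ us]; have [bp ep] := IH us.
have e : (fun t : T => \prod_(j <- i :: s) f (v j t)) = (fun t => f (v i t) * \prod_(j <- s) f (v j t)).
 by apply/funext => t; rewrite big_cons.
rewrite e; split; first by apply: bmfM => //; exact: bmf_v.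
pose J1 : {set idx N} := finset (fun k : 'I_N * 'I_N + 'I_N => match k with inl _ => false | inr j => j == i end).
pose J2 : {set idx N} := finset (fun k : 'I_N * 'I_N + 'I_N => match k with inl _ => false | inr j => j \in s end).
have ind : independent_classes P <<s genX J1 >> <<s genX J2 >>.
 apply: gen_indep.
 - by apply/fintype.subsetP => -[p|k]; rewrite !inE.
 - by apply/fintype.subsetP => -[p|k]; rewrite !inE.
 - apply/fintype.pred0P => -[p|k] /=; rewrite !inE //.
  by case: eqVneq => //= ->; rewrite (negbTE is_).
have [mf _] := bf.
rewrite (indep_expectation (@gen_measurable _ theta C0 mu N X J1) (@gen_measurable _ theta C0 mu N X J2) ind (bmf_v i bf) bp).
- by rewrite mean_v // ep exprS.
- by apply: measurableT_comp mf _; apply: mfun_gen; rewrite inE.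
- have h (r : seq 'I_N) : {subset r <= s} -> measurable_fun setT (fun t : g_sigma_algebraType (genX J2) => \prod_(j <- r) f (v j t)).
  elim: r => [|j r IHr] rs.
   have -> : (fun t : g_sigma_algebraType (genX J2) => \prod_(j <- [::]) f (v j t)) = (fun=> 1) by apply/funext => t; rewrite big_nil.
   exact: measurable_cst.
  have -> : (fun t : g_sigma_algebraType (genX J2) => \prod_(j <- j :: r) f (v j t)) = (fun t => f (v j t) * \prod_(j <- r) f (v j t)) by apply/funext => t; rewrite big_cons.
  apply: measurable_funM; last by apply: IHr => k kr; apply: rs; rewrite inE kr orbT.
  by apply: measurableT_comp mf _; apply: mfun_gen; rewrite inE rs // inE eqxx.
 exact: h.
Qed.

(** Chernoff's bound with parameter [s = 1 / (2 M sqrt N)]: each factor has mean at most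
    [exp (2 (s M)^2)], the [N] of them contribute [exp (1/2) <= 2], and the threshold contributes
    [exp (- La)]. *)
Lemma v_deviation (f : R -> R) (M La : R) : bmf f -> (forall x, `|f x| <= M) -> 0 < M -> 0 < La ->
 \int[mu]_x f x = 0 ->
 (P [set t : T | (2 * M * sqrt N%:R * La <= \sum_i f (v i t))%R] <= (2 * expR (- La))%:E)%E.
Proof.
move=> bf hM M0 L0 f0; have [mf _] := bf.
have Np : 0 < N%:R :> R by rewrite ltr0n.
have Np1 : 1 <= sqrt N%:R :> R by rewrite -[X in X <= _]sqrtr1 ler_wsqrtr // ler1n.
set r := sqrt N%:R in Np1 *; have r0 : 0 < r by exact: lt_le_trans Np1.
have r2 : r ^+ 2 = N%:R by rewrite sqr_sqrtr // ltW.
pose s := (2 * r * M)^-1; have s0 : 0 < s by rewrite invr_gt0 !mulr_gt0.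
pose e x := expR (s * f x).
have hs x : `|s * f x| <= 2^-1.
 rewrite normrM gtr0_norm //; apply: (via (s * M)); first by apply: ler_wpM2l => //; exact: ltW.
 have -> : s * M = 2^-1 * r^-1 by rewrite /s; field; rewrite !gt_eqF.
 by rewrite -[leRHS]mulr1; apply: ler_wpM2l => //; rewrite invf_le1.
have me : measurable_fun setT e by apply: measurableT_comp => //; apply: measurable_funM => //; exact: measurable_cst.
have be : bmf e.
 split => //; exists (expR 2^-1) => x; rewrite ger0_norm ?expR_ge0 // ler_expR.
 exact: le_trans (ler_norm _) (hs x).
have me1 : \int[mu]_x e x <= expR (2 * (s * M) ^+ 2).
 apply: (via (\int[mu]_x (s * f x + (1 + 2 * (s * M) ^+ 2)))).
  apply: (mean_le hmu) => //; first by apply: bmfD; [exact: bmfZ|exact: bmf_cst].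
  move=> x; apply: le_trans (expR_quad (hs x)) _; rewrite [1 + _]addrC -addrA lerD2l lerD2l ler_wpM2l //.
  rewrite -(real_normK (num_real (s * f x))) ler_sqr ?nnegrE //; last by rewrite mulr_ge0 ?(ltW s0) ?(ltW M0).
  by rewrite normrM gtr0_norm // ler_wpM2l // ltW.
 have b1 : bmf (fun x => s * f x) by exact: bmfZ.
 rewrite (meanD hmu b1 (bmf_cst _)) (meanZ hmu _ bf) f0 mulr0 add0r (mean_const hmu).
 exact: expR_ge1Dx.
have [bp ep] := mean_prod_v be (enum_uniq 'I_N).
pose a := 2 * M * r * La.
pose g t := expR (- s * a) * \prod_(i <- enum 'I_N) e (v i t).
have gE t : g t = expR (s * (\sum_i f (v i t) - a)).
 rewrite /g -expR_sum -expRD; congr expR; rewrite big_enum /= mulrBr mulr_sumr; ring.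
have mA : measurable [set t : T | (a <= \sum_i f (v i t))%R].
 apply: mset_le; first exact: measurable_cst.
 by apply: measurable_sum => i; apply: measurableT_comp mf _; exact: mfun_v.
have bg : bmf g by exact: bmfZ.
have g0 t : 0 <= g t by rewrite gE expR_ge0.
have gA t : [set t : T | (a <= \sum_i f (v i t))%R] t -> 1 <= g t.
 by move=> /= ht; rewrite gE -expR0 ler_expR mulr_ge0 ?(ltW s0) // subr_ge0.
have hm := prob_markov P mA bg g0 gA; apply: (le_trans hm).
rewrite lee_fin (meanZ hE _ bp) ep -cardE card_ord.
apply: (via (expR (- s * a) * expR (2 * (s * M) ^+ 2) ^+ N)).
 apply: ler_wpM2l; first exact: expR_ge0.
 apply: lerXn2r => //; rewrite nnegrE ?expR_ge0 //.
 by apply: (mean_ge0 hmu) => // x; exact: expR_ge0.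
rewrite -expRM_natl -expRD.
have -> : - s * a + N%:R * (2 * (s * M) ^+ 2) = 2^-1 - La.
 by rewrite -r2 /s /a; field; rewrite !gt_eqF.
rewrite expRD; apply: ler_wpM2r; first exact: expR_ge0.
have h : `|2^-1 : R| <= 2^-1 by rewrite ger0_norm.
by apply: le_trans (expR_quad h) _; lra.
Qed.

Lemma v_conc (lam : R) (w : R[i]) (La : R) : 0 < Iz w -> 0 < La ->
 exists A : set T, [/\ measurable A, (P (~` A) <= (8 * expR (- La))%:E)%E &
  forall t, A t -> nc (stj (emp (v^~ t)) lam w - stj (fun f => \int[mu]_x f x) lam w)
    <= 8 * La / (Iz w * sqrt N%:R)].
Proof.
move=> w0 L0; pose M := 2 / Iz w; have M0 : 0 < M by rewrite divr_gt0.
have Np : 0 < N%:R :> R by rewrite ltr0n.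
have r0 : 0 < sqrt N%:R :> R by rewrite sqrtr_gt0.
pose a := 2 * M * sqrt N%:R * La.
have [b1 b2] := cbm_gr lam w0.
have key (g : R -> R) : bmf g -> (forall x, `|g x| <= (Iz w)^-1) ->
  exists A : set T, [/\ measurable A, (P (~` A) <= (4 * expR (- La))%:E)%E &
   forall t, A t -> `|emp (v^~ t) g - \int[mu]_x g x| <= a / N%:R].
 move=> bg hg; set mg := \int[mu]_x g x.
 have hmg : `|mg| <= (Iz w)^-1.
  rewrite ler_norml -[X in _ <= _ <= X](mean_const hmu) -[X in X <= _ <= _](mean_const hmu).
  by apply/andP; split; apply: (mean_le hmu) => //; try exact: bmf_cst; move=> x; have := hg x; rewrite ler_norml => /andP[].
 pose f1 x := g x - mg; pose f2 x := mg - g x.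
 have bf1 : bmf f1 by apply: bmfB => //; exact: bmf_cst.
 have bf2 : bmf f2 by apply: bmfB => //; exact: bmf_cst.
 have h1 x : `|f1 x| <= M.
  apply: le_trans (ler_normB _ _) _; rewrite /M; have -> : 2 / Iz w = (Iz w)^-1 + (Iz w)^-1 by ring.
  exact: lerD.
 have h2 x : `|f2 x| <= M by rewrite /f2 distrC; exact: h1.
 have z1 : \int[mu]_x f1 x = 0 by rewrite (meanB hmu bg (bmf_cst _)) (mean_const hmu) subrr.
 have z2 : \int[mu]_x f2 x = 0 by rewrite (meanB hmu (bmf_cst _) bg) (mean_const hmu) subrr.
 have p1 := v_deviation bf1 h1 M0 L0 z1; have p2 := v_deviation bf2 h2 M0 L0 z2.
 have ms (f : R -> R) : bmf f -> measurable [set t : T | (a <= \sum_i f (v i t))%R].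
  move=> [mf _]; apply: mset_le; first exact: measurable_cst.
  by apply: measurable_sum => i; apply: measurableT_comp mf _; exact: mfun_v.
 exists (~` [set t : T | (a <= \sum_i f1 (v i t))%R] `&` ~` [set t : T | (a <= \sum_i f2 (v i t))%R]); split.
 - by apply: measurableI; apply: measurableC; exact: ms.
 - have -> : 4 * expR (- La) = 2 * expR (- La) + 2 * expR (- La) by ring.
  by apply: prob_setCI; rewrite ?setCK //; apply: measurableC; exact: ms.
 move=> t [/= /negP n1 /negP n2]; rewrite -ltNge in n1; rewrite -ltNge in n2.
 have e1 : \sum_i f1 (v i t) = N%:R * (emp (v^~ t) g - mg).
  by rewrite /f1 sumrB sumr_const card_ord /emp mulrBr mulVKf ?gt_eqF // mulr_natl.
 have e2 : \sum_i f2 (v i t) = - (N%:R * (emp (v^~ t) g - mg)).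
  by rewrite -e1 -sumrN; apply: eq_bigr => i _; rewrite /f1 /f2 opprB.
 rewrite e1 in n1; rewrite e2 in n2.
 by rewrite ler_pdivlMr // -{1}(gtr0_norm Np) -normrM mulrC ler_norml; apply/andP; split; lra.
have g1 x : `|Rz (gr lam w x)| <= (Iz w)^-1 by apply: le_trans (Re_le _) (gr_nc _ _ w0).
have g2 x : `|Iz (gr lam w x)| <= (Iz w)^-1 by apply: le_trans (Im_le _) (gr_nc _ _ w0).
have [A1 [mA1 pA1 hA1]] := key _ b1 g1.
have [A2 [mA2 pA2 hA2]] := key _ b2 g2.
exists (A1 `&` A2); split; first exact: measurableI.
 have -> : 8 * expR (- La) = 4 * expR (- La) + 4 * expR (- La) by ring.
 exact: prob_setCI.
move=> t [/hA1 k1 /hA2 k2]; apply: le_trans (nc_le_ReIm _) _; rewrite cReB cImB.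
apply: (via (a / N%:R + a / N%:R)); first exact: lerD.
have -> : a / N%:R + a / N%:R = 8 * La / (Iz w * sqrt N%:R).
 rewrite /a /M -{2 4}(sqr_sqrtr (ltW Np)); by field; rewrite !gt_eqF.
by [].
Qed.
End potential.

(** * Truncation of the matrix entries *)

Section truncation.
Context {R : realType} {d : measure_display} {T : measurableType d} (P : probability T R).
Variables (w : T -> R[i]) (theta C0 M La s : R).
Hypotheses (mw : cme w) (theta0 : 0 < theta) (C00 : 0 < C0) (M0 : 0 < M) (La0 : 0 < La) (s0 : 0 < s)
 (MLa : s * M = La).
Hypothesis tail : forall x : R, 0 < x ->
 (P [set t | (x < s * nc (w t))%R] <= (C0 * expR (- x `^ theta^-1))%:E)%E.
Hypothesis big : 3 * theta <= La `^ theta^-1.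
Notation tau := (8 * M ^+ 2 * C0 * expR (- La `^ theta^-1)).
Let mnc := measurable_nc mw.

Definition out : set T := [set t | M < nc (w t)].
Lemma measurable_out : measurable out.
Proof. by apply: mset_lt => //; exact: measurable_cst. Qed.

(** Here [(2^k La)^(1/theta)] is at least [La^(1/theta) (1 + k ln 2 / theta)], and [big] makes the
    second part at least [3 k ln 2], which is the factor [8^-k]. *)
Lemma tail_k (k : nat) : (P [set t | (2 ^+ k * M < nc (w t))%R] <= (C0 * expR (- La `^ theta^-1) / 8 ^+ k)%:E)%E.
Proof.
have x0 : 0 < 2 ^+ k * La by rewrite mulr_gt0 ?exprn_gt0.
have e : [set t | (2 ^+ k * M < nc (w t))%R] = [set t | (2 ^+ k * La < s * nc (w t))%R].
 by apply/seteqP; split => t /=; rewrite -MLa mulrCA ltr_pM2l.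
rewrite e; apply: le_trans (tail x0) _; rewrite lee_fin -mulrA; apply: ler_wpM2l; first exact: ltW.
have -> : (8 ^+ k)^-1 = expR (- (3 * k%:R * ln 2)) :> R.
 have -> : 3 * k%:R * ln 2 = k%:R * (3%:R * ln 2) :> R by ring.
 by rewrite expRN expRM_natl expRM_natl lnK ?posrE //; congr ((_ ^+ _)^-1); ring.
rewrite -expRD ler_expR -opprD lerN2 powRM ?exprn_ge0 ?(ltW La0) //.
have -> : (2 ^+ k) `^ theta^-1 = expR (theta^-1 * (k%:R * ln 2)) :> R.
 by rewrite /powR expf_eq0 pnatr_eq0 andbF lnXn // mulr_natl.
have l2 : 0 <= ln 2 :> R by rewrite ln_ge0 // ler1n.
have h := expR_ge1Dx (theta^-1 * (k%:R * ln 2)).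
have L0 : 0 <= La `^ theta^-1 by exact: powR_ge0.
apply: (via ((1 + theta^-1 * (k%:R * ln 2)) * La `^ theta^-1)); last exact: ler_wpM2r.
rewrite [leRHS]mulrDl mul1r lerD2l.
have : theta^-1 * (k%:R * ln 2) * (3 * theta) <= theta^-1 * (k%:R * ln 2) * La `^ theta^-1.
 by apply: ler_wpM2l => //; rewrite mulr_ge0 ?invr_ge0 ?(ltW theta0) // mulr_ge0.
by apply: le_trans; apply: eq_ler; field; rewrite gt_eqF.
Qed.

(** Dyadic layers: where [2^k M < |w| <= 2^(k+1) M] the square is at most [4^(k+1) M^2], so [tail_k]
    leaves [4 * 2^-k]; summing over [k] gives the [8] in [tau]. *)
Lemma tail_sqr : (\int[P]_t (nc (w t) ^+ 2 * \1_out t)%:E <= tau%:E)%E.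
Proof.
pose F k t := (4 ^+ k.+1 * M ^+ 2 * \1_[set t | 2 ^+ k * M < nc (w t)] t)%:E.
have mS k : measurable [set t | 2 ^+ k * M < nc (w t)] by apply: mset_lt => //; exact: measurable_cst.
have c0 k : 0 <= 4 ^+ k.+1 * M ^+ 2 by rewrite mulr_ge0 ?sqr_ge0 // exprn_ge0.
have F0 k t : (0 <= F k t)%E by rewrite lee_fin mulr_ge0.
have mF k : measurable_fun setT (F k).
 by apply/measurable_EFinP; apply: measurable_funM; [exact: measurable_cst|exact: measurable_indic].
apply: (via (\int[P]_t (\sum_(0 <= k <oo) F k t))%E).
 apply: ge0_le_integral => //.
 - by move=> t _; rewrite lee_fin mulr_ge0 ?sqr_ge0.
 - apply/measurable_EFinP; apply: measurable_funM; first exact: measurable_nc2.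
  exact/measurable_indic/measurable_out.
 - by apply: ge0_emeasurable_sum.
 move=> t _; rewrite indicE; case: (boolP (t \in out)) => [/set_mem ht|_]; last first.
  by rewrite mulr0; apply: nneseries_ge0.
 have [n hn] : exists n, nc (w t) <= 2 ^+ n * M.
  have [n hn] : exists n, nc (w t) / M <= n%:R.
   exists (Num.trunc (nc (w t) / M)).+1; apply: ltW; exact: Num.Theory.truncnS_gt.
  exists n; rewrite -ler_pdivrMr //; apply: le_trans hn _.
  by rewrite -natrX ler_nat; apply: ltnW; exact: ltn_expl.
 have ex : exists n, nc (w t) <= 2 ^+ n * M by exists n.
 case: (ex_minnP ex) => -[|k] hk hmin.
  by move: hk; rewrite expr0 mul1r leNgt; move: ht; rewrite /out /= => ->.
 have hk' : 2 ^+ k * M < nc (w t).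
  by rewrite ltNge; apply/negP => /hmin; rewrite ltnn.
 apply: (via (F k t)).
  rewrite lee_fin indicE mem_set // !mulr1.
  have -> : 4 ^+ k.+1 * M ^+ 2 = (2 ^+ k.+1 * M) ^+ 2.
   by rewrite exprMn -exprM mulnC exprM; congr (_ ^+ _ * _); ring.
  by rewrite ler_sqr ?nnegrE ?nc_ge0 // mulr_ge0 ?exprn_ge0 // ltW.
 apply: le_trans (nneseries_lim_ge k.+1 (fun n _ _ => F0 n t)).
 rewrite big_nat_recr //=; apply: leeDr; exact: sume_ge0.
rewrite integral_nneseries //.
apply: (via (\sum_(0 <= k <oo) (tau / (2 ^ k.+1)%:R)%:E)%E); last first.
 by apply: epsilon_trick0; rewrite !mulr_ge0 ?sqr_ge0 ?expR_ge0 // ltW.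
apply: lee_nneseries => [k _ _|k _]; first exact: integral_ge0.
have -> : (\int[P]_t F k t = (4 ^+ k.+1 * M ^+ 2)%:E * P [set t | (2 ^+ k * M < nc (w t))%R])%E.
 rewrite -[in RHS](setIT [set t | (2 ^+ k * M < nc (w t))%R]) -integral_indic // -ge0_integralZl //.
 - by apply/measurable_EFinP; exact: measurable_indic.
 - by rewrite lee_fin.
apply: (via ((4 ^+ k.+1 * M ^+ 2)%:E * (C0 * expR (- La `^ theta^-1) / 8 ^+ k)%:E)%E).
 by apply: lee_wpmul2l; [rewrite lee_fin|exact: tail_k].
rewrite -EFinM lee_fin natrX; apply: eq_ler.
have e8 : 8 ^+ k = 4 ^+ k * 2 ^+ k :> R by rewrite -exprMn; congr (_ ^+ _); ring.
have p2 : 2 ^+ k != 0 :> R by rewrite expf_neq0.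
have p4 : 4 ^+ k != 0 :> R by rewrite expf_neq0.
by rewrite e8 !exprS; field; rewrite p2 p4.
Qed.

Hypothesis fin2 : P.-integrable setT (fun t => (nc (w t) ^+ 2)%:E).

Lemma trunc_part (g : T -> R) (K : R) : measurable_fun setT g -> 0 <= K ->
 (forall t, `|g t| <= 1 + nc (w t) ^+ 2) -> (forall t, out t -> `|g t| <= K * nc (w t) ^+ 2) ->
 `|\int[P]_t (if nc (w t) <= M then g t else 0) - \int[P]_t g t| <= K * tau.
Proof.
move=> mg K0 hg hK.
have i1 : P.-integrable setT (fun t => (1 + nc (w t) ^+ 2)%:E).
 have h : P.-integrable setT (EFin \o (fun _ : T => 1 : R)) by apply: bmf_integrable; exact: bmf_cst.
 exact: (integrableD measurableT h fin2).
have ig : P.-integrable setT (EFin \o g).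
 apply: le_integrable i1 => //; first exact/measurable_EFinP.
 move=> t _; rewrite /= lee_fin [leRHS]ger0_norm ?addr_ge0 ?sqr_ge0 //.
pose h t := g t * \1_out t.
have mh : measurable_fun setT h.
 by apply: measurable_funM => //; exact/measurable_indic/measurable_out.
have mS : measurable_fun setT (fun t => nc (w t) ^+ 2 * \1_out t).
 by apply: measurable_funM; [exact: measurable_nc2|exact/measurable_indic/measurable_out].
have hS t : `|h t| <= K * (nc (w t) ^+ 2 * \1_out t).
 rewrite /h indicE; case: (boolP (t \in out)) => [/set_mem/hK ht|_]; last by rewrite !mulr0 normr0.
 by rewrite !mulr1.
have iS : P.-integrable setT (EFin \o (fun t => nc (w t) ^+ 2 * \1_out t)).
 apply: le_integrable fin2 => //; first exact/measurable_EFinP.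
 move=> t _; rewrite /= lee_fin normrM [leRHS]ger0_norm ?sqr_ge0 // [`|nc _ ^+ 2|]ger0_norm ?sqr_ge0 //.
 rewrite -[leRHS]mulr1; apply: ler_wpM2l; first exact: sqr_ge0.
 by rewrite indicE; case: (t \in out); rewrite ?normr1 ?normr0.
have ih : P.-integrable setT (EFin \o h).
 apply: le_integrable ig => //; first exact/measurable_EFinP.
 move=> t _; rewrite /= lee_fin /h normrM -[leRHS]mulr1; apply: ler_wpM2l => //.
 by rewrite indicE; case: (t \in out); rewrite ?normr1 ?normr0.
have e : (fun t => if nc (w t) <= M then g t else 0) = (fun t => g t - h t).
 apply/funext => t; rewrite /h indicE; case: leP => ht.
  by rewrite (_ : t \in out = false) ?mulr0 ?subr0 //; apply/negP => /set_mem; rewrite /out /= ltNge ht.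
 by rewrite mem_set // mulr1 subrr.
rewrite e RintegralB // addrAC subrr add0r normrN.
apply: le_trans (le_normr_Rintegral _ ih) _ => //.
have iK : P.-integrable setT (EFin \o (fun t => K * (nc (w t) ^+ 2 * \1_out t))) by exact: (integrableZl measurableT K iS).
apply: (via (\int[P]_t (K * (nc (w t) ^+ 2 * \1_out t)))).
 apply: le_Rintegral => //; exact: integrable_norm.
rewrite RintegralZl //; apply: ler_wpM2l => //.
rewrite -lee_fin /Rintegral fineK; first exact: tail_sqr.
exact: integrable_fin_num.
Qed.

(** Truncated entries keep all products bounded, hence inside the class where means are linear; on
    the good events truncation changes nothing. *)
Definition trunc t : R[i] := if nc (w t) <= M then w t else 0.

Lemma cme_trunc : cme trunc.
Proof.
have h (g : T -> R) : measurable_fun setT g -> measurable_fun setT (fun t => if nc (w t) <= M then g t else 0).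
 move=> mg; apply: (measurable_fun_ifT (measurable_fun_ler mnc (measurable_cst M))) => //.
have [m1 m2] := mw; split; [have := h _ m1|have := h _ m2]; congr measurable_fun;
 by apply/funext => t; rewrite /trunc; case: ifP.
Qed.

Lemma nc_trunc t : nc (trunc t) <= M.
Proof. by rewrite /trunc; case: ifP => // _; rewrite nc0 ltW. Qed.

Lemma trunc_moments (M1 : M <= 1) :
 let E := fun f : T -> R => \int[P]_t f t in
 (cmean E w = 0 -> nc (cmean E trunc) <= 2 * (tau / M)) /\
 `|E (fun t => nc (trunc t) ^+ 2) - E (fun t => nc (w t) ^+ 2)| <= 2 * (tau / M).
Proof.
move=> E; have [m1 m2] := mw.
have t0 : 0 <= tau by rewrite !mulr_ge0 ?sqr_ge0 ?expR_ge0 // ltW.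
have Mi : 1 <= M^-1 by rewrite invf_ge1.
have iM : 0 <= M^-1 by rewrite invr_ge0 ltW.
have K1 t : out t -> nc (w t) <= M^-1 * nc (w t) ^+ 2.
 move=> ht; rewrite mulrC ler_pdivlMr // expr2; apply: ler_wpM2l; [exact: nc_ge0|exact: ltW].
have nle t : nc (w t) <= 1 + nc (w t) ^+ 2.
 by have := sqr_ge0 (nc (w t) - 1); rewrite sqrrB1; have := nc_ge0 (w t); lra.
have key (g : T -> R) (g' : T -> R) : measurable_fun setT g -> (forall t, `|g t| <= 1 + nc (w t) ^+ 2) ->
  (forall t, out t -> `|g t| <= M^-1 * nc (w t) ^+ 2) ->
  (forall t, g' t = if nc (w t) <= M then g t else 0) -> `|E g' - E g| <= tau / M.
 move=> mg hg ho eg; have -> : g' = (fun t => if nc (w t) <= M then g t else 0) by apply/funext.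
 by rewrite [tau / M]mulrC; apply: trunc_part.
split=> [[e1 e2]|].
- apply: le_trans (nc_le_ReIm _) _; rewrite mulr2n mulrDl mul1r; apply: lerD => /=.
 + rewrite -[X in `|X|]subr0 -e1; apply: key => // [t|t ht|t]; last by rewrite /trunc; case: ifP.
   exact: le_trans (Re_le _) (nle t).
  exact: le_trans (Re_le _) (K1 t ht).
 + rewrite -[X in `|X|]subr0 -e2; apply: key => // [t|t ht|t]; last by rewrite /trunc; case: ifP.
   exact: le_trans (Im_le _) (nle t).
  exact: le_trans (Im_le _) (K1 t ht).
- have h : 0 <= tau / M by rewrite divr_ge0 // ltW.
 apply: le_trans (_ : tau / M <= _); last by apply: ler_peMl => //; rewrite ler1n.
 apply: key => [|t|t _|t]; [exact: measurable_nc2| | |].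
 + by rewrite ger0_norm ?sqr_ge0 // lerDr.
 + by rewrite ger0_norm ?sqr_ge0 // -[leLHS]mul1r; apply: ler_wpM2r => //; exact: sqr_ge0.
 + by rewrite /trunc; case: ifP => // _; rewrite nc0 expr0n.
Qed.
End truncation.

(** * Weak law down a column of dyadic heights *)

Section weak_law.
Context {R : realType} (N : nat) (N0 : (0 < N)%N).
Variables (H : 'M[R[i]]_N) (hH : herm H) (lam : R) (v : 'I_N -> R) (D : 'I_N -> R[i]).
Variables (La c : R) (m : R[i] -> R[i]).
Hypotheses (La1 : 1 <= La) (c0 : 0 < c) (c1 : c <= 1) (HD : forall i, H i i = rc (lam * v i) + D i)
 (hD : forall i, nc (D i) <= La / sqrt N%:R).
Notation F z := (stj (emp v) lam (z + m z)).
Notation u z := (La / sqrt (N%:R * Iz z)).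

Let Np : 0 < N%:R :> R. by rewrite ltr0n. Qed.

(** What the probabilistic input provides at one point. The smallness [2 * 10^4 u <= c^5] makes the
    error [3 * 10^3 u / c^4] of [controlled] less than [c / 4], the margin needed to continue the
    induction. *)
Definition regular z := [/\ 0 < Iz z, Iz z <= 2, c <= Iz (m z), 2 * 10 ^+ 4 * u z <= c ^+ 5 &
 (forall i, nc (quad_err H z i) <= 2 * La / N%:R * sqrt (quad_var H z i)) /\
 nc (F z - m z) <= 8 * La / (c * sqrt N%:R)].

Definition controlled z := [/\ Iz (mN H z) <= 4, c / 4 <= Iz (z + mN H z),
 nc (mN H z - m z) <= 3 * 10 ^+ 3 * u z / c ^+ 4,
 (forall i, nc (res H z i i) <= 8 / c) &
 (forall i, nc (res H z i i - gr lam (z + mN H z) (v i)) <= 288 * u z / c ^+ 2)].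

Lemma u_bound z : 0 < Iz z -> Iz z <= 2 -> La / sqrt N%:R <= 2 * u z.
Proof.
move=> z0 z2; rewrite mulrA [2 * La]mulrC -mulrA; apply: ler_wpM2l; first exact: le_trans La1.
rewrite sqrtrM ?(ltW Np) // invfM mulrCA -[leLHS]mulr1; apply: ler_wpM2l; first by rewrite invr_ge0 sqrtr_ge0.
rewrite ler_pdivlMr ?sqrtr_gt0 // mul1r -[leRHS]ger0_norm // -sqrtr_sqr; apply: ler_wsqrtr.
by apply: le_trans z2 _; rewrite expr2 -natrM ler_nat.
Qed.

Lemma weak_point z : regular z -> Iz (mN H z) <= 4 -> c / 4 <= Iz (z + mN H z) -> controlled z.
Proof.
move=> [z0 z2 hc hu [hq hb]] h4 hw.
have L0 : 0 < La by exact: lt_le_trans La1.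
have sq0 : 0 < sqrt (N%:R * Iz z) by rewrite sqrtr_gt0 mulr_gt0.
have u0 : 0 < u z by rewrite divr_gt0.
have c5 : c ^+ 5 <= c by rewrite exprS -[leRHS]mulr1; apply: ler_wpM2l; [exact: ltW|rewrite expr_le1 // ltW].
have u1 : u z <= 1 by move: hu c5 c1; move: (c ^+ 5) (u z) => a b; lra.
have Neta : 1 <= N%:R * Iz z.
 have : 1 <= sqrt (N%:R * Iz z) by apply: le_trans La1 _; move: u1; rewrite ler_pdivrMr // mul1r.
 by rewrite -{1}sqrtr1 ler_psqrt ?nnegrE // mulr_ge0 // ltW.
have b0 : 0 < c / 4 by rewrite divr_gt0.
have hL := u_bound z0 z2.
have he : La / sqrt N%:R + 7 * La / sqrt (N%:R * Iz z) <= 9 * u z.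
 have -> : 7 * La / sqrt (N%:R * Iz z) = 7 * u z by ring.
 by move: hL; move: (u z) (La / _) => a b; lra.
have heb : La / sqrt N%:R + 7 * La / sqrt (N%:R * Iz z) <= c / 4 / 2.
 by apply: le_trans he _; move: hu c5; move: (c ^+ 5) (u z) => a b; lra.
have e2 : 2 * (La / sqrt N%:R + 7 * La / sqrt (N%:R * Iz z)) / (c / 4) ^+ 2 <= 288 * u z / c ^+ 2.
 have -> : 288 * u z / c ^+ 2 = 2 * (9 * u z) / (c / 4) ^+ 2 by field; rewrite ?gt_eqF.
 by apply: ler_wpM2r; [rewrite invr_ge0 sqr_ge0|apply: ler_wpM2l].
have wd i := @weak_diag _ N N0 H hH lam v D z z0 La _ (c / 4) La1 HD hD hq Neta h4 b0 hw heb i.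
have ws := @weak_self _ N N0 H hH lam v D z z0 La _ (c / 4) La1 HD hD hq Neta h4 b0 hw heb.
have ws' := le_trans ws e2.
have k1 : nc (mN H z - m z) <= 8 / c ^+ 2 * (nc (mN H z - stj (emp v) lam (z + mN H z)) + nc (m z - F z)).
 apply: (@weak_stab _ (emp v) (emp_is_mean N0 v) lam z (mN H z) (m z) _ _ (c / 4) c z0 b0 c0 hw hc _ _ _ _ c1).
 - by rewrite addrC subrK.
 - by rewrite addrC subrK.
 - apply: le_trans ws' _; rewrite ler_pdivrMr ?exprn_gt0 //.
  have -> : c / 4 * c ^+ 2 / 8 * c ^+ 2 = c ^+ 5 / 32 by field.
  by move: hu; move: (c ^+ 5) (u z) u0 => a b; clra.
 - rewrite ncC; apply: le_trans hb _.
  have -> : 8 * La / (c * sqrt N%:R) = 8 * (La / sqrt N%:R) / c.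
   by field; rewrite !gt_eqF // sqrtr_gt0.
  rewrite ler_pdivrMr //.
  have -> : c ^+ 3 / 8 * c = c ^+ 4 / 8 by ring.
  have c45 : c ^+ 5 <= c ^+ 4 by rewrite exprSr -[leRHS]mulr1; apply: ler_wpM2l; rewrite ?exprn_ge0 // ltW.
  by move: hu hL c45 u0; move: (c ^+ 5) (c ^+ 4) (u z) (La / _) => a b e g; clra.
split => //.
- apply: (le_trans k1).
 have k2 : nc (m z - F z) <= 16 * u z / c ^+ 2.
  rewrite ncC; apply: le_trans hb _.
  have -> : 8 * La / (c * sqrt N%:R) = 8 * (La / sqrt N%:R) / c.
   by field; rewrite !gt_eqF // sqrtr_gt0.
  have -> : 16 * u z / c ^+ 2 = 16 * u z * c^-1 / c by field; rewrite ?gt_eqF.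
  apply: ler_wpM2r; first by rewrite invr_ge0 ltW.
  have ci : 1 <= c^-1 by rewrite invf_ge1.
  apply: (via (16 * u z)); first by move: hL; move: (u z) (La / _) => a b; clra.
  by apply: ler_peMr => //; rewrite mulr_ge0 // ltW.
 apply: (via (8 / c ^+ 2 * (288 * u z / c ^+ 2 + 16 * u z / c ^+ 2))).
  by apply: ler_wpM2l; [rewrite divr_ge0 // sqr_ge0|exact: lerD].
 have -> : 8 / c ^+ 2 * (288 * u z / c ^+ 2 + 16 * u z / c ^+ 2) = 2432 * u z / c ^+ 4 by field; rewrite ?gt_eqF.
 by apply: ler_wpM2r; [rewrite invr_ge0 exprn_ge0 // ltW|apply: ler_wpM2r; [exact: ltW|lra]].
- by move=> i; have [h _] := wd i; apply: le_trans h _; apply: eq_ler; field; rewrite ?gt_eqF.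
- by move=> i; have [_ h] := wd i; exact: le_trans e2.
Qed.

Hypothesis m1 : forall z, 0 < Iz z -> nc (m z) <= 1.

(** Induction downwards from a height at least one, where the a priori bounds are trivial. If the
    law holds at height [2 y], halving the height changes [Im mN] by a factor of at most two, so at
    height [y] one has [Im mN <= 2 (1 + c/4) <= 4] and [Im mN >= (c - c/4) / 2 >= c/4]; these are
    the a priori bounds that [weak_point] requires. *)
Lemma weak_column (x y : R) (n : nat) : 0 < y -> 1 <= 2 ^+ n * y ->
 (forall l, (l <= n)%N -> regular (Cx x (2 ^+ l * y))) ->
 forall l, (l <= n)%N -> controlled (Cx x (2 ^+ l * y)).
Proof.
move=> y0 hn hr; have yl l : 0 < 2 ^+ l * y by rewrite mulr_gt0 ?exprn_gt0.
suff h k : (k <= n)%N -> controlled (Cx x (2 ^+ (n - k) * y)).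
 by move=> l ln; rewrite -(subKn ln); apply: h; exact: leq_subr.
elim: k => [_|k IH kn].
 rewrite subn0; have r := hr n (leqnn n); set z := Cx _ _ in r *.
 have z1 : 1 <= Iz z by [].
 have z0 : 0 < Iz z by exact: yl.
 have I0 := Im_mN_ge0 hH z0.
 apply: weak_point => //.
  apply: (via 1); last by rewrite ler1n.
  apply: le_trans (ler_norm _) _; apply: le_trans (Im_le _) _; apply: (le_trans (nc_mN hH N0 z0)).
  by rewrite invf_le1.
 by rewrite cImD; move: z1 I0 c1; lra.
have {}IH := IH (ltnW kn).
have e : (n - k = (n - k.+1).+1)%N by rewrite subnS prednK // subn_gt0.
set l := (n - k.+1)%N in e *; have ln : (l < n)%N by rewrite /l subnS prednK ?leq_subr // subn_gt0.
rewrite e exprS -mulrA in IH; set y' := 2 ^+ l * y in IH *.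
have y'0 : 0 < y' by exact: yl.
have r1 := hr l (ltnW ln); have r2 := hr l.+1 ln; rewrite exprS -mulrA -/y' in r2.
have [s1 s2] := Im_mN_scale hH x y'0.
case: IH => _ _ i3 _ _; case: r2 => r20 r22 rc2 ru2 _.
set z2 := Cx x (2 * y') in i3 r20 r22 rc2 ru2 s1 s2.
have hz : nc (mN H z2 - m z2) <= c / 4.
 apply: (le_trans i3); rewrite ler_pdivrMr ?exprn_gt0 //.
 have -> : c / 4 * c ^+ 4 = c ^+ 5 / 4 by ring.
 by have c50 : 0 <= c ^+ 5 by [rewrite exprn_ge0 // ltW]; move: ru2 c50; move: (c ^+ 5) (u z2) => a b; clra.
have hI : `|Iz (mN H z2) - Iz (m z2)| <= c / 4 by rewrite -cImB; apply: le_trans hz; exact: Im_le.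
have hm1 : Iz (m z2) <= 1 by apply: le_trans (m1 r20); apply: le_trans (Im_le _); exact: ler_norm.
move: hI; rewrite ler_distl => /andP[hI1 hI2].
apply: weak_point => //.
- by move: hI2 s1 hm1 c1; clra.
- by rewrite cImD /=; move: hI1 s2 rc2 y'0 c0; clra.
Qed.
End weak_law.

(** * The linearised equation and the approximation of [mN] by row-independent quantities *)

Section minor_expansion.
Context {R : realType} (N : nat).
Variables (H : 'M[R[i]]_N) (hH : herm H) (z : R[i]) (z0 : 0 < Iz z) (i : 'I_N).
Notation G := (res H z).
Notation M := (res (zrc H i) z).
Let hZ := herm_zrc hH i.

Lemma minor_rowE k : k != i -> G i k = - (\sum_(q | q != i) H i q * M q k) * G i i.
Proof.
move=> ki; have /matrixP/(_ i k) := res_diff hH hZ z0; rewrite mxE [RHS]mxE.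
rewrite mxE (minor_row hH z0 ki).1 subr0 => ->.
rewrite mulNr mulrC -mulrN -sumrN mulr_sumr [LHS](bigD1 i) //= (minor_row hH z0 ki).1 mulr0 add0r.
apply: eq_bigr => q qi; rewrite mxE (bigD1 i) //= big1 ?addr0 => [|p pi].
 by rewrite !mxE eqxx /= sub0r; ring.
by rewrite !mxE (negbTE pi) (negbTE qi) /= subrr mulr0.
Qed.

(** Row [i] and column [i] of [G] are proportional to [G i i]; summing the rank-one corrections over
    the diagonal assembles the square of the resolvent of the minor. *)
Lemma minor_trace_eq : \sum_k G k k = \sum_(k | k != i) M k k
 + G i i * (1 + \sum_(p | p != i) \sum_(q | q != i) H i p * (M *m M) p q * H q i).
Proof.
rewrite (bigD1 i) //= mulrDr mulr1 addrCA; congr (_ + _).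
apply/eqP; rewrite -subr_eq0 opprD addrA -sumrB subr_eq0; apply/eqP.
transitivity (\sum_(k | k != i) G i i * ((\sum_(p | p != i) H i p * M p k) * (\sum_(q | q != i) M k q * H q i))).
 apply: eq_bigr => k ki; rewrite (minor_diff hH z0 k ki) (minor_rowE ki).
 by move: (\sum_(q | _) _) (\sum_(q | _) _) => a b; ring.
rewrite -mulr_sumr; congr (_ * _).
transitivity (\sum_(k | k != i) \sum_(p | p != i) H i p * M p k * (\sum_(q | q != i) M k q * H q i)).
 by apply: eq_bigr => k _; rewrite mulr_suml.
rewrite exchange_big /=; apply: eq_bigr => p pi.
transitivity (\sum_(k | k != i) \sum_(q | q != i) H i p * M p k * (M k q * H q i)).
 by apply: eq_bigr => k _; rewrite mulr_sumr.
rewrite exchange_big /=; apply: eq_bigr => q qi.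
rewrite mxE mulr_sumr mulr_suml [RHS](bigD1 i) //= (minor_row hH z0 pi).2 mul0r mulr0 mul0r add0r.
by apply: eq_bigr => k ki; ring.
Qed.
End minor_expansion.

Section strong_point.
Context {R : realType} (N : nat) (N0 : (0 < N)%N).
Variables (H : 'M[R[i]]_N) (hH : herm H) (lam : R) (v : 'I_N -> R) (D : 'I_N -> R[i]).
Variables (La c : R) (m : R[i] -> R[i]).
Hypotheses (La1 : 1 <= La) (c0 : 0 < c) (c1 : c <= 1) (HD : forall i, H i i = rc (lam * v i) + D i)
 (hD : forall i, nc (D i) <= La / sqrt N%:R).
Variables (z : R[i]) (r : R).
Notation eta := (Iz z).
Notation u := (La / sqrt (N%:R * eta)).
Notation G := (res H z).
Notation M i := (res (zrc H i) z).
Hypotheses (reg : regular H lam v La c m z) (ctl : controlled H lam v La c m z) (hr : La / sqrt N%:R <= r)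
 (hur : u ^+ 2 <= r).
Notation w0 := (z + m z).
Notation g i := (gr lam w0 (v i)).
Notation zeta := (mN H z - m z).
Notation tr2 i := (rc N%:R^-1 * \sum_(k | k != i) (M i *m M i) k k).
Notation quad2 i := (\sum_(k | k != i) \sum_(l | l != i) H i k * (M i *m M i) k l * H l i).
Hypothesis h2 : forall i, nc (quad2 i - tr2 i)
 <= 2 * La / N%:R * sqrt (\sum_(k | k != i) \sum_(l | l != i) nc ((M i *m M i) k l) ^+ 2).

Let Np : 0 < N%:R :> R. by rewrite ltr0n. Qed.
Let z0 : 0 < eta. by case: reg. Qed.
Let z2 : eta <= 2. by case: reg. Qed.
Let hc : c <= Iz (m z). by case: reg. Qed.
Let hq i : nc (quad_err H z i) <= 2 * La / N%:R * sqrt (quad_var H z i).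
Proof. by case: reg => _ _ _ _ []. Qed.
Let sqp : 0 < sqrt (N%:R * eta). by rewrite sqrtr_gt0 mulr_gt0. Qed.
Let Lp : 0 < La. exact: lt_le_trans La1. Qed.
Let up : 0 < u. by rewrite divr_gt0. Qed.
Let hu : 2 * 10 ^+ 4 * u <= c ^+ 5. by case: reg. Qed.
Let c5 : c ^+ 5 <= c.
Proof. by rewrite exprS -[leRHS]mulr1; apply: ler_wpM2l; [exact: ltW|rewrite expr_le1 // ltW]. Qed.
Let u1 : u <= 1. by move: hu c5 c1; move: (c ^+ 5) u => a b; lra. Qed.
Let Neta : 1 <= N%:R * eta.
Proof.
have : 1 <= sqrt (N%:R * eta) by apply: le_trans La1 _; move: u1; rewrite ler_pdivrMr // mul1r.
by rewrite -{1}sqrtr1 ler_psqrt ?nnegrE // mulr_ge0 // ltW.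
Qed.
Let sqE : sqrt (N%:R * eta) ^+ 2 = N%:R * eta.
Proof. by rewrite sqr_sqrtr // mulr_ge0 // ltW. Qed.
Let Im4 : Iz (mN H z) <= 4. by case: ctl. Qed.
Let ci k : 1 <= c ^- k. by rewrite invf_ge1 ?exprn_gt0 //; apply: exprn_ile1 => //; exact: ltW. Qed.
Let ck k : 0 < c ^- k. by rewrite invr_gt0 exprn_gt0. Qed.
Let w0c : c <= Iz w0. by rewrite cImD; apply: le_trans hc _; rewrite lerDr ltW. Qed.
Let w0p : 0 < Iz w0. exact: lt_le_trans w0c. Qed.

Lemma nc_g i : nc (g i) <= c^-1.
Proof. by apply: le_trans (gr_nc _ _ w0p) _; rewrite lef_pV2 ?posrE. Qed.

Lemma nc_zeta : nc zeta <= 3 * 10 ^+ 3 * u / c ^+ 4. Proof. by case: ctl. Qed.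

Lemma inv_Neta : (N%:R * eta)^-1 <= u ^+ 2.
Proof.
rewrite expr_div_n sqE -[leLHS]mul1r; apply: ler_wpM2r; first by rewrite invr_ge0 mulr_ge0 // ltW.
by rewrite expr_ge1 // (le_trans ler01).
Qed.

Lemma nc_quad i : nc (quad_err H z i) <= 5 * u.
Proof.
apply: le_trans (@nc_quad_err _ N N0 H hH z z0 La La1 hq Neta Im4 i) _.
by rewrite mulrA.
Qed.

Lemma nc_self i : nc (self_err H D z i) <= 9 * u.
Proof.
apply: le_trans (@nc_self_err _ N N0 H hH D z z0 La _ La1 hD hq Neta Im4 i) _.
have := @u_bound R N N0 La La1 z z0 z2.
have -> : 7 * La / sqrt (N%:R * eta) = 7 * u by ring.
by move: (La / sqrt N%:R) u => a b; lra.
Qed.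

(** In [minor_trace_eq], [G i i] is replaced by the explicit [g i] and the quadratic form in the row
    by its mean [tr2 i]. The result no longer depends on the row, yet for fixed [c] differs from
    [zeta] only by a multiple of [u / (N eta)], smaller by [1 / (N eta)] than the weak law error. *)
Definition zeta_minor i : R[i] :=
 rc N%:R^-1 * \sum_(k | k != i) M i k k + rc N%:R^-1 * (g i * (1 + tr2 i)) - m z.

Lemma zeta_minor_close i : nc (zeta - zeta_minor i) <= 10 ^+ 6 * u / (c ^+ 6 * (N%:R * eta)).
Proof.
have hZ := herm_zrc hH i.
have -> : zeta - zeta_minor i = rc N%:R^-1 * ((G i i - g i) * (1 + tr2 i) + G i i * (quad2 i - tr2 i)).
 rewrite /zeta_minor {1}/mN (minor_trace_eq hH z0 i).
 by move: (\sum_(k | k != i) M i k k) (tr2 i) (quad2 i) (g i) => a b e f; ring.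
rewrite ncM nc_rc ger0_norm ?invr_ge0 ?(ltW Np) //.
have [_ hw _ hG hGg] := ctl.
have e1 : nc (G i i - g i) <= 2 * 10 ^+ 4 * u / c ^+ 6.
 have -> : G i i - g i = (G i i - gr lam (z + mN H z) (v i)) + (gr lam (z + mN H z) (v i) - g i) by ring.
 apply: le_trans (ncD _ _) _.
 have wp : 0 < Iz (z + mN H z) by apply: lt_le_trans hw; rewrite divr_gt0.
 have k1 : nc (gr lam (z + mN H z) (v i) - g i) <= 12 * 10 ^+ 3 * u / c ^+ 6.
  rewrite gr_diff // (_ : z + mN H z - w0 = zeta); last by ring.
  rewrite ncM ncM; have k2 : nc (gr lam (z + mN H z) (v i)) <= 4 / c.
   by apply: le_trans (gr_nc _ _ wp) _; rewrite -invf_div lef_pV2 ?posrE // divr_gt0.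
  have -> : 12 * 10 ^+ 3 * u / c ^+ 6 = 3 * 10 ^+ 3 * u / c ^+ 4 * (4 / c * c^-1) by field; rewrite !gt_eqF.
  apply: ler_pM; rewrite ?mulr_ge0 ?nc_ge0 //; first exact: nc_zeta.
  by apply: ler_pM; rewrite ?nc_ge0 //; exact: nc_g.
 have k3 : 288 * u / c ^+ 2 <= 288 * u / c ^+ 6.
  apply: ler_wpM2l; first by apply: mulr_ge0; [exact: ler0n|exact: ltW].
  rewrite lef_pV2 ?posrE ?exprn_gt0 //; apply: ler_wiXn2l => //; exact: ltW.
 have k4 := le_trans (hGg i) k3.
 have -> : 2 * 10 ^+ 4 * u / c ^+ 6 = 288 * u / c ^+ 6 + 12 * 10 ^+ 3 * u / c ^+ 6 + (8 * 10 ^+ 3 - 288) * (u / c ^+ 6) by ring.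
 by have : 0 <= u / c ^+ 6 by [rewrite divr_ge0 ?exprn_ge0 ?(ltW up) ?(ltW c0)]; move: k1 k4; lra.
have hmi := @minor_im_le _ N N0 H hH z z0 Neta Im4 i.
have e2 : nc (1 + tr2 i) <= 8 / eta.
 apply: le_trans (ncD _ _) _; rewrite nc1 ncM nc_rc ger0_norm ?invr_ge0 ?(ltW Np) //.
 have k1 : nc (\sum_(k | k != i) (M i *m M i) k k) <= 6 * N%:R / eta.
  apply: le_trans (nc_sum _ _ _) _; apply: (via (\sum_(k | k != i) Iz (M i k k) / eta)).
   apply: ler_sum => k _; apply: le_trans (nc_res2 hZ z0 k k) _.
   by apply: eq_ler; field; rewrite gt_eqF.
  by rewrite -mulr_suml; apply: ler_wpM2r => //; rewrite invr_ge0 ltW.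
 have k2 : N%:R^-1 * nc (\sum_(k | k != i) (M i *m M i) k k) <= 6 / eta.
  rewrite ler_pdivrMl //; apply: (le_trans k1).
  by apply: eq_ler; ring.
 have k3 : 1 <= 2 / eta by rewrite ler_pdivlMr // mul1r.
 have -> : 8 / eta = 2 / eta + 6 / eta by ring.
 exact: lerD.
have e3 : nc (quad2 i - tr2 i) <= 6 * u / eta.
 apply: le_trans (h2 i) _.
 have s1 : \sum_(k | k != i) \sum_(l | l != i) nc ((M i *m M i) k l) ^+ 2 <= 9 * (N%:R / eta ^+ 3).
  apply: (via (\sum_k \sum_l nc ((M i *m M i) k l) ^+ 2)).
   rewrite [leRHS](bigD1 i) //= ler_wpDl //; first by apply: sumr_ge0 => l _; exact: sqr_ge0.
   apply: ler_sum => k _; rewrite [leRHS](bigD1 i) //= ler_wpDl //; exact: sqr_ge0.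
  apply: le_trans (sum_nc_res2 hZ z0) _; rewrite mulrA; apply: ler_wpM2r; first by rewrite invr_ge0 exprn_ge0 // ltW.
  rewrite (bigD1 i) //=; have k1 : Iz (M i i i) <= N%:R.
   apply: le_trans (ler_norm _) _; apply: le_trans (Im_le _) _; apply: le_trans (nc_res_diag hZ z0 i) _.
   by rewrite -[leLHS]mul1r ler_pdivrMr.
  by move: hmi k1 Np; move: (\sum_(_ | _) _) (Iz _) (N%:R) => a b d; lra.
 have s2 : sqrt (\sum_(k | k != i) \sum_(l | l != i) nc ((M i *m M i) k l) ^+ 2) <= 3 * (N%:R / (sqrt (N%:R * eta) * eta)).
  have p : 0 <= 3 * (N%:R / (sqrt (N%:R * eta) * eta)) by rewrite mulr_ge0 // divr_ge0 ?mulr_ge0 // ltW.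
  rewrite -[leRHS]ger0_norm // -sqrtr_sqr; apply: ler_wsqrtr; apply: (le_trans s1).
  have -> : (3 * (N%:R / (sqrt (N%:R * eta) * eta))) ^+ 2 = 9 * (N%:R ^+ 2 / (sqrt (N%:R * eta) ^+ 2 * eta ^+ 2)).
   by field; rewrite !gt_eqF.
  by rewrite sqE; apply: eq_ler; field; rewrite !gt_eqF.
 apply: (via (2 * La / N%:R * (3 * (N%:R / (sqrt (N%:R * eta) * eta))))).
  by apply: ler_wpM2l => //; rewrite divr_ge0 ?(ltW Np) // mulr_ge0 // ltW.
 by apply: eq_ler; field; rewrite !gt_eqF.
have -> : 10 ^+ 6 * u / (c ^+ 6 * (N%:R * eta)) = N%:R^-1 * (10 ^+ 6 * u / c ^+ 6 / eta).
 by field; rewrite !gt_eqF.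
apply: ler_wpM2l; first by rewrite invr_ge0 ltW.
apply: le_trans (ncD _ _) _; rewrite !ncM.
have e4 : nc (G i i - g i) * nc (1 + tr2 i) <= 2 * 10 ^+ 4 * u / c ^+ 6 * (8 / eta) by apply: ler_pM; rewrite ?nc_ge0.
have e5 : nc (G i i) * nc (quad2 i - tr2 i) <= 8 / c * (6 * u / eta) by apply: ler_pM; rewrite ?nc_ge0.
have e6 : 8 / c * (6 * u / eta) <= 48 * u / c ^+ 6 / eta.
 have -> : 8 / c * (6 * u / eta) = 48 * u / c / eta by field; rewrite !gt_eqF.
 apply: ler_wpM2r; first by rewrite invr_ge0 ltW.
 apply: ler_wpM2l; first by rewrite mulr_ge0 // ltW.
 rewrite lef_pV2 ?posrE ?exprn_gt0 // -[leRHS]expr1; apply: ler_wiXn2l => //; exact: ltW.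
have -> : 10 ^+ 6 * u / c ^+ 6 / eta = 2 * 10 ^+ 4 * u / c ^+ 6 * (8 / eta) + 48 * u / c ^+ 6 / eta + (10 ^+ 6 - 16 * 10 ^+ 4 - 48) * (u / c ^+ 6 / eta) by ring.
have : 0 <= u / c ^+ 6 / eta by apply: divr_ge0 (ltW z0); apply: divr_ge0 (ltW up) _; apply: exprn_ge0; exact: ltW.
by move: (le_trans e5 e6) e4; lra.
Qed.

Notation F := (stj (emp v) lam w0).
Notation S := (1 - kap (emp v) lam w0 w0).

Lemma nc_beta : nc (F - m z) <= 8 * r / c.
Proof.
case: reg => _ _ _ _ [_ hb]; apply: (le_trans hb).
have -> : 8 * La / (c * sqrt N%:R) = 8 * (La / sqrt N%:R) / c.
 by field; rewrite !gt_eqF // sqrtr_gt0.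
by apply: ler_wpM2r; [rewrite invr_ge0 ltW|apply: ler_wpM2l].
Qed.

Lemma nc_beta_small : nc (F - m z) <= c ^+ 3 / 8.
Proof.
case: reg => _ _ _ _ [_ hb]; apply: (le_trans hb).
have -> : 8 * La / (c * sqrt N%:R) = 8 * (La / sqrt N%:R) / c.
 by field; rewrite !gt_eqF // sqrtr_gt0.
rewrite ler_pdivrMr //; have -> : c ^+ 3 / 8 * c = c ^+ 4 / 8 by ring.
have c45 : c ^+ 5 <= c ^+ 4 by rewrite exprSr -[leRHS]mulr1; apply: ler_wpM2l; rewrite ?exprn_ge0 // ltW.
have := @u_bound R N N0 La La1 z z0 z2.
by move: hu c45 up; move: (c ^+ 5) (c ^+ 4) u (La / _) => a b e g'; lra.
Qed.

(** [Re_kap] at equal points gives [1 - Re kap >= 1 - sq + 2 (Im F)^2]. Since [F] is close to [m z],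
    [sq] exceeds [1] by at most [c^2 / 8] while [2 (Im F)^2 >= 9/8 c^2]. *)
Lemma Re_S : c ^+ 2 <= Rz S.
Proof.
have hE := emp_is_mean N0 v.
rewrite cReB [Rz 1]/=; have := Re_kap hE lam w0p w0p; have sE := Im_stj hE lam w0p.
have hb := nc_beta_small; have hI : `|Iz F - Iz (m z)| <= c ^+ 3 / 8 by rewrite -cImB; apply: le_trans hb; exact: Im_le.
move: hI; rewrite ler_distl => /andP[i1 i2].
have c3 : c ^+ 3 / 8 <= c / 8.
 apply: ler_wpM2r => //; rewrite exprS -[leRHS]mulr1; apply: ler_wpM2l; [exact: ltW|by rewrite expr_le1 // ltW].
have f1 : 3 / 4 * c <= Iz F by move: i1 c3 hc c0; lra.
have f2 : 9 / 16 * c ^+ 2 <= Iz F ^+ 2.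
 have -> : 9 / 16 * c ^+ 2 = (3 / 4 * c) ^+ 2 by field.
 have fp : 0 <= Iz F by apply: le_trans f1; rewrite mulr_ge0 // ltW.
 by apply: lesq f1; rewrite mulr_ge0 // ltW.
have f3 : sq (emp v) lam w0 <= 1 + c ^+ 2 / 8.
 have -> : sq (emp v) lam w0 = Iz F / Iz w0 by rewrite sE mulrC mulKf // gt_eqF.
 rewrite ler_pdivrMr // mulrDl mul1r.
 apply: (via (Iz w0 + c ^+ 2 / 8 * c)).
  have -> : c ^+ 2 / 8 * c = c ^+ 3 / 8 by ring.
  by rewrite cImD; move: i2 z0; lra.
 by rewrite lerD2l; apply: ler_wpM2l => //; rewrite divr_ge0 // sqr_ge0.
have e : (Iz F + Iz F) ^+ 2 = 4 * Iz F ^+ 2 by ring.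
rewrite e; move: f2 f3; have := sqr_ge0 c; move: (Iz F ^+ 2) (sq _ _ _) (Rz _) (c ^+ 2) => a b e' f'; lra.
Qed.

(** With [x = zeta + self_err], [G i i = g + g^2 x + g^2 G x^2]. Averaging over [i] and moving the
    terms [g^2 zeta] to the left produces the factor [1 - kap]. The term linear in [quad_err] is
    kept, for its average is smaller than its size; all else is of order [r]. The power [c^-11] is
    that of the quadratic term, [c^-2 c^-1 c^-8]. *)
Lemma self_consistent :
 nc (zeta * S - rc N%:R^-1 * \sum_i g i ^+ 2 * quad_err H z i) <= 2 * 10 ^+ 8 * r / c ^+ 11.
Proof.
have hE := emp_is_mean N0 v; have Nn : N%:R != 0 :> R by rewrite gt_eqF.
pose x i := zeta + self_err H D z i.
pose t i := rc N%:R^-1 * \sum_(k | k != i) M i k k - mN H z.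
have eG i : G i i - g i = g i ^+ 2 * x i + g i ^+ 2 * G i i * x i ^+ 2.
 have h1 := self_eq hH z0 HD i; have n1 := gr_den lam (v i) w0p.
 set a := rc (lam * v i) - w0 in n1 *.
 have e1 : rc (lam * v i) - (z + mN H z) - self_err H D z i = a - x i by rewrite /a /x; ring.
 rewrite e1 in h1.
 have n2 : a - x i != 0 by apply/eqP => h; move: h1; rewrite h mul0r => /eqP; rewrite eq_sym oner_eq0.
 have eGi : G i i = (a - x i)^-1 by apply: (mulfI n2); rewrite h1 mulfV.
 by rewrite eGi /gr -/a; field; rewrite n1 n2.
have e1 : zeta = (F - m z) + rc N%:R^-1 * \sum_i (g i ^+ 2 * x i + g i ^+ 2 * G i i * x i ^+ 2).
 under eq_bigr do rewrite -eG.
 by rewrite sumrB mulrBr /stj emp_cmean; rewrite /mN; ring.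
have ek : kap (emp v) lam w0 w0 = rc N%:R^-1 * \sum_i g i ^+ 2.
 by rewrite /kap emp_cmean; congr (_ * _); apply: eq_bigr => i _; rewrite expr2.
have e2 : zeta * S - rc N%:R^-1 * \sum_i g i ^+ 2 * quad_err H z i =
  (F - m z) + rc N%:R^-1 * \sum_i (g i ^+ 2 * (t i - D i) + g i ^+ 2 * G i i * x i ^+ 2).
 rewrite ek mulrBr mulr1 {1}e1.
 have -> : \sum_i (g i ^+ 2 * x i + g i ^+ 2 * G i i * x i ^+ 2) = zeta * (\sum_i g i ^+ 2)
   + \sum_i g i ^+ 2 * quad_err H z i + \sum_i (g i ^+ 2 * (t i - D i) + g i ^+ 2 * G i i * x i ^+ 2).
  rewrite mulr_sumr -!big_split /=; apply: eq_bigr => i _.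
  by rewrite /x /self_err -/(t i); move: (t i) (G i i) (g i) (quad_err H z i) => a b e f; ring.
 by move: (\sum_i _) (\sum_i _) (\sum_i _) => a b e; ring.
rewrite e2; apply: le_trans (ncD _ _) _.
have k1 i : nc (g i ^+ 2 * (t i - D i) + g i ^+ 2 * G i i * x i ^+ 2) <= 14 * 10 ^+ 7 * r / c ^+ 11.
 have g2 : nc (g i ^+ 2) <= c ^- 2.
  by rewrite ncX -exprVn; apply: lerXn2r; rewrite ?nnegrE ?nc_ge0 ?invr_ge0 ?(ltW c0) //; exact: nc_g.
 have ht : nc (t i) <= 2 * r.
  rewrite /t /mN -mulrBr ncM nc_rc ger0_norm ?invr_ge0 ?(ltW Np) // ncC.
  apply: (via (N%:R^-1 * (2 / eta))).
   by apply: ler_wpM2l; [rewrite invr_ge0 ltW|exact: minor_trace].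
  have -> : N%:R^-1 * (2 / eta) = 2 * (N%:R * eta)^-1 by field; rewrite !gt_eqF.
  by apply: ler_wpM2l => //; apply: le_trans inv_Neta _.
 have k2 : nc (g i ^+ 2 * (t i - D i)) <= c ^- 2 * (3 * r).
  rewrite ncM; apply: ler_pM; rewrite ?nc_ge0 //; apply: le_trans (ncB _ _) _.
  by move: ht (le_trans (hD i) hr); lra.
 have hx : nc (x i) <= 4 * 10 ^+ 3 * u / c ^+ 4.
  apply: le_trans (ncD _ _) _; have := nc_self i; have := nc_zeta => a1 a2.
  have a3 : 9 * u <= 9 * u / c ^+ 4 by apply: ler_peMr => //; rewrite mulr_ge0 // ltW.
  have -> : 4 * 10 ^+ 3 * u / c ^+ 4 = 3 * 10 ^+ 3 * u / c ^+ 4 + 9 * u / c ^+ 4 + (10 ^+ 3 - 9) * (u / c ^+ 4) by ring.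
  apply: ler_wpDr; first by apply: mulr_ge0; [lra|apply: divr_ge0 (ltW up) _; apply: exprn_ge0; exact: ltW].
  by apply: lerD => //; exact: le_trans a3.
 have hx2 : nc (x i ^+ 2) <= 16 * 10 ^+ 6 * r / c ^+ 8.
  rewrite ncX; apply: (via ((4 * 10 ^+ 3 * u / c ^+ 4) ^+ 2)).
   by apply: lesq hx; exact: nc_ge0.
  have -> : (4 * 10 ^+ 3 * u / c ^+ 4) ^+ 2 = (4 * 10 ^+ 3) ^+ 2 * u ^+ 2 / c ^+ 8 by field; rewrite ?gt_eqF.
  apply: ler_wpM2r; first by rewrite invr_ge0 exprn_ge0 // ltW.
  by move: hur (sqr_ge0 u); move: (u ^+ 2) => a; lra.
 have [_ _ _ hG _] := ctl.
 have k3 : nc (g i ^+ 2 * G i i * x i ^+ 2) <= c ^- 2 * (8 / c) * (16 * 10 ^+ 6 * r / c ^+ 8).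
  rewrite ncM; apply: ler_pM; rewrite ?nc_ge0 //.
  by rewrite ncM; apply: ler_pM; rewrite ?nc_ge0.
 apply: le_trans (ncD _ _) _.
 have r0 : 0 <= r by apply: le_trans hr; rewrite divr_ge0 ?sqrtr_ge0 // ltW.
 have k4 : c ^- 2 * (3 * r) <= 3 * r / c ^+ 11.
  rewrite mulrC; apply: ler_wpM2l; first by rewrite mulr_ge0.
  by rewrite lef_pV2 ?posrE ?exprn_gt0 //; apply: ler_wiXn2l => //; exact: ltW.
 have k5 : c ^- 2 * (8 / c) * (16 * 10 ^+ 6 * r / c ^+ 8) = 128 * 10 ^+ 6 * (r / c ^+ 11) by field; rewrite ?gt_eqF.
 have k6 : 0 <= r / c ^+ 11 by rewrite divr_ge0 ?exprn_ge0 // ltW.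
 rewrite k5 in k3; move: (le_trans k2 k4) k3; rewrite -!mulrA; move: (r / c ^+ 11) k6 => a; lra.
have k2 : nc (rc N%:R^-1 * \sum_i (g i ^+ 2 * (t i - D i) + g i ^+ 2 * G i i * x i ^+ 2)) <= 14 * 10 ^+ 7 * r / c ^+ 11.
 rewrite ncM nc_rc ger0_norm ?invr_ge0 ?(ltW Np) // ler_pdivrMl //.
 apply: le_trans (nc_sum _ _ _) _.
 by apply: (le_trans (ler_sum _ (fun i _ => k1 i))); rewrite sumr_const card_ord -[X in X <= _]mulr_natl.
have k3 : 8 * r / c <= 8 * r / c ^+ 11.
 apply: ler_wpM2l; first by rewrite mulr_ge0 // (le_trans _ hr) // divr_ge0 ?sqrtr_ge0 // ltW.
 by rewrite lef_pV2 ?posrE ?exprn_gt0 // -[leRHS]expr1; apply: ler_wiXn2l => //; exact: ltW.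
have k6 : 0 <= r / c ^+ 11.
 by rewrite divr_ge0 ?exprn_ge0 ?(ltW c0) // (le_trans _ hr) // divr_ge0 ?sqrtr_ge0 // ltW.
by move: (le_trans nc_beta k3) k2; rewrite -!mulrA; move: (r / c ^+ 11) k6 => a; lra.
Qed.
End strong_point.

(** * One step of the moment method, for a fixed realisation *)

Section moment_step.
Context {R : realType}.
Variables (kp : R) (q : nat).
Hypothesis kp0 : 0 < kp.
(** The squared modulus regularised at the scale [kp]: a perturbation of [x] small against [kp / q]
    then changes the [q]-th power by a bounded factor, even near [x = 0]. The companion [qq]
    satisfies [x * qq x = |x|^2 tq^q]. *)
Definition tq (x : R[i]) : R := nc x ^+ 2 + kp ^+ 2.
Definition qq (x : R[i]) : R[i] := conjc x * rc (tq x ^+ q).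

Lemma tq_ge0 x : 0 <= tq x. Proof. by rewrite addr_ge0 ?sqr_ge0. Qed.

Lemma nc_qq x : nc (qq x) = nc x * tq x ^+ q.
Proof. by rewrite ncM ncJ nc_rc ger0_norm // exprn_ge0 // tq_ge0. Qed.

Lemma one_plus_pow (h : R) k : 0 <= h -> k%:R * h <= 1 -> (1 + h) ^+ k * (1 - k%:R * h) <= 1.
Proof.
move=> h0; elim: k => [|k IH] hk; first by rewrite expr0 mul0r subr0 mul1r.
have hk' : k%:R * h <= 1 by apply: le_trans hk; apply: ler_wpM2r => //; rewrite ler_nat.
apply: le_trans (IH hk'); rewrite exprSr -mulrA; apply: ler_wpM2l; first by rewrite exprn_ge0 // addr_ge0.
rewrite -natr1; have : 0 <= (k%:R + 1) * h ^+ 2 by rewrite mulr_ge0 ?sqr_ge0 // addr_ge0.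
move=> h1; have -> : (1 + h) * (1 - (k%:R + 1) * h) = (1 - k%:R * h) - (k%:R + 1) * h ^+ 2 by ring.
by rewrite gerBl.
Qed.

(** The perturbation changes [tq] by a relative amount of at most [5 / (16 (q + 1))], so powers up
    to the [q]-th grow at most by [16/11 <= 3/2]; the rest is telescoping of the difference of
    powers. *)
Lemma qq_diff x y : nc (x - y) <= kp / (4 * q.+1%:R) ->
 nc (qq x - qq y) <= 7 * q.+1%:R * nc (x - y) * tq x ^+ q.
Proof.
move=> hd; set d := nc (x - y) in hd *; set A := tq x; set B := tq y.
have d0 : 0 <= d by exact: nc_ge0.
have n0 : 0 <= nc x by exact: nc_ge0.
have A0 : 0 <= A by exact: tq_ge0.
have B0 : 0 <= B by exact: tq_ge0.
have q0 : 0 < q.+1%:R :> R by rewrite ltr0n.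
pose dl : R := (4 * q.+1%:R)^-1.
have dl0 : 0 < dl by rewrite invr_gt0 mulr_gt0.
have dl4 : dl <= 4^-1.
 by rewrite lef_pV2 ?posrE ?mulr_gt0 // -[leLHS]mulr1; apply: ler_wpM2l => //; rewrite ler1n.
have hdk : d <= dl * kp by rewrite mulrC.
have k1 : kp ^+ 2 <= A by rewrite lerDr sqr_ge0.
have k2 : nc x ^+ 2 <= A by rewrite lerDl sqr_ge0.
have xd : nc x * d <= dl * A / 2.
 apply: (via (dl * (nc x * kp))).
  by rewrite mulrCA; apply: ler_wpM2l.
 rewrite -mulrA; apply: ler_wpM2l; first exact: ltW.
 by have := sqr_ge0 (nc x - kp); rewrite sqrrB /A /tq; lra.
have dd : d ^+ 2 <= dl * A / 4.
 apply: (via ((dl * kp) ^+ 2)); first exact: lesq.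
 rewrite exprMn expr2 -!mulrA; apply: ler_wpM2l; first exact: ltW.
 rewrite [leRHS]mulrC; apply: ler_pM => //; [exact: ltW|exact: sqr_ge0].
have hnc : `|nc y - nc x| <= d.
 have t1 := nc_triB x y; have t2 := nc_triB y x.
 by rewrite ncC in t2; rewrite ler_norml; apply/andP; split; rewrite /d; lra.
have hAB : `|A - B| <= d * (2 * nc x + d).
 have -> : A - B = - ((nc y - nc x) * (2 * nc x + (nc y - nc x))) by rewrite /A /B /tq; ring.
 rewrite normrN normrM; apply: ler_pM => //; apply: le_trans (ler_normD _ _) _.
 by apply: lerD => //; rewrite ger0_norm // mulr_ge0.
have hAB2 : `|A - B| <= 5 / 4 * dl * A.
 by apply: le_trans hAB _; move: xd dd; have -> : d * (2 * nc x + d) = 2 * (nc x * d) + d ^+ 2 by [ring]; lra.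
pose h := 5 / 4 * dl; have h0 : 0 <= h by rewrite mulr_ge0 // ltW.
have hB : B <= (1 + h) * A by move: hAB2; rewrite ler_norml -/h => /andP[hh _]; move: hh; lra.
have Bk k : (k <= q)%N -> B ^+ k <= 3 / 2 * A ^+ k.
 move=> kq; apply: (via (((1 + h) * A) ^+ k)).
  have p1 : 0 <= (1 + h) * A by rewrite mulr_ge0 // addr_ge0.
  by apply: lerXn2r; rewrite ?nnegrE.
 rewrite exprMn; apply: ler_wpM2r; first exact: exprn_ge0.
 have hk : k%:R * h <= 5 / 16.
  apply: (via (q.+1%:R * h)); first by apply: ler_wpM2r => //; rewrite ler_nat ltnW.
  by apply: eq_ler; rewrite /h /dl; field; rewrite gt_eqF.
 have hk1 : k%:R * h <= 1 by move: hk; clra.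
 have := one_plus_pow h0 hk1; have : 0 <= (1 + h) ^+ k by rewrite exprn_ge0 // addr_ge0.
 move: ((1 + h) ^+ k) => u u0 hu; have : u * (11 / 16) <= u * (1 - k%:R * h) by apply: ler_wpM2l => //; move: hk; clra.
 by move: hu; clra.
have hsum : `|A ^+ q - B ^+ q| * nc x <= 27 / 8 * q%:R * d * A ^+ q.
 case: (posnP q) => [->|qp]; first by rewrite !expr0 subrr normr0 mul0r mulr0 !mul0r.
 rewrite subrXX normrM mulrAC.
 have s1 : `|A - B| * nc x <= 9 / 4 * d * A.
  apply: (via (d * (2 * nc x + d) * nc x)); first exact: ler_wpM2r.
  have -> : d * (2 * nc x + d) * nc x = d * (2 * nc x ^+ 2 + nc x * d) by ring.
  have -> : 9 / 4 * d * A = d * (9 / 4 * A) by ring.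
  apply: ler_wpM2l => //; have : dl * A <= 4^-1 * A by exact: ler_wpM2r.
  by move: xd k2; clra.
 have s2 : `|\sum_(i < q) A ^+ (q.-1 - i) * B ^+ i| <= q%:R * (3 / 2 * A ^+ q.-1).
  apply: le_trans (ler_norm_sum _ _ _) _.
  apply: (via (\sum_(i < q) (3 / 2 * A ^+ q.-1))); last by rewrite sumr_const card_ord -[X in X <= _]mulr_natl.
  apply: ler_sum => i _; rewrite ger0_norm ?mulr_ge0 ?exprn_ge0 //.
  apply: (via (A ^+ (q.-1 - i) * (3 / 2 * A ^+ i))).
   by apply: ler_wpM2l; [exact: exprn_ge0|apply: Bk; exact: ltnW].
  by rewrite mulrCA -exprD subnK // -ltnS prednK.
 have -> : 27 / 8 * q%:R * d * A ^+ q = 9 / 4 * d * A * (q%:R * (3 / 2 * A ^+ q.-1)).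
  by rewrite -[in LHS](prednK qp) exprS prednK //; field.
 by apply: ler_pM => //; rewrite mulr_ge0.
have e : qq x - qq y = conjc x * rc (A ^+ q - B ^+ q) + conjc (x - y) * rc (B ^+ q).
 by rewrite /qq -/A -/B rmorphB rmorphB /=; ring.
rewrite e; apply: le_trans (ncD _ _) _; rewrite !ncM !ncJ !nc_rc [`|B ^+ q|]ger0_norm ?exprn_ge0 //.
have b1 : d * B ^+ q <= d * (3 / 2 * A ^+ q) by apply: ler_wpM2l => //; exact: Bk.
have qd : 0 <= d * A ^+ q by rewrite mulr_ge0 ?exprn_ge0.
have qd2 : 0 <= q%:R * (d * A ^+ q) by rewrite mulr_ge0.
have e1 : 7 * q.+1%:R * d * A ^+ q = 7 * (q%:R * (d * A ^+ q)) + 7 * (d * A ^+ q) by rewrite -[q.+1%:R]natr1; ring.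
have e2 : 27 / 8 * q%:R * d * A ^+ q = 27 / 8 * (q%:R * (d * A ^+ q)) by ring.
have e3 : d * (3 / 2 * A ^+ q) = 3 / 2 * (d * A ^+ q) by ring.
rewrite e1 [nc x * _]mulrC -/d; move: hsum b1 qd qd2; rewrite e2 e3.
move: (`|_| * _) (d * B ^+ q) (q%:R * (d * A ^+ q)) (d * A ^+ q) => s t a b; clra.
Qed.

(** The linearised equation is multiplied by [qq zeta], so that its left side has real part
    [Re S * |zeta|^2 tq^q]. In each summand [qq zeta] is then replaced by [qq (zm i)], at a cost
    absorbed in the [kp^2] part of [tq]. In the application [zm i] does not involve row [i], so the
    remaining sum has almost vanishing expectation. *)
Lemma moment_step (N : nat) (zeta S : R[i]) (a Z zm : 'I_N -> R[i]) (c2 B : R) : (0 < N)%N ->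
 0 < c2 -> c2 <= Rz S -> 2 * B <= kp * c2 ->
 nc (zeta * S - rc N%:R^-1 * \sum_i a i * Z i) <= B ->
 (forall i, nc (zeta - zm i) <= kp / (4 * q.+1%:R)) ->
 (forall i, nc (a i * Z i) * nc (zeta - zm i) * (7 * q.+1%:R) <= kp ^+ 2 * c2 / 8) ->
 tq zeta ^+ q.+1 <= 2 * (3 * kp ^+ 2) ^+ q.+1 + 4 / c2 * (N%:R^-1 * \sum_i Rz (a i * Z i * qq (zm i))).
Proof.
move=> N0 c20 hS hB hsc hd hZ; have Np : 0 < N%:R :> R by rewrite ltr0n.
set n := nc zeta; set A := tq zeta ^+ q; set Y := N%:R^-1 * _.
have n0 : 0 <= n by exact: nc_ge0.
have A0 : 0 <= A by rewrite exprn_ge0 // tq_ge0.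
have B0 : 0 <= B by exact: le_trans (nc_ge0 _) hsc.
have e1 : Rz (zeta * S * qq zeta) = Rz S * (n ^+ 2 * A).
 have -> : zeta * S * qq zeta = rc (n ^+ 2 * A) * S.
  by rewrite /qq -/A rmorphM /= -mulJ; ring.
 by rewrite cReM Re_rc Im_rc mul0r subr0 mulrC.
have e2 : zeta * S * qq zeta = (zeta * S - rc N%:R^-1 * \sum_i a i * Z i) * qq zeta
  + rc N%:R^-1 * \sum_i a i * Z i * qq (zm i) + rc N%:R^-1 * \sum_i a i * Z i * (qq zeta - qq (zm i)).
 have -> : \sum_i a i * Z i * (qq zeta - qq (zm i)) = (\sum_i a i * Z i) * qq zeta - \sum_i a i * Z i * qq (zm i).
  by rewrite mulr_suml -sumrB; apply: eq_bigr => i _; rewrite mulrBr.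
 by move: (\sum_i _) (\sum_i _) => s t; ring.
have b1 : Rz ((zeta * S - rc N%:R^-1 * \sum_i a i * Z i) * qq zeta) <= B * (n * A).
 apply: le_trans (ler_norm _) _; apply: le_trans (Re_le _) _; rewrite ncM nc_qq.
 by apply: ler_wpM2r => //; rewrite mulr_ge0.
have b2 : Rz (rc N%:R^-1 * \sum_i a i * Z i * qq (zm i)) = Y.
 by rewrite cReM Re_rc Im_rc mul0r subr0 Re_sum.
have b3 : Rz (rc N%:R^-1 * \sum_i a i * Z i * (qq zeta - qq (zm i))) <= kp ^+ 2 * c2 / 8 * A.
 apply: le_trans (ler_norm _) _; apply: le_trans (Re_le _) _; rewrite ncM nc_rc ger0_norm ?invr_ge0 ?(ltW Np) //.
 rewrite ler_pdivrMl //; apply: le_trans (nc_sum _ _ _) _.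
 apply: (via (\sum_(i < N) (kp ^+ 2 * c2 / 8 * A))); last by rewrite sumr_const card_ord -[X in X <= _]mulr_natl.
 apply: ler_sum => i _; rewrite ncM.
 apply: (via (nc (a i * Z i) * (7 * q.+1%:R * nc (zeta - zm i) * A))).
  by apply: ler_wpM2l; [exact: nc_ge0|exact: qq_diff].
 have -> : nc (a i * Z i) * (7 * q.+1%:R * nc (zeta - zm i) * A) = nc (a i * Z i) * nc (zeta - zm i) * (7 * q.+1%:R) * A by ring.
 exact: ler_wpM2r.
have h1 : c2 * (n ^+ 2 * A) <= B * (n * A) + Y + kp ^+ 2 * c2 / 8 * A.
 apply: (via (Rz (zeta * S * qq zeta))).
  by rewrite e1; apply: ler_wpM2r => //; rewrite mulr_ge0 ?sqr_ge0.
 by rewrite e2 cReD cReD b2; apply: lerD => //; rewrite lerD2r.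
have h2 : B * (n * A) <= c2 * (n ^+ 2 / 2 + kp ^+ 2 / 8) * A.
 rewrite mulrA; apply: ler_wpM2r => //.
 apply: (via (kp * c2 / 2 * n)); first by apply: ler_wpM2r => //; move: hB; lra.
 have -> : kp * c2 / 2 * n = c2 * (kp * n / 2) by ring.
 apply: ler_wpM2l; first exact: ltW.
 have := sqr_ge0 (n - kp / 2); have -> : (n - kp / 2) ^+ 2 = n ^+ 2 - kp * n + kp ^+ 2 / 4 by field.
 by lra.
have h3 : n ^+ 2 * A <= 2 / c2 * Y + kp ^+ 2 / 2 * A.
 rewrite -(ler_pM2l c20); have -> : c2 * (2 / c2 * Y + kp ^+ 2 / 2 * A) = 2 * Y + c2 * (kp ^+ 2 / 2 * A) by field; rewrite gt_eqF.
 move: h1 h2; have -> : kp ^+ 2 * c2 / 8 * A = c2 * (kp ^+ 2 * A) / 8 by ring.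
 have -> : c2 * (n ^+ 2 / 2 + kp ^+ 2 / 8) * A = c2 * (n ^+ 2 * A) / 2 + c2 * (kp ^+ 2 * A) / 8 by ring.
 have -> : c2 * (kp ^+ 2 / 2 * A) = c2 * (kp ^+ 2 * A) / 2 by ring.
 move: (c2 * (n ^+ 2 * A)) (c2 * (kp ^+ 2 * A)) (B * (n * A)) => x y w; lra.
have k0 : 0 <= kp ^+ 2 by exact: sqr_ge0.
(* Where [tq >= 3 kp^2] the term is absorbed in half of the left side; elsewhere [tq^q] is below
   [(3 kp^2)^q]. *)
have h4 : 3 / 2 * (kp ^+ 2 * A) <= tq zeta ^+ q.+1 / 2 + (3 * kp ^+ 2) ^+ q.+1.
 have [h|h] := leP (3 * kp ^+ 2) (tq zeta).
  have : 3 * (kp ^+ 2 * A) <= tq zeta * A by rewrite mulrA; exact: ler_wpM2r.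
  have : 0 <= (3 * kp ^+ 2) ^+ q.+1 by rewrite exprn_ge0 // mulr_ge0.
  by rewrite [tq zeta ^+ q.+1]exprS -/A; move: ((3 * _) ^+ _) (tq zeta * A) (kp ^+ 2 * A) => x y w; clra.
 have : A <= (3 * kp ^+ 2) ^+ q by apply: lerXn2r; rewrite ?nnegrE ?tq_ge0 ?mulr_ge0 // ltW.
 move=> hA; have : 3 * (kp ^+ 2 * A) <= (3 * kp ^+ 2) ^+ q.+1 by rewrite [(3 * kp ^+ 2) ^+ q.+1]exprS mulrA; apply: ler_wpM2l => //; rewrite mulr_ge0.
 have : 0 <= tq zeta ^+ q.+1 by rewrite exprn_ge0 // tq_ge0.
 have : 0 <= kp ^+ 2 * A by rewrite mulr_ge0.
 by move: ((3 * _) ^+ _) (tq zeta ^+ _) (kp ^+ 2 * A) => x y w; clra.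
have h5 : tq zeta ^+ q.+1 = n ^+ 2 * A + kp ^+ 2 * A by rewrite exprS -/A {1}/tq -/n mulrDl.
have -> : 4 / c2 * Y = 2 * (2 / c2 * Y) by ring.
move: h3 h4; rewrite h5; have -> : kp ^+ 2 / 2 * A = kp ^+ 2 * A / 2 by ring.
move: (n ^+ 2 * A) (kp ^+ 2 * A) ((3 * _) ^+ _) (2 / c2 * Y) => x y w u; clra.
Qed.
End moment_step.

Lemma sum_const2 (R : pzRingType) (N : nat) (x : R) : \sum_(k < N) \sum_(l < N) x = N%:R ^+ 2 * x.
Proof. by rewrite sumr_const card_ord sumr_const card_ord -mulrnA -[LHS]mulr_natl natrM expr2. Qed.

(** * Mean of the truncated quadratic form against functions of the minor *)

Section independence.
Context {R : realType} (theta C0 : R) (mu : probability (measurableTypeR R) R) (N : nat).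
Variable X : deformed_wigner theta C0 mu N.
Notation T := (dw_space X).
Notation P := (dw_prob X).
Notation genX := (@gen _ theta C0 mu N X).
Notation EE := (fun f : T -> R => \int[P]_t f t).
Let hE : is_mean EE := expectation_is_mean P.

Lemma indep_cmean (J1 J2 : {set idx N}) (f g : T -> R[i]) :
 J1 \subset idxD N -> J2 \subset idxD N -> fintype.disjoint (mem J1) (mem J2) ->
 cbm f -> cbm g -> cme (f : g_sigma_algebraType (genX J1) -> R[i]) ->
 cme (g : g_sigma_algebraType (genX J2) -> R[i]) ->
 cmean EE (fun t => f t * g t) = cmean EE f * cmean EE g.
Proof.
move=> s1 s2 dj [f1 f2] [g1 g2] [mf1 mf2] [mg1 mg2].
have ind := @gen_indep _ theta C0 mu N X J1 J2 s1 s2 dj.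
have key (a b : T -> R) : bmf a -> bmf b ->
  measurable_fun setT (a : g_sigma_algebraType (genX J1) -> R) ->
  measurable_fun setT (b : g_sigma_algebraType (genX J2) -> R) ->
  \int[P]_t (a t * b t) = (\int[P]_t a t) * (\int[P]_t b t).
 exact: (indep_expectation (@gen_measurable _ theta C0 mu N X J1) (@gen_measurable _ theta C0 mu N X J2) ind).
apply: complex_eq; rewrite ?cReM ?cImM /=.
 under eq_Rintegral do rewrite cReM.
 rewrite (meanB hE (bmfM f1 g1) (bmfM f2 g2)) /=.
 by congr (_ - _); apply: key.
under eq_Rintegral do rewrite cImM.
rewrite (meanD hE (bmfM f1 g2) (bmfM f2 g1)) /=.
by congr (_ + _); apply: key.
Qed.

Section row_mean.
Variables (lam : R) (z : R[i]) (z0 : 0 < Iz z) (i : 'I_N) (Mt eps BY : R).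
Hypotheses (N0 : (0 < N)%N) (Mt0 : 0 < Mt) (eps0 : 0 <= eps) (eps1 : eps <= 1).
Notation W := (@dw_W _ _ _ _ _ X).
Notation ham := (@hamiltonian _ theta C0 mu N X lam).
Notation tw := (fun k t => trunc (fun t => W t k i) Mt t).
Notation J1 := (row_idx i).
Notation J2 := (idxD N :\: row_idx i)%SET.
Notation T1 := (g_sigma_algebraType (genX J1)).
Notation T2 := (g_sigma_algebraType (genX J2)).
Notation M t := (punct i (res (zrc (ham t) i) z)).
Hypotheses (hm1 : forall k, nc (cmean EE (tw k)) <= eps)
 (hm2 : forall k, `|\int[P]_t (nc (tw k t) ^+ 2) - N%:R^-1| <= eps).
Variable Y : T -> R[i].
Hypotheses (bY : cbm Y) (mY : cme (Y : T2 -> R[i])) (hY : forall t, nc (Y t) <= BY).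

Definition trunc_quad t : R[i] :=
 \sum_k \sum_l conjc (tw k t) * M t k l * tw l t - rc N%:R^-1 * \sum_k M t k k.

Let cme_tw k (J : {set idx N}) : inl (ordp k i) \in J -> cme (tw k : g_sigma_algebraType (genX J) -> R[i]).
Proof. by move=> kJ; apply: cme_trunc; exact: cme_gen. Qed.

Let cbm_tw k : cbm (tw k).
Proof.
apply/cbm_cme; split; first by apply: cme_trunc; exact: cme_W.
by exists Mt => t; exact: nc_trunc.
Qed.

Let nc_M t k l : nc (M t k l) <= (Iz z)^-1.
Proof.
rewrite /punct; case: ifP => _; first by rewrite nc0 invr_ge0 ltW.
by apply: nc_res => //; apply: herm_zrc; exact: ham_herm.
Qed.

Let cme_M2 k l : cme (fun t : T2 => M t k l).
Proof. by apply: (@cme_punct _ _ _ _ _ X i (fun t => res (zrc (ham t) i) z)) => a b; exact: cme_minor. Qed.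

Let cme_M k l : cme (fun t : T => M t k l).
Proof.
rewrite /punct; case: ((k == i) || (l == i)); first exact: cme_cst.
apply: cme_res => // [a b|s]; last by apply: herm_zrc; exact: ham_herm.
have -> : (fun s : T => zrc (ham s) i a b) = (fun s : T => if (a == i) || (b == i) then 0 else ham s a b).
 by apply/funext => s; rewrite mxE.
by case: ((a == i) || (b == i)); [exact: cme_cst|exact: cme_ham].
Qed.

Let cbm_M k l : cbm (fun t : T => M t k l).
Proof. by apply/cbm_cme; split; [exact: cme_M|exists (Iz z)^-1 => t; exact: nc_M]. Qed.

Lemma cbm_trunc_quad : cbm trunc_quad.
Proof.
apply: cbmB; last by apply: cbmM; [exact: cbm_cst|apply: cbm_sum => k; exact: cbm_M].
apply: cbm_sum => k; apply: cbm_sum => l; apply: cbmM (cbm_tw l).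
by apply: cbmM => //; exact: cbmJ.
Qed.

Lemma nc_trunc_quad t : Mt <= 1 -> nc (trunc_quad t) <= 2 * N%:R ^+ 2 / Iz z.
Proof.
move=> M1; have Np : 0 < N%:R :> R by rewrite ltr0n.
have N1 : 1 <= N%:R :> R by rewrite ler1n.
have h0 : 0 <= (Iz z)^-1 by rewrite invr_ge0 ltW.
apply: le_trans (ncB _ _) _.
have h1 : nc (\sum_k \sum_l conjc (tw k t) * M t k l * tw l t) <= N%:R ^+ 2 * (Iz z)^-1.
 apply: le_trans (nc_sum _ _ _) _.
 apply: (via (\sum_(k < N) \sum_(l < N) (Iz z)^-1)).
  apply: ler_sum => k _; apply: le_trans (nc_sum _ _ _) _; apply: ler_sum => l _.
  rewrite !ncM ncJ -[leRHS]mulr1 -[X in _ <= X * _]mul1r.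
  apply: ler_pM; rewrite ?mulr_ge0 ?nc_ge0 //; last by apply: le_trans M1; exact: nc_trunc.
  by apply: ler_pM; rewrite ?nc_ge0 //; apply: le_trans M1; exact: nc_trunc.
 by rewrite sum_const2.
have h2 : nc (rc N%:R^-1 * \sum_k M t k k) <= N%:R ^+ 2 * (Iz z)^-1.
 rewrite ncM nc_rc ger0_norm ?invr_ge0 ?(ltW Np) // ler_pdivrMl //.
 apply: le_trans (nc_sum _ _ _) _.
 apply: (via (\sum_(k < N) (Iz z)^-1)); first by apply: ler_sum => k _; exact: nc_M.
 rewrite sumr_const card_ord -[X in X <= _]mulr_natl; apply: ler_wpM2l; first exact: ltW.
 by apply: ler_peMl => //; rewrite expr_ge1.
have -> : 2 * N%:R ^+ 2 / Iz z = N%:R ^+ 2 * (Iz z)^-1 + N%:R ^+ 2 * (Iz z)^-1 by ring.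
exact: lerD.
Qed.

Let tw_mean k l : nc (cmean EE (fun t => conjc (tw k t) * tw l t) - (rc N%:R^-1) *+ (k == l)) <= eps.
Proof.
have [->|kl] := eqVneq k l.
 have -> : (fun t => conjc (tw l t) * tw l t) = (fun t => rc (nc (tw l t) ^+ 2)).
  by apply/funext => t; rewrite mulrC mulJ.
 have -> : cmean EE (fun t => rc (nc (tw l t) ^+ 2)) = rc (\int[P]_t (nc (tw l t) ^+ 2)).
  by apply: complex_eq => //=; rewrite (mean_const hE).
 by rewrite -[rc _ *+ true]/(rc N%:R^-1) -rmorphB nc_rc.
rewrite mulr0n subr0.
have fs (p : 'I_N) : finset.set1 (inl (ordp p i) : idx N) \subset idxD N.
 by apply/fintype.subsetP => x /finset.set1P ->; rewrite inE ordp_le.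
rewrite (@indep_cmean (finset.set1 (inl (ordp k i))) (finset.set1 (inl (ordp l i)))) //.
- rewrite ncM; have -> : cmean EE (fun t => conjc (tw k t)) = conjc (cmean EE (tw k)).
  apply: complex_eq; rewrite ?cReJ ?cImJ /=.
   by congr (Rintegral _ _ _); apply/funext => t; rewrite cReJ.
  rewrite -(meanN hE (cbm_tw k).2); congr (Rintegral _ _ _); apply/funext => t; by rewrite cImJ.
 rewrite ncJ -[leRHS]mulr1; apply: ler_pM; rewrite ?nc_ge0 //; exact: le_trans eps1.
- rewrite disjoints1 inE; apply/eqP => -[] e; move/eqP: kl; apply.
 by move: e; rewrite /ordp; case: ifP => _; case: ifP => _ []; intros; congruence.
- exact: cbmJ.
- by apply: cmeJ; apply: cme_tw; rewrite inE.
- by apply: cme_tw; rewrite inE.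
Qed.

(** The products [conj (w_k) w_l] depend on the row, their coefficients times [Y] on the remaining
    inputs, so expectations factor. The first factor is [1/N] on the diagonal and [0] off it, up to
    the truncation error [eps], and the subtracted trace cancels this exactly. *)
Lemma row_mean : nc (cmean EE (fun t => trunc_quad t * Y t)) <= N%:R ^+ 2 * eps * (BY / Iz z).
Proof.
have B0 : 0 <= BY by apply: le_trans (nc_ge0 _) (hY point).
pose f k l t := conjc (tw k t) * tw l t.
pose g k l t := M t k l * Y t.
have bf k l : cbm (f k l) by apply: cbmM; [exact: cbmJ|].
have bg k l : cbm (g k l) by exact: cbmM.
have e t : trunc_quad t * Y t = \sum_k \sum_l (f k l t * g k l t - ((rc N%:R^-1) *+ (k == l)) * g k l t).
 rewrite /trunc_quad mulrBl mulr_suml -mulrA mulr_suml mulr_sumr -sumrB; apply: eq_bigr => k _.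
 rewrite sumrB mulr_suml; congr (_ - _); first by apply: eq_bigr => l _; rewrite /f /g; ring.
 by rewrite (bigD1 k) //= eqxx big1 ?addr0 // => l lk; rewrite eq_sym (negbTE lk) mul0r.
have b1 k l : cbm (fun t => f k l t * g k l t - ((rc N%:R^-1) *+ (k == l)) * g k l t).
 by apply: cbmB; apply: cbmM => //; exact: cbm_cst.
have -> : (fun t => trunc_quad t * Y t) = (fun t => \sum_k \sum_l (f k l t * g k l t - ((rc N%:R^-1) *+ (k == l)) * g k l t)).
 by apply/funext => t; exact: e.
rewrite (cmean_sum hE) => [|k]; last by apply: cbm_sum.
apply: le_trans (nc_sum _ _ _) _.
apply: (via (\sum_(k < N) \sum_(l < N) (eps * (BY / Iz z)))); last first.
 by rewrite sum_const2 -[leRHS]mulrA.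
apply: ler_sum => k _; rewrite (cmean_sum hE) //; apply: le_trans (nc_sum _ _ _) _; apply: ler_sum => l _.
rewrite (cmeanB hE) ?(cmeanZ hE) //; try by apply: cbmM => //; exact: cbm_cst.
rewrite (@indep_cmean J1 J2) //.
- rewrite -mulrBl ncM; apply: ler_pM; rewrite ?nc_ge0 //; first exact: tw_mean.
 apply: le_trans (nc_cmean hE (bg k l)) _; rewrite -[leRHS](mean_const hE).
 apply: (mean_le hE); [exact: bmf_nc|exact: bmf_cst|move=> t].
 by rewrite /g ncM mulrC; apply: ler_pM; rewrite ?nc_ge0.
- by apply/fintype.subsetP => -[p|k']; rewrite !inE // => /andP[].
- exact: finset.subsetDl.
- by rewrite disjoint_sym; apply/finset.setDidPl; rewrite finset.setDDl finset.setUid.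
- by apply: cmeM; [apply: cmeJ|]; apply: cme_tw; rewrite inE ordp_le ordp_mem eqxx orbT.
- by apply: cmeM.
Qed.
End row_mean.
End independence.

(** * The moment bound and Markov's inequality *)

Section strong_moment.
Context {R : realType} (theta C0 : R) (mu : probability (measurableTypeR R) R) (N : nat).
Variable X : deformed_wigner theta C0 mu N.
Notation T := (dw_space X).
Notation P := (dw_prob X).
Notation W := (@dw_W _ _ _ _ _ X).
Notation v := (@dw_v _ _ _ _ _ X).
Notation genX := (@gen _ theta C0 mu N X).
Notation EE := (fun f : T -> R => \int[P]_t f t).
Variables (lam : R) (m : R[i] -> R[i]) (z : R[i]) (kp c2 B Mt eps pb : R) (q : nat).
Notation tw i := (fun k t => trunc (fun t => W t k i) Mt t).
Notation ham := (@hamiltonian _ theta C0 mu N X lam).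
Notation w0 := (z + m z).
Notation zeta t := (mN (ham t) z - m z).
Notation S t := (1 - kap (emp (v^~ t)) lam w0 w0).
Notation a t i := (gr lam w0 (v i t) ^+ 2).
Notation zm t i := (zeta_minor (ham t) lam (v^~ t) m z i).
Hypotheses (N5 : (5 <= N)%N) (zN : N%:R^-1 <= Iz z) (m0 : 0 <= Iz (m z)) (m1 : nc (m z) <= 1)
 (kpN : N%:R^-1 <= kp) (kp1 : kp <= 1) (c20 : 0 < c2) (c21 : c2 <= 1) (Mt0 : 0 < Mt) (Mt1 : Mt <= 1)
 (eps0 : 0 <= eps) (eps1 : eps <= 1) (hm1 : forall i k, nc (cmean EE (tw i k)) <= eps)
 (hm2 : forall i k, `|\int[P]_t (nc (tw i k t) ^+ 2) - N%:R^-1| <= eps).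
Variable Gd : set T.
Hypotheses (mGd : measurable Gd) (pGd : (P (~` Gd) <= pb%:E)%E) (hB : 2 * B <= kp * c2).
Hypothesis hG : forall t, Gd t ->
 [/\ c2 <= Rz (S t),
   nc (zeta t * S t - rc N%:R^-1 * \sum_i a t i * quad_err (ham t) z i) <= B,
   (forall i, nc (zeta t - zm t i) <= kp / (4 * q.+1%:R)),
   (forall i, nc (a t i * quad_err (ham t) z i) * nc (zeta t - zm t i) * (7 * q.+1%:R) <= kp ^+ 2 * c2 / 8) &
   (forall k i, nc (W t k i) <= Mt)].

Let hE : is_mean EE := expectation_is_mean P.
Let N0 : (0 < N)%N. exact: leq_trans N5. Qed.
Let Np : 0 < N%:R :> R. by rewrite ltr0n. Qed.
Let N5R : 5 <= N%:R :> R. by rewrite ler_nat. Qed.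
Let z0 : 0 < Iz z. by apply: lt_le_trans zN; rewrite invr_gt0. Qed.
Let zi : (Iz z)^-1 <= N%:R. by rewrite -[leRHS]invrK lef_pV2 ?posrE ?invr_gt0. Qed.
Let kp0 : 0 < kp. by apply: lt_le_trans kpN; rewrite invr_gt0. Qed.
Let w0p : 0 < Iz w0. by rewrite cImD ltr_pwDl. Qed.
Let w0i : (Iz w0)^-1 <= N%:R.
Proof. by apply: le_trans zi; rewrite lef_pV2 ?posrE // cImD lerDl. Qed.

Let trunc_quadE t i : (forall k, nc (W t k i) <= Mt) -> trunc_quad lam z i Mt t = quad_err (ham t) z i.
Proof.
move=> hW; have e k : tw i k t = W t k i by rewrite /trunc hW.
rewrite /trunc_quad /quad_err; congr (_ - _ * _).
 rewrite (bigD1 i) //= [X in X + _]big1 ?add0r => [|l _]; last by rewrite /punct eqxx mulr0 mul0r.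
 apply: eq_bigr => k ki; rewrite (bigD1 i) //= {1}/punct eqxx orbT mulr0 mul0r add0r.
 apply: eq_bigr => l li; rewrite !e /punct (negbTE ki) (negbTE li) /= !hamE [i == k]eq_sym (negbTE ki) (negbTE li).
 by rewrite !mulr0n !mulr0 !add0r -W_herm.
rewrite (bigD1 i) //= {1}/punct eqxx add0r; apply: eq_bigr => k ki.
by rewrite /punct (negbTE ki).
Qed.

Let cbm_a i : cbm (fun t : T => a t i).
Proof.
apply/cbm_cme; split; last first.
 exists (N%:R ^+ 2) => t; rewrite ncX; apply: lesq; first exact: nc_ge0.
 by apply: le_trans w0i; exact: gr_nc.
have h : cme (fun t : T => gr lam w0 (v i t)).
 apply: cmeV; apply: cmeB (cme_cst w0); apply: cme_rc; apply: measurable_funM; first exact: measurable_cst.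
 exact: mfun_v.
by have := cmeM h h; congr cme; apply/funext => t; rewrite expr2.
Qed.

Let nc_a t i : nc (a t i) <= N%:R ^+ 2.
Proof.
rewrite ncX; apply: lesq; first exact: nc_ge0.
by apply: le_trans w0i; exact: gr_nc.
Qed.

Section minors.
Variable i : 'I_N.
Notation J2 := (idxD N :\: row_idx i)%SET.
Notation T2 := (g_sigma_algebraType (genX J2)).

Let cme_g2 : cme (fun t : T2 => gr lam w0 (v i t)).
Proof.
apply: cmeV; apply: cmeB (cme_cst w0); apply: cme_rc; apply: measurable_funM; first exact: measurable_cst.
by apply: mfun_gen; rewrite !inE.
Qed.

Let cme_zm : cme (fun t : T2 => zm t i).
Proof.
apply: cmeB (cme_cst _); apply: cmeD; apply: cmeM; try exact: cme_cst.
 by apply: cme_sum => k; exact: cme_minor.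
apply: cmeM; first exact: cme_g2.
apply: cmeD; first exact: cme_cst.
apply: cmeM; first exact: cme_cst.
by apply: cme_sum => k; exact: cme_minor2.
Qed.

Let sub_cme (f : T -> R[i]) : cme (f : T2 -> R[i]) -> cme f.
Proof.
have mT := measurable_toF (@gen_measurable _ theta C0 mu N X J2).
by move=> [h1 h2]; split; [exact: (measurableT_comp h1 mT)|exact: (measurableT_comp h2 mT)].
Qed.

(** This bound and its companions only need to be polynomial in [N]: they multiply nothing but [eps]
    and [pb], which will be exponentially small. *)
Lemma nc_zm t : nc (zm t i) <= N%:R ^+ 3.
Proof.
have hZ := herm_zrc (@ham_herm _ _ _ _ _ X lam t) i.
have s0 (F : 'I_N -> R[i]) (b : R) : (forall k, nc (F k) <= b) -> nc (rc N%:R^-1 * \sum_(k | k != i) F k) <= b.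
 move=> hF; rewrite ncM nc_rc ger0_norm ?invr_ge0 ?(ltW Np) // ler_pdivrMl //.
 apply: le_trans (nc_sum _ _ _) _; apply: (via (\sum_(k < N) b)); last by rewrite sumr_const card_ord -[X in X <= _]mulr_natl.
 rewrite [leRHS](bigID (fun k => k != i)) /= ler_wpDr //.
  by apply: sumr_ge0 => k _; apply: le_trans (hF k); exact: nc_ge0.
 by apply: ler_sum => k _.
have h1 := s0 _ _ (fun k => nc_res hZ z0 k k).
have h3 k : (Iz (res (zrc (ham t) i) z k k) + Iz (res (zrc (ham t) i) z k k)) / (2 * Iz z) <= N%:R ^+ 2.
 have -> : forall x : R, (x + x) / (2 * Iz z) = x * (Iz z)^-1 by move=> x; field; rewrite gt_eqF.
 have := Im_res_ge0 hZ z0 k; have := le_trans (ler_norm _) (le_trans (Im_le _) (nc_res hZ z0 k k)).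
 by move=> a1 a2; rewrite expr2; apply: ler_pM => //; [rewrite invr_ge0 ltW|exact: le_trans zi].
have h4 := s0 _ _ (fun k => le_trans (nc_res2 hZ z0 k k) (h3 k)).
have hg : nc (gr lam w0 (v i t)) <= N%:R by apply: le_trans w0i; exact: gr_nc.
apply: le_trans (ncB _ _) _; apply: (via (N%:R + (1 + N%:R ^+ 2) + 1)).
 apply: lerD m1; apply: le_trans (ncD _ _) _; apply: lerD; first exact: le_trans zi.
 rewrite ncM nc_rc ger0_norm ?invr_ge0 ?(ltW Np) // ler_pdivrMl // ncM; apply: ler_pM; rewrite ?nc_ge0 //.
 by apply: le_trans (ncD _ _) _; rewrite nc1 lerD2l.
have e3 : 5 * N%:R ^+ 2 <= N%:R ^+ 3 :> R by rewrite [leRHS]exprS; apply: ler_wpM2r; rewrite ?sqr_ge0.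
have e2 : 5 * N%:R <= N%:R ^+ 2 :> R by rewrite expr2; apply: ler_wpM2r; rewrite ?ler0n.
by move: e3 e2 N5R; move: (N%:R) (N%:R ^+ 2) (N%:R ^+ 3) => x y w; lra.
Qed.

Notation Y t := (a t i * qq kp q (zm t i)).

Let cme_qq {d'} {S' : measurableType d'} (f : S' -> R[i]) : cme f -> cme (fun t => qq kp q (f t)).
Proof.
move=> hf; apply: cmeM; first exact: cmeJ.
apply: cme_rc; apply: measurable_funX; apply: measurable_funD; last exact: measurable_cst.
exact: measurable_nc2.
Qed.

Let cme_Y2 : cme (fun t : T2 => Y t).
Proof.
apply: cmeM; last exact: cme_qq.
by have := cmeM cme_g2 cme_g2; congr cme; apply/funext => t; rewrite expr2.
Qed.

Lemma tq_zm t : tq kp (zm t i) <= N%:R ^+ 7.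
Proof.
have k2 : kp ^+ 2 <= 1 by rewrite expr_le1 // ltW.
have n6 : nc (zm t i) ^+ 2 <= N%:R ^+ 6.
 by have -> : N%:R ^+ 6 = (N%:R ^+ 3) ^+ 2 :> R by [rewrite -exprM]; apply: lesq (nc_zm t); exact: nc_ge0.
have n6' : 1 <= N%:R ^+ 6 :> R by rewrite expr_ge1 // ler1n.
have n7 : 5 * N%:R ^+ 6 <= N%:R ^+ 7 :> R by rewrite [leRHS]exprS; apply: ler_wpM2r => //; rewrite exprn_ge0.
by rewrite /tq; move: k2 n6 n6' n7; move: (N%:R ^+ 7) (N%:R ^+ 6) (kp ^+ 2) (_ ^+ 2) => x y w u; lra.
Qed.

Lemma nc_Y t : nc (Y t) <= N%:R ^+ (7 * q + 5).
Proof.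
rewrite ncM nc_qq; have -> : N%:R ^+ (7 * q + 5) = N%:R ^+ 2 * (N%:R ^+ 3 * (N%:R ^+ 7) ^+ q) :> R.
 by rewrite -exprM -!exprD; congr (_ ^+ _); rewrite addnA addnC.
apply: ler_pM; rewrite ?mulr_ge0 ?nc_ge0 ?exprn_ge0 ?tq_ge0 //.
apply: ler_pM; rewrite ?nc_ge0 ?exprn_ge0 ?tq_ge0 ?nc_zm //.
by apply: lerXn2r; rewrite ?nnegrE ?tq_ge0 ?exprn_ge0 // tq_zm.
Qed.

Lemma cbm_Y : cbm (fun t : T => Y t).
Proof. by apply/cbm_cme; split; [exact: sub_cme cme_Y2|exists (N%:R ^+ (7 * q + 5)) => t; exact: nc_Y]. Qed.

Lemma mean_Y : `|\int[P]_t Rz (trunc_quad lam z i Mt t * Y t)| <= N%:R ^+ (7 * q + 8) * eps.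
Proof.
have h := row_mean lam z0 Mt0 eps1 (hm1 i) (hm2 i) cbm_Y cme_Y2 nc_Y.
apply: le_trans (Re_le (cmean EE (fun t => trunc_quad lam z i Mt t * Y t))) _; apply: (le_trans h).
have -> : N%:R ^+ (7 * q + 8) = N%:R ^+ 2 * (N%:R ^+ (7 * q + 5) * N%:R) :> R.
 by rewrite -exprSr -exprD; congr (_ ^+ _); rewrite !addnS.
rewrite mulrAC; apply: ler_wpM2r => //; apply: ler_wpM2l; first exact: sqr_ge0.
by apply: ler_wpM2l => //; rewrite exprn_ge0.
Qed.

Lemma nc_quadY t : nc (trunc_quad lam z i Mt t * Y t) <= N%:R ^+ (7 * q + 9).
Proof.
have -> : N%:R ^+ (7 * q + 9) = N%:R ^+ 4 * N%:R ^+ (7 * q + 5) :> R.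
 by rewrite -exprD; congr (_ ^+ _); rewrite [RHS]addnC -addnA.
rewrite ncM; apply: ler_pM; rewrite ?nc_ge0 ?nc_Y //.
apply: le_trans (nc_trunc_quad lam z0 i N0 Mt0 t Mt1) _.
rewrite -mulrA [leRHS]exprS; apply: ler_pM => //.
- by rewrite mulr_ge0 ?sqr_ge0 // invr_ge0 ltW.
- by apply: le_trans N5R; rewrite ler_nat.
- by rewrite [leRHS]exprSr; apply: ler_wpM2l; rewrite ?sqr_ge0.
Qed.

Lemma cbm_quadY : cbm (fun t : T => trunc_quad lam z i Mt t * Y t).
Proof. by apply: cbmM cbm_Y; exact: cbm_trunc_quad. Qed.
End minors.

Lemma cbm_zeta : cbm (fun t : T => zeta t).
Proof.
apply: cbmB (cbm_cst _); apply: cbmM (cbm_cst _) _; apply: cbm_sum => i.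
by apply: cbm_res => // [k l|s]; [exact: cme_ham|exact: ham_herm].
Qed.

Let tqz t := tq kp (zeta t).
Let bmf_tqz k : bmf (fun t => tqz t ^+ k).
Proof. by apply: bmfX; apply: bmfD (bmf_cst _); apply: bmfX; apply: bmf_nc; exact: cbm_zeta. Qed.

Lemma tqz_le t : tqz t <= N%:R ^+ 7.
Proof.
have hH := @ham_herm _ _ _ _ _ X lam t.
have k2 : kp ^+ 2 <= 1 by rewrite expr_le1 // ltW.
have e2 : 5 * N%:R <= N%:R ^+ 2 :> R by rewrite expr2; apply: ler_wpM2r; rewrite ?ler0n.
have n4 : nc (zeta t) ^+ 2 <= N%:R ^+ 4.
 have -> : N%:R ^+ 4 = (N%:R ^+ 2) ^+ 2 :> R by rewrite -exprM.
 apply: lesq; first exact: nc_ge0.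
 apply: le_trans (ncB _ _) _; have := le_trans (nc_mN hH N0 z0) zi.
 by move: m1 e2 N5R; move: (nc (m z)) (nc _) (N%:R) (N%:R ^+ 2) => x y w u; lra.
have n4' : 1 <= N%:R ^+ 4 :> R by rewrite expr_ge1 // ler1n.
have n5 : 5 * N%:R ^+ 4 <= N%:R ^+ 5 :> R by rewrite [leRHS]exprS; apply: ler_wpM2r => //; rewrite exprn_ge0.
have n7 : N%:R ^+ 5 <= N%:R ^+ 7 :> R by apply: ler_weXn2l => //; rewrite ler1n.
by rewrite /tqz /tq; move: k2 n4 n4' n5 n7; move: (N%:R ^+ 7) (N%:R ^+ 5) (N%:R ^+ 4) (kp ^+ 2) (_ ^+ 2) => x y w u s; lra.
Qed.

Lemma strong_moment :
 \int[P]_t (tqz t ^+ q.+1) <= 2 * (3 * kp ^+ 2) ^+ q.+1 + 8 / c2 * N%:R ^+ (7 * q + 9) * (eps + pb).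
Proof.
set K : R := N%:R ^+ (7 * q + 9).
have K0 : 0 <= K by rewrite exprn_ge0.
pose Yt t := N%:R^-1 * \sum_i Rz (trunc_quad lam z i Mt t * (a t i * qq kp q (zm t i))).
have bY : bmf Yt by apply: bmfZ; apply: bmf_sum => i; exact: (cbm_quadY i).1.
have hY t : `|Yt t| <= K.
 rewrite normrM ger0_norm ?invr_ge0 ?(ltW Np) // ler_pdivrMl //; apply: le_trans (ler_norm_sum _ _ _) _.
 apply: (via (\sum_(i < N) K)); last by rewrite sumr_const card_ord -[X in X <= _]mulr_natl.
 by apply: ler_sum => i _; apply: le_trans (Re_le _) _; exact: nc_quadY.
have c4 : 1 <= 4 / c2 by rewrite ler_pdivlMr // mul1r; apply: le_trans c21 _; rewrite ler1n.
(* On [Gd] this is [moment_step], where truncation is invisible; off [Gd] the term with the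
   indicator outweighs the crude bounds on both [tqz] and [Yt]. *)
have pw t : tqz t ^+ q.+1 <= (2 * (3 * kp ^+ 2) ^+ q.+1 + 4 / c2 * Yt t) + (8 / c2 * K) * \1_(~` Gd) t.
 have T0 : 0 <= 2 * (3 * kp ^+ 2) ^+ q.+1 by rewrite mulr_ge0 // exprn_ge0 // mulr_ge0 // sqr_ge0.
 rewrite indicE; case: (boolP (t \in ~` Gd)) => [_|]; last first.
  rewrite in_setC negbK => /set_mem Gt; rewrite mulr0 addr0.
  have [g1 g2 g3 g4 g5] := hG Gt.
  have := moment_step kp0 N0 c20 g1 hB g2 g3 g4.
  congr (_ <= _ + _ * (_ * _)); apply: eq_bigr => i _; congr (Rz _).
  by rewrite (trunc_quadE (fun k => g5 k i)) mulrA [quad_err _ _ _ * _]mulrC.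
 rewrite mulr1; have h1 : tqz t ^+ q.+1 <= K.
  apply: (via ((N%:R ^+ 7) ^+ q.+1)).
   by apply: lerXn2r; rewrite ?nnegrE ?tq_ge0 ?exprn_ge0 // tqz_le.
  by rewrite -exprM; apply: ler_weXn2l; [rewrite ler1n|rewrite mulnS addnC leq_add2l].
 have h2 : - (4 / c2 * K) <= 4 / c2 * Yt t.
  rewrite -mulrN; apply: ler_wpM2l; first by rewrite divr_ge0 // ltW.
  by have := hY t; rewrite ler_norml => /andP[].
 have h3 : K <= 4 / c2 * K by apply: ler_peMl.
 have -> : 8 / c2 * K = 4 / c2 * K + 4 / c2 * K by ring.
 by move: T0 h1 h2 h3; move: (2 * _) (4 / c2 * K) (4 / c2 * Yt t) (tqz t ^+ _) => x y w u; lra.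
have bI : bmf (fun t => (8 / c2 * K) * \1_(~` Gd) t) by apply: bmfZ; apply: bmf_indic; exact: measurableC.
have b4 : bmf (fun t => 4 / c2 * Yt t) by exact: bmfZ.
have b5 : bmf (fun t => 2 * (3 * kp ^+ 2) ^+ q.+1 + 4 / c2 * Yt t) by apply: bmfD b4; exact: bmf_cst.
apply: le_trans (mean_le hE (bmf_tqz q.+1) (bmfD b5 bI) pw) _.
rewrite (meanD hE b5 bI) (meanD hE (bmf_cst _) b4) (mean_const hE) (meanZ hE _ bY) (meanZ hE _ (bmf_indic (measurableC mGd))).
have hYm : \int[P]_t Yt t <= K * eps.
 have bs : bmf (fun t => \sum_i Rz (trunc_quad lam z i Mt t * (a t i * qq kp q (zm t i)))).
  by apply: bmf_sum => i; exact: (cbm_quadY i).1.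
 rewrite /Yt (meanZ hE _ bs) (mean_sum hE) => [|i]; last exact: (cbm_quadY i).1.
 rewrite ler_pdivrMl //; apply: (via (\sum_(i < N) (N%:R ^+ (7 * q + 8) * eps))).
  by apply: ler_sum => i _; apply: le_trans (ler_norm _) _; exact: mean_Y.
 rewrite sumr_const card_ord -[leLHS]mulr_natl; apply: ler_wpM2l; first exact: ltW.
 by apply: ler_wpM2r => //; apply: ler_weXn2l; [rewrite ler1n|rewrite leq_add2l].
have hI : \int[P]_t \1_(~` Gd) t <= pb.
 by move: pGd; rewrite prob_indic ?lee_fin //; exact: measurableC.
have k1 : 4 / c2 * \int[P]_t Yt t <= 8 / c2 * K * eps.
 apply: (via (4 / c2 * (K * eps))); first by apply: ler_wpM2l => //; rewrite divr_ge0 // ltW.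
 rewrite -[leRHS]mulrA; apply: ler_wpM2r; first by rewrite mulr_ge0.
 by apply: ler_wpM2r; [rewrite invr_ge0 ltW|rewrite ler_nat].
have k2 : 8 / c2 * K * \int[P]_t \1_(~` Gd) t <= 8 / c2 * K * pb.
 by apply: ler_wpM2l => //; rewrite mulr_ge0 // divr_ge0 // ltW.
by rewrite mulrDr -addrA lerD2l; apply: lerD.
Qed.

(** If [|zeta| > 4 kp] then [tq >= 12 kp^2], four times the scale [3 kp^2] of the moment bound;
    hence [4^-(q+1)]. Dividing the remainder by powers of [kp >= 1/N] only raises its power of
    [N]. *)
Lemma strong_markov : 0 <= pb ->
 measurable [set t : T | (nc (zeta t) <= 4 * kp)%R] /\
 (P (~` [set t : T | (nc (zeta t) <= 4 * kp)%R])
  <= (2 / 4 ^+ q.+1 + 8 / c2 * N%:R ^+ (9 * q + 11) * (eps + pb))%:E)%E.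
Proof.
move=> pb0.
have mS : measurable [set t : T | (nc (zeta t) <= 4 * kp)%R].
 by apply: mset_le; [have /cbm_cme[hz _] := cbm_zeta; exact: (measurable_nc hz)|exact: measurable_cst].
split => //; set D := (12 * kp ^+ 2) ^- q.+1.
have D0 : 0 < 12 * kp ^+ 2 by rewrite mulr_gt0 // exprn_gt0.
have D1 : 0 <= D by rewrite invr_ge0 exprn_ge0 // ltW.
have bg : bmf (fun t => D * tqz t ^+ q.+1) by exact: bmfZ.
have g0 t : 0 <= D * tqz t ^+ q.+1 by rewrite mulr_ge0 // exprn_ge0 // tq_ge0.
have gA t : (~` [set t : T | (nc (zeta t) <= 4 * kp)%R]) t -> 1 <= D * tqz t ^+ q.+1.
 move=> /= /negP; rewrite -ltNge => h; rewrite mulrC ler_pdivlMr ?exprn_gt0 // mul1r.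
 apply: lerXn2r; rewrite ?nnegrE ?tq_ge0 ?(ltW D0) //.
 have : (4 * kp) ^+ 2 <= nc (zeta t) ^+ 2 by apply: lesq (ltW h); rewrite mulr_ge0 // ltW.
 by rewrite /tqz /tq; have := sqr_ge0 kp; rewrite exprMn; lra.
apply: le_trans (prob_markov P (measurableC mS) bg g0 gA) _; rewrite lee_fin (meanZ hE _ (bmf_tqz _)).
apply: le_trans (ler_wpM2l D1 strong_moment) _; rewrite mulrDr; apply: lerD.
 rewrite mulrCA; apply: ler_wpM2l => //.
 rewrite /D; have -> : 12 * kp ^+ 2 = 4 * (3 * kp ^+ 2) by ring.
 by rewrite exprMn invfM mulfVK // expf_neq0 // gt_eqF // mulr_gt0 // exprn_gt0.
have hD : D <= N%:R ^+ (2 * q + 2).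
 rewrite -[leRHS]invrK lef_pV2 ?posrE ?invr_gt0 ?exprn_gt0 // -exprVn.
 have -> : (2 * q + 2 = 2 * q.+1)%N by rewrite mulnS addnC.
 rewrite exprM; apply: lerXn2r; rewrite ?nnegrE ?sqr_ge0 ?(ltW D0) //.
 apply: (via (kp ^+ 2)); first by apply: lesq => //; rewrite invr_ge0 ltW.
 by apply: ler_peMl; rewrite ?sqr_ge0 // ler1n.
have -> : N%:R ^+ (9 * q + 11) = N%:R ^+ (2 * q + 2) * N%:R ^+ (7 * q + 9) :> R.
 by rewrite -exprD; congr (_ ^+ _); rewrite addnACA -mulnDl.
have c8 : 0 <= 8 / c2 by rewrite divr_ge0 // ltW.
have K0 : 0 <= N%:R ^+ (7 * q + 9) :> R by rewrite exprn_ge0.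
have e0 : 0 <= eps + pb by exact: addr_ge0.
have -> : 8 / c2 * (N%:R ^+ (2 * q + 2) * N%:R ^+ (7 * q + 9)) * (eps + pb) =
 N%:R ^+ (2 * q + 2) * (8 / c2 * N%:R ^+ (7 * q + 9) * (eps + pb)) by ring.
by apply: ler_wpM2r => //; rewrite mulr_ge0 // mulr_ge0.
Qed.
End strong_moment.

(** * The strong law at one point *)

Section point_law.
Context {R : realType} (theta C0 : R) (mu : probability (measurableTypeR R) R) (N : nat).
Variable X : deformed_wigner theta C0 mu N.
Notation T := (dw_space X).
Notation P := (dw_prob X).
Notation W := (@dw_W _ _ _ _ _ X).
Notation v := (@dw_v _ _ _ _ _ X).
Notation EE := (fun f : T -> R => \int[P]_t f t).
Variables (lam Cphi xi La c : R).
Notation ham := (@hamiltonian _ theta C0 mu N X lam).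
Notation m := (m_fc mu lam).
Notation f := (phi Cphi N `^ xi).
Notation L2 := (ln N%:R `^ xi).
Notation q := (expR (- L2)).
Notation u z := (La / sqrt (N%:R * Iz z)).
Hypotheses (N5 : (5 <= N)%N) (theta0 : 0 < theta) (C00 : 0 < C0) (LD : ld_at theta C0 Cphi N xi) (f0 : 0 < f)
 (L20 : 0 < L2) (fLa : f <= La) (L2La : L2 <= La) (La1 : 1 <= La) (LaN : La <= sqrt N%:R)
 (big : 3 * theta <= La `^ theta^-1) (tailq : 16 * C0 * expR (- La `^ theta^-1) <= q) (c0 : 0 < c)
 (c1 : c <= 1).

Let N0 : (0 < N)%N. exact: leq_trans N5. Qed.
Let N3 : (3 <= N)%N. exact: leq_trans N5. Qed.
Let Np : 0 < N%:R :> R. by rewrite ltr0n. Qed.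
Let N5R : 5 <= N%:R :> R. by rewrite ler_nat. Qed.
Let sN : 0 < sqrt N%:R :> R. by rewrite sqrtr_gt0. Qed.
Let q0 : 0 <= q. exact: expR_ge0. Qed.
Let Lp : 0 < La. exact: lt_le_trans La1. Qed.
Let hE : is_mean EE := expectation_is_mean P.
Let hmu := law_is_mean mu.
Let m1 z : 0 < Iz z -> nc (m z) <= 1.
Proof. exact: (nc_m hmu (@m_fc_ge0 _ mu lam) (@m_fc_eq _ mu lam)). Qed.

Notation M t i z := (res (zrc (ham t) i) z).
Definition minor_sqr t z i := nc (\sum_(k | k != i) \sum_(l | l != i) ham t i k * (M t i z *m M t i z) k l * ham t l i
  - rc N%:R^-1 * \sum_(k | k != i) (M t i z *m M t i z) k k)
 <= 2 * La / N%:R * sqrt (\sum_(k | k != i) \sum_(l | l != i) nc ((M t i z *m M t i z) k l) ^+ 2).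

Lemma height_event z : 0 < Iz z -> c <= Iz (m z) -> exists A : set T,
 [/\ measurable A, (P (~` A) <= (5 * N%:R ^+ 2 * q)%:E)%E & forall t, A t ->
  [/\ (forall k i, nc (W t k i) <= La / sqrt N%:R),
    (forall i, nc (quad_err (ham t) z i) <= 2 * La / N%:R * sqrt (quad_var (ham t) z i)),
    (forall i, minor_sqr t z i) &
    nc (stj (emp (v^~ t)) lam (z + m z) - m z) <= 8 * La / (c * sqrt N%:R)]].
Proof.
move=> z0 zc; have w0 : 0 < Iz (z + m z) by rewrite cImD addr_gt0 // (lt_le_trans c0).
have [A [mA pA hA]] := v_conc X N0 lam w0 L20.
have hr i := row_eventP N3 theta0 X lam LD f0 z0 i.
pose Rw i : set T := @row_event R theta C0 mu N X lam Cphi xi z i.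
have mR i : measurable (Rw i) by case: (hr i).
have pR i : (P (~` Rw i) <= ((N.+2)%:R * q + (N.+2)%:R * q)%:E)%E by case: (hr i).
exists (A `&` \bigcap_(i in [set: 'I_N]) Rw i); split.
- by apply: measurableI => //; apply: fin_bigcap_measurable.
- have -> : 5 * N%:R ^+ 2 * q = 8 * q + (5 * N%:R ^+ 2 - 8) * q by ring.
 apply: prob_setCI => //; first exact: fin_bigcap_measurable.
 have := prob_setC_bigcap mR pR; rewrite card_ord; move/le_trans; apply; rewrite lee_fin -mulrDl mulrA.
 apply: ler_wpM2r => //; rewrite -addn2 natrD.
 have : 5 * N%:R <= N%:R ^+ 2 :> R by rewrite expr2; apply: ler_wpM2r; rewrite ?ler0n.
 have -> : N%:R * (N%:R + 2 + (N%:R + 2)) = 2 * N%:R ^+ 2 + 4 * N%:R :> R by ring.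
 by move: N5R; move: (N%:R) (N%:R ^+ 2) => x y; lra.
move=> t [tA tR].
have fN : 2 * f / N%:R <= 2 * La / N%:R.
 by apply: ler_wpM2r; [rewrite invr_ge0 ltW|apply: ler_wpM2l].
split.
- move=> k i; have [_ _ h] := hr i; have [h1 _ _] := h t (tR i I).
 by apply: le_trans (h1 k) _; apply: ler_wpM2r => //; rewrite invr_ge0 ltW.
- move=> i; have [_ _ h] := hr i; have [_ h1 _] := h t (tR i I).
 by apply: le_trans h1 _; apply: ler_wpM2r => //; exact: sqrtr_ge0.
- move=> i; have [_ _ h] := hr i; have [_ _ h1] := h t (tR i I).
 by apply: le_trans h1 _; apply: ler_wpM2r => //; exact: sqrtr_ge0.
- rewrite [X in nc (_ - X)](@m_fc_eq _ mu lam _ z0); apply: le_trans (hA t tA) _.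
 have wc : c <= Iz (z + m z) by rewrite cImD; apply: le_trans zc _; rewrite lerDr ltW.
 apply: ler_pM; rewrite ?invr_ge0 ?mulr_ge0 ?(ltW w0) ?(ltW sN) ?(ltW L20) //; first by apply: ler_wpM2l.
 by rewrite lef_pV2 ?posrE ?mulr_gt0 //; apply: ler_wpM2r => //; exact: ltW.
Qed.

Variables (x eta : R) (n : nat).
Hypotheses (etaN : N%:R^-1 <= eta) (n1 : 1 <= 2 ^+ n * eta) (n2 : 2 ^+ n * eta <= 2) (nN : (n.+1 <= N)%N)
 (him : forall e, 0 < e -> e <= 2 -> c <= Iz (m (Cx x e))).
Notation z := (Cx x eta).
Hypothesis small : 2 * 10 ^+ 4 * u z <= c ^+ 5.
Let eta0 : 0 < eta. by apply: lt_le_trans etaN; rewrite invr_gt0. Qed.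

(** The weak law at [z] descends from height one, so the large deviation events are needed at all
    dyadic heights above [z]; there are at most [N] of them. *)
Lemma column_event : exists A : set T,
 [/\ measurable A, (P (~` A) <= (5 * N%:R ^+ 3 * q)%:E)%E & forall t, A t ->
  [/\ (forall k i, nc (W t k i) <= La / sqrt N%:R),
    regular (ham t) lam (v^~ t) La c m z,
    controlled (ham t) lam (v^~ t) La c m z &
    (forall i, minor_sqr t z i)]].
Proof.
pose zl (l : nat) := Cx x (2 ^+ l * eta).
have yl l : 0 < 2 ^+ l * eta by rewrite mulr_gt0 ?exprn_gt0.
have y2 l : (l <= n)%N -> 2 ^+ l * eta <= 2.
 move=> ln; apply: le_trans n2; apply: ler_wpM2r; first exact: ltW.
 by apply: ler_weXn2l => //; rewrite ler1n.
have hc l : (l <= n)%N -> c <= Iz (m (zl l)) by move=> ln; apply: him => //; exact: y2.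
have /choice[A hA] : forall l : 'I_n.+1, exists A : set T,
 [/\ measurable A, (P (~` A) <= (5 * N%:R ^+ 2 * q)%:E)%E & forall t, A t ->
  [/\ (forall k i, nc (W t k i) <= La / sqrt N%:R),
    (forall i, nc (quad_err (ham t) (zl l) i) <= 2 * La / N%:R * sqrt (quad_var (ham t) (zl l) i)),
    (forall i, minor_sqr t (zl l) i) &
    nc (stj (emp (v^~ t)) lam (zl l + m (zl l)) - m (zl l)) <= 8 * La / (c * sqrt N%:R)]].
 by move=> l; exact: (@height_event (zl l) (yl l) (hc l (leq_ord l))).
have mA l : measurable (A l) by case: (hA l).
have pA l : (P (~` A l) <= (5 * N%:R ^+ 2 * q)%:E)%E by case: (hA l).
exists (\bigcap_(l in [set: 'I_n.+1]) A l); split.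
- exact: fin_bigcap_measurable.
- apply: le_trans (prob_setC_bigcap mA pA) _; rewrite lee_fin card_ord.
 have -> : 5 * N%:R ^+ 3 * q = N%:R * (5 * N%:R ^+ 2 * q) by ring.
 by apply: ler_wpM2r; rewrite ?ler_nat // mulr_ge0 // mulr_ge0 // sqr_ge0.
move=> t tA; have ht l : _ := let: And3 _ _ h := hA l in h t (tA l I).
have [hW _ _ _] := ht ord0.
have hH := @ham_herm _ _ _ _ _ X lam t.
have HD i : ham t i i = rc (lam * v i t) + W t i i := ham_diag lam t i.
have reg l : (l <= n)%N -> regular (ham t) lam (v^~ t) La c m (zl l).
 move=> ln; have ln' : (l < n.+1)%N by rewrite ltnS.
 have [_ hq _ hF] := ht (Ordinal ln').
 split; [exact: yl|exact: y2|exact: hc| |by split].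
 apply: le_trans small; apply: ler_wpM2l; first by rewrite mulr_ge0 // exprn_ge0.
 apply: ler_wpM2l; first exact: ltW.
 rewrite lef_pV2 ?posrE ?sqrtr_gt0 ?mulr_gt0 //; apply: ler_wsqrtr; apply: ler_wpM2l; first exact: ltW.
 by apply: ler_peMl; [exact: ltW|rewrite exprn_ege1 // ler1n].
have ctl := weak_column N0 hH La1 c0 c1 HD (fun i => hW i i) m1 eta0 n1 reg (leq0n n).
have e0 : zl 0%N = z by rewrite /zl expr0 mul1r.
have reg0 := reg 0%N (leq0n n); rewrite e0 in reg0.
rewrite -/(zl 0%N) e0 in ctl.
split => //; have [_ _ h _] := ht ord0.
by move: h; rewrite -[zl ord0]/(zl 0%N) e0.
Qed.

Lemma fin_second_moment i k : P.-integrable setT (fun t => (nc (W t k i) ^+ 2)%:E).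
Proof.
have [_ _ _ [_ _ h _] _] := dw_wigner X.
have mW : measurable_fun setT (fun t : T => nc (W t k i) ^+ 2) by apply: measurable_nc2; exact: cme_W.
apply/integrableP; split; first exact/measurable_EFinP.
have e : (\int[P]_t `|(nc (W t k i) ^+ 2)%:E| = \int[P]_t (nc (W t k i) ^+ 2)%:E)%E.
 by apply: eq_integral => t _; rewrite gee0_abs // lee_fin sqr_ge0.
rewrite e ltey; apply/eqP => hy; have := h k i; rewrite /Rintegral hy /= => /esym/eqP.
by rewrite invr_eq0 gt_eqF.
Qed.

(* The exponent [p = q + 1] of the moment method is at our disposal; the moments
  are compared at the scale [kp], proportional to [p r]. *)
Lemma point_law (r : R) (p : nat) : La / sqrt N%:R <= r -> u z ^+ 2 <= r ->
 10 ^+ 9 * p.+1%:R * r / c ^+ 13 <= 1 ->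
 exists A : set T, [/\ measurable A,
  (P (~` A) <= (5 * N%:R ^+ 3 * q + (2 / 4 ^+ p.+1 + 48 / c ^+ 2 * N%:R ^+ (9 * p + 14) * q))%:E)%E &
  forall t, A t -> nc (mN (ham t) z - m z) <= 3 * 10 ^+ 3 * u z / c ^+ 4 /\
   nc (mN (ham t) z - m z) <= 4 * (10 ^+ 9 * p.+1%:R * r / c ^+ 13)].
Proof.
move=> hr hur kp1; set kp := 10 ^+ 9 * _ * r / _ in kp1 *.
have [A [mA pA hA]] := column_event.
pose Mt := La / sqrt N%:R.
have Mt0 : 0 < Mt by exact: divr_gt0.
have Mt1 : Mt <= 1 by rewrite ler_pdivrMr // mul1r.
have sM : sqrt N%:R * Mt = La by rewrite mulrC divfK // gt_eqF.
pose eps := 2 * (8 * Mt ^+ 2 * C0 * expR (- La `^ theta^-1) / Mt).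
have epsq : eps <= q.
 have -> : eps = Mt * (16 * C0 * expR (- La `^ theta^-1)) by rewrite /eps; field; rewrite gt_eqF.
 apply: le_trans tailq; rewrite -[leRHS]mul1r; apply: ler_wpM2r => //.
 by rewrite !mulr_ge0 ?expR_ge0 // ltW.
have eps0 : 0 <= eps by rewrite /eps mulr_ge0 // divr_ge0 ?(ltW Mt0) // !mulr_ge0 ?sqr_ge0 ?expR_ge0 // ltW.
have q1 : q <= 1 by rewrite -[leRHS]expR0 ler_expR oppr_le0 ltW.
have eps1 : eps <= 1 by exact: le_trans q1.
have [wm wz' _ [w1 _ w2 _] wt] := dw_wigner X.
have hm i k := @trunc_moments _ _ _ P (fun t => W t k i) theta C0 Mt La (sqrt N%:R) (cme_W X k i) theta0 C00 Mt0 Lp sN sM (wt k i) big (fin_second_moment i k) Mt1.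
have hm1 i k : nc (cmean EE (fun t => trunc (fun t => W t k i) Mt t)) <= eps by have [h _] := hm i k; apply: h; exact: w1.
have hm2 i k : `|\int[P]_t (nc (trunc (fun t => W t k i) Mt t) ^+ 2) - N%:R^-1| <= eps.
 by have [_ h] := hm i k; rewrite -(w2 k i).
have r0 : 0 < r by apply: lt_le_trans hr.
have p1 : 1 <= p.+1%:R :> R by rewrite ler1n.
have p0 : 0 < p.+1%:R :> R by rewrite ltr0n.
have ci k : 1 <= c ^- k by rewrite invf_ge1 ?exprn_gt0 //; apply: exprn_ile1 => //; exact: ltW.
have ck k : 0 < c ^- k by rewrite invr_gt0 exprn_gt0.
have rkp : 10 ^+ 9 * r <= kp * c ^+ 13.
 have -> : kp * c ^+ 13 = 10 ^+ 9 * r * p.+1%:R by rewrite /kp; field; rewrite ?gt_eqF.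
 by apply: ler_peMr => //; rewrite mulr_ge0 ?exprn_ge0 // ltW.
have kp0 : 0 < kp by rewrite /kp !mulr_gt0 ?exprn_gt0.
have kpN : N%:R^-1 <= kp.
 apply: (via r).
  apply: le_trans hr; apply: (via (sqrt N%:R)^-1).
   rewrite lef_pV2 ?posrE // -[leRHS]ger0_norm ?(ltW Np) // -sqrtr_sqr; apply: ler_wsqrtr.
   by rewrite -[leLHS]mul1r expr2; apply: ler_wpM2r => //; apply: le_trans N5R; rewrite ler1n.
  by apply: ler_peMl; rewrite ?invr_ge0 ?(ltW sN).
 have c13 : kp * c ^+ 13 <= kp by rewrite -[leRHS]mulr1; apply: ler_wpM2l; [exact: ltW|apply: exprn_ile1 => //; exact: ltW].
 by move: rkp c13 r0; move: (kp * _) => y; lra.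
pose c2 := c ^+ 2.
have c20 : 0 < c2 by exact: exprn_gt0.
have c21 : c2 <= 1 by apply: exprn_ile1 => //; exact: ltW.
pose B := 2 * 10 ^+ 8 * r / c ^+ 11.
have hB : 2 * B <= kp * c2.
 have -> : kp * c2 = kp * c ^+ 13 / c ^+ 11 by rewrite /c2; field; rewrite ?gt_eqF.
 have -> : 2 * B = 4 * 10 ^+ 8 * r / c ^+ 11 by rewrite /B; ring.
 apply: ler_wpM2r; first exact: ltW.
 by move: rkp r0; move: (kp * _) => y; lra.
have pb0 : 0 <= 5 * N%:R ^+ 3 * q by rewrite mulr_ge0 // mulr_ge0 // exprn_ge0.
have z0 : 0 < Iz z by [].
have := @strong_markov _ theta C0 mu N X lam m z kp c2 B Mt eps _ p N5 etaN (@m_fc_ge0 _ mu lam z z0) (m1 z0) kpN kp1 c20 c21 Mt0 Mt1 eps0 eps1 hm1 hm2 A mA pA hB _ pb0.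
case.
 move=> t tA; have [hW reg ctl hM] := hA t tA.
 have hH := @ham_herm _ _ _ _ _ X lam t.
 have HD i : ham t i i = rc (lam * v i t) + W t i i := ham_diag lam t i.
 have hz i := zeta_minor_close N0 hH La1 c0 c1 reg ctl hM i.
 have u0 : 0 < u z by rewrite divr_gt0 // sqrtr_gt0 mulr_gt0.
 have u1 : u z <= 1.
  have c51 : c ^+ 5 <= 1 by apply: exprn_ile1 => //; exact: ltW.
  by move: small c51 u0; move: (c ^+ 5) (u z) => a b; clra.
 have hNe : (N%:R * eta)^-1 <= r by apply: le_trans hur; exact: (inv_Neta La1 reg).
 have hd i : nc (mN (ham t) z - m z - zeta_minor (ham t) lam (v^~ t) m z i) <= 10 ^+ 6 * (u z * r) / c ^+ 6.
  apply: le_trans (hz i) _.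
  have -> : 10 ^+ 6 * u z / (c ^+ 6 * (N%:R * Iz z)) = 10 ^+ 6 * (u z * (N%:R * eta)^-1) / c ^+ 6.
   by move: (u z) => y; rewrite [Iz _]/=; field; rewrite !gt_eqF.
  apply: ler_wpM2r; first exact: ltW.
  apply: ler_wpM2l; first exact: exprn_ge0.
  by apply: ler_wpM2l => //; exact: ltW.
 split => //.
 - exact: (Re_S N0 La1 c0 c1 reg).
 - exact: (self_consistent N0 hH La1 c0 c1 HD (fun i => hW i i) reg ctl hr hur).
 - move=> i; apply: le_trans (hd i) _; rewrite ler_pdivlMr ?mulr_gt0 //.
  apply: (via (10 ^+ 6 * r / c ^+ 6 * (4 * p.+1%:R))).
   apply: ler_wpM2r; first by rewrite mulr_ge0 // ltW.
   apply: ler_wpM2r; first exact: ltW.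
   apply: ler_wpM2l; first exact: exprn_ge0.
   by rewrite -[leRHS]mul1r; apply: ler_wpM2r => //; exact: ltW.
  have -> : kp = 10 ^+ 9 * (r * p.+1%:R / c ^+ 6) / c ^+ 7 by rewrite /kp; field; rewrite ?gt_eqF.
  have -> : 10 ^+ 6 * r / c ^+ 6 * (4 * p.+1%:R) = 4 * 10 ^+ 6 * (r * p.+1%:R / c ^+ 6) by ring.
  have y0 : 0 <= r * p.+1%:R / c ^+ 6 by rewrite mulr_ge0 ?(ltW (ck 6)) // mulr_ge0 // ltW.
  apply: (via (10 ^+ 9 * (r * p.+1%:R / c ^+ 6))).
   by apply: ler_wpM2r => //; clra.
  by apply: ler_peMr; [rewrite mulr_ge0 ?exprn_ge0|exact: ci].
 - move=> i; rewrite ncM.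
  have h1 : nc (gr lam (z + m z) (v i t) ^+ 2) <= c ^- 2.
   rewrite ncX -exprVn; apply: lesq; first exact: nc_ge0.
   exact: (nc_g c0 reg).
  have h2 := nc_quad N0 hH La1 c0 c1 reg ctl i.
  have h3 : nc (gr lam (z + m z) (v i t) ^+ 2) * nc (quad_err (ham t) z i) <= c ^- 2 * (5 * u z).
   by apply: ler_pM; rewrite ?nc_ge0.
  have h4 := ler_pM (mulr_ge0 (nc_ge0 _) (nc_ge0 _)) (nc_ge0 _) h3 (hd i).
  apply: (via (c ^- 2 * (5 * u z) * (10 ^+ 6 * (u z * r) / c ^+ 6) * (7 * p.+1%:R))).
   by apply: ler_wpM2r => //; rewrite mulr_ge0 // ltW.
  have -> : c ^- 2 * (5 * u z) * (10 ^+ 6 * (u z * r) / c ^+ 6) * (7 * p.+1%:R) = 35 * 10 ^+ 6 * (r * p.+1%:R / c ^+ 8) * u z ^+ 2.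
   by move: (u z) => y; field; rewrite ?gt_eqF.
  have y0 : 0 <= r * p.+1%:R / c ^+ 8 by rewrite mulr_ge0 ?(ltW (ck 8)) // mulr_ge0 // ltW.
  apply: (via (35 * 10 ^+ 6 * (r * p.+1%:R / c ^+ 8) * r)).
   by apply: ler_wpM2l => //; rewrite mulr_ge0 // mulr_ge0 // exprn_ge0.
  have -> : kp ^+ 2 * c2 / 8 = (10 ^+ 18 / 8 * (r * p.+1%:R / c ^+ 8) * r) * (p.+1%:R * c ^- 16).
   by rewrite /kp /c2; field; rewrite ?gt_eqF.
  apply: (via (10 ^+ 18 / 8 * (r * p.+1%:R / c ^+ 8) * r)).
   apply: ler_wpM2r; first exact: ltW.
   by apply: ler_wpM2r => //; clra.
  apply: ler_peMr.
   by rewrite mulr_ge0 ?(ltW r0) // mulr_ge0 // divr_ge0 // exprn_ge0.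
  by rewrite -[leLHS]mulr1; apply: ler_pM.
set S := [set t | _] => mS pS; exists (A `&` S); split; first exact: measurableI.
 apply: prob_setCI => //; apply: le_trans pS _; rewrite lee_fin lerD2l.
 have N30 : 1 <= N%:R ^+ 3 :> R by rewrite exprn_ege1 // (le_trans _ N5R) // ler1n.
 have e6 : eps + 5 * N%:R ^+ 3 * q <= 6 * N%:R ^+ 3 * q.
  have -> : 6 * N%:R ^+ 3 * q = N%:R ^+ 3 * q + 5 * N%:R ^+ 3 * q by ring.
  by rewrite lerD2r; apply: le_trans epsq _; apply: ler_peMl.
 have -> : 48 / c ^+ 2 * N%:R ^+ (9 * p + 14) * q = 8 / c2 * N%:R ^+ (9 * p + 11) * (6 * N%:R ^+ 3 * q).
  have -> : (9 * p + 14 = 9 * p + 11 + 3)%N by rewrite -addnA.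
  by rewrite exprD /c2; ring.
 by apply: ler_wpM2l => //; rewrite mulr_ge0 ?exprn_ge0 // divr_ge0 // ltW.
move=> t [tA tS]; have [_ _ ctl _] := hA t tA; split => //.
by case: ctl.
Qed.
End point_law.

(** The least [n] that reaches height one overshoots by a factor of at most two. It is below [N]
    because [2^n <= 2 N < 2^N], the last inequality being true from [N = 5] on. *)
Lemma dyadic_height (R : realType) (N : nat) (eta : R) : (5 <= N)%N -> N%:R^-1 <= eta -> eta <= 2 ->
 exists n : nat, [/\ 1 <= 2 ^+ n * eta, 2 ^+ n * eta <= 2 & (n.+1 <= N)%N].
Proof.
move=> N5 hN h2; have Np : 0 < N%:R :> R by rewrite ltr0n (leq_trans _ N5).
have e0 : 0 < eta by apply: lt_le_trans hN; rewrite invr_gt0.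
have ex : exists n, 1 <= 2 ^+ n * eta.
 exists N; apply: (via (N%:R * eta)); first by rewrite -ler_pdivrMl // mulr1.
 by apply: ler_wpM2r; [exact: ltW|rewrite -natrX ler_nat ltnW // ltn_expl].
case: (ex_minnP ex) => n hn hmin; exists n.
have nup : 2 ^+ n * eta <= 2.
 case: n hn hmin => [|k] hn hmin; first by rewrite expr0 mul1r.
 have : 2 ^+ k * eta < 1 by rewrite ltNge; apply/negP => /hmin; rewrite ltnn.
 by rewrite exprS -mulrA; move: (2 ^+ k * eta) => w; lra.
split => //; have h : 2 ^+ n <= 2 * N%:R :> R.
 have : 2 ^+ n * N%:R^-1 <= 2 :> R by apply: le_trans nup; apply: ler_wpM2l => //; exact: exprn_ge0.
 by rewrite ler_pdivrMr.
have {}h : (2 ^ n <= 2 * N)%N by rewrite -(ler_nat R) natrX natrM.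
rewrite ltnNge; apply/negP => nN.
have h2N : (2 ^ N <= 2 * N)%N by apply: leq_trans h; rewrite leq_pexp2l.
have : forall k, (5 <= k)%N -> (2 * k < 2 ^ k)%N.
 elim=> // k IH; rewrite leq_eqVlt => /predU1P[[<-] //|k5]; have := IH k5.
 have k5' : (5 <= k)%N by rewrite -ltnS.
 rewrite expnS mulnS => hk; apply: (@leq_ltn_trans (k + 2 * k)%N); first by rewrite leq_add2r; apply: leq_trans k5'.
 rewrite [(2 * 2 ^ k)%N]mul2n -addnn -addnS; apply: leq_add => //; apply: ltnW; apply: leq_ltn_trans hk; exact: leq_pmull.
by move=> /(_ N N5); rewrite ltnNge h2N.
Qed.

Lemma rate_combine {R : realType} (r1 r2 r3 r4 : R) : 0 <= r3 -> r4 <= r3 -> r3 <= r1 -> r2 <= 2 * r1 ->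
 4 * r4 + 4 * 10 ^+ 9 * r2 <= 10 ^+ 10 * r1.
Proof. lra. Qed.

(** * The strong law at all points of the bulk simultaneously *)

Section uniform_law.
Context {R : realType} (theta C0 : R) (mu : probability (measurableTypeR R) R) (N : nat).
Variable X : deformed_wigner theta C0 mu N.
Notation T := (dw_space X).
Notation P := (dw_prob X).
Variables (lam Cphi xi La c : R).
Notation ham := (@hamiltonian _ theta C0 mu N X lam).
Notation m := (m_fc mu lam).
Notation f := (phi Cphi N `^ xi).
Notation L2 := (ln N%:R `^ xi).
Notation q := (expR (- L2)).
Hypotheses (N5 : (5 <= N)%N) (theta0 : 0 < theta) (C00 : 0 < C0) (LD : ld_at theta C0 Cphi N xi) (f0 : 0 < f)
 (L20 : 0 < L2) (fLa : f <= La) (L2La : L2 <= La) (La1 : 1 <= La) (LaN : La <= sqrt N%:R)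
 (big : 3 * theta <= La `^ theta^-1) (tailq : 16 * C0 * expR (- La `^ theta^-1) <= q) (c0 : 0 < c)
 (c1 : c <= 1).
Variables (x1 x2 y : R) (p : nat).
Hypotheses (x12 : x2 - x1 <= N%:R) (him : forall x e, x1 <= x <= x2 -> 0 < e -> e <= 2 -> c <= Iz (m (Cx x e)))
 (yN : N%:R^-1 <= y) (small : 2 * 10 ^+ 4 * (La / sqrt (N%:R * y)) <= c ^+ 5).
Notation rate e := (La ^+ 2 * ((sqrt N%:R)^-1 + (N%:R * e)^-1)).
Hypotheses (kp1 : 10 ^+ 9 * p.+1%:R * rate y / c ^+ 13 <= 1) (cN : 2 <= N%:R * c ^+ 2).

Let N0 : (0 < N)%N. exact: leq_trans N5. Qed.
Let Np : 0 < N%:R :> R. by rewrite ltr0n. Qed.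
Let N5R : 5 <= N%:R :> R. by rewrite ler_nat. Qed.
Let sN : 0 < sqrt N%:R :> R. by rewrite sqrtr_gt0. Qed.
Let Lp : 0 < La. exact: lt_le_trans La1. Qed.
Let y0 : 0 < y. by apply: lt_le_trans yN; rewrite invr_gt0. Qed.
Let q0 : 0 <= q. exact: expR_ge0. Qed.
Let hmu := law_is_mean mu.
Let ci k : 1 <= c ^- k.
Proof. by rewrite invf_ge1 ?exprn_gt0 //; apply: exprn_ile1 => //; exact: ltW. Qed.
Let p1 : 1 <= p.+1%:R :> R. by rewrite ler1n. Qed.

Notation pb := (2 / 4 ^+ p.+1 + 53 / c ^+ 2 * N%:R ^+ (9 * p + 14) * q).

Lemma rate_le e : y <= e -> rate e <= rate y.
Proof.
move=> ye; have e0 : 0 < e by exact: lt_le_trans ye.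
apply: ler_wpM2l; first exact: sqr_ge0.
rewrite lerD2l lef_pV2 ?posrE ?mulr_gt0 //.
by apply: ler_wpM2l => //; exact: ltW.
Qed.

Lemma point_rate x e : x1 <= x <= x2 -> y <= e -> e <= 2 -> exists A : set T,
 [/\ measurable A, (P (~` A) <= pb%:E)%E & forall t, A t ->
  nc (mN (ham t) (Cx x e) - m (Cx x e)) <= 4 * 10 ^+ 9 * p.+1%:R * rate e / c ^+ 13].
Proof.
move=> hx ye e2; have e0 : 0 < e by exact: lt_le_trans ye.
have eN : N%:R^-1 <= e by exact: le_trans ye.
have [n [n1 n2 nN]] := dyadic_height N5 eN e2.
have sm : 2 * 10 ^+ 4 * (La / sqrt (N%:R * e)) <= c ^+ 5.
 apply: le_trans small; apply: ler_wpM2l; first by rewrite mulr_ge0 // exprn_ge0.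
 apply: ler_wpM2l; first exact: ltW.
 rewrite lef_pV2 ?posrE ?sqrtr_gt0 ?mulr_gt0 //; apply: ler_wsqrtr.
 by apply: ler_wpM2l => //; exact: ltW.
have L21 : La <= La ^+ 2 by rewrite expr2 -[leLHS]mulr1; apply: ler_wpM2l => //; exact: ltW.
have hr : La / sqrt N%:R <= rate e.
 apply: ler_pM => //; rewrite ?invr_ge0 ?(ltW Lp) ?(ltW sN) //.
 by rewrite lerDl invr_ge0 mulr_ge0 // ltW.
have hur : (La / sqrt (N%:R * e)) ^+ 2 <= rate e.
 rewrite expr_div_n sqr_sqrtr ?mulr_ge0 ?(ltW e0) //; apply: ler_wpM2l; first exact: sqr_ge0.
 by rewrite lerDr invr_ge0 ltW.
have kpe : 10 ^+ 9 * p.+1%:R * rate e / c ^+ 13 <= 1.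
 apply: le_trans kp1; apply: ler_wpM2r; first by rewrite invr_ge0 exprn_ge0 // ltW.
 by apply: ler_wpM2l; [rewrite mulr_ge0 // exprn_ge0|exact: rate_le].
have [A [mA pA hA]] := @point_law R theta C0 mu N X lam Cphi xi La c N5 theta0 C00 LD f0 L20 fLa L2La La1 LaN big tailq c0 c1
  x e n eN n1 n2 nN (fun e' => him hx) sm _ p hr hur kpe.
exists A; split => //; last first.
 move=> t /hA[_]; have -> : 4 * 10 ^+ 9 * p.+1%:R * rate e / c ^+ 13 = 4 * (10 ^+ 9 * p.+1%:R * rate e / c ^+ 13) by ring.
 by [].
apply: le_trans pA _; rewrite lee_fin [leLHS]addrCA lerD2l.
have k1 : 5 * N%:R ^+ 3 * q <= 5 / c ^+ 2 * N%:R ^+ (9 * p + 14) * q.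
 apply: ler_wpM2r => //; apply: ler_pM; [by []|exact: exprn_ge0| |].
  by apply: ler_peMr.
 by apply: ler_weXn2l; [rewrite ler1n|apply: leq_trans (leq_addl _ _)].
have -> : 53 / c ^+ 2 * N%:R ^+ (9 * p + 14) * q = 5 / c ^+ 2 * N%:R ^+ (9 * p + 14) * q + 48 / c ^+ 2 * N%:R ^+ (9 * p + 14) * q by ring.
by rewrite lerD2r.
Qed.

Let h : R := N%:R ^- 4.
Let h0 : 0 < h. by rewrite invr_gt0 exprn_gt0. Qed.

Lemma m_lip x e x' e' : x1 <= x <= x2 -> x1 <= x' <= x2 -> 0 < e -> e <= 2 -> 0 < e' -> e' <= 2 ->
 nc (m (Cx x e) - m (Cx x' e')) <= 2 / c ^+ 2 * nc (Cx x e - Cx x' e').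
Proof.
move=> hx hx' e0 e2 e0' e2'; set z := Cx x e; set z' := Cx x' e'.
have := wz_lip hmu (@m_fc_ge0 _ mu lam) (@m_fc_eq _ mu lam) (e0 : 0 < Iz z) (e0' : 0 < Iz z').
have k1 := him hx e0 e2; have k2 := him hx' e0' e2'.
have k3 : (c + c) ^+ 2 <= (Iz (m z) + Iz (m z')) ^+ 2.
 by apply: lesq; [rewrite addr_ge0 // ltW|exact: lerD].
set w := wz m z - wz m z' => hw.
have k4 : nc w * (c + c) ^+ 2 <= 2 * nc (z - z').
 by apply: le_trans hw; apply: ler_wpM2l => //; exact: nc_ge0.
have k5 : nc w <= 1 / 2 / c ^+ 2 * nc (z - z').
 have -> : 1 / 2 / c ^+ 2 * nc (z - z') = 2 * nc (z - z') / (c + c) ^+ 2 by field; rewrite !gt_eqF ?addr_gt0.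
 by rewrite ler_pdivlMr // exprn_gt0 // addr_gt0.
have -> : m z - m z' = w - (z - z') by rewrite /w /wz; ring.
apply: le_trans (ncB _ _) _.
have k6 : nc (z - z') <= 1 / c ^+ 2 * nc (z - z').
 by apply: ler_peMl; [exact: nc_ge0|rewrite mul1r].
have k7 : 0 <= c ^- 2 * nc (z - z') by rewrite mulr_ge0 ?nc_ge0 // invr_ge0 sqr_ge0.
by move: k5 k6 k7; rewrite !mul1r -!mulrA; move: (c ^- 2 * _) => s; lra.
Qed.

Lemma grid_point (a b : R) : 0 <= a -> exists k : nat, k%:R * h <= a /\ a <= k%:R * h + h /\ (a <= b * h -> k%:R <= b).
Proof.
move=> a0; exists (Num.truncn (a / h)).
have ah : 0 <= a / h by rewrite divr_ge0 // ltW.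
have h1 : (Num.truncn (a / h))%:R * h <= a.
 by rewrite -ler_pdivlMr //; have /andP[] := Num.Theory.truncn_itv ah.
split => //; split.
 have : a / h < (Num.truncn (a / h)).+1%:R by exact: Num.Theory.truncnS_gt.
 by rewrite ltr_pdivrMr // -natr1 mulrDl mul1r => /ltW.
by move=> hb; rewrite -(ler_pM2r h0); exact: le_trans hb.
Qed.

(** A net of mesh [N^-4]. Above height [1/N] the function [mN] is Lipschitz with constant [N^2], and
    in the bulk [m] is Lipschitz with constant [2 / c^2 <= N], so passing to the nearest net point
    below costs a multiple of [N^-2], less than the rate. *)
Lemma uniform_law : exists A : set T,
 [/\ measurable A, (P (~` A) <= (N%:R ^+ 12 * pb)%:E)%E & forall t, A t -> forall x e,
  x1 <= x <= x2 -> y <= e -> e <= 2 ->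
  nc (mN (ham t) (Cx x e) - m (Cx x e)) <= 10 ^+ 10 * p.+1%:R * rate e / c ^+ 13].
Proof.
(* The region has width at most [N] and height at most [2], so [N^5 + 1] points in each direction
   suffice, and [(N^5 + 1)^2 <= N^12]. Net points outside the region receive the full event. *)
pose K := (N ^ 5).+1; pose pt (k : 'I_K * 'I_K) := (x1 + (k.1 : nat)%:R * h, y + (k.2 : nat)%:R * h).
have pb0 : 0 <= pb.
 by rewrite addr_ge0 ?divr_ge0 ?exprn_ge0 // !mulr_ge0 ?invr_ge0 ?exprn_ge0 // ltW.
have /choice[A hA] : forall k : 'I_K * 'I_K, exists A : set T,
  [/\ measurable A, (P (~` A) <= pb%:E)%E & forall t, A t -> x1 <= (pt k).1 <= x2 -> (pt k).2 <= 2 ->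
   nc (mN (ham t) (Cx (pt k).1 (pt k).2) - m (Cx (pt k).1 (pt k).2)) <= 4 * 10 ^+ 9 * p.+1%:R * rate (pt k).2 / c ^+ 13].
 move=> k; have [hx|hx] := boolP (x1 <= (pt k).1 <= x2); last first.
  by exists setT; split => //; rewrite setCT measure0 lee_fin.
 have [h2|h2] := leP (pt k).2 2; last first.
  by exists setT; split => //; rewrite setCT measure0 lee_fin.
 have [|A [mA pA hA]] := @point_rate (pt k).1 (pt k).2 hx _ h2; first by rewrite lerDl mulr_ge0 // ltW.
 by exists A; split => // t At _ _; exact: hA.
have mA k : measurable (A k) by case: (hA k).
have pA k : (P (~` A k) <= pb%:E)%E by case: (hA k).
exists (\bigcap_(k in [set: 'I_K * 'I_K]) A k); split.
- exact: fin_bigcap_measurable.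
- apply: le_trans (prob_setC_bigcap mA pA) _; rewrite lee_fin card_prod card_ord; apply: ler_wpM2r => //.
 rewrite -natrX ler_nat /K; apply: (@leq_trans ((N * N ^ 5) * (N * N ^ 5))%N).
  by apply: leq_mul; (apply: (@leq_trans (2 * N ^ 5)%N); [rewrite mul2n -addnn -addn1 leq_add2l expn_gt0 N0|rewrite leq_mul2r (leq_trans _ N5) ?orbT]).
 by rewrite -expnS -expnD.
move=> t tA x e hx ye e2; have e0 : 0 < e by exact: lt_le_trans ye.
have [hx1 hx2] := andP hx.
have N5p : N%:R * h * N%:R ^+ 5 = N%:R ^+ 2 :> R by rewrite /h; field; rewrite gt_eqF.
have hN5 : N%:R ^+ 5 * h = N%:R by rewrite /h; field; rewrite gt_eqF.
have [k1 [k1a [k1b k1c]]] := @grid_point (x - x1) (N%:R ^+ 5) (ltac:(by rewrite subr_ge0)).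
have [k2 [k2a [k2b k2c]]] := @grid_point (e - y) (N%:R ^+ 5) (ltac:(by rewrite subr_ge0)).
have l1 : (k1 < K)%N.
 by rewrite ltnS -(ler_nat R) natrX; apply: k1c; rewrite hN5; apply: le_trans x12; rewrite lerD2r.
have l2 : (k2 < K)%N.
 by rewrite ltnS -(ler_nat R) natrX; apply: k2c; rewrite hN5; move: e2 y0 N5R; lra.
pose k := (Ordinal l1, Ordinal l2).
set x' := x1 + k1%:R * h; set e' := y + k2%:R * h.
have xx' : x' <= x by rewrite /x'; move: k1a; lra.
have hx' : x1 <= x' <= x2 by rewrite (le_trans xx' hx2) andbT /x' lerDl mulr_ge0 // ltW.
have ee' : e' <= e by rewrite /e'; move: k2a; lra.
have ye' : y <= e' by rewrite /e' lerDl mulr_ge0 // ltW.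
have e0' : 0 < e' by exact: lt_le_trans ye'.
have e2' : e' <= 2 by exact: le_trans e2.
have [_ _ hk] := hA k; have {hk}g := hk t (tA k I) hx' e2'.
rewrite -[(pt k).1]/x' -[(pt k).2]/e' in g.
have N1 : 1 <= N%:R :> R by apply: le_trans N5R; rewrite ler1n.
have hh : h <= N%:R^-1.
 by rewrite lef_pV2 ?posrE ?exprn_gt0 // -[leLHS]expr1; apply: ler_weXn2l.
have eN' : N%:R^-1 <= e' by exact: le_trans ye'.
have eh : e <= e' + h by rewrite /e'; move: k2b; lra.
have ee2 : e <= 2 * e' by move: eh hh eN'; lra.
have dz : nc (Cx x e - Cx x' e') <= 2 * h.
 apply: le_trans (nc_le_ReIm _) _; rewrite cReB cImB /= !ger0_norm ?subr_ge0 //.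
 by rewrite /x' /e'; move: k1b k2b; lra.
have hH := @ham_herm _ _ _ _ _ X lam t.
have s1 : nc (mN (ham t) (Cx x e) - mN (ham t) (Cx x' e')) <= 2 * N%:R ^- 2.
 apply: le_trans (mN_lip hH N0 (e0 : 0 < Iz (Cx x e)) (e0' : 0 < Iz (Cx x' e'))) _ => /=.
 rewrite ler_pdivrMr ?mulr_gt0 //; apply: (le_trans dz).
 have -> : 2 * h = 2 * N%:R ^- 2 * (N%:R^-1 * N%:R^-1) by rewrite /h; field; rewrite gt_eqF.
 apply: ler_wpM2l; first by rewrite mulr_ge0 // invr_ge0 sqr_ge0.
 by apply: ler_pM; rewrite ?invr_ge0 //; exact: (le_trans yN).
have s2 : nc (m (Cx x e) - m (Cx x' e')) <= 2 * N%:R ^- 2.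
 apply: le_trans (m_lip hx hx' e0 e2 e0' e2') _.
 apply: (via (2 / c ^+ 2 * (2 * h))).
  by apply: ler_wpM2l dz; rewrite divr_ge0 // sqr_ge0.
 have c2 : 2 / c ^+ 2 <= N%:R by rewrite ler_pdivrMr // exprn_gt0.
 apply: (via (N%:R * (2 * h))); first by apply: ler_wpM2r => //; rewrite mulr_ge0 // ltW.
 have -> : N%:R * (2 * h) = 2 * N%:R ^- 2 * N%:R^-1 by rewrite /h; field; rewrite gt_eqF.
 rewrite -[leRHS]mulr1; apply: ler_wpM2l; first by rewrite mulr_ge0 // invr_ge0 sqr_ge0.
 by rewrite invf_le1.
have tri : nc (mN (ham t) (Cx x e) - m (Cx x e)) <= 4 * N%:R ^- 2 + 4 * 10 ^+ 9 * p.+1%:R * rate e' / c ^+ 13.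
 have -> : mN (ham t) (Cx x e) - m (Cx x e) = (mN (ham t) (Cx x e) - mN (ham t) (Cx x' e'))
   - (m (Cx x e) - m (Cx x' e')) + (mN (ham t) (Cx x' e') - m (Cx x' e')) by ring.
 apply: le_trans (ncD _ _) _; have := ncB (mN (ham t) (Cx x e) - mN (ham t) (Cx x' e')) (m (Cx x e) - m (Cx x' e')).
 by move: s1 s2 g; move: (4 * _ * _ * _ / _) (nc _) (nc _) (nc _) (nc _) => r1 r2 r3 r4 r5; clra.
apply: (le_trans tri).
have re : rate e' <= 2 * rate e.
 rewrite mulrCA; apply: ler_wpM2l; first exact: sqr_ge0.
 rewrite [leRHS]mulrDr; apply: lerD; first by rewrite mulr_natl mulr2n lerDl invr_ge0 ltW.
 rewrite -[leLHS]mul1r ler_pdivrMr ?mulr_gt0 // mulrAC ler_pdivlMr ?mulr_gt0 // mul1r.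
 by rewrite mulrCA; apply: ler_wpM2l => //; exact: ltW.
have n2 : N%:R ^- 2 <= rate e.
 apply: (via (sqrt N%:R)^-1).
  rewrite lef_pV2 ?posrE ?exprn_gt0 // -[leRHS]ger0_norm ?exprn_ge0 // -sqrtr_sqr; apply: ler_wsqrtr.
  by rewrite -exprM -[leLHS]expr1; apply: ler_weXn2l.
 rewrite -[leLHS]mul1r; apply: ler_pM => //; rewrite ?invr_ge0 ?(ltW sN) ?exprn_ege1 //.
 by rewrite lerDl invr_ge0 mulr_ge0 // ltW.
have r0 : 0 <= rate e by apply: le_trans n2; rewrite invr_ge0 sqr_ge0.
have f1 : rate e <= p.+1%:R * rate e / c ^+ 13.
 rewrite -[leLHS]mulr1; apply: ler_pM => //.
 by apply: ler_peMl.
have f2 : p.+1%:R * rate e' / c ^+ 13 <= 2 * (p.+1%:R * rate e / c ^+ 13).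
 have -> : 2 * (p.+1%:R * rate e / c ^+ 13) = p.+1%:R * (2 * rate e) / c ^+ 13 by ring.
 apply: ler_wpM2r; first by rewrite invr_ge0 exprn_ge0 // ltW.
 exact: ler_wpM2l.
have -> : 4 * 10 ^+ 9 * p.+1%:R * rate e' / c ^+ 13 = 4 * 10 ^+ 9 * (p.+1%:R * rate e' / c ^+ 13) by ring.
have -> : 10 ^+ 10 * p.+1%:R * rate e / c ^+ 13 = 10 ^+ 10 * (p.+1%:R * rate e / c ^+ 13) by ring.
exact: (rate_combine r0 n2 f1 f2).
Qed.
End uniform_law.

(** * Smoothed counting functions *)

Section arctangent.
Context {R : realType}.

Lemma atan_le_id (t : R) : 0 <= t -> atan t <= t.
Proof.
move=> t0; have d (s : R) : 0 <= s <= t -> is_derive s (1 : R) (@atan R) (1 + s ^+ 2)^-1 by move=> _; exact: is_derive1_atan.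
have /andP[_] := @mvt_bounds R (@atan R) _ 0 t 0 1 t0 d (fun s _ => ltac:(by
 rewrite invr_ge0 invf_le1 ?lerDl ?addr_ge0 ?sqr_ge0 ?ltr_pwDl ?sqr_ge0)).
by rewrite atan0 !subr0 mul1r.
Qed.

(** For [t > 1] the defect [pi/2 - atan t] equals [atan (1/t) <= 1/t]; for [t <= 1] the right side
    is at least [1/2]. *)
Lemma atan_tail (t : R) : 0 <= t -> 0 <= 2^-1 - atan t / pi <= (sqrt (1 + t ^+ 2))^-1.
Proof.
move=> t0; have p0 := @pi_gt0 R; have p2 := @pi_ge2 R.
have a1 := atan_ltpi2 t; have a0 : 0 <= atan t by rewrite -[X in X <= _](@atan0 R); exact: le_atan.
have e : 2^-1 - atan t / pi = (pi / 2 - atan t) / pi by rewrite mulrBl [pi / 2]mulrC mulfK ?gt_eqF.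
have s0 : 0 < sqrt (1 + t ^+ 2) by rewrite sqrtr_gt0 ltr_pwDl ?sqr_ge0.
rewrite e; apply/andP; split; first by rewrite divr_ge0 ?(ltW p0) // subr_ge0 ltW.
rewrite ler_pdivrMr // ler_pdivlMl //.
have sq2 (b : R) : 0 <= b -> 1 + t ^+ 2 <= b ^+ 2 -> sqrt (1 + t ^+ 2) <= b.
 by move=> b0 hb; rewrite -[leRHS]ger0_norm // -sqrtr_sqr; exact: ler_wsqrtr.
have [t1|t1] := leP t 1.
 have s2 : sqrt (1 + t ^+ 2) <= 2.
  by apply: sq2 => //; have := lesq t0 t1; rewrite expr1n; lra.
 apply: (via (2 * (pi / 2))); last by rewrite mulrCA divff ?mulr1.
 by apply: ler_pM => //; [rewrite subr_ge0 ltW|rewrite lerBlDl lerDr].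
have tp : 0 < t by apply: lt_trans t1.
have s2 : sqrt (1 + t ^+ 2) <= 2 * t.
 by apply: sq2; [rewrite mulr_ge0|have := lesq ler01 (ltW t1); rewrite expr1n exprMn; lra].
have ct : cos (atan t) != 0 by rewrite cos_atan invr_eq0 gt_eqF.
have st : sin (atan t) != 0.
 apply/eqP => h; have := atanK t; rewrite /tan h mul0r => /esym h'; by move: tp; rewrite h' ltxx.
have phi : pi / 2 - atan t = atan t^-1.
 have ap : 0 < atan t by rewrite -[X in X < _](@atan0 R); exact: lt_atan.
 rewrite -[LHS]tanK; last by rewrite in_itv /=; apply/andP; split; move: ap a1 p0; lra.
 congr atan; rewrite -[t in RHS]atanK /tan sinB cosB cos_pihalf sin_pihalf.
 by rewrite !mul0r mul1r subr0 mul1r add0r invf_div.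
rewrite phi; apply: (via (2 * t * t^-1)); last by rewrite mulfK ?gt_eqF.
apply: ler_pM => //; first by rewrite -phi subr_ge0 ltW.
by apply: atan_le_id; rewrite invr_ge0.
Qed.

(** The value of [chi] at [a = E] is free in [[0, 1]], so the same bound serves for strict, large
    and index-based counting. *)
Lemma count_error (a E y chi : R) : 0 < y -> 0 <= chi <= 1 -> (a < E -> chi = 1) -> (E < a -> chi = 0) ->
 `|chi - 2^-1 - atan ((E - a) / y) / pi| <= y / sqrt ((a - E) ^+ 2 + y ^+ 2).
Proof.
move=> y0 /andP[c0 c1] h1 h2; have p0 := @pi_gt0 R.
have hs (t : R) : t ^+ 2 = (a - E) ^+ 2 / y ^+ 2 -> y / sqrt ((a - E) ^+ 2 + y ^+ 2) = (sqrt (1 + t ^+ 2))^-1.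
 move=> et; have -> : (a - E) ^+ 2 + y ^+ 2 = y ^+ 2 * (1 + t ^+ 2) by rewrite et; field; rewrite gt_eqF.
 rewrite sqrtrM ?sqr_ge0 // sqrtr_sqr gtr0_norm // invfM mulrA mulfV ?mul1r // gt_eqF //.
case: (ltgtP a E) => h.
- rewrite h1 //; have t0 : 0 <= (E - a) / y by rewrite divr_ge0 ?(ltW y0) // subr_ge0 ltW.
 have /andP[k1 k2] := atan_tail t0.
 have -> : 1 - 2^-1 = 2^-1 :> R by lra.
 by rewrite ger0_norm // (hs ((E - a) / y)) // expr_div_n -sqrrN opprB.
- rewrite h2 //; have t0 : 0 <= (a - E) / y by rewrite divr_ge0 ?(ltW y0) // subr_ge0 ltW.
 have /andP[k1 k2] := atan_tail t0.
 have -> : 0 - 2^-1 - atan ((E - a) / y) / pi = - (2^-1 - atan ((a - E) / y) / pi).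
  have -> : (E - a) / y = - ((a - E) / y) by ring.
  by rewrite atanN; ring.
 by rewrite normrN ger0_norm // (hs ((a - E) / y)) // expr_div_n.
- rewrite h subrr mul0r atan0 mul0r subr0 expr0n /= add0r sqrtr_sqr [`|y|]gtr0_norm // divff ?gt_eqF //.
 by rewrite ler_norml; apply/andP; split; lra.
Qed.

Lemma is_derive_bigsum (I : Type) (s : seq I) (F : I -> R -> R) (F' : I -> R) (x : R) :
 (forall i, is_derive x (1 : R) (F i) (F' i)) ->
 is_derive x (1 : R) (fun t => \sum_(i <- s) F i t) (\sum_(i <- s) F' i).
Proof.
move=> h; elim: s => [|i s IH].
 by under eq_fun do rewrite big_nil; rewrite big_nil; exact: is_derive_cst.
under eq_fun do rewrite big_cons; rewrite big_cons; exact: (is_deriveD (h i) IH).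
Qed.
End arctangent.

Section counting.
Context {R : realType} (N : nat) (N0 : (0 < N)%N) (H : 'M[R[i]]_N) (hH : herm H).
Notation s := (eigenvalues H).
Let Np : 0 < N%:R :> R. by rewrite ltr0n. Qed.

(** The Poisson smoothing at height [y] of the eigenvalue counting function, without its constant
    [N / 2]. *)
Definition smooth_count (y E : R) : R := \sum_k atan ((E - ev H k) / y) / pi.

Lemma size_eigenvalues : size s = N.
Proof. by rewrite /eigenvalues size_sort size_map -cardE card_ord. Qed.

Lemma sum_eigenvalues (f : R -> R) : \sum_k f (ev H k) = \sum_(p < N) f s`_p.
Proof.
transitivity (\sum_(x <- s) f x).
 have e : perm_eq s [seq ev H k | k <- enum 'I_N] by rewrite /eigenvalues perm_sort.
 by rewrite (perm_big _ e) /= big_map big_enum.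
by rewrite (big_nth 0) size_eigenvalues big_mkord.
Qed.

Lemma eigenvalues_le (p r : nat) : (p <= r)%N -> (r < N)%N -> s`_p <= s`_r.
Proof.
move=> pr rN; have so : sorted <=%R s by apply: sort_sorted; exact: le_total.
by apply: (sorted_leq_nth le_trans lexx 0 so) => //; rewrite inE size_eigenvalues // (leq_ltn_trans pr).
Qed.

Lemma smooth_count_dE (y E : R) : 0 < y ->
 is_derive E (1 : R) (smooth_count y) (N%:R / pi * Iz (mN H (Cx E y))).
Proof.
move=> y0; have p0 := @pi_gt0 R.
have -> : N%:R / pi * Iz (mN H (Cx E y)) = \sum_k pi^-1 * pker (Cx (ev H k) y) E.
 rewrite Im_mN_ev // mulrA [_ * N%:R^-1]mulrAC mulfV ?gt_eqF // mul1r mulr_sumr.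
 by apply: eq_bigr => k _; rewrite /pois /pker /= -sqrrN opprB.
apply: is_derive_bigsum => k.
have h := is_deriveZ pi^-1 (@is_derive_poisson R (Cx (ev H k) y) E y0).
have -> : (fun t : R => atan ((t - ev H k) / y) / pi) = (pi^-1 \*: (fun x : R => atan ((x - Rz (Cx (ev H k) y)) / Iz (Cx (ev H k) y)))).
 by apply/funext => t; rewrite /= mulrC.
exact: h.
Qed.

Lemma smooth_count_dy (y E : R) : 0 < y ->
 is_derive y (1 : R) (fun y => smooth_count y E) (N%:R / pi * Rz (mN H (Cx E y))).
Proof.
move=> y0; have p0 := @pi_gt0 R; have yn : y != 0 by rewrite gt_eqF.
have -> : N%:R / pi * Rz (mN H (Cx E y)) = \sum_k pi^-1 * ((ev H k - E) / ((ev H k - E) ^+ 2 + y ^+ 2)).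
 rewrite mN_ev // cReM Re_rc Im_rc mul0r subr0 mulrA [_ * N%:R^-1]mulrAC mulfV ?gt_eqF // mul1r Re_sum mulr_sumr.
 by apply: eq_bigr => k _; rewrite cReV nc2 cReB cImB /= sub0r sqrrN.
apply: is_derive_bigsum => k; set a := ev H k.
have hV : is_derive y (1 : R) (fun y : R => (E - a) * y^-1) ((E - a) * (- y ^- 2)).
 have h := is_deriveZ (E - a) (is_deriveV (yn : id y != 0) (is_derive_id y (1 : R))).
 by apply: (is_derive_eq h); rewrite /= scaler1; congr (_ * _).
have h2 := @is_derive1_comp _ (@atan R) (fun y : R => (E - a) / y) y _ _ (is_derive1_atan ((E - a) / y)) hV.
have h := is_deriveZ pi^-1 h2.
have -> : (fun y : R => atan ((E - a) / y) / pi) = (fun y => pi^-1 *: atan ((E - a) / y)) by apply/funext => t; rewrite mulrC.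
apply: (is_derive_eq h).
have q0 : 0 < (a - E) ^+ 2 + y ^+ 2 by rewrite ltr_wpDl ?sqr_ge0 ?exprn_gt0.
have q1 : 0 < y ^+ 2 + (E - a) ^+ 2 by rewrite ltr_pwDl ?sqr_ge0 ?exprn_gt0.
rewrite -[_ *: _]/(_ * _); congr (_ * _).
have -> : a - E = - (E - a) by ring.
rewrite sqrrN; move: (E - a) q1 => d q1; have -> : 1 + (d / y) ^+ 2 = (y ^+ 2 + d ^+ 2) / y ^+ 2 by field; rewrite yn.
by rewrite [d ^+ 2 + _]addrC; field; rewrite yn gt_eqF.
Qed.

(* [n] dyadic heights from [y] up to order one control the smoothing error. *)
Lemma smooth_count_error (y E : R) (n : nat) (chi : 'I_N -> R) : 0 < y -> 1 <= 2 ^+ n * y ->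
 (forall l, (l <= n)%N -> Iz (mN H (Cx E (2 ^+ l * y))) <= 2) ->
 (forall p, 0 <= chi p <= 1) ->
 (forall p : 'I_N, s`_p < E -> chi p = 1) -> (forall p : 'I_N, E < s`_p -> chi p = 0) ->
 `|\sum_p chi p - N%:R / 2 - smooth_count y E| <= 9 * n.+1%:R * (N%:R * y).
Proof.
move=> y0 hn hI c01 h1 h2.
have -> : \sum_p chi p - N%:R / 2 - smooth_count y E = \sum_p (chi p - 2^-1 - atan ((E - s`_p) / y) / pi).
 rewrite /smooth_count (sum_eigenvalues (fun a => atan ((E - a) / y) / pi)) !sumrB sumr_const card_ord.
 by rewrite [N%:R / 2]mulr_natl.
apply: le_trans (ler_norm_sum _ _ _) _.
apply: (via (\sum_(p < N) y / sqrt ((s`_p - E) ^+ 2 + y ^+ 2))).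
 by apply: ler_sum => p _; apply: count_error => //; [exact: h1|exact: h2].
rewrite -(sum_eigenvalues (fun a => y / sqrt ((a - E) ^+ 2 + y ^+ 2))).
apply: (via (\sum_k y * (4 * (\sum_(l < n.+1) pois (ev H k - E) (2 ^+ l * y)) + 1))).
 apply: ler_sum => k _; apply: ler_wpM2l; first exact: ltW.
 apply: le_trans (dyadic_bound _ n y0) _; rewrite lerD2l invf_le1 //; exact: lt_le_trans hn.
rewrite -mulr_sumr big_split /= sumr_const card_ord -mulr_sumr exchange_big /=.
have hl (l : 'I_n.+1) : \sum_k pois (ev H k - E) (2 ^+ l * y) <= N%:R * 2.
 have yl : 0 < 2 ^+ l * y by rewrite mulr_gt0 ?exprn_gt0.
 by have := hI l (leq_ord l); rewrite (Im_mN_ev hH) //= ler_pdivrMl.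
have hs : \sum_(l < n.+1) \sum_k pois (ev H k - E) (2 ^+ l * y) <= n.+1%:R * (N%:R * 2).
 by apply: (le_trans (ler_sum _ (fun l _ => hl l))); rewrite sumr_const card_ord -[X in X <= _]mulr_natl.
have -> : 9 * n.+1%:R * (N%:R * y) = y * (9 * (n.+1%:R * N%:R)) by ring.
apply: ler_wpM2l; first exact: ltW.
have k1 : N%:R <= n.+1%:R * N%:R :> R by apply: ler_peMl; rewrite ?ler0n ?ler1n.
move: hs; have -> : n.+1%:R * (N%:R * 2) = 2 * (n.+1%:R * N%:R) :> R by ring.
by move: (\sum_(l < _) _) k1; move: (n.+1%:R * N%:R) => u w; lra.
Qed.
End counting.

Lemma norm_diff_le {R : realType} (F F' G G' : R -> R) (a b M : R) : a <= b ->
 (forall x, a <= x <= b -> is_derive x (1 : R) F (F' x)) -> (forall x, a <= x <= b -> is_derive x (1 : R) G (G' x)) ->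
 (forall x, a < x < b -> `|F' x| <= G' x) -> (forall x, a < x < b -> G' x <= `|M|) -> `|F b - F a| <= G b - G a.
Proof.
move=> ab dF dG FG GM.
have hB x : a < x < b -> 0 <= G' x - F' x <= 2 * `|M| /\ 0 <= G' x + F' x <= 2 * `|M|.
 move=> hx; move: (FG x hx) (GM x hx); rewrite ler_norml => /andP[h1 h2] h3.
 by split; apply/andP; split; move: h1 h2 h3; lra.
have /andP[h1 _] := mvt_bounds ab (fun x h => is_deriveB (dG x h) (dF x h)) (fun x h => (hB x h).1).
have /andP[h2 _] := mvt_bounds ab (fun x h => is_deriveD (dG x h) (dF x h)) (fun x h => (hB x h).2).
have k1 : 0 * (b - a) <= G b - F b - (G a - F a) := h1.
have k2 : 0 * (b - a) <= G b + F b - (G a + F a) := h2.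
by move: k1 k2; rewrite !mul0r ler_norml => k1 k2; apply/andP; split; lra.
Qed.

(** * From the local law to distances of eigenvalues *)

Section spacing.
Context {R : realType} (N : nat) (N0 : (0 < N)%N) (H : 'M[R[i]]_N) (hH : herm H).
Notation s := (eigenvalues H).
Notation theta := (smooth_count H).
Let Np : 0 < N%:R :> R. by rewrite ltr0n. Qed.
Let pi0 : 0 < pi :> R. exact: pi_gt0. Qed.
Let Npi : 0 < N%:R / pi :> R. exact: divr_gt0. Qed.
Variables (m : R[i] -> R[i]) (b : R -> R) (x1 x2 y dl : R) (n : nat).
Hypotheses (m1 : forall z, 0 < Iz z -> nc (m z) <= 1) (y0 : 0 < y) (n1 : 1 <= 2 ^+ n * y) (n2 : 2 ^+ n * y <= 2)
 (dl1 : dl <= 1)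
 (hloc : forall x e, x1 <= x <= x2 -> y <= e -> e <= 2 -> nc (mN H (Cx x e) - m (Cx x e)) <= dl)
 (hb : forall x, x1 <= x <= x2 -> `|Iz (m (Cx x y)) - b x| <= dl).
Notation Er := (9 * n.+1%:R * (N%:R * y)).

Let y2 : y <= 2.
Proof. by apply: le_trans n2; apply: ler_peMl; [exact: ltW|rewrite exprn_ege1 // ler1n]. Qed.

Lemma Im_mN_near x : x1 <= x <= x2 -> `|Iz (mN H (Cx x y)) - b x| <= 2 * dl.
Proof.
move=> hx; have h1 := hb hx; have := hloc hx (lexx y) y2.
set u := mN H _; set w := m _ in h1 *; move=> h2.
have h3 : `|Iz u - Iz w| <= dl by rewrite -cImB; apply: le_trans h2; exact: Im_le.
have -> : Iz u - b x = (Iz u - Iz w) + (Iz w - b x) by ring.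
apply: le_trans (ler_normD _ _) _; rewrite mulr_natl mulr2n; exact: lerD.
Qed.

Lemma cdf_error E (chi : 'I_N -> R) : x1 <= E <= x2 -> (forall p, 0 <= chi p <= 1) ->
 (forall p : 'I_N, s`_p < E -> chi p = 1) -> (forall p : 'I_N, E < s`_p -> chi p = 0) ->
 `|\sum_p chi p - N%:R / 2 - theta y E| <= Er.
Proof.
move=> hE c01 h1 h2; apply: smooth_count_error => // l ln.
have yl : 0 < 2 ^+ l * y by rewrite mulr_gt0 ?exprn_gt0.
have yle : y <= 2 ^+ l * y.
 by apply: ler_peMl; [exact: ltW|rewrite exprn_ege1 // ler1n].
have l2 : 2 ^+ l * y <= 2.
 by apply: le_trans n2; apply: ler_wpM2r; [exact: ltW|apply: ler_weXn2l => //; rewrite ler1n].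
apply: le_trans (ler_norm _) _; apply: le_trans (Im_le _) _.
apply: le_trans (nc_triB _ (m (Cx E (2 ^+ l * y)))) _.
have -> : (2 : R) = 1 + 1 by ring.
by apply: lerD; [apply: le_trans (hloc hE yle l2) _|apply: m1].
Qed.

(** Counting the indices up to [p] instead of the eigenvalues up to [s_p] gives exactly [p + 1]
    whatever the multiplicities, since ties only affect [chi] where it is free. *)
Lemma rank_error (p : nat) : (p < N)%N -> x1 <= s`_p <= x2 -> `|p.+1%:R - N%:R / 2 - theta y s`_p| <= Er.
Proof.
move=> pN hp; pose chi (k : 'I_N) : R := (k <= p)%N%:R.
have -> : p.+1%:R = \sum_k chi k.
 rewrite /chi -natr_sum; congr (_%:R).
 rewrite -(big_mkord xpredT (fun k => nat_of_bool (k <= p)%N)) (big_cat_nat (n := p.+1)) //=.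
 rewrite (eq_big_nat _ _ (F2 := fun=> 1%N)) => [|k /andP[_ kp]]; last by rewrite -ltnS kp.
 rewrite [X in (_ + X)%N](eq_big_nat _ _ (F2 := fun=> 0%N)) => [|k /andP[kp _]]; last by rewrite leqNgt kp.
 by rewrite !sum_nat_const_nat subn0 muln1 muln0 addn0.
apply: cdf_error => //.
- by move=> k; rewrite /chi; case: (k <= p)%N; rewrite ?lexx ?ler01.
- move=> k hk; rewrite /chi; case: (leqP k p) => // pk.
 by have := eigenvalues_le H (ltnW pk) (ltn_ord k); rewrite leNgt hk.
- move=> k hk; rewrite /chi; case: (leqP k p) => // kp.
 by have := eigenvalues_le H kp pN; rewrite leNgt hk.
Qed.

Lemma theta_bounds (a a' lo hi : R) : a <= a' -> x1 <= a -> a' <= x2 ->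
 (forall x, a <= x <= a' -> lo <= b x <= hi) ->
 N%:R / pi * (lo - 2 * dl) * (a' - a) <= theta y a' - theta y a <= N%:R / pi * (hi + 2 * dl) * (a' - a).
Proof.
move=> aa' ha ha' hlo.
apply: (mvt_bounds aa' (fun x _ => smooth_count_dE N0 hH x y0)) => x /andP[h1 h2].
have hx : x1 <= x <= x2 by rewrite (le_trans ha (ltW h1)) (le_trans (ltW h2) ha').
have := Im_mN_near hx; rewrite ler_distl => /andP[k1 k2].
have /andP[l1 l2] := hlo x ltac:(by rewrite !ltW).
by rewrite !(ler_pM2l Npi); apply/andP; split; move: k1 k2 l1 l2; lra.
Qed.

Lemma spacing_rough (p r : nat) (lo hi : R) : (p <= r)%N -> (r < N)%N -> x1 <= s`_p -> s`_r <= x2 ->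
 (forall x, s`_p <= x <= s`_r -> lo <= b x <= hi) ->
 N%:R / pi * (lo - 2 * dl) * (s`_r - s`_p) <= (r%:R - p%:R) + 2 * Er /\
 (r%:R - p%:R) - 2 * Er <= N%:R / pi * (hi + 2 * dl) * (s`_r - s`_p).
Proof.
move=> pr rN h1 h2 hlo; have le := eigenvalues_le H pr rN.
have pN : (p < N)%N by exact: leq_ltn_trans pr rN.
have hp : x1 <= s`_p <= x2 by rewrite h1 (le_trans le).
have hr : x1 <= s`_r <= x2 by rewrite h2 andbT (le_trans h1).
have /andP[k1 k2] := theta_bounds le h1 h2 hlo.
have := rank_error pN hp; have := rank_error rN hr; rewrite !ler_norml => /andP[e1 e2] /andP[e3 e4].
move: k1 k2 e1 e2 e3 e4; rewrite -(natr1 p) -(natr1 r).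
move: (theta y _) (theta y _) Er (_ * _ * (s`_r - s`_p)) (_ * _ * (s`_r - s`_p)) => u u' w v v'.
by move: (r%:R) (p%:R) (N%:R / 2) => a1 a2 a3; split; lra.
Qed.

(** The smoothed count increases over [[x1, x2]] by [N / pi] times the mass of the bulk, up to the
    local error, so almost all indices are accounted for there. An eigenvalue left of [x1] forces
    all smaller ones to be there too, which bounds its index; likewise on the right. *)
Lemma bulk_rank (A : R -> R) (e : R) (p : nat) : (p < N)%N -> x1 <= x2 ->
 (forall x : R, is_derive x (1 : R) A (b x)) -> pi - e <= A x2 - A x1 ->
 (s`_p < x1 -> p.+1%:R <= N%:R / pi * (e + 2 * dl * (x2 - x1)) + 2 * Er) /\
 (x2 < s`_p -> N%:R - p%:R <= N%:R / pi * (e + 2 * dl * (x2 - x1)) + 2 * Er).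
Proof.
move=> pN x12 dA hA.
pose c1 (k : 'I_N) : R := (s`_k < x1)%R%:R; pose c2 (k : 'I_N) : R := (s`_k <= x2)%R%:R.
have hx1 : x1 <= x1 <= x2 by rewrite lexx.
have hx2 : x1 <= x2 <= x2 by rewrite x12 lexx.
have b01 (B : bool) : 0 <= (B%:R : R) <= 1 by case: B; rewrite ?lexx ?ler01.
have g1 : `|\sum_k c1 k - N%:R / 2 - theta y x1| <= Er.
 apply: cdf_error => [//|k|k hk|k hk]; first exact: b01; rewrite /c1; first by rewrite hk.
 by rewrite ltNge (ltW hk).
have g2 : `|\sum_k c2 k - N%:R / 2 - theta y x2| <= Er.
 apply: cdf_error => [//|k|k hk|k hk]; first exact: b01; rewrite /c2; first by rewrite (ltW hk).
 by rewrite leNgt hk.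
pose F E := theta y E - N%:R / pi * A E.
have hF : N%:R / pi * (- (2 * dl)) * (x2 - x1) <= F x2 - F x1.
 have dF (x : R) : x1 <= x <= x2 -> is_derive x (1 : R) F (N%:R / pi * Iz (mN H (Cx x y)) - N%:R / pi * b x).
  move=> _; have := is_deriveB (smooth_count_dE N0 hH x y0) (is_deriveZ (N%:R / pi) (dA x)).
  by [].
 suff h : N%:R / pi * (- (2 * dl)) * (x2 - x1) <= F x2 - F x1 <= N%:R / pi * (2 * dl) * (x2 - x1) by case/andP: h.
 apply: (mvt_bounds x12 dF).
 move=> x /andP[h1 h2]; rewrite -mulrBr !(ler_pM2l Npi) -ler_norml; apply: Im_mN_near.
 by rewrite !ltW.
have hth : N%:R - N%:R / pi * (e + 2 * dl * (x2 - x1)) <= theta y x2 - theta y x1.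
 have k1 : N%:R / pi * (pi - e) <= N%:R / pi * (A x2 - A x1) by rewrite ler_pM2l.
 have e1 : N%:R / pi * (pi - e) = N%:R - N%:R / pi * e by rewrite mulrBr divfK // gt_eqF.
 by move: hF k1; rewrite e1 /F; lra.
have tot : N%:R - N%:R / pi * (e + 2 * dl * (x2 - x1)) - 2 * Er <= \sum_k c2 k - \sum_k c1 k.
 move: g1 g2 hth; rewrite !ler_norml => /andP[_ k1] /andP[k2 _].
 by move: (\sum_k c1 k) (\sum_k c2 k) k1 k2 => a1 a2; lra.
have c12 k : c1 k <= c2 k.
 rewrite /c1 /c2 ler_nat; case: ltP => //= h; rewrite (ltW (lt_le_trans h x12)) //.
split => hp.
- have h1 : \sum_k c2 k <= N%:R.
  apply: (via (\sum_(k < N) 1)); last by rewrite sumr_const card_ord.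
  by apply: ler_sum => k _; have /andP[] := b01 (s`_k <= x2)%R.
 have h2 : p.+1%:R <= \sum_k c1 k.
  apply: (via (\sum_(k < N) ((k <= p)%N%:R : R))).
   rewrite -natr_sum ler_nat -(big_mkord xpredT (fun k => nat_of_bool (k <= p)%N)) (big_cat_nat (n := p.+1)) //=.
   rewrite (eq_big_nat _ _ (F2 := fun=> 1%N)) => [|k /andP[_ kp]]; last by rewrite -ltnS kp.
   by rewrite sum_nat_const_nat subn0 muln1 leq_addr.
  apply: ler_sum => k _; rewrite ler_nat; case: (leqP k p) => //= kp.
  by rewrite (le_lt_trans (eigenvalues_le H kp pN) hp).
 by move: tot h1 h2; move: (\sum_k c1 k) (\sum_k c2 k) => a1 a2; lra.
- have h1 : \sum_k c2 k <= p%:R.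
  apply: (via (\sum_(k < N) ((k < p)%N%:R : R))); last first.
   rewrite -natr_sum ler_nat -(big_mkord xpredT (fun k => nat_of_bool (k < p)%N)) (big_cat_nat (n := p)) ?(ltnW pN) //=.
   rewrite (eq_big_nat _ _ (F2 := fun=> 1%N)) => [|k /andP[_ kp]]; last by rewrite kp.
   rewrite [X in (_ + X)%N](eq_big_nat _ _ (F2 := fun=> 0%N)) => [|k /andP[kp _]]; last by rewrite ltnNge kp.
   by rewrite !sum_nat_const_nat subn0 muln1 muln0 addn0.
  apply: ler_sum => k _; rewrite ler_nat; case: (ltnP k p) => //= [_|pk]; first by case: (_ <= _)%R.
  by rewrite leNgt (lt_le_trans hp (eigenvalues_le H pk (ltn_ord k))).
 have h2 : 0 <= \sum_k c1 k by apply: sumr_ge0 => k _; have /andP[] := b01 (s`_k < x1)%R.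
 by move: tot h1 h2; move: (\sum_k c1 k) (\sum_k c2 k) => a1 a2; lra.
Qed.

Variables (kp lp : R).
Notation l := ((sqrt N%:R)^-1 : R).
Hypotheses (yl : y <= l) (l2 : l <= 2) (kp0 : 0 <= kp) (lp0 : 0 <= lp).
Hypothesis hstr : forall x e, x1 <= x <= x2 -> y <= e -> e <= 2 ->
 nc (mN H (Cx x e) - m (Cx x e)) <= kp * ((sqrt N%:R)^-1 + (N%:R * e)^-1).
Hypothesis hlip : forall x x' e, x1 <= x <= x2 -> x1 <= x' <= x2 -> 0 < e -> e <= 2 ->
 nc (m (Cx x e) - m (Cx x' e)) <= lp * `|x - x'|.
Hypothesis hbl : forall x e, x1 <= x <= x2 -> 0 < e -> e <= 2 -> `|Iz (m (Cx x e)) - b x| <= lp * e.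
Let sN : 0 < sqrt N%:R :> R. by rewrite sqrtr_gt0. Qed.
Let l0 : 0 < l :> R. by rewrite invr_gt0. Qed.
Let sq2 : sqrt N%:R * sqrt N%:R = N%:R :> R. by rewrite -expr2 sqr_sqrtr // ltW. Qed.

(** The derivative in the height is governed by [Re mN] at [a'] minus [Re mN] at [a]: the strong law
    at both points and the Lipschitz bound for [m] between them. Integrating the part [1 / (N e)] of
    the rate yields the logarithm. *)
Lemma vertical (a a' : R) : a <= a' -> x1 <= a -> a' <= x2 ->
 `|(theta l a' - theta l a) - (theta y a' - theta y a)| <=
  N%:R / pi * (2 * kp / N%:R * ln (l / y) + (2 * kp * l + lp * (a' - a)) * l).
Proof.
move=> aa' ha ha'; have hxa : x1 <= a <= x2 by rewrite ha (le_trans aa').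
have hxa' : x1 <= a' <= x2 by rewrite ha' (le_trans ha).
pose B1 := 2 * kp / N%:R; pose B2 := 2 * kp * l + lp * (a' - a).
have B20 : 0 <= B2 by rewrite addr_ge0 ?mulr_ge0 ?subr_ge0 // ltW.
pose G e := theta e a' - theta e a.
pose G' e := N%:R / pi * Rz (mN H (Cx a' e)) - N%:R / pi * Rz (mN H (Cx a e)).
have dG (e : R) : 0 < e -> is_derive e (1 : R) G (G' e).
 by move=> e0; exact: (is_deriveB (smooth_count_dy N0 hH a' e0) (smooth_count_dy N0 hH a e0)).
have bG e : y <= e -> e <= 2 -> `|G' e| <= N%:R / pi * (B1 * e^-1 + B2).
 move=> ye e2; have e0 : 0 < e by exact: lt_le_trans ye.
 rewrite /G' -mulrBr normrM gtr0_norm //; apply: ler_wpM2l; first exact: ltW.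
 rewrite -cReB; apply: le_trans (Re_le _) _.
 have -> : mN H (Cx a' e) - mN H (Cx a e) = (mN H (Cx a' e) - m (Cx a' e))
   - (mN H (Cx a e) - m (Cx a e)) + (m (Cx a' e) - m (Cx a e)) by ring.
 apply: le_trans (ncD _ _) _.
 have h1 := le_trans (ncB _ _) (lerD (hstr hxa' ye e2) (hstr hxa ye e2)).
 have h2 := hlip hxa' hxa e0 e2; rewrite ger0_norm ?subr_ge0 // in h2.
 apply: le_trans (lerD h1 h2) _; rewrite /B1 /B2; apply: eq_ler.
 by rewrite invfM; ring.
pose Lg e := N%:R / pi * (B1 * ln e + B2 * e).
have pos e : y <= e <= l -> 0 < e by case/andP => ye _; exact: lt_le_trans ye.
have dL (e : R) : 0 < e -> is_derive e (1 : R) Lg (N%:R / pi * (B1 * e^-1 + B2)).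
 move=> e0; have h1 := is_deriveZ B1 (is_derive1_ln e0).
 have h2 := is_deriveZ B2 (is_derive_id e (1 : R)).
 have := is_deriveZ (N%:R / pi) (is_deriveD h1 h2).
 by move=> h; apply: (is_derive_eq h); rewrite -[B2 *: 1]/(B2 * 1) mulr1.
have Ld : Lg l - Lg y <= N%:R / pi * (B1 * ln (l / y) + B2 * l).
 rewrite /Lg -mulrBr; apply: ler_wpM2l; first exact: ltW.
 rewrite ln_div ?posrE // mulrBr; have : 0 <= B2 * y by rewrite mulr_ge0 // ltW.
 by move: (B1 * ln l) (B1 * ln y) (B2 * l) (B2 * y) => r1 r2 r3 r4; lra.
apply: le_trans Ld; apply: (norm_diff_le yl (fun e h => dG e (pos e h)) (fun e h => dL e (pos e h))) => e /andP[ye el].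
 exact: bG (ltW ye) (le_trans (ltW el) l2).
apply: (via (N%:R / pi * (B1 * y^-1 + B2))); last exact: ler_norm.
apply: ler_wpM2l; first exact: ltW.
rewrite lerD2r; apply: ler_wpM2l; first by rewrite divr_ge0 ?mulr_ge0 // ltW.
by rewrite lef_pV2 ?posrE ?(lt_trans y0 ye) // ltW.
Qed.

(** At height [N^-1/2] both terms of the rate equal [N^-1/2], and moving [m] to the real axis and to
    the point [a] costs [lp] times the height and the distance. *)
Lemma horizontal (a a' : R) : a <= a' -> x1 <= a -> a' <= x2 ->
 `|(theta l a' - theta l a) - N%:R / pi * b a * (a' - a)| <=
  N%:R / pi * ((2 * kp + lp) * l + lp * (a' - a)) * (a' - a).
Proof.
move=> aa' ha ha'; set D := (2 * kp + lp) * l + _.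
have := @mvt_bounds R (theta l) _ a a' (N%:R / pi * (b a - D)) (N%:R / pi * (b a + D)) aa' (fun x _ => smooth_count_dE N0 hH x l0).
case/(_ _)/andP => [x /andP[h1 h2]|k1 k2]; last first.
 rewrite ler_norml; move: k1 k2.
 have -> : N%:R / pi * (b a - D) * (a' - a) = N%:R / pi * b a * (a' - a) - N%:R / pi * D * (a' - a) by ring.
 have -> : N%:R / pi * (b a + D) * (a' - a) = N%:R / pi * b a * (a' - a) + N%:R / pi * D * (a' - a) by ring.
 by move: (_ * b a * _) (_ * D * _) (theta l a' - _) => r1 r2 r3 *; apply/andP; split; lra.
have hx : x1 <= x <= x2 by rewrite (le_trans ha (ltW h1)) (le_trans (ltW h2) ha').
have hxa : x1 <= a <= x2 by rewrite ha (le_trans aa').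
rewrite !(ler_pM2l Npi) -ler_distl.
have -> : Iz (mN H (Cx x l)) - b a = Iz (mN H (Cx x l) - m (Cx x l)) + Iz (m (Cx x l) - m (Cx a l))
  + (Iz (m (Cx a l)) - b a) by rewrite !cImB; ring.
apply: le_trans (ler_normD _ _) _; apply: le_trans (lerD (ler_normD _ _) (hbl hxa l0 l2)) _.
have g1 := le_trans (Im_le _) (hstr hx yl l2).
have g2 := le_trans (Im_le _) (hlip hx hxa l0 l2); rewrite (ger0_norm (x := x - a)) ?subr_ge0 ?(ltW h1) // in g2.
have g3 : lp * (x - a) <= lp * (a' - a) by apply: ler_wpM2l => //; rewrite lerD2r ltW.
have el : (N%:R * l)^-1 = l.
 by rewrite -{1}sq2 mulfK ?gt_eqF.
rewrite el in g1; rewrite /D; move: g1 g2 g3; move: (`|Iz (mN _ _ - _)|) (`|Iz (m _ - _)|) (lp * (x - a)) (lp * (a' - a)) => r1 r2 r3 r4.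
by move: (sqrt N%:R)^-1 => r5; lra.
Qed.

Lemma spacing_fine (p r : nat) : (p <= r)%N -> (r < N)%N -> x1 <= s`_p -> s`_r <= x2 ->
 forall d, d = s`_r - s`_p ->
 `|(r%:R - p%:R) - N%:R / pi * b s`_p * d| <= 2 * Er +
  (2 * kp * (ln (l / y) + 1 + d * sqrt N%:R) + lp * (2 * (d * sqrt N%:R) + (d * sqrt N%:R) ^+ 2)).
Proof.
move=> pr rN h1 h2 d dE; have le := eigenvalues_le H pr rN.
have d0 : 0 <= d by rewrite dE subr_ge0.
have pN : (p < N)%N by exact: leq_ltn_trans pr rN.
have hp : x1 <= s`_p <= x2 by rewrite h1 (le_trans le).
have hr : x1 <= s`_r <= x2 by rewrite h2 andbT (le_trans h1).
have := rank_error pN hp; have := rank_error rN hr.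
have := vertical le h1 h2; have := horizontal le h1 h2; rewrite -dE.
set T1 := N%:R / pi * (_ + _) * d; set T2 := N%:R / pi * (_ + _) => k1 k2.
have lne : 0 <= ln (l / y) by rewrite ln_ge0 // ler_pdivlMr // mul1r.
have pi1 : pi^-1 <= 1 :> R by rewrite invf_le1 //; apply: le_trans (@pi_ge2 R); rewrite ler1n.
have NE : N%:R = sqrt N%:R ^+ 2 :> R by rewrite expr2 sq2.
have T12 : T1 + T2 <= 2 * kp * (ln (l / y) + 1 + d * sqrt N%:R) + lp * (2 * (d * sqrt N%:R) + (d * sqrt N%:R) ^+ 2).
 set X := leRHS; have -> : T1 + T2 = pi^-1 * X.
  have sn : sqrt N%:R != 0 :> R by rewrite gt_eqF.
  rewrite /T1 /T2 /X; move: (ln _) => w; move: (sqrt N%:R) NE sn => q NE qn; rewrite NE.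
  have pn : pi != 0 :> R by rewrite gt_eqF.
  move: (pi : R) pn => P pn.
  by field; rewrite pn.
 rewrite -[leRHS]mul1r; apply: ler_wpM2r => //.
 have dN : 0 <= d * sqrt N%:R by rewrite mulr_ge0 // ltW.
 by rewrite /X addr_ge0 // mulr_ge0 ?mulr_ge0 ?addr_ge0 ?mulr_ge0 ?sqr_ge0.
move: k1 k2 T12; rewrite !ler_norml => /andP[a1 a2] /andP[a3 a4] a5 /andP[a6 a7] /andP[a8 a9].
move: a1 a2 a3 a4 a5 a6 a7 a8 a9; rewrite -(natr1 p) -(natr1 r).
set X := 2 * kp * _ + _.
move: X T1 T2 (theta l _ - theta l _) (theta y _) (theta y _) Er (_ * _ * d) => X T1 T2 u1 u2 u3 u4 u5.
move: (r%:R) (p%:R) (N%:R / 2) => b1 b2 b3 *.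
by apply/andP; split; lra.
Qed.
End spacing.

Lemma near_loglog {R : realType} (M : R) : \forall N \near \oo, M <= loglog N /\ 0 < ln N%:R :> R.
Proof.
near=> N.
have h : expR (expR M) <= N%:R by near: N; exact: nbhs_infty_ger.
have N0 : 0 < N%:R :> R by exact: lt_le_trans (expR_gt0 _) h.
have h1 : expR M <= ln N%:R by rewrite -[leLHS]expRK ler_ln ?posrE // expR_gt0.
have l0 : 0 < ln N%:R :> R by exact: lt_le_trans (expR_gt0 _) h1.
by split => //; rewrite /loglog -[leLHS]expRK ler_ln ?posrE // expR_gt0.
Unshelve. all: by end_near. Qed.

Lemma expR_ge_cube {R : realType} (B l : R) : 0 <= B -> 27 * B <= l -> B * l ^+ 2 <= expR l.
Proof.
move=> B0 hl; have l0 : 0 <= l by apply: le_trans hl; rewrite mulr_ge0.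
have h : l / 3 <= expR (l / 3) by apply: le_trans (expR_ge1Dx _); rewrite lerDr.
have -> : expR l = expR (l / 3) ^+ 3 by rewrite -expRM_natl; congr expR; field.
apply: (via ((l / 3) ^+ 3)); last first.
 by rewrite lerXn2r // nnegrE ?divr_ge0 // expR_ge0.
have -> : (l / 3) ^+ 3 = (l / 27) * l ^+ 2 by field.
by apply: ler_wpM2r; [exact: sqr_ge0|rewrite ler_pdivlMr // mulrC].
Qed.

(** * Conditions valid for large [N] *)

Section near_parameters.
Context {R : realType} (theta C0 a0 A0 Cphi : R).
Hypotheses (a02 : 2 < a0) (A010 : 10 <= A0) (hLD : large_deviation_constants theta C0 a0 A0 Cphi).
Variable xi : nat -> R.
Hypothesis hxi : xi_sequence A0 xi.

(** With [l = loglog N], [L = exp (xi l)] and [xi <= (A0 + 1)/2 l], so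
    [L^K <= exp (K (A0 + 1) l^2 / 2)], below [exp (log N / 2) = sqrt N] since [log N = exp l]
    outgrows [l^2]. The exponent [3/2 xi] stays below [A0 l] because [3/4 (A0 + 1) <= A0]. *)
Lemma near_params (M K : R) : 0 <= K -> \forall N \near \oo,
 (ld_at theta C0 Cphi N (3 / 2 * xi N) /\ M <= ln N%:R) /\
 [/\ 3 <= xi N, M <= ln N%:R `^ xi N & (ln N%:R `^ xi N) `^ K <= sqrt N%:R].
Proof.
move=> K0; case: hxi => o o0 ho.
pose M' := a0 + `|M| + 27 * (K * (A0 + 1)).
near=> N.
have ld : forall xi : R, a0 <= xi -> xi <= A0 * loglog N -> ld_at theta C0 Cphi N xi.
 by near: N.
have hx : xi N = (A0 + o N) / 2 * loglog N by near: N.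
have [hl x0] : M' <= loglog N /\ 0 < ln N%:R :> R by near: N; exact: near_loglog.
have : `|o N| <= 1 by near: N; exact: (cvgr0_norm_le _ o0).
rewrite ler_norml => /andP[oL oU].
set x := ln N%:R in x0 *; rewrite /loglog -/x in hl hx ld *; set l := ln x in hl hx ld *.
have xE : x = expR l by rewrite lnK.
have KA : 0 <= K * (A0 + 1) by rewrite mulr_ge0 //; move: A010; lra.
have Mn : 0 <= `|M| by exact: normr_ge0.
have l2 : 2 <= l by move: hl KA Mn a02; rewrite /M'; lra.
have la : a0 <= l by move: hl KA Mn; rewrite /M'; lra.
have lM : M <= l by apply: le_trans (ler_norm _) _; move: hl KA Mn a02; rewrite /M'; lra.
have lK : 27 * (K * (A0 + 1)) <= l by move: hl Mn a02; rewrite /M'; lra.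
have l0 : 0 <= l by move: l2; lra.
have lx : l <= x by rewrite xE; apply: le_trans (expR_ge1Dx _); rewrite lerDr.
have xi1 : 9 / 2 * l <= xi N by rewrite hx; apply: ler_wpM2r => //; move: A010 oL; clra.
have xi2 : xi N <= (A0 + 1) / 2 * l by rewrite hx; apply: ler_wpM2r => //; move: oU; clra.
have xi0 : 0 <= xi N by move: xi1 l0; lra.
have LE : x `^ xi N = expR (xi N * l) by rewrite /powR gt_eqF.
split; split.
- apply: ld; first by move: xi1 la l2; lra.
 have h : 3 / 2 * ((A0 + 1) / 2 * l) <= A0 * l.
  by rewrite mulrA; apply: ler_wpM2r => //; move: A010; clra.
 by apply: le_trans h; apply: ler_wpM2l.
- exact: le_trans lM lx.
- by move: xi1 l2; clra.
- apply: (le_trans lM); apply: (le_trans lx); rewrite LE xE ler_expR -[leLHS]mul1r.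
 by apply: ler_wpM2r => //; move: xi1 l2; clra.
- rewrite LE -expRM.
 have N0 : 0 < N%:R :> R.
  by rewrite ltNge; apply/negP => /ln0 h; move: x0; rewrite /x h ltxx.
 have -> : sqrt N%:R = expR (x / 2).
  suff -> : N%:R = expR (x / 2) ^+ 2 by rewrite sqrtr_sqr ger0_norm ?expR_ge0.
  by rewrite -expRM_natl (_ : 2%:R * (x / 2) = x) ?lnK //; field.
 rewrite ler_expR.
 have h1 := expR_ge_cube KA lK; rewrite -xE in h1.
 have h2 : xi N * l * K <= (A0 + 1) / 2 * l * l * K.
  by apply: ler_wpM2r => //; apply: ler_wpM2r.
 move: h1 h2; set u := _ * l * K; have -> : (A0 + 1) / 2 * l * l * K = K * (A0 + 1) * l ^+ 2 / 2 by ring.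
 by move: (K * (A0 + 1) * _) => r; clra.
Unshelve. all: by end_near. Qed.
End near_parameters.

Lemma expR1_le4 {R : realType} : expR 1 <= 4 :> R.
Proof.
have h : 2^-1 <= expR (- 2^-1) :> R by apply: le_trans (expR_ge1Dx _); lra.
have h2 : expR 2^-1 <= 2 :> R.
 by rewrite -[leLHS]invrK -expRN -[leRHS]invrK lef_pV2 ?posrE ?invr_gt0 ?expR_gt0.
have -> : expR 1 = expR 2^-1 ^+ 2 :> R by rewrite -expRM_natl; congr expR; field.
have -> : 4 = 2 ^+ 2 :> R by ring.
by rewrite lerXn2r ?nnegrE ?expR_ge0.
Qed.

Lemma linear_exponent {R : realType} (l u s r : R) : s <= 153 * u -> 155 * u <= r -> l * 1 <= u -> l + (s - r) <= - l.
Proof. lra. Qed.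

(** * Regularity of the density in the bulk and deterministic consequences for the spacing *)

Section bulk_density.
Context {R : realType} {mu : probability (measurableTypeR R) R} {lam c x1 x2 : R}.
Notation m := (m_fc mu lam).
Notation b := (imb (m_fc mu lam)).
Hypotheses (c0 : 0 < c) (c1 : c <= 1)
 (him : forall x e, x1 <= x <= x2 -> 0 < e -> e <= 2 -> c <= Iz (m (Cx x e))).
Let hE := law_is_mean mu.
Let near x e (e0 : 0 < e) := imb_near hE (m_fc_ge0 mu lam) (m_fc_eq mu lam) x e0.

Lemma imb_bulk_ge x : x1 <= x <= x2 -> c <= b x.
Proof.
move=> hx; rewrite leNgt; apply/negP => h.
have g0 : 0 < (c - b x) / 2 by rewrite divr_gt0 // subr_gt0.
have [d d0 hd] := cr_small g0.
pose e := Num.min d 2; have e0 : 0 < e by rewrite lt_min d0 ltr0n.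
have ed : e <= d by rewrite ge_min lexx.
have e2 : e <= 2 by rewrite ge_min lexx orbT.
have := le_trans (near x e0) (hd e (ltW e0) ed); have := him hx e0 e2.
by rewrite ler_norml => k1 /andP[_ k2]; move: k1 k2 g0; lra.
Qed.

Lemma imb_m_fc_le1 x : b x <= 1.
Proof. exact: (imb_le1 hE (m_fc_ge0 mu lam) (m_fc_eq mu lam)). Qed.

Lemma m_lip_horizontal x x' e : x1 <= x <= x2 -> x1 <= x' <= x2 -> 0 < e -> e <= 2 ->
 nc (m (Cx x e) - m (Cx x' e)) <= 2 / c ^+ 2 * `|x - x'|.
Proof.
move=> hx hx' e0 e2; apply: le_trans (m_lip c0 c1 him hx hx' e0 e2 e0 e2) _.
apply: ler_wpM2l; first by rewrite divr_ge0 // exprn_ge0 // ltW.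
by apply: le_trans (nc_le_ReIm _) _; rewrite cReB cImB /= subrr normr0 addr0.
Qed.

Lemma imb_lip x e : x1 <= x <= x2 -> 0 < e -> e <= 2 -> `|Iz (m (Cx x e)) - b x| <= 2 / c ^+ 2 * e.
Proof.
move=> hx e0 e2; rewrite leNgt; apply/negP; rewrite -subr_gt0 => h.
have g0 := divr_gt0 h (ltr0n R 2 : 0 < 2).
have [d d0 hd] := cr_small g0.
pose e' := Num.min d e; have e'0 : 0 < e' by rewrite lt_min d0.
have ed : e' <= d by rewrite ge_min lexx.
have ee : e' <= e by rewrite ge_min lexx orbT.
have k1 := le_trans (near x e'0) (hd e' (ltW e'0) ed).
have k2 : `|Iz (m (Cx x e)) - Iz (m (Cx x e'))| <= 2 / c ^+ 2 * e.
 rewrite -cImB; apply: le_trans (Im_le _) _.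
 apply: le_trans (m_lip c0 c1 him hx hx e0 e2 e'0 (le_trans ee e2)) _.
 apply: ler_wpM2l; first by rewrite divr_ge0 // exprn_ge0 // ltW.
 apply: le_trans (nc_le_ReIm _) _; rewrite cReB cImB /= subrr normr0 add0r.
 by rewrite ger0_norm ?subr_ge0 // gerBl ltW.
have k3 : `|Iz (m (Cx x e)) - b x| <= `|Iz (m (Cx x e)) - Iz (m (Cx x e'))| + `|Iz (m (Cx x e')) - b x|.
 by rewrite -[in leLHS](subrKA (Iz (m (Cx x e')))) ler_normD.
have := le_trans k3 (lerD k2 k1).
by rewrite -lerBlDl leNgt ltr_pdivrMr // ltr_pMr // ltr1n.
Qed.
End bulk_density.

Section spaced.
Context {R : realType} (mu : probability (measurableTypeR R) R) (lam c : R) (N : nat).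
Notation b := (imb (m_fc mu lam)).

(** All that the probabilistic part says about two eigenvalues [a], [a'] with index gap [G]; [T] is
    the scale of the counting error, [kp] that of the local law and [x] bounds the logarithm. The
    third clause quantifies over all bounds of the density, so that its extrema between [a] and [a']
    can be inserted; the fourth takes a bound on the distance in units of [N^-1/2]. *)
Definition spaced (T kp x G a a' : R) : Prop :=
 [/\ a <= a', forall E, a <= E <= a' -> c <= b E,
   forall lo hi, c <= lo -> c <= hi -> (forall E, a <= E <= a' -> lo <= b E <= hi) ->
    N%:R / pi * lo * (a' - a) <= 2 * G /\ G <= 2 * (N%:R / pi * hi * (a' - a)) &
   forall D, (a' - a) * sqrt N%:R <= D ->
    `|G - N%:R / pi * b a * (a' - a)| <= 90 * T + (2 * kp * (x + 1 + D) + 2 / c ^+ 2 * (2 * D + D ^+ 2))].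

Hypotheses (N0 : 0 < N%:R :> R) (c0 : 0 < c).
Let pi0 : 0 < pi :> R. exact: pi_gt0. Qed.

Lemma spaced_rough (T kp x G a a' : R) (rho : R -> R) : (forall E, rho E = b E / pi) -> spaced T kp x G a a' ->
 let rmax := max_on rho a a' in let rmin := min_on rho a a' in
 [/\ 0 < rmax, 0 < rmin, (2 * rmax)^-1 * (G / N%:R) <= `|a - a'| & `|a - a'| <= 2 / rmin * (G / N%:R)].
Proof.
move=> rhoE [aa' cb hG _] rmax rmin.
have rho1 E : rho E <= pi^-1.
 by rewrite rhoE -[leRHS]mul1r; apply: ler_wpM2r; [rewrite invr_ge0 ltW|exact: imb_m_fc_le1].
have rhoc E : a <= E <= a' -> c / pi <= rho E.
 by move=> hE; rewrite rhoE; apply: ler_wpM2r; [rewrite invr_ge0 ltW|exact: cb].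
pose S := [set rho t | t in `[a, a']].
have S0 : S !=set0 by exists (rho a), a => //=; rewrite in_itv /= lexx aa'.
have ubS : has_ubound S by exists pi^-1 => _ [t _ <-].
have lbS : lbound S (c / pi).
 by move=> _ [t ht <-]; apply: rhoc; move: ht; rewrite /= in_itv.
have inS E : a <= E <= a' -> S (rho E) by move=> hE; exists E => //=; rewrite in_itv.
have cmin : c / pi <= rmin by exact: lb_le_inf.
have hmin E : a <= E <= a' -> rmin <= rho E.
 by move=> hE; apply: ge_inf; [exists (c / pi)|exact: inS].
have hmax E : a <= E <= a' -> rho E <= rmax.
 by move=> hE; apply: ub_le_sup => //; exact: inS.
have haa : a <= a <= a' by rewrite lexx.
have cmax : c / pi <= rmax by apply: le_trans (hmax a haa); exact: rhoc.
have min0 : 0 < rmin by apply: lt_le_trans cmin; exact: divr_gt0.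
have max0 : 0 < rmax by apply: lt_le_trans cmax; exact: divr_gt0.
have cl : c <= pi * rmin by rewrite -ler_pdivrMl // mulrC.
have ch : c <= pi * rmax by rewrite -ler_pdivrMl // mulrC.
have hb E : a <= E <= a' -> pi * rmin <= b E <= pi * rmax.
 move=> hE; have := hmin E hE; have := hmax E hE; rewrite rhoE.
 by rewrite ler_pdivrMr // ler_pdivlMr // mulrC => -> ; rewrite mulrC => ->.
have [k1 k2] := hG _ _ cl ch hb.
have dn : `|a - a'| = a' - a by rewrite distrC ger0_norm // subr_ge0.
have e1 r : N%:R / pi * (pi * r) * (a' - a) = N%:R * r * (a' - a).
 by rewrite mulrA divfK // gt_eqF.
rewrite e1 in k1; rewrite e1 in k2; rewrite dn; split => //.
- rewrite ler_pdivrMl ?mulr_gt0 // ler_pdivrMr //; move: k2; congr (_ <= _); ring.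
- rewrite mulrAC ler_pdivlMr // mulrA ler_pdivlMr //; move: k1; congr (_ <= _); ring.
Qed.

(** The third clause with [lo = c], and [pi <= 4], give a distance of at most [8 F / c] in units of
    [N^-1/2]. Every error term is then a multiple of [La^2 L^3 F^2], and the lower bound on [L]
    absorbs the multiple in a fourth power. *)
Lemma spaced_fine (La L F x G a a' rho : R) : c <= 1 -> rho = b a / pi -> 1 <= La -> 1 <= L -> x <= L -> 1 <= F ->
 G <= F * sqrt N%:R ->
 4 / c * (90 + 2 * (15 * 10 ^+ 10 / c ^+ 13) * (2 + 8 / c) + 2 / c ^+ 2 * (2 * (8 / c) + (8 / c) ^+ 2)) <= L ->
 spaced ((La * L) ^+ 2 * L) (15 * 10 ^+ 10 / c ^+ 13 * (La ^+ 2 * L)) x G a a' ->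
 `| `|a - a'| - G / (N%:R * rho) | <= La ^+ 2 * L ^+ 4 * F ^+ 2 * N%:R^-1.
Proof.
move=> c1 rhoE La1 L1 xL F1 GF hL [aa' cb hG hlaw].
have haa : a <= a <= a' by rewrite lexx.
have pi4 : pi <= 4 :> R by have := @pihalf_lt2 R; move: (pi : R) => P; lra.
have s0 : 0 < sqrt N%:R :> R by rewrite sqrtr_gt0.
have sq2 : sqrt N%:R ^+ 2 = N%:R :> R by rewrite sqr_sqrtr // ltW.
have dn : `|a - a'| = a' - a by rewrite distrC ger0_norm // subr_ge0.
have d0 : 0 <= a' - a by rewrite subr_ge0.
have dF : (a' - a) * sqrt N%:R <= 8 / c * F.
 have [k1 _] := hG c 1 (lexx c) c1 (fun E hE => introT andP (conj (cb E hE) (imb_m_fc_le1 E))).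
 have k2 : N%:R * c * (a' - a) <= 8 * G.
  have : pi * (N%:R / pi * c * (a' - a)) <= pi * (2 * G) by apply: ler_wpM2l => //; exact: ltW.
  have -> : pi * (N%:R / pi * c * (a' - a)) = N%:R * c * (a' - a).
   by move: (pi : R) pi0 => P P0; field; rewrite gt_eqF.
  have : pi * (2 * G) <= 4 * (2 * G).
   by apply: ler_wpM2r => //; apply: le_trans k1; rewrite !mulr_ge0 ?invr_ge0 // ltW.
  by move=> h1 h2; apply: (le_trans h2); apply: (le_trans h1); rewrite mulrA -natrM.
 have k3 : sqrt N%:R * (c * (sqrt N%:R * (a' - a))) <= sqrt N%:R * (8 * F).
  rewrite -{1}sq2 expr2 in k2; apply: le_trans (_ : 8 * G <= _); first by move: k2; congr (_ <= _); ring.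
  by rewrite mulrCA; apply: ler_wpM2l => //; rewrite mulrC.
 move: k3; rewrite ler_pM2l // => k3; rewrite [leRHS]mulrAC ler_pdivlMr // mulrC [X in _ * X]mulrC; exact: k3.
have := hlaw _ dF; set B := leRHS => hB.
have b0 : 0 < b a by apply: lt_le_trans (cb a haa).
have Nr0 : 0 < N%:R * rho by rewrite mulr_gt0 // rhoE divr_gt0.
rewrite dn; have -> : a' - a - G / (N%:R * rho) = - ((N%:R * rho)^-1 * (G - N%:R / pi * b a * (a' - a))).
 have -> : N%:R / pi * b a = N%:R * rho by rewrite rhoE mulrAC mulrA.
 by rewrite mulrBr mulKf ?gt_eqF // opprB [_^-1 * G]mulrC.
rewrite normrN normrM gtr0_norm ?invr_gt0 //.
have r4 : (N%:R * rho)^-1 <= 4 / c * N%:R^-1.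
 rewrite invfM mulrC; apply: ler_wpM2r; first by rewrite invr_ge0 ltW.
 rewrite rhoE invf_div; apply: ler_pM; rewrite ?invr_ge0 ?(ltW pi0) ?(ltW b0) //.
 by rewrite lef_pV2 ?posrE // cb.
apply: le_trans (ler_pM _ (normr_ge0 _) r4 hB) _; first by rewrite invr_ge0 ltW.
rewrite mulrAC; apply: ler_wpM2r; first by rewrite invr_ge0 ltW.
have W1 : 1 <= La ^+ 2 by rewrite exprn_ege1.
have W0 : 0 <= La ^+ 2 by exact: le_trans W1.
have F2 : F <= F ^+ 2 by rewrite -[leLHS]expr1; apply: ler_weXn2l.
have F0 : 0 <= F by exact: le_trans F1.
have L0 : 0 <= L by exact: le_trans L1.
have FF1 : 1 <= F ^+ 2 by rewrite exprn_ege1.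
have L2 : L ^+ 2 <= L ^+ 3 by apply: ler_weXn2l.
have L31 : 1 <= L ^+ 3 by rewrite exprn_ege1.
set k := 15 * 10 ^+ 10 / c ^+ 13 in B hB hL *.
have k0 : 0 <= k by rewrite !mulr_ge0 ?invr_ge0 ?exprn_ge0 // ltW.
set q := 2 / c ^+ 2 in B hB hL *; have q0 : 0 <= q by rewrite divr_ge0 // exprn_ge0 // ltW.
set g := 8 / c in dF B hB hL *; have g0 : 0 <= g by rewrite divr_ge0 // ltW.
pose Z := La ^+ 2 * L ^+ 3 * F ^+ 2.
have Z0 : 0 <= Z by apply: mulr_ge0; [apply: mulr_ge0 => //; exact: le_trans L31|exact: le_trans FF1].
have hBZ : B <= (90 + 2 * k * (2 + g) + q * (2 * g + g ^+ 2)) * Z.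
 have z1 : (La * L) ^+ 2 * L <= Z.
  by rewrite exprMn -mulrA -exprSr -[leLHS]mulr1; apply: ler_wpM2l => //; rewrite mulr_ge0 // exprn_ge0.
 have z2 : La ^+ 2 * L * (x + 1 + g * F) <= (2 + g) * Z.
  apply: (via (La ^+ 2 * L * (L * F ^+ 2 * (2 + g)))).
   apply: ler_wpM2l; first by rewrite mulr_ge0.
   have u1 : x + 1 <= 2 * (L * F ^+ 2).
    have : L * 1 <= L * F ^+ 2 by apply: ler_wpM2l.
    by move: (L * F ^+ 2) xL L1 => w; clra.
   have u2 : g * F <= L * F ^+ 2 * g.
    rewrite mulrC; apply: ler_wpM2r => //; apply: (le_trans F2).
    by apply: ler_peMl => //; rewrite exprn_ge0.
   by rewrite mulrDr [L * _ * 2]mulrC; exact: lerD.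
  have -> : La ^+ 2 * L * (L * F ^+ 2 * (2 + g)) = (2 + g) * (La ^+ 2 * L ^+ 2 * F ^+ 2) by ring.
  apply: ler_wpM2l; first by rewrite addr_ge0.
  by apply: ler_wpM2r; [rewrite exprn_ge0|apply: ler_wpM2l].
 have FZ : F ^+ 2 <= Z.
  by apply: ler_peMl; [rewrite exprn_ge0|rewrite -[leLHS]mul1r; apply: ler_pM].
 have z3 : 2 * (g * F) + (g * F) ^+ 2 <= (2 * g + g ^+ 2) * Z.
  apply: (via ((2 * g + g ^+ 2) * F ^+ 2)); last by apply: ler_wpM2l => //; apply: addr_ge0; [exact: mulr_ge0|exact: sqr_ge0].
  rewrite [leRHS]mulrDl exprMn lerD2r -[leRHS]mulrA; apply: ler_wpM2l => //; exact: ler_wpM2l.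
 have w1 : 90 * ((La * L) ^+ 2 * L) <= 90 * Z by apply: ler_wpM2l.
 have w2 : 2 * (k * (La ^+ 2 * L)) * (x + 1 + g * F) <= 2 * k * (2 + g) * Z.
  have -> : 2 * (k * (La ^+ 2 * L)) * (x + 1 + g * F) = 2 * k * (La ^+ 2 * L * (x + 1 + g * F)) by ring.
  by rewrite -[leRHS]mulrA; apply: ler_wpM2l => //; rewrite mulr_ge0.
 have w3 : q * (2 * (g * F) + (g * F) ^+ 2) <= q * (2 * g + g ^+ 2) * Z.
  by rewrite -[leRHS]mulrA; apply: ler_wpM2l.
 rewrite [leRHS]mulrDl [X in _ <= X + _]mulrDl -[leRHS]addrA; exact: lerD w1 (lerD w2 w3).
apply: le_trans (ler_wpM2l _ hBZ) _; first by rewrite divr_ge0 // ltW.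
rewrite mulrA; apply: le_trans (ler_wpM2r Z0 hL) _.
by rewrite /Z; apply: eq_ler; ring.
Qed.
End spaced.

(** * Choice of the scales at a given [N] *)

Section law_event.
Context {R : realType} {theta C0 : R} {mu : probability (measurableTypeR R) R} {N : nat}.
Variables (X : deformed_wigner theta C0 mu N) (lam Cphi xi x L La c dl eps x1 x2 : R) (f : R -> R).
Hypotheses (th0 : 0 < theta) (C00 : 0 < C0) (c0 : 0 < c) (c1 : c <= 1) (dl0 : 0 < dl) (dl1 : dl <= 1)
 (NE : N%:R = expR x) (lx1 : 1 <= x) (xL3 : x ^+ 3 <= L) (LD : ld_at theta C0 Cphi N xi)
 (L15 : ln N%:R `^ xi = L * sqrt L) (f0 : 0 < phi Cphi N `^ xi) (hfL : phi Cphi N `^ xi <= La)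
 (hL2 : L * sqrt L <= La) (Lth : L ^+ 2 <= La `^ theta^-1).
Hypothesis large : [/\ 10 ^+ 5 <= x, 3 * theta <= L & 16 * C0 <= L] /\
 [/\ 106 / c ^+ 2 <= L, 2 * 10 ^+ 4 / c ^+ 5 <= L, 3 * 10 ^+ 11 / (c ^+ 13 * dl) <= L &
   (La * L) ^+ 2 * L ^+ 2 <= sqrt N%:R].
Hypotheses (x21 : x2 - x1 <= x)
 (him : forall x e, x1 <= x <= x2 -> 0 < e -> e <= 2 -> c <= Iz (m_fc mu lam (Cx x e))).
Notation y := ((La * L) ^+ 2 / N%:R).
Notation kp := (15 * 10 ^+ 10 / c ^+ 13 * (La ^+ 2 * L)).

Let N5 : (4 < N)%N.
Proof.
rewrite -(ltr_nat R) NE; apply: lt_le_trans (expR_ge1Dx _); have [[h _ _] _] := large.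
apply: (@lt_le_trans _ _ (10 ^+ 5)); first by rewrite -natrX ltr_nat.
by apply: (le_trans h); rewrite lerDr.
Qed.
Let xL : x <= L.
Proof. by apply: le_trans xL3; rewrite -[leLHS]expr1; apply: ler_weXn2l. Qed.
Let Np : 0 < N%:R :> R. by rewrite NE expR_gt0. Qed.
Let L1 : 1 <= L. exact: le_trans xL. Qed.
Let L0 : 0 < L. exact: lt_le_trans ltr01 L1. Qed.
Let sL1 : 1 <= sqrt L. by apply: (via (sqrt 1)); [rewrite sqrtr1|exact: ler_wsqrtr]. Qed.
Let La1 : 1 <= La.
Proof. by apply: le_trans hL2; rewrite -[leLHS]mulr1; apply: ler_pM. Qed.
Let La0 : 0 < La. exact: lt_le_trans ltr01 La1. Qed.
Let sN0 : 0 < sqrt N%:R :> R. by rewrite sqrtr_gt0. Qed.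
Let sq2 : sqrt N%:R ^+ 2 = N%:R :> R. by rewrite sqr_sqrtr // ltW. Qed.
Let sN : (La * L) ^+ 2 * L ^+ 2 <= sqrt N%:R. by case: large => _ []. Qed.

Let LaL1 : 1 <= La * L. by rewrite -[leLHS]mulr1; apply: ler_pM. Qed.

Lemma y_bounds : [/\ 0 < y, N%:R^-1 <= y, y <= (sqrt N%:R)^-1 & (sqrt N%:R)^-1 <= 1 :> R].
Proof.
have q1 : 1 <= (La * L) ^+ 2 by rewrite exprn_ege1.
have q2 : 1 <= L ^+ 2 by rewrite exprn_ege1.
have q3 : (La * L) ^+ 2 <= sqrt N%:R.
 by apply: le_trans sN; apply: ler_peMr => //; apply: le_trans q1.
have s1 : 1 <= sqrt N%:R :> R by exact: le_trans q3.
split.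
- by rewrite divr_gt0 // exprn_gt0 // mulr_gt0.
- by apply: ler_peMl => //; rewrite invr_ge0 ltW.
- by rewrite ler_pdivrMr //; apply: le_trans q3 _; rewrite -[X in _ <= _ * X]sq2 expr2 mulKf ?gt_eqF.
- by rewrite invf_le1.
Qed.

Let y0 : 0 < y. by case: y_bounds. Qed.
Let yN : N%:R^-1 <= y. by case: y_bounds. Qed.
Let ys : y <= (sqrt N%:R)^-1. by case: y_bounds. Qed.
Let s1 : (sqrt N%:R)^-1 <= 1 :> R. by case: y_bounds. Qed.

Lemma kp_dl e : y <= e -> kp * ((sqrt N%:R)^-1 + (N%:R * e)^-1) <= dl.
Proof.
move=> ye.
have h1 : (N%:R * e)^-1 <= ((La * L) ^+ 2)^-1.
 have q : (La * L) ^+ 2 <= N%:R * e by rewrite -ler_pdivrMl // mulrC.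
 by rewrite lef_pV2 ?posrE ?exprn_gt0 ?mulr_gt0 //; apply: lt_le_trans ye.
have h2 : (sqrt N%:R)^-1 <= ((La * L) ^+ 2)^-1.
 rewrite lef_pV2 ?posrE ?exprn_gt0 ?mulr_gt0 //.
 by apply: le_trans sN; apply: ler_peMr; [rewrite exprn_ge0 // mulr_ge0 ?ltW|rewrite exprn_ege1].
have k0 : 0 <= kp by rewrite !mulr_ge0 ?invr_ge0 ?exprn_ge0 // ltW.
apply: le_trans (ler_wpM2l k0 (lerD h2 h1)) _.
have [_ [_ _ M5 _]] := large; move: M5; rewrite ler_pdivrMr ?mulr_gt0 ?exprn_gt0 //.
have cp : 0 < c ^+ 13 by rewrite exprn_gt0.
move: La0 L0 cp; move: (c ^+ 13) => d; move: (La) (L) => a l a0 l0 d0 h.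
have -> : 15 * 10 ^+ 10 / d * (a ^+ 2 * l) * (((a * l) ^+ 2)^-1 + ((a * l) ^+ 2)^-1) = 3 * 10 ^+ 11 / (d * l).
 by move: (10 ^+ 10 : R) (exprS (10 : R) 10) => g ->; field; rewrite !gt_eqF.
by rewrite ler_pdivrMr ?mulr_gt0 //; move: h; congr (_ <= _); ring.
Qed.

Lemma law_event : exists A : set (dw_space X), [/\ measurable A,
 (dw_prob X (~` A) <= (expR (- 1 * L))%:E)%E &
 forall t, A t -> forall x e, x1 <= x <= x2 -> y <= e -> e <= 2 ->
 nc (mN (hamiltonian lam t) (Cx x e) - m_fc mu lam (Cx x e)) <= kp * ((sqrt N%:R)^-1 + (N%:R * e)^-1)].
Proof.
have sL0 : 0 < sqrt L by rewrite sqrtr_gt0.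
have sL2 : sqrt L ^+ 2 = L by rewrite sqr_sqrtr // ltW.
have L20 : 0 < ln N%:R `^ xi by rewrite L15 mulr_gt0.
have hL2' : ln N%:R `^ xi <= La by rewrite L15.
have L5 : 100 <= L.
 apply: le_trans xL; case: large => [[h _ _] _]; apply: le_trans h.
 by rewrite (_ : 10 ^+ 5 = 100 * 10 ^+ 3); [rewrite ler_peMr // exprn_ege1 // ler1n|ring].
have LaS : La <= sqrt N%:R.
 apply: le_trans sN; rewrite exprMn -[leLHS]mulr1 -mulrA; apply: ler_pM => //; first exact: ltW.
  by rewrite -[leLHS]expr1; apply: ler_weXn2l.
 by rewrite -[leLHS]mulr1; apply: ler_pM => //; rewrite exprn_ege1.
have L21 : L <= L ^+ 2 by rewrite -[leLHS]expr1; apply: ler_weXn2l.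
have big : 3 * theta <= La `^ theta^-1 by case: large => [[_ M1 _] _]; apply: (le_trans M1); apply: le_trans Lth.
have sL4 : 2 * sqrt L <= L.
 rewrite -{2}sL2 expr2; apply: ler_wpM2r; first exact: ltW.
 rewrite -[leLHS]ger0_norm // -sqrtr_sqr; apply: ler_wsqrtr; apply: le_trans L5.
 by rewrite -natrX ler_nat.
have tailq : 16 * C0 * expR (- La `^ theta^-1) <= expR (- ln N%:R `^ xi).
 have e1 : 16 * C0 <= expR L by case: large => [[_ _ M2] _]; apply: (le_trans M2); apply: le_trans (expR_ge1Dx _); rewrite lerDr.
 have e2 : expR (- La `^ theta^-1) <= expR (- L ^+ 2) by rewrite ler_expR lerN2.
 apply: (via (expR L * expR (- L ^+ 2))); first by apply: ler_pM; rewrite ?mulr_ge0 ?expR_ge0 // ltW.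
 rewrite -expRD ler_expR L15.
 have : L * (2 * sqrt L) <= L * L by apply: ler_wpM2l => //; exact: ltW.
 have : L * 2 <= L * L.
  apply: ler_wpM2l; first exact: ltW; apply: le_trans sL4; apply: ler_peMr => //.
 by rewrite expr2; move: (L * L) (sqrt L) (L) => r s l; lra.
have L0' : 0 <= 14 * L by rewrite mulr_ge0 // ltW.
(* The moment exponent: as [4 >= e] and [log N <= L], the net and the moment bound give [N^12 * 2 *
   4^-(p+1) <= 2 exp (12 L - 14 L)], at most half of [exp (- L)]. *)
have [p1 p2] : (Num.truncn (14 * L))%:R <= 14 * L /\ 14 * L < (Num.truncn (14 * L)).+1%:R.
 by have /andP[] := Num.Theory.truncn_itv L0'.
set p := Num.truncn _ in p1 p2.
have p3 : p.+1%:R <= 15 * L by rewrite -natr1 (_ : 15 * L = 14 * L + L) ?lerD //; ring.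
have x12N : x2 - x1 <= N%:R.
 by apply: (le_trans x21); rewrite [leRHS]NE; apply: le_trans (expR_ge1Dx _); rewrite lerDr.
have small : 2 * 10 ^+ 4 * (La / sqrt (N%:R * y)) <= c ^+ 5.
 have -> : N%:R * y = (La * L) ^+ 2 by rewrite mulrC divfK // gt_eqF.
 rewrite sqrtr_sqr ger0_norm; last by rewrite mulr_ge0 // ltW.
 have -> : La / (La * L) = L^-1 by rewrite invfM mulVKf // gt_eqF.
 have [_ [_ M4 _ _]] := large; move: M4; rewrite !ler_pdivrMr ?exprn_gt0 // [L * _]mulrC; apply.
have cp : 0 < c ^+ 13 by rewrite exprn_gt0.
have rk : forall e, 0 < e -> 10 ^+ 10 * p.+1%:R * (La ^+ 2 * ((sqrt N%:R)^-1 + (N%:R * e)^-1)) / c ^+ 13 <=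
  kp * ((sqrt N%:R)^-1 + (N%:R * e)^-1).
 move=> e e0.
 have r0 : 0 <= (sqrt N%:R)^-1 + (N%:R * e)^-1 by rewrite addr_ge0 // invr_ge0 ?mulr_ge0 // ltW.
 have a0 : 0 <= La ^+ 2 by rewrite exprn_ge0 // ltW.
 move: r0 a0 p3 cp; move: (_ + _ : R) (La ^+ 2) => r a r0 a0; move: (p.+1%:R : R) (c ^+ 13) (L) => q d l p3 d0.
 have -> : 15 * 10 ^+ 10 / d * (a * l) * r = (10 ^+ 10 * a * r / d) * (15 * l) by ring.
 have -> : 10 ^+ 10 * q * (a * r) / d = (10 ^+ 10 * a * r / d) * q by ring.
 by apply: ler_wpM2l => //; rewrite !mulr_ge0 ?invr_ge0 ?exprn_ge0 // ltW.
have kp_le1 : 10 ^+ 9 * p.+1%:R * (La ^+ 2 * ((sqrt N%:R)^-1 + (N%:R * y)^-1)) / c ^+ 13 <= 1.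
 apply: le_trans dl1; apply: le_trans (kp_dl (lexx y)); apply: le_trans (rk _ y0).
 have r0 : 0 <= p.+1%:R * (La ^+ 2 * ((sqrt N%:R)^-1 + (N%:R * y)^-1)) / c ^+ 13.
  by rewrite !mulr_ge0 ?invr_ge0 ?exprn_ge0 ?addr_ge0 ?invr_ge0 ?mulr_ge0 // ltW.
 have h (g q a d : R) : g * q * a / d = g * (q * a / d) by rewrite !mulrA.
 rewrite (h (10 ^+ 9)) (h (10 ^+ 10)); apply: ler_wpM2r; first exact: r0.
 by apply: ler_weXn2l => //; rewrite ler1n.
have cN : 2 <= N%:R * c ^+ 2.
 rewrite -ler_pdivrMr ?exprn_gt0 //; apply: le_trans (_ : L <= _).
  have [_ [M3 _ _ _]] := large; apply: le_trans M3; apply: ler_wpM2r; first by rewrite invr_ge0 exprn_ge0 // ltW.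
  by rewrite ler_nat.
 have s1' : 1 <= sqrt N%:R :> R by rewrite -[leLHS]invr1 -(invrK (sqrt _)) lef_pV2 ?posrE ?invr_gt0.
 apply: le_trans (_ : sqrt N%:R <= _); last by rewrite -{2}sq2 expr2 -[leLHS]mul1r; apply: ler_wpM2r => //; exact: ltW.
 apply: le_trans sN; apply: (le_trans L21); apply: ler_peMl; first by rewrite exprn_ge0 // ltW.
 by rewrite exprn_ege1.
have [A [mA PA hA]] := uniform_law X N5 th0 C00 LD f0 L20 hfL hL2' La1 LaS big tailq c0 c1 x12N him yN small kp_le1 cN.
exists A; split => //; last first.
 by move=> t At E e hx ye e2; apply: le_trans (hA t At E e hx ye e2) _; apply: rk; apply: lt_le_trans ye.
apply: le_trans PA _; rewrite lee_fin mulN1r L15.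
(* The remainder is a constant times [exp ((9 p + 26) log N - L^(3/2))]. The positive part is at
   most [153 L log N], while [sqrt L >= 155 log N] because [L >= (log N)^3] and [log N >= 10^5]; the
   surplus [2 L log N] pays for the constant and for [exp (- L)]. *)
have LX : (9 * p + 26)%:R * x <= 153 * L * x.
 by apply: ler_wpM2r; [exact: le_trans lx1|rewrite natrD natrM; move: p1 L5; lra].
have sLx : 155 * x <= sqrt L.
 have x0 : 0 <= 155 * x :> R by rewrite mulr_ge0 // (le_trans _ lx1).
 rewrite -[leLHS]ger0_norm // -sqrtr_sqr; apply: ler_wsqrtr.
 apply: le_trans xL3; rewrite exprMn [leRHS]exprSr mulrC; apply: ler_wpM2l; first by rewrite exprn_ge0 // (le_trans _ lx1).
 have [[Mx _ _] _] := large; apply: le_trans Mx; rewrite (_ : 155 ^+ 2 = 25 * (31 * 31)); last by ring.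
 rewrite (_ : 10 ^+ 5 = 25 * 4000); last by ring.
 by rewrite ler_pM2l // -natrM ler_nat.
have N12 : N%:R ^+ 12 * (2 / 4 ^+ p.+1) <= expR (- L) / 2.
 have h4 : expR p.+1%:R <= (4 : R) ^+ p.+1.
  have -> : expR p.+1%:R = expR 1 ^+ p.+1 :> R by rewrite -expRM_natl mulr1.
  by rewrite lerXn2r ?nnegrE ?expR_ge0 // expR1_le4.
 have h5 : (4 ^+ p.+1)^-1 <= expR (- (14 * L)).
  rewrite expRN lef_pV2 ?posrE ?expR_gt0 ?exprn_gt0 //; apply: le_trans h4; by rewrite ler_expR ltW.
 have h6 : N%:R ^+ 12 <= expR (12 * L).
  rewrite NE -expRM_natl ler_expR; apply: ler_wpM2l => //; exact: xL.
 have h7 : 4 <= expR L by apply: le_trans (expR_ge1Dx _); apply: (via L); [apply: le_trans L5; rewrite ler_nat|rewrite lerDr].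
 apply: (via (expR (12 * L) * (2 * expR (- (14 * L))))).
  by apply: ler_pM => //; rewrite ?exprn_ge0 ?mulr_ge0 ?invr_ge0 ?exprn_ge0 //; apply: ler_wpM2l.
 have -> : expR (12 * L) * (2 * expR (- (14 * L))) = expR (- L) * (2 * expR (- L)).
  by rewrite mulrCA -expRD [RHS]mulrCA -expRD; congr (_ * expR _); ring.
 apply: ler_wpM2l; first exact: expR_ge0.
 by rewrite expRN -[leRHS](_ : 2 * 4^-1 = _); [apply: ler_wpM2l => //; rewrite lef_pV2 ?posrE ?expR_gt0|field].
have N26 : N%:R ^+ 12 * (53 / c ^+ 2 * N%:R ^+ (9 * p + 14) * expR (- (L * sqrt L))) <= expR (- L) / 2.
 have h1 : 53 / c ^+ 2 <= expR L / 2.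
  rewrite ler_pdivlMr // mulrAC -natrM; have [_ [M3 _ _ _]] := large; apply: (le_trans M3); apply: le_trans (expR_ge1Dx _); by rewrite lerDr.
 have -> : N%:R ^+ 12 * (53 / c ^+ 2 * N%:R ^+ (9 * p + 14) * expR (- (L * sqrt L))) =
  53 / c ^+ 2 * expR ((9 * p + 26)%:R * x - L * sqrt L).
  rewrite expRD [expR (_ %:R * _)]expRM_natl -NE (_ : (9 * p + 26 = 12 + (9 * p + 14))%N); last by rewrite addnCA.
  by rewrite (exprD _ 12); move: (_ ^+ (9 * p + 14)) (_ ^+ 12) (expR _) (53 / _) => r s u v; ring.
 apply: le_trans (ler_wpM2r (expR_ge0 _) h1) _.
 rewrite mulrAC -expRD; apply: ler_wpM2r; first by rewrite invr_ge0.
 rewrite ler_expR.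
 have h2 : L * (155 * x) <= L * sqrt L by apply: ler_wpM2l => //; exact: ltW.
 have h3 : L * 1 <= L * x by apply: ler_wpM2l => //; exact: ltW.
 move: LX h2 h3; move: (L * sqrt L) ((9 * p + 26)%:R * _) => r s.
 have -> : 153 * L * x = 153 * (L * x) by ring.
 have -> : L * (155 * x) = 155 * (L * x) by ring.
 exact: linear_exponent.
rewrite mulrDr; apply: le_trans (lerD N12 N26) _.
by rewrite [leRHS]splitr.
Qed.

Variable (muf : has_density mu f) (fout : forall v, ~~ (-1 <= v <= 1) -> f v = 0) (lam_ge0 : 0 <= lam).
Hypothesis x12 : x1 <= x2.
Hypothesis hA : forall A : R -> R, (forall x : R, is_derive x (1 : R) A (imb (m_fc mu lam) x)) ->
 A (lam + 3) - A (- (lam + 3)) = pi -> pi - pi * eps / 8 <= A x2 - A x1.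
Hypotheses (dlc : 16 * dl <= c) (dle : 8 * dl * (x2 - x1) <= eps) (Lc : 2 / (c ^+ 2 * dl) <= L) (eps0 : 0 < eps)
 (Le : 180 / eps <= L).
Notation m := (m_fc mu lam).
Notation b := (imb (m_fc mu lam)).
Notation T := ((La * L) ^+ 2 * L).
Let N0 : (0 < N)%N. exact: leq_trans N5. Qed.
Let kp0 : 0 <= kp.
Proof.
by apply: mulr_ge0; [apply: divr_ge0; [apply: mulr_ge0 => //; exact: exprn_ge0|apply: exprn_ge0; exact: ltW]|apply: mulr_ge0; [exact: sqr_ge0|exact: ltW]].
Qed.

Section spectrum.
Context {H : 'M[R[i]]_N} (hH : herm H).
Notation s := (eigenvalues H).
Hypothesis hstr : forall x e, x1 <= x <= x2 -> y <= e -> e <= 2 ->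
 nc (mN H (Cx x e) - m (Cx x e)) <= kp * ((sqrt N%:R)^-1 + (N%:R * e)^-1).
Variable n : nat.
Hypotheses (n1 : 1 <= 2 ^+ n * y) (n2 : 2 ^+ n * y <= 2).
Notation Er := (9 * n.+1%:R * (N%:R * y)).
Let m1 z : 0 < Iz z -> nc (m z) <= 1.
Proof. exact: (nc_m (law_is_mean mu) (m_fc_ge0 mu lam) (m_fc_eq mu lam)). Qed.
Let q1 : 1 <= (La * L) ^+ 2. by rewrite exprn_ege1. Qed.
Let sT : T * L <= sqrt N%:R. by move: sN; rewrite [L ^+ 2]expr2 mulrA. Qed.
Let y2 : y <= 2. by apply: (le_trans ys); apply: (le_trans s1); rewrite ler1n. Qed.
Let hloc E e : x1 <= E <= x2 -> y <= e -> e <= 2 -> nc (mN H (Cx E e) - m (Cx E e)) <= dl.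
Proof. by move=> hE ye e2; apply: le_trans (hstr hE ye e2) _; exact: kp_dl. Qed.
Let hb E : x1 <= E <= x2 -> `|Iz (m (Cx E y)) - b E| <= dl.
Proof.
move=> hE; apply: le_trans (imb_lip c0 c1 him hE y0 y2) _.
have cc : 0 < c ^+ 2 by rewrite exprn_gt0.
have LS : L <= sqrt N%:R by apply: le_trans sT; apply: ler_peMl; [exact: ltW|rewrite -[leLHS]mulr1; apply: ler_pM].
have yL : y <= L^-1 by apply: (le_trans ys); rewrite lef_pV2.
apply: (via (2 / c ^+ 2 * L^-1)); first by apply: ler_wpM2l => //; rewrite divr_ge0 // ltW.
move: Lc; rewrite !ler_pdivrMr // ?mulr_gt0 // -mulrA => h.
by move: h; congr (_ <= _); ring.
Qed.

Lemma Er_bound : 2 * Er <= 90 * T.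
Proof.
have NyE : N%:R * y = (La * L) ^+ 2 by rewrite mulrC divfK // gt_eqF.
have k1 : 2 ^+ n <= 2 * N%:R :> R.
 have h : 2 ^+ n * N%:R^-1 <= 2 :> R by apply: le_trans n2; apply: ler_wpM2l => //; rewrite exprn_ge0.
 by move: h; rewrite ler_pdivrMr.
have k2 : n%:R <= 2 + 2 * x.
 rewrite -ler_expR -[n%:R]mulr1 expRM_natl; apply: (via (4 ^+ n)).
  by rewrite lerXn2r ?nnegrE ?expR_ge0 // expR1_le4.
 have -> : 4 = 2 ^+ 2 :> R by ring.
 rewrite -exprM mulnC exprM; have -> : expR (2 + 2 * x) = (expR 1 * N%:R) ^+ 2.
  by rewrite NE -expRD -expRM_natl; congr expR; ring.
 apply: lerXn2r; rewrite ?nnegrE ?exprn_ge0 ?mulr_ge0 ?expR_ge0 //; apply: (le_trans k1).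
 by apply: ler_wpM2r; [exact: ltW|apply: le_trans (expR_ge1Dx _); lra].
have k3 : n.+1%:R <= 5 * L by rewrite -natr1; move: (n%:R : R) k2 lx1 xL => u; lra.
rewrite NyE; have -> : 2 * (9 * n.+1%:R * (La * L) ^+ 2) = 18 * (La * L) ^+ 2 * n.+1%:R by ring.
have -> : 90 * T = 18 * (La * L) ^+ 2 * (5 * L) by ring.
by apply: ler_wpM2l => //; rewrite mulr_ge0 // (le_trans ler01).
Qed.

Section positions.
Variables p r : nat.
Hypotheses (pr : (p <= r)%N) (pe : eps * N%:R <= p.+1%:R) (re : r.+1%:R <= (1 - eps) * N%:R).
Notation d := (s`_r - s`_p).
Notation G := (r%:R - p%:R : R).

Let rN : (r < N)%N.
Proof.
rewrite -(ler_nat R); apply: (le_trans re); rewrite mulrBl mul1r gerBl mulr_ge0 // ltW //.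
Qed.

(** An eigenvalue outside the bulk would have a rank, counted from its end of the spectrum, of at
    most [7/8 eps N]: [3/8] from the missing mass and the local error, [1/2] from the counting
    error. Here [p] and [r] are numbered from [0], hence the successors in [pe] and [re]. *)
Lemma positions_bulk : x1 <= s`_p /\ s`_r <= x2.
Proof.
have [A dA tA] := imb_primitive muf fout lam_ge0; have hA' := hA dA tA.
have B : N%:R / pi * (pi * eps / 8 + 2 * dl * (x2 - x1)) + 2 * Er < eps * N%:R.
 have h1 : N%:R / pi * (pi * eps / 8 + 2 * dl * (x2 - x1)) <= eps * N%:R * (3 / 8).
  have pi1 : 1 <= pi :> R by apply: le_trans (@pi_ge2 R); rewrite ler1n.
  have pi0 : 0 < pi :> R by exact: lt_le_trans pi1.
  have k : pi * eps / 8 + 2 * dl * (x2 - x1) <= pi * (eps * (3 / 8)).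
   have : eps <= pi * eps by apply: ler_peMl => //; exact: ltW.
   have -> : 2 * dl * (x2 - x1) = (8 * dl * (x2 - x1)) / 4 by field.
   by rewrite mulrA; move: dle; move: (pi * eps) (8 * dl * _) => u v; lra.
  apply: le_trans (ler_wpM2l _ k) _; first by rewrite divr_ge0 // ltW.
  by move: (pi : R) pi0 => P P0; apply: eq_ler; field; rewrite gt_eqF.
 have h2 : 90 * T <= eps * N%:R / 2.
  have k1 : 90 * T * L <= 90 * sqrt N%:R by rewrite -mulrA; apply: ler_wpM2l.
  have k2 : 90 * sqrt N%:R <= 90 * N%:R :> R.
   apply: ler_wpM2l => //; rewrite -{2}sq2 expr2 -[leLHS]mul1r; apply: ler_wpM2r; first exact: ltW.
   by rewrite -[leRHS]invrK -[leLHS]invr1 lef_pV2 ?posrE ?invr_gt0.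
  have k3 : 180 * N%:R <= eps * L * N%:R.
   by apply: ler_wpM2r; [exact: ltW|move: Le; rewrite ler_pdivrMr // mulrC].
  rewrite -(ler_pM2r L0).
  have -> : eps * N%:R / 2 * L = (eps * L * N%:R) / 2 by ring.
  by move: k1 k2 k3; move: (N%:R) (eps * L * _) (sqrt N%:R) (90 * T * L) => u v w z; lra.
 have h3 := Er_bound; have e0 : 0 < eps * N%:R by rewrite mulr_gt0.
 by move: h1 h2 h3 e0; move: (_ / pi * _) (2 * Er) (90 * T) (eps * _) => u v w z; lra.
have pN : (p < N)%N by exact: leq_ltn_trans pr rN.
have [b1 _] := bulk_rank N0 hH m1 y0 n1 n2 dl1 hloc hb pN x12 dA hA'.
have [_ b2] := bulk_rank N0 hH m1 y0 n1 n2 dl1 hloc hb rN x12 dA hA'.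
split; rewrite leNgt; apply/negP => h.
- by have := le_lt_trans (b1 h) B; rewrite ltNge pe.
- have := le_lt_trans (b2 h) B; move: re; rewrite -natr1 mulrBl mul1r.
 by move: (N%:R) (r%:R : R) (eps * _) => u v w; lra.
Qed.

Hypotheses (hp : x1 <= s`_p) (hr : s`_r <= x2) (GT : 720 * T <= G).

(** The counting error is at most an eighth of the gap, since [720 = 8 * 90], and [2 dl] at most an
    eighth of [c]; so both ratios are bounded by [9/7], which is rounded up to [2]. *)
Lemma spacing_bounds (lo hi : R) : c <= lo -> c <= hi -> (forall x, s`_p <= x <= s`_r -> lo <= b x <= hi) ->
 N%:R / pi * lo * d <= 2 * G /\ G <= 2 * (N%:R / pi * hi * d).
Proof.
move=> cl ch hlo.
have [k1 k2] := spacing_rough N0 hH m1 y0 n1 n2 dl1 hloc hb pr rN hp hr hlo.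
have d0 : 0 <= N%:R / pi * d by rewrite mulr_ge0 ?divr_ge0 ?pi_ge0 // subr_ge0 eigenvalues_le.
have G0 : 0 <= G by rewrite subr_ge0 ler_nat.
have h4 : 8 * (2 * Er) <= G by apply: le_trans GT; move: Er_bound; move: (2 * Er) T => u v; lra.
move: k1 k2; set D := N%:R / pi * d in d0.
have -> : N%:R / pi * (lo - 2 * dl) * d = D * (lo - 2 * dl) by rewrite /D mulrAC.
have -> : N%:R / pi * (hi + 2 * dl) * d = D * (hi + 2 * dl) by rewrite /D mulrAC.
have -> : N%:R / pi * lo * d = D * lo by rewrite /D mulrAC.
have -> : N%:R / pi * hi * d = D * hi by rewrite /D mulrAC.
move: (2 * Er) G h4 G0 D d0 => u v h4 v0 D d0 k1 k2.
have g1 : D * (7 / 8 * lo) <= D * (lo - 2 * dl) by apply: ler_wpM2l => //; move: dlc cl; lra.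
have g2 : D * (hi + 2 * dl) <= D * (9 / 8 * hi) by apply: ler_wpM2l => //; move: dlc ch; lra.
have e1 : D * (7 / 8 * lo) = 7 / 8 * (D * lo) by ring.
have e2 : D * (9 / 8 * hi) = 9 / 8 * (D * hi) by ring.
rewrite e1 in g1; rewrite e2 in g2.
move: k1 k2 g1 g2 h4 v0; move: (D * (lo - _)) (D * (hi + _)) (D * lo) (D * hi) => r1 r2 r3 r4 *.
by split; lra.
Qed.

Lemma spacing_law (D : R) : d * sqrt N%:R <= D ->
 `|G - N%:R / pi * b s`_p * d| <= 90 * T + (2 * kp * (x + 1 + D) + 2 / c ^+ 2 * (2 * D + D ^+ 2)).
Proof.
move=> dD; have lp0 : 0 <= 2 / c ^+ 2 by rewrite divr_ge0 // exprn_ge0 // ltW.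
have l2 : (sqrt N%:R)^-1 <= 2 :> R by apply: le_trans s1 _; rewrite ler1n.
have := spacing_fine N0 hH m1 y0 n1 n2 dl1 hloc ys l2 kp0 lp0 hstr (m_lip_horizontal c0 c1 him) (imb_lip c0 c1 him)
 pr rN hp hr (erefl d).
move/le_trans; apply; apply: lerD; first exact: Er_bound.
have d0 : 0 <= d * sqrt N%:R by rewrite mulr_ge0 ?subr_ge0 ?eigenvalues_le // ltW.
have lnx : ln ((sqrt N%:R)^-1 / y) <= x.
 have -> : x = ln N%:R by rewrite NE expRK.
 have ly0 : 0 < (sqrt N%:R)^-1 / y by apply: divr_gt0 => //; rewrite invr_gt0.
 rewrite ler_ln ?posrE //; apply: (via (1 / y)).
  by apply: ler_wpM2r => //; rewrite invr_ge0 ltW.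
 by rewrite div1r -[leRHS]invrK lef_pV2 ?posrE ?invr_gt0.
apply: lerD.
- by apply: ler_wpM2l; [rewrite mulr_ge0|rewrite lerD // lerD2r].
- apply: ler_wpM2l => //; apply: lerD; first by apply: ler_wpM2l.
 by apply: lerXn2r; rewrite ?nnegrE // (le_trans d0).
Qed.
End positions.
End spectrum.

Variables i j : nat.
Hypotheses (ij : (i < j)%N) (iN : eps * N%:R <= i%:R) (jN : j%:R <= (1 - eps) * N%:R) (L720 : 720 <= L)
 (hgap : (La * L) ^+ 2 * L ^+ 2 <= gap i j).

Lemma spacing_event : exists A : set (dw_space X), [/\ measurable A, (dw_prob X (~` A) <= (expR (- 1 * L))%:E)%E &
 forall t, A t -> spaced mu lam c N ((La * L) ^+ 2 * L) (15 * 10 ^+ 10 / c ^+ 13 * (La ^+ 2 * L)) x (gap i j)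
  (eig lam i t) (eig lam j t)].
Proof.
have [A [mA PA hAt]] := law_event.
exists A; split; [exact: mA|exact: PA|move=> t At].
have hstr := hAt t At; have hH := @ham_herm _ _ _ _ _ X lam t.
have y2 : (La * L) ^+ 2 / N%:R <= 2 by apply: (le_trans ys); apply: (le_trans s1); rewrite ler1n.
have [n [n1 n2 _]] := dyadic_height N5 yN y2.
have i0 : (0 < i)%N by rewrite -(ltr_nat R); apply: lt_le_trans iN; exact: mulr_gt0.
have j0 : (0 < j)%N by exact: leq_ltn_trans ij.
have pr : (i.-1 <= j.-1)%N by rewrite -ltnS !prednK // ltnW.
have pe : eps * N%:R <= i.-1.+1%:R by rewrite prednK.
have re : j.-1.+1%:R <= (1 - eps) * N%:R by rewrite prednK.
have gE : gap i j = j.-1%:R - i.-1%:R :> R.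
 rewrite /gap distrC ger0_norm ?subr_ge0 ?ler_nat 1?ltnW // -[in LHS](prednK i0) -[in LHS](prednK j0).
 by rewrite -!(natr1 _.-1); ring.
have [hp hr] := positions_bulk hH hstr n1 n2 pr pe re.
have GT : 720 * ((La * L) ^+ 2 * L) <= j.-1%:R - i.-1%:R.
 rewrite -gE; apply: le_trans hgap; rewrite [L ^+ 2]expr2 [leRHS]mulrA [leRHS]mulrC; apply: ler_wpM2r => //.
 by apply: mulr_ge0; [exact: sqr_ge0|exact: ltW].
rewrite /spaced gE; split.
- apply: (eigenvalues_le _ pr); rewrite -(ler_nat R); apply: (le_trans re); rewrite mulrBl mul1r gerBl.
 by apply: mulr_ge0; exact: ltW.
- move=> E /andP[h1 h2]; apply: (imb_bulk_ge him); rewrite (le_trans hp h1) /=.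
 exact: le_trans hr.
- exact: (spacing_bounds hH hstr n1 n2 pr re hp hr GT).
- exact: (spacing_law hH hstr n1 n2 pr re hp hr).
Qed.
End law_event.

Lemma phi_powR {R : realType} (Cphi : R) N (a xi : R) : phi Cphi N `^ (a * xi) = (ln N%:R `^ xi) `^ (Cphi * a).
Proof. by rewrite /phi -!powRrM; congr (_ `^ _); ring. Qed.

Lemma powR_split {R : realType} (L k q : R) : 0 < L -> L `^ (k * 2 + 4 + q * 2) = (L `^ k) ^+ 2 * L ^+ 4 * (L `^ q) ^+ 2.
Proof.
move=> L0; have hD (r s : R) : L `^ (r + s) = L `^ r * L `^ s.
 by apply: powRD; apply/implyP => _; rewrite gt_eqF.
have h2 r : L `^ (r * 2) = (L `^ r) ^+ 2 by rewrite powRrM powR_mulrn ?powR_ge0.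
have h4 : L `^ 4 = L ^+ 4 by rewrite powR_mulrn // ltW.
by rewrite hD hD !h2 h4.
Qed.

Lemma sqr_le_powR {R : realType} (L k r : R) : 1 <= L -> 0 < r -> 2 * r <= k -> L ^+ 2 <= (L `^ k) `^ r^-1.
Proof.
move=> L1 r0 kr; have L0 : 0 <= L by exact: le_trans L1.
by rewrite -powRrM -powR_mulrn //; apply: ler_powR; rewrite // ler_pdivlMr.
Qed.

(** * All conditions together, for large [N] and uniformly in [lam] *)

Section spacing_near.
Context {R : realType} (theta C0 lam0 a0 A0 Cphi : R) (mu : probability (measurableTypeR R) R).
Hypotheses (th1 : 1 < theta) (C00 : 0 < C0) (lam00 : 0 < lam0) (a02 : 2 < a0) (A010 : 10 <= A0)
 (Cp1 : 1 <= Cphi) (hLD : large_deviation_constants theta C0 a0 A0 Cphi) (pd : positive_density mu).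
(** The power of [L] taken for [La]. The first term ensures that [La] dominates
    [phi^(3/2 xi) = L^(3/2 Cphi)], the second that [La^(1/theta) >= L^2], so that truncation errors
    are below [exp (- L^(3/2))]. *)
Notation ka := (3 / 2 * Cphi + 2 * theta).
Let ka0 : 0 <= ka. by move: th1 Cp1; lra. Qed.
Let ka2 : 2 * theta <= ka. by move: Cp1; lra. Qed.
Let kaC : 3 / 2 * Cphi <= ka. by move: th1; lra. Qed.
Let ka3 : 3 / 2 <= ka. by move: th1 Cp1; lra. Qed.
Let ka24 : 0 <= ka * 2 + 4. by move: ka0; lra. Qed.

Section sequence.
Variable xi : nat -> R.
Hypothesis hxi : xi_sequence A0 xi.
Let np := near_params a02 A010 hLD hxi.

Lemma near_L M : \forall N \near \oo, M <= ln N%:R `^ xi N.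
Proof. by apply: filterS (np M (lexx 0)) => N [_ []]. Qed.
Lemma near_ln M : \forall N \near \oo, M <= ln N%:R :> R.
Proof. by apply: filterS (np M (lexx 0)) => N [[]]. Qed.
Lemma near_xi3 : \forall N \near \oo, 3 <= xi N.
Proof. by apply: filterS (np 0 (lexx 0)) => N [_ []]. Qed.
Lemma near_ld : \forall N \near \oo, ld_at theta C0 Cphi N (3 / 2 * xi N).
Proof. by apply: filterS (np 0 (lexx 0)) => N [[]]. Qed.
Lemma near_pow : \forall N \near \oo, (ln N%:R `^ xi N) `^ (ka * 2 + 4) <= sqrt N%:R.
Proof. by apply: filterS (np 0 ka24) => N [_ []]. Qed.
End sequence.

Definition spaced_at (eps c C' xi : R) N (X : deformed_wigner theta C0 mu N) : Prop :=
 forall (lam : R) (i j : nat), in_D lam0 lam -> (i < j)%N -> eps * N%:R <= i%:R -> j%:R <= (1 - eps) * N%:R ->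
 phi Cphi N `^ (C' * xi) <= gap i j ->
 exists A : set (dw_space X), [/\ measurable A, (dw_prob X (~` A) <= (expR (- 1 * ln N%:R `^ xi))%:E)%E &
  forall t, A t -> let L := ln N%:R `^ xi in let La := L `^ ka in
  spaced mu lam c N ((La * L) ^+ 2 * L) (15 * 10 ^+ 10 / c ^+ 13 * (La ^+ 2 * L)) (ln N%:R) (gap i j) (eig lam i t) (eig lam j t)].

Lemma spacing_near (eps : R) : 0 < eps -> exists c : R, [/\ 0 < c, c <= 1 &
 forall C' (X : forall N, deformed_wigner theta C0 mu N) (xi : nat -> R), 2 * ka + 4 <= C' -> xi_sequence A0 xi ->
 \forall N \near \oo, spaced_at eps c C' (xi N) (X N)].
Proof.
move=> eps0; have width (u v l : R) : - (l + 3) <= u -> v <= l + 3 -> l <= lam0 -> v - u <= 2 * (lam0 + 3) by lra.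
have [f [muf _ _ fout]] := pd.
(* The bulk may miss the fraction [eps / 8] of the total mass [pi]; the other errors in
   [positions_bulk] fit into the rest of [eps]. *)
have pe0 : 0 < pi * eps / 8 by rewrite divr_gt0 // mulr_gt0 // pi_gt0.
have [c' c'0 hc] := bulk_exists pd lam00 pe0.
pose c := Num.min c' 1; have c0 : 0 < c by rewrite lt_min c'0 ltr01.
have c1 : c <= 1 by rewrite ge_min lexx orbT.
have cc' : c <= c' by rewrite ge_min lexx.
exists c; split => // C' X xi hC' hxi.
have hK : ka * 2 + 4 <= Cphi * C'.
 rewrite mulrC in hC'; apply: (le_trans hC'); apply: ler_peMl => //.
 exact: le_trans hC'.
have l30 : 0 < lam0 + 3 by move: lam00; lra.
(* The accuracy asked of the weak law: [c / 16] preserves the lower bound on the density, and the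
   second term keeps the error accumulated over the whole bulk below a fraction of [eps]. *)
pose dl := Num.min (c / 16) (eps / (16 * (lam0 + 3))).
have dl0 : 0 < dl by rewrite lt_min !divr_gt0 // mulr_gt0.
have dlc : 16 * dl <= c by rewrite mulrC -ler_pdivlMr // ge_min lexx.
have dl1 : dl <= 1 by move: dlc dl0 c1; move: (dl) (c) => u v; lra.
have dleps : dl * (16 * (lam0 + 3)) <= eps by rewrite -ler_pdivlMr ?mulr_gt0 // ge_min lexx orbT.
have widthd (u v l : R) : - (l + 3) <= u -> v <= l + 3 -> l <= lam0 -> 8 * dl * (v - u) <= eps.
 move=> h1 h2 h3; apply: le_trans dleps; rewrite [8 * dl]mulrC -mulrA; apply: ler_wpM2l; first exact: ltW.
 by have := width u v l h1 h2 h3; move: (v - u) (lam0 + 3) => w z; lra.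
near=> N => lam i j [lam_ge0 lam_le] ij iN jN hgap.
have xi3 : 3 <= xi N by near: N; exact: (near_xi3 hxi).
have x5 : 10 ^+ 5 <= ln N%:R :> R by near: N; exact: (near_ln hxi).
have xl : 2 * (lam0 + 3) <= ln N%:R :> R by near: N; exact: (near_ln hxi).
have L1 : 3 * theta <= ln N%:R `^ xi N by near: N; exact: (near_L hxi).
have L2 : 16 * C0 <= ln N%:R `^ xi N by near: N; exact: (near_L hxi).
have L3 : 106 / c ^+ 2 <= ln N%:R `^ xi N by near: N; exact: (near_L hxi).
have L4 : 2 * 10 ^+ 4 / c ^+ 5 <= ln N%:R `^ xi N by near: N; exact: (near_L hxi).
have L5 : 3 * 10 ^+ 11 / (c ^+ 13 * dl) <= ln N%:R `^ xi N by near: N; exact: (near_L hxi).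
have L6 : 2 / (c ^+ 2 * dl) <= ln N%:R `^ xi N by near: N; exact: (near_L hxi).
have L7 : 180 / eps <= ln N%:R `^ xi N by near: N; exact: (near_L hxi).
have L8 : 720 <= ln N%:R `^ xi N by near: N; exact: (near_L hxi).
have LD : ld_at theta C0 Cphi N (3 / 2 * xi N) by near: N; exact: (near_ld hxi).
have Lpow : (ln N%:R `^ xi N) `^ (ka * 2 + 4) <= sqrt N%:R by near: N; exact: (near_pow hxi).
move: xi3 x5 xl L1 L2 L3 L4 L5 L6 L7 L8 Lpow.
set x := ln N%:R : R; set L := ln N%:R `^ xi N; set La := L `^ ka => xi3 x5 xl L1 L2 L3 L4 L5 L6 L7 L8 Lpow.
have x1' : 1 <= x by apply: le_trans x5; rewrite exprn_ege1 // ler1n.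
have N0 : 0 < N%:R :> R by rewrite ltNge; apply/negP => /ln0 h; move: x1'; rewrite /x h ler10.
have NE : N%:R = expR x by rewrite lnK.
have xL3 : x ^+ 3 <= L by rewrite -powR_mulrn ?(le_trans ler01) //; apply: ler_powR.
have xL : x <= L by apply: le_trans xL3; rewrite -[leLHS]expr1; apply: ler_weXn2l.
have Lge1 : 1 <= L by exact: le_trans xL.
have L0 : 0 < L by exact: lt_le_trans Lge1.
have L15 : ln N%:R `^ (3 / 2 * xi N) = L * sqrt L.
 rewrite mulrC powRrM -/L -powR12_sqrt ?ltW // (_ : 3 / 2 = 1 + 2^-1); last by field.
 by rewrite powRD ?powRr1 ?ltW // gt_eqF ?implybT.
have fE : phi Cphi N `^ (3 / 2 * xi N) = L `^ (Cphi * (3 / 2)) by exact: phi_powR.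
have f0 : 0 < phi Cphi N `^ (3 / 2 * xi N) by rewrite fE powR_gt0.
have hfL : phi Cphi N `^ (3 / 2 * xi N) <= La by rewrite fE mulrC; apply: ler_powR.
have hL2 : L * sqrt L <= La by rewrite -L15 mulrC powRrM; apply: ler_powR.
have th0 : 0 < theta by exact: lt_trans th1.
have Lth : L ^+ 2 <= La `^ theta^-1 by exact: sqr_le_powR.
have La1 : 1 <= La by rewrite -(powRr0 L); apply: ler_powR.
have LpE : (La * L) ^+ 2 * L ^+ 2 = L `^ (ka * 2 + 4).
 by have := powR_split ka 0 L0; rewrite mul0r addr0 powRr0 expr1n mulr1 => ->; rewrite /La; ring.
have Lp : (La * L) ^+ 2 * L ^+ 2 <= sqrt N%:R by rewrite LpE.
have [x1 [x2 [x12 x1l x2l him' hA]]] := hc lam lam_ge0 lam_le.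
have him E e : x1 <= E <= x2 -> 0 < e -> e <= 2 -> c <= Iz (m_fc mu lam (Cx E e)).
 by move=> hE e0 e2; apply: (le_trans cc'); exact: him'.
have x21 : x2 - x1 <= 2 * (lam0 + 3) by exact: (width _ _ _ x1l x2l lam_le).
have x21x : x2 - x1 <= x by exact: le_trans xl.
have large : [/\ 10 ^+ 5 <= x, 3 * theta <= L & 16 * C0 <= L] /\
 [/\ 106 / c ^+ 2 <= L, 2 * 10 ^+ 4 / c ^+ 5 <= L, 3 * 10 ^+ 11 / (c ^+ 13 * dl) <= L &
   (La * L) ^+ 2 * L ^+ 2 <= sqrt N%:R].
 exact: (conj (And3 x5 L1 L2) (And4 L3 L4 L5 Lp)).
have dle := widthd _ _ _ x1l x2l lam_le.
have GT : (La * L) ^+ 2 * L ^+ 2 <= gap i j.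
 by rewrite LpE; apply: le_trans hgap; rewrite phi_powR -/L; exact: (ler_powR Lge1 hK).
exact: (spacing_event (X N) th0 C00 c0 c1 dl0 dl1 NE x1' xL3 LD L15 f0 hfL hL2 Lth large x21x him muf fout lam_ge0 x12 hA
 dlc dle L6 eps0 L7 ij iN jN L8 GT).
Unshelve. all: by end_near. Qed.
End spacing_near.
Theorem theorem2p18 (R : realType) :
  exists C1 C2 : R -> R -> R -> R,
  (forall eps rmax rmin, 0 < eps -> 0 < C1 eps rmax rmin /\ 0 < C2 eps rmax rmin) /\
  forall (theta C0 lam0 E0 a0 A0 Cphi : R) (mu : probability (measurableTypeR R) R),
  1 < theta -> 0 < C0 -> 0 < lam0 -> 3 + lam0 <= E0 ->
  2 < a0 -> 10 <= A0 -> 1 <= Cphi ->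
  large_deviation_constants theta C0 a0 A0 Cphi ->
  support_law mu = `[-1, 1]%classic -> centered_law mu ->
  (forall lam, in_D lam0 lam -> law_assumption mu lam) ->
  exists nu C : R, 0 < nu /\ 0 < C /\
  forall eps C' : R, 0 < eps -> C < C' ->
  (forall (X : forall N, deformed_wigner theta C0 mu N) (xi : nat -> R),
     xi_sequence A0 xi ->
     \forall N \near \oo, forall (lam : R) (i j : nat),
     in_D lam0 lam -> (i < j)%N -> eps * N%:R <= i%:R -> j%:R <= (1 - eps) * N%:R ->
     phi Cphi N `^ (C' * xi N) <= gap i j ->
     high_probability (dw_prob (X N)) N (xi N) nu
       [set t |
          let mui := eig lam i t in
          let muj := eig lam j t in
          let rmax := max_on (rho_fc mu lam) mui muj in
          let rmin := min_on (rho_fc mu lam) mui muj in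
          C1 eps rmax rmin * (gap i j / N%:R) <= `|mui - muj| /\
          `|mui - muj| <= C2 eps rmax rmin * (gap i j / N%:R)]) /\
  (forall c : R, 0 < c -> exists K : R,
     forall (X : forall N, deformed_wigner theta C0 mu N) (xi : nat -> R),
     xi_sequence A0 xi ->
     \forall N \near \oo, forall (lam : R) (i j : nat),
     in_D lam0 lam -> (i < j)%N -> eps * N%:R <= i%:R -> j%:R <= (1 - eps) * N%:R ->
     phi Cphi N `^ (C' * xi N) <= gap i j ->
     gap i j <= phi Cphi N `^ (c * xi N) * Num.sqrt N%:R ->
     high_probability (dw_prob (X N)) N (xi N) nu
       [set t |
          let mui := eig lam i t in
          let muj := eig lam j t in
          `| `|mui - muj| - gap i j / (N%:R * rho_fc mu lam mui) |
            <= phi Cphi N `^ (K * xi N) * N%:R^-1]).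
Proof.
(* The constants are [1 / (2 rmax)] and [2 / rmin]; the default [1] makes them positive for all
   arguments, while between bulk eigenvalues the density is at least [c / pi] and the first branch
   applies. *)
exists (fun _ rmax _ => if 0 < rmax then (2 * rmax)^-1 else 1), (fun _ _ rmin => if 0 < rmin then 2 / rmin else 1).
split=> [eps rmax rmin _|theta C0 lam0 E0 a0 A0 Cphi mu th1 C00 lam00 _ a02 A010 Cp1 hLD _ _ hlaw].
 by split; [case: ifP => // h; rewrite invr_gt0 mulr_gt0|case: ifP => // h; rewrite divr_gt0].
(* The assumption at [lam = 0], which falls in the range [lam <= 1], provides the density of
   [mu]. *)
have pd : positive_density mu.
 by have [h _] := hlaw 0 (conj (lexx 0) (ltW lam00)); apply: h; exact: ler01.
have [f [muf _ _ fout]] := pd.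
pose ka := 3 / 2 * Cphi + 2 * theta.
have ka0 : 0 <= ka by rewrite /ka; move: th1 Cp1; lra.
(* With [La = L^ka], the gap has to exceed [(La L)^2 L^2 = L^(2 ka + 4)], the counting error with
   room to spare; and [phi^(C' xi) = L^(Cphi C')] with [1 <= Cphi]. *)
exists 1, (2 * ka + 4); split; first exact: ltr01.
split; first by move: ka0; move: (ka) => k; lra.
move=> eps C' eps0 hC'; have [c [c0 c1 hc]] := spacing_near th1 C00 lam00 a02 A010 Cp1 hLD pd eps0.
split=> [X xi hxi|c' c'0].
 near=> N => lam i j hD ij iN jN hgap.
 have hN : spaced_at lam0 Cphi eps c C' (xi N) (X N) by near: N; exact: hc (ltW hC') hxi.
 have x1 : 1 <= ln N%:R :> R by near: N; exact: (near_ln a02 A010 hLD hxi).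
 have N0 : 0 < N%:R :> R by rewrite ltNge; apply/negP => /ln0 h; move: x1; rewrite h ler10.
 have [A [mA PA hA]] := hN lam i j hD ij iN jN hgap; exists A; split => // t At /=.
 have [max0 min0 h1 h2] := spaced_rough N0 c0 (rho_fcE muf fout hD.1) (hA t At).
 by rewrite max0 min0.
(* The upper bound on the gap reads [F sqrt N] with [F = L^q], and the error [La^2 L^4 F^2 / N] of
   [spaced_fine] is [L] to the exponent chosen for [K], divided by [N]. *)
pose q := Cphi * c'; exists (ka * 2 + 4 + q * 2) => X xi hxi.
have q0 : 0 <= q by rewrite mulr_ge0 // ltW // (lt_le_trans ltr01).
pose D := 4 / c * (90 + 2 * (15 * 10 ^+ 10 / c ^+ 13) * (2 + 8 / c) + 2 / c ^+ 2 * (2 * (8 / c) + (8 / c) ^+ 2)).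
near=> N => lam i j hD ij iN jN hgap hgap2.
have hN : spaced_at lam0 Cphi eps c C' (xi N) (X N) by near: N; exact: hc (ltW hC') hxi.
have x1 : 1 <= ln N%:R :> R by near: N; exact: (near_ln a02 A010 hLD hxi).
have xi3 : 3 <= xi N by near: N; exact: (near_xi3 a02 A010 hLD hxi).
have hL : D <= ln N%:R `^ xi N by near: N; exact: (near_L a02 A010 hLD hxi).
have N0 : 0 < N%:R :> R by rewrite ltNge; apply/negP => /ln0 h; move: x1; rewrite h ler10.
move: hL; set L := ln N%:R `^ xi N => hL; pose La := L `^ ka; pose F := L `^ q.
have xL : ln N%:R <= L by rewrite -[leLHS]powRr1 ?(le_trans ler01) //; apply: ler_powR => //; move: xi3; clra.
have L1 : 1 <= L by exact: le_trans xL.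
have L0 : 0 < L by exact: lt_le_trans L1.
have La1 : 1 <= La by rewrite -(powRr0 L); apply: ler_powR.
have F1 : 1 <= F by rewrite -(powRr0 L); apply: ler_powR.
have [A [mA PA hA]] := hN lam i j hD ij iN jN hgap; exists A; split => // t At /=.
rewrite phi_powR -/L -/q in hgap2.
have h := spaced_fine N0 c0 c1 (rho_fcE muf fout hD.1 _) La1 L1 xL F1 hgap2 hL (hA t At).
apply: le_trans h _; apply: ler_wpM2r; first by rewrite invr_ge0 ltW.
have -> : La ^+ 2 * L ^+ 4 * F ^+ 2 = L `^ (ka * 2 + 4 + q * 2) by rewrite powR_split.
rewrite phi_powR -/L; apply: ler_powR => //.
have k0 : 0 <= ka * 2 + 4 + q * 2 by apply: addr_ge0; [apply: addr_ge0 => //|]; exact: mulr_ge0.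
by apply: ler_peMl.
Unshelve. all: by end_near. Qed.
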